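(* Let $\nu>0$ be real and let $z\in\mathbb{C}$ with $\mathrm{Re}\,z>0$. Then $$\frac{\partial J_\nu(z)}{\partial\nu}=\frac\pi2\left[Y_\nu(z)\,\frac{(z/2)^{2\nu}}{\Gamma^2(\nu+1)}\,{}_2F_3\left(\left.\begin{array}{c}\nu,\ \frac12+\nu\\ 2\nu+1,\ \nu+1,\ \nu+1\end{array}\right|-z^2\right)-\frac{\nu J_\nu(z)}{\sqrt\pi}\,G_{2,4}^{3,0}\left(z^2\left|\begin{array}{c}\frac12,\ 1\\ 0,\ 0,\ \nu,\ -\nu\end{array}\right.\right)\right].$$
   Context: Powers take their principal values. $J_\nu(z)=(z/2)^\nu\sum_{k\ge0}\frac{(-1)^k(z/2)^{2k}}{k!\,\Gamma(\nu+k+1)}$, and $Y_\nu(z)=\frac{J_\nu(z)\cos\pi\nu-J_{-\nu}(z)}{\sin\pi\nu}$ for $\nu\notin\mathbb{Z}$ (defined by the limit in $\nu$ for integral $\nu$); $\partial/\partial\nu$ is the derivative with respect to the order at fixed $z$. ${}_pF_q\left(\left.\begin{array}{c}a_1,\dots,a_p\\ b_1,\dots,b_q\end{array}\right|x\right)=\sum_{k\ge0}\frac{(a_1)_k\cdots(a_p)_k}{(b_1)_k\cdots(b_q)_k}\frac{x^k}{k!}$ with $(\alpha)_k=\alpha(\alpha+1)\cdots(\alpha+k-1)$. The Meijer $G$-function is $$G_{p,q}^{m,n}\left(x\left|\begin{array}{c}a_1,\dots,a_p\\ b_1,\dots,b_q\end{array}\right.\right)=\frac1{2\pi i}\int_L\frac{\prod_{\ell=1}^m\Gamma(b_\ell-s)\prod_{\ell=1}^n\Gamma(1-a_\ell+s)}{\prod_{\ell=m+1}^{q}\Gamma(1-b_\ell+s)\prod_{\ell=n+1}^{p}\Gamma(a_\ell-s)}\,x^s\,ds,$$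 where $L$ separates the poles of the factors $\Gamma(b_\ell-s)$ ($1\le\ell\le m$) from those of the factors $\Gamma(1-a_\ell+s)$ ($1\le\ell\le n$); for $p<q$ one may take $L$ to be a loop starting and ending at $+\infty$ and encircling all poles of the $\Gamma(b_\ell-s)$ once in the negative (clockwise) direction. $x^s$ is the principal value. *)

(* Defs.v *)
(* Stdlib reals and Coquelicot complex numbers. *)
From Stdlib Require Export Reals List Factorial.
From Coquelicot Require Export Coquelicot.
Export ListNotations.
Open Scope R_scope.
Open Scope C_scope.

(* [iota P] is the unique element satisfying [P] (arbitrary if there is none). *)
Definition the (P : C -> Prop) : C := iota (T := C_R_CompleteNormedModule) P.

Definition Clim (u : nat -> C) : C :=
  the (fun l => filterlim u eventually (locally l)).

Definition Cseries (a : nat -> C) : C :=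
  the (fun l => is_series (V := C_R_NormedModule) a l).

Definition Cexp (z : C) : C :=
  RtoC (exp (Re z)) * (cos (Im z), sin (Im z)).

(* Principal argument, in (-pi, pi]; meaningful for z <> 0. *)
Definition Carg (z : C) : R :=
  if Rle_dec 0 (Im z) then acos (Re z / Cmod z) else (- acos (Re z / Cmod z))%R.

Definition Clog (z : C) : C := (ln (Cmod z), Carg z).

(* Principal value of z^s, for z <> 0. *)
Definition Cpower (z s : C) : C := Cexp (s * Clog z).

Definition Cprod (l : list C) : C := fold_right Cmult (RtoC 1) l.

(* Rising factorial (alpha)_k. *)
Fixpoint pochhammer (alpha : C) (k : nat) : C :=
  match k with
  | O => RtoC 1
  | S k' => pochhammer alpha k' * (alpha + RtoC (INR k'))
  end.

(* Euler's product formula, n! n^z / (z (z+1) ... (z+n)) -> Gamma(z), valid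
   for every z other than 0, -1, -2, ...  At these poles the terms are
   eventually [_ / 0 = 0], so that [Gamma z = 0] and hence [/ Gamma z = 0]:
   the reciprocal takes there the usual value of the entire function 1/Gamma. *)
Definition Gamma (z : C) : C :=
  Clim (fun n => RtoC (INR (fact n)) * Cpower (RtoC (INR n)) z
                 / pochhammer z (S n)).

Definition besselJ (nu : R) (z : C) : C :=
  Cpower (z / 2) (RtoC nu) *
  Cseries (fun k => (- (1)) ^ k * (z / 2) ^ (2 * k)
                    / (RtoC (INR (fact k)) * Gamma (RtoC (nu + INR k + 1)))).

Definition besselY_quotient (nu : R) (z : C) : C :=
  (besselJ nu z * RtoC (cos (PI * nu)) - besselJ (- nu) z)
  / RtoC (sin (PI * nu)).

(* [frac_part nu = 0] says that nu is an integer; [locally' nu] is the filter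
   of punctured neighbourhoods of nu. *)
Definition besselY (nu : R) (z : C) : C :=
  if Req_EM_T (frac_part nu) 0
  then the (fun y => filterlim (fun mu => besselY_quotient mu z)
                               (locally' nu) (locally y))
  else besselY_quotient nu z.

Definition pFq (a b : list C) (x : C) : C :=
  Cseries (fun k =>
    Cprod (map (fun al => pochhammer al k) a)
    / Cprod (map (fun be => pochhammer be k) b)
    * (x ^ k / RtoC (INR (fact k)))).

(* p = length a, q = length b. *)
Definition meijerG_integrand (m n : nat) (a b : list C) (x s : C) : C :=
  Cprod (map (fun bl => Gamma (bl - s)) (firstn m b))
  * Cprod (map (fun al => Gamma (1 - al + s)) (firstn n a))
  / (Cprod (map (fun bl => Gamma (1 - bl + s)) (skipn m b))
     * Cprod (map (fun al => Gamma (al - s)) (skipn n a)))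
  * Cpower x s.

(* Integral of f along the clockwise boundary of the half-strip
   { s | c <= Re s, h1 <= Im s <= h2 }: from +oo + i h1 to c + i h1, up to
   c + i h2, and back to +oo + i h2. *)
Definition is_loop_integral (f : C -> C) (c h1 h2 : R) (v : C) : Prop :=
  exists lower side upper : C,
    is_RInt_gen (V := C_R_NormedModule) (fun t : R => f (t, h1))
      (at_point c) (Rbar_locally p_infty) lower /\
    is_RInt (V := C_R_NormedModule) (fun t : R => f (c, t) * Ci) h1 h2 side /\
    is_RInt_gen (V := C_R_NormedModule) (fun t : R => f (t, h2))
      (at_point c) (Rbar_locally p_infty) upper /\
    v = - lower + side + upper.

(* The loop encircles the poles b_l + k of Gamma(b_l - s), l <= m, and leaves
   outside the poles a_l - 1 - k of Gamma(1 - a_l + s), l <= n. *)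
Definition separating_loop (m n : nat) (a b : list C) (c h1 h2 : R) : Prop :=
  (forall bl, In bl (firstn m b) -> forall k : nat,
     (c < Re (bl + RtoC (INR k)) /\
      h1 < Im (bl + RtoC (INR k)) < h2)%R) /\
  (forall al, In al (firstn n a) -> forall k : nat,
     ~ (c <= Re (al - 1 - RtoC (INR k)) /\
        h1 <= Im (al - 1 - RtoC (INR k)) <= h2)%R) /\
  (h1 < h2)%R.

(* By Cauchy's theorem the integral does not depend on the loop; g is the
   common value for all of them.  This covers p < q with parameters for which
   a half-strip loop exists, in particular every case with n = 0. *)
Definition is_meijerG (m n : nat) (a b : list C) (x g : C) : Prop :=
  (exists c h1 h2 : R, separating_loop m n a b c h1 h2) /\
  (forall c h1 h2 : R, separating_loop m n a b c h1 h2 ->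
     is_loop_integral (meijerG_integrand m n a b x) c h1 h2
       (2 * RtoC PI * Ci * g)).

Definition meijerG (m n : nat) (a b : list C) (x : C) : C :=
  the (is_meijerG m n a b x).

(* Main.v *)
Require Import Defs.
From Stdlib Require Import Lra Lia ClassicalEpsilon FunctionalExtensionality Compare_dec.
From Stdlib Require FinFun.

(* Suppose first that 2 nu is not an integer.  Evaluating the loop integral by residues (a double pole at
   s = 0 and simple poles at s = k and s = nu + k) expresses G through log(z/2), the digamma value at nu + 1, the series
   sum_{k >= 1} (u v)_k x^k / k and the 2F3, where x = (z/2)^2 and u, v are the normalised series of
   J_nu and J_{-nu}.  The claim becomes a power series identity for the nu-derivative of u, and this one holds
   because both sides solve the same second order equation; the Wronskian of u and v enters here.
   The residue evaluation uses no Cauchy theorem: with 1/Gamma(w) replaced by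
   w (w+1) ... (w+n) / (n! n^w), the integrand becomes exp(-L s) times a rational function, the integral of
   exp(-L s)/(s - p) over the loop is elementary, and n tends to infinity by dominated convergence.
   When 2 nu is an integer, both sides are limits of their values at nearby orders. *)

(** * Complex limits and series *)

(** The integrand contains Gamma(-s)^2 / Gamma(1 - s) = - Gamma(-s) / s, so for non-integer nu the
    only double pole is s = 0; this is why a single logarithm and a few digamma values appear.
    Integer nu is postponed because the poles k and nu + k then collide, half-odd nu because the
    recurrence that bounds the residues divides by factors that may then vanish. All limits rest on
    one fact: consecutive approximants of 1/Gamma differ by a factor 1 + O(1/m^2), uniformly on
    bounded sets. The majorant on the horizontal lines has to hold for all large n at once, even
    where Re s is far beyond n. It comes from the shift s -> s + 1, which multiplies the approximant
    by an explicit rational function of modulus eventually below a multiple of exp(-1) as small as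
    desired. The poles nu + k produce a cotangent that cancels the J_nu part of Y_nu, so that the
    remaining identity involves only J_nu, J_{-nu} and the derivative of the series in nu. The
    contour stays away from the poles for every positive order, which is what makes the passage to
    exceptional orders possible. *)

Definition ctends {T : Type} (F : (T -> Prop) -> Prop) (f : T -> C) (l : C) : Prop :=
  forall eps : R, (0 < eps)%R -> F (fun a => (Cmod (f a - l) < eps)%R).

Ltac ev := try match goal with
  | |- Filter _ => apply eventually_filter
  | |- ProperFilter _ => apply eventually_filter end.

Lemma Cmod_sub_sym (a b : C) : Cmod (a - b) = Cmod (b - a).
Proof. rewrite <- Cmod_opp. f_equal. ring. Qed.

Lemma Cmod_le_add (z : C) : (Cmod z <= Rabs (Re z) + Rabs (Im z))%R.
Proof.
  replace z with (RtoC (Re z) + Ci * RtoC (Im z)) at 1.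
  - eapply Rle_trans; [apply Cmod_triangle|].
    rewrite Cmod_mult, !Cmod_R, Cmod_Ci. lra.
  - destruct z as [a b]; unfold Ci, RtoC; simpl; unfold Cplus, Cmult; simpl.
    f_equal; ring.
Qed.

Lemma Im_le_Cmod (z : C) : (Rabs (Im z) <= Cmod z)%R.
Proof.
  eapply Rle_trans; [|apply Rmax_Cmod]. apply Rmax_r.
Qed.

(** The library neighbourhoods of a complex number come from the product uniform structure; norm
    compatibility makes them equivalent to discs for [Cmod], in which all later estimates are
    phrased. *)
Lemma ctends_iff {T : Type} (F : (T -> Prop) -> Prop) {FF : Filter F} (f : T -> C) (l : C) :
  ctends F f l <-> filterlim f F (locally (T := C_R_NormedModule) l).
Proof.
  split.
  - intros H P [eps HP]. unfold filtermap.
    generalize (H eps (cond_pos eps)). apply filter_imp.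
    intros a Ha. apply HP. apply (norm_compat1 (V := C_R_NormedModule)).
    rewrite Cmod_norm in Ha. exact Ha.
  - intros H eps Heps.
    assert (H' := H (fun y => (Cmod (y - l) < eps)%R)).
    apply H'. destruct (locally_le_locally_norm (V := C_R_NormedModule) l
       (fun y => (Cmod (y - l) < eps)%R)) as [d Hd].
    + exists (mkposreal eps Heps). intros y Hy. unfold ball_norm in Hy.
      rewrite Cmod_norm. exact Hy.
    + exists d. exact Hd.
Qed.

Lemma ctends_ext {T} F {FF : Filter F} (f g : T -> C) (l : C) :
  (forall a, f a = g a) -> ctends F f l -> ctends F g l.
Proof.
  intros E H eps He. generalize (H eps He). apply filter_imp.
  intros a. now rewrite E.
Qed.

Lemma ctends_ext_loc {T} F {FF : Filter F} (f g : T -> C) (l : C) :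
  F (fun a => f a = g a) -> ctends F f l -> ctends F g l.
Proof.
  intros E H eps He. generalize (filter_and _ _ E (H eps He)). apply filter_imp.
  intros a [Ea Ha]. now rewrite <- Ea.
Qed.

Lemma ctends_unique {T} F {FF : ProperFilter F} (f : T -> C) l l' :
  ctends F f l -> ctends F f l' -> l = l'.
Proof.
  intros H H'.
  destruct (Req_dec (Cmod (l - l')) 0) as [E|E].
  - apply Cmod_eq_0 in E. replace l with (l - l' + l') by ring. rewrite E. ring.
  - assert (P : (0 < Cmod (l - l') / 2)%R).
    { generalize (Cmod_ge_0 (l - l')). lra. }
    destruct (filter_ex _ (filter_and _ _ (H _ P) (H' _ P))) as [a [Ha Hb]].
    exfalso.
    assert (Cmod (l - l') <= Cmod (f a - l) + Cmod (f a - l'))%R.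
    { replace (l - l') with (- (f a - l) + (f a - l')) by ring.
      eapply Rle_trans; [apply Cmod_triangle|]. rewrite Cmod_opp. lra. }
    lra.
Qed.

Lemma ctends_const {T} F {FF : Filter F} (l : C) : ctends F (fun _ : T => l) l.
Proof.
  intros eps He. apply filter_forall. intros _.
  replace (l - l) with (RtoC 0) by ring. now rewrite Cmod_0.
Qed.

Lemma ctends_plus {T} F {FF : Filter F} (f g : T -> C) (l m : C) :
  ctends F f l -> ctends F g m -> ctends F (fun a => f a + g a) (l + m).
Proof.
  intros H H' eps He.
  assert (He' : (0 < eps / 2)%R) by lra.
  generalize (filter_and _ _ (H _ He') (H' _ He')). apply filter_imp.
  intros a [Ha Hb].
  replace (f a + g a - (l + m)) with ((f a - l) + (g a - m)) by ring.
  eapply Rle_lt_trans; [apply Cmod_triangle|]. lra.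
Qed.

Lemma ctends_dom {T} F {FF : Filter F} (f : T -> C) (l : C) (g : T -> R) :
  F (fun a => (Cmod (f a - l) <= g a)%R) -> filterlim g F (locally 0%R) -> ctends F f l.
Proof.
  intros H Hg eps He.
  assert (Hb : F (fun a => (Rabs (g a) < eps)%R)).
  { apply (Hg (fun y => (Rabs y < eps)%R)).
    exists (mkposreal eps He). intros y Hy.
    change (Rabs (y - 0) < eps)%R in Hy. rewrite Rminus_0_r in Hy. exact Hy. }
  generalize (filter_and _ _ H Hb). apply filter_imp. intros a [A B].
  eapply Rle_lt_trans; [exact A|]. eapply Rle_lt_trans; [apply Rle_abs|exact B].
Qed.

Lemma ctends_bounded {T} F {FF : Filter F} (f : T -> C) (l : C) :
  ctends F f l -> F (fun a => (Cmod (f a) <= Cmod l + 1)%R).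
Proof.
  intros H. generalize (H 1%R Rlt_0_1). apply filter_imp. intros a Ha.
  replace (f a) with ((f a - l) + l) by ring.
  eapply Rle_trans; [apply Cmod_triangle|]. lra.
Qed.

Lemma ctends_mult {T} F {FF : Filter F} (f g : T -> C) (l m : C) :
  ctends F f l -> ctends F g m -> ctends F (fun a => f a * g a) (l * m).
Proof.
  intros H H' eps He.
  assert (Pl := Cmod_ge_0 l). assert (Pm := Cmod_ge_0 m).
  assert (He1 : (0 < eps / 2 / (Cmod m + 1))%R).
  { apply Rdiv_lt_0_compat; lra. }
  assert (He2 : (0 < eps / 2 / (Cmod l + 1))%R).
  { apply Rdiv_lt_0_compat; lra. }
  generalize (filter_and _ _ (filter_and _ _ (H _ He1) (H' _ He2)) (ctends_bounded _ _ _ H')).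
  apply filter_imp. intros a [[Ha Hb] Hc].
  replace (f a * g a - l * m) with ((f a - l) * g a + l * (g a - m)) by ring.
  eapply Rle_lt_trans; [apply Cmod_triangle|]. rewrite !Cmod_mult.
  assert (Cmod (f a - l) * Cmod (g a) <= eps / 2 / (Cmod m + 1) * (Cmod m + 1))%R.
  { apply Rmult_le_compat; try apply Cmod_ge_0; lra. }
  assert (Cmod l * Cmod (g a - m) <= Cmod l * (eps / 2 / (Cmod l + 1)))%R.
  { apply Rmult_le_compat_l; lra. }
  assert (Cmod l * (eps / 2 / (Cmod l + 1)) < eps / 2)%R.
  { replace (Cmod l * (eps / 2 / (Cmod l + 1)))%R
      with (eps / 2 - eps / 2 / (Cmod l + 1))%R by (field; lra). lra. }
  replace (eps / 2 / (Cmod m + 1) * (Cmod m + 1))%R with (eps / 2)%R in * by (field; lra).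
  lra.
Qed.

Lemma ctends_opp {T} F {FF : Filter F} (f : T -> C) (l : C) :
  ctends F f l -> ctends F (fun a => - f a) (- l).
Proof.
  intros H eps He. generalize (H eps He). apply filter_imp. intros a Ha.
  replace (- f a - - l) with (- (f a - l)) by ring. now rewrite Cmod_opp.
Qed.

Lemma ctends_minus {T} F {FF : Filter F} (f g : T -> C) (l m : C) :
  ctends F f l -> ctends F g m -> ctends F (fun a => f a - g a) (l - m).
Proof. intros H H'. apply ctends_plus; auto. now apply ctends_opp. Qed.

Lemma ctends_inv {T} F {FF : Filter F} (f : T -> C) (l : C) :
  l <> RtoC 0 -> ctends F f l -> ctends F (fun a => / f a) (/ l).
Proof.
  intros Hl H eps He.
  assert (P : (0 < Cmod l)%R) by (apply Cmod_gt_0; exact Hl).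
  assert (He1 : (0 < Cmod l / 2)%R) by lra.
  assert (He2 : (0 < eps * (Cmod l * Cmod l) / 2)%R).
  { assert (0 < eps * (Cmod l * Cmod l))%R by (repeat apply Rmult_lt_0_compat; lra). lra. }
  generalize (filter_and _ _ (H _ He1) (H _ He2)). apply filter_imp. intros a [Ha Hb].
  assert (Q : (Cmod l / 2 < Cmod (f a))%R).
  { assert (Cmod l <= Cmod (f a) + Cmod (f a - l))%R; [|lra].
    replace l with (f a + - (f a - l)) at 1 by ring.
    eapply Rle_trans; [apply Cmod_triangle|]. rewrite Cmod_opp. lra. }
  assert (Nz : f a <> RtoC 0) by (apply Cmod_gt_0; lra).
  replace (/ f a - / l) with (- (f a - l) / (f a * l)) by (field; auto).
  rewrite Cmod_div by (apply Cmult_neq_0; auto).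
  rewrite Cmod_opp, Cmod_mult.
  apply Rmult_lt_reg_r with (Cmod (f a) * Cmod l)%R; [apply Rmult_lt_0_compat; lra|].
  unfold Rdiv. rewrite Rmult_assoc, Rinv_l, Rmult_1_r.
  2:{ apply Rgt_not_eq, Rmult_lt_0_compat; lra. }
  eapply Rlt_trans; [exact Hb|].
  assert (eps * (Cmod l * (Cmod l / 2)) < eps * (Cmod l * Cmod (f a)))%R.
  { apply Rmult_lt_compat_l; auto. apply Rmult_lt_compat_l; auto. }
  lra.
Qed.

Lemma ctends_RtoC {T} F {FF : Filter F} (f : T -> R) (l : R) :
  filterlim f F (locally l) -> ctends F (fun a => RtoC (f a)) (RtoC l).
Proof.
  intros H eps He.
  apply (H (fun y => (Cmod (RtoC y - RtoC l) < eps)%R)).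
  exists (mkposreal eps He). intros y Hy.
  rewrite <- RtoC_minus, Cmod_R. exact Hy.
Qed.

Lemma ctends_Re {T} F {FF : Filter F} (f : T -> C) (l : C) :
  ctends F f l -> filterlim (fun a => Re (f a)) F (locally (Re l)).
Proof.
  intros H P [eps HP]. unfold filtermap.
  generalize (H eps (cond_pos eps)). apply filter_imp. intros a Ha. apply HP.
  change (Rabs (Re (f a) - Re l) < eps)%R.
  eapply Rle_lt_trans; [|exact Ha].
  replace (Re (f a) - Re l)%R with (Re (f a - l)) by (destruct (f a), l; reflexivity).
  apply re_le_Cmod.
Qed.

Lemma ctends_Im {T} F {FF : Filter F} (f : T -> C) (l : C) :
  ctends F f l -> filterlim (fun a => Im (f a)) F (locally (Im l)).
Proof.
  intros H P [eps HP]. unfold filtermap.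
  generalize (H eps (cond_pos eps)). apply filter_imp. intros a Ha. apply HP.
  change (Rabs (Im (f a) - Im l) < eps)%R.
  eapply Rle_lt_trans; [|exact Ha].
  replace (Im (f a) - Im l)%R with (Im (f a - l)) by (destruct (f a), l; reflexivity).
  apply Im_le_Cmod.
Qed.

Lemma ctends_pair {T} F {FF : Filter F} (f : T -> C) (l : C) :
  filterlim (fun a => Re (f a)) F (locally (Re l)) ->
  filterlim (fun a => Im (f a)) F (locally (Im l)) -> ctends F f l.
Proof.
  intros H1 H2.
  apply ctends_ext with (f := fun a => RtoC (Re (f a)) + RtoC (Im (f a)) * Ci); auto.
  { intros a. destruct (f a). unfold RtoC, Ci, Cplus, Cmult; simpl. f_equal; ring. }
  replace l with (RtoC (Re l) + RtoC (Im l) * Ci).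
  2:{ destruct l. unfold RtoC, Ci, Cplus, Cmult; simpl. f_equal; ring. }
  apply ctends_plus; auto. apply ctends_RtoC; auto.
  apply ctends_mult; auto. apply ctends_RtoC; auto. apply ctends_const; auto.
Qed.

Lemma ctends_filter_le {T} F G (f : T -> C) (l : C) :
  filter_le F G -> ctends G f l -> ctends F f l.
Proof. intros H H' eps He. apply H. now apply H'. Qed.

Lemma the_unique (P : C -> Prop) (x : C) :
  (forall y, P y -> y = x) -> P x -> the P = x.
Proof.
  intros H H'. unfold the.
  exact (iota_unique (V := C_R_CompleteNormedModule) P x H H').
Qed.

Lemma the_filterlim {T} (F : (T -> Prop) -> Prop) {FF : ProperFilter F} (f : T -> C) (l : C) :
  ctends F f l -> the (fun y => filterlim f F (locally y)) = l.
Proof.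
  intros H. apply the_unique.
  - intros y Hy. apply (ctends_unique F f); auto. apply ctends_iff; auto; apply FF.
  - apply (ctends_iff F f l). exact H.
Qed.

Lemma Clim_eq (u : nat -> C) l : ctends eventually u l -> Clim u = l.
Proof. intros H. apply the_filterlim; [apply eventually_filter|exact H]. Qed.

(** * Series, tails and dominated convergence *)

Fixpoint csum (a : nat -> C) (n : nat) : C :=
  match n with O => a O | S m => csum a m + a (S m) end.

Definition cseries (a : nat -> C) (l : C) : Prop := ctends eventually (csum a) l.

Lemma csum_sum_n (a : nat -> C) n : sum_n (G := C_R_NormedModule) a n = csum a n.
Proof.
  induction n as [|n IH].
  - now rewrite sum_O.
  - rewrite sum_Sn, IH. reflexivity.
Qed.

Lemma csum_ext (a b : nat -> C) n :
  (forall k, (k <= n)%nat -> a k = b k) -> csum a n = csum b n.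
Proof.
  induction n as [|n IH]; intros H; simpl.
  - apply H; lia.
  - rewrite IH, H; auto.
Qed.

Lemma csum_plus (a b : nat -> C) n : csum (fun k => a k + b k) n = csum a n + csum b n.
Proof. induction n as [|n IH]; simpl; [reflexivity|]. rewrite IH. ring. Qed.

Lemma csum_scal (c : C) (a : nat -> C) n : csum (fun k => c * a k) n = c * csum a n.
Proof. induction n as [|n IH]; simpl; [reflexivity|]. rewrite IH. ring. Qed.

Lemma csum_shift (a : nat -> C) n : csum a (S n) = a O + csum (fun k => a (S k)) n.
Proof. induction n as [|n IH]; [reflexivity|]. simpl in *. rewrite IH. ring. Qed.

Lemma csum_RtoC (a : nat -> R) n : csum (fun k => RtoC (a k)) n = RtoC (sum_f_R0 a n).
Proof. induction n as [|n IH]; simpl; [reflexivity|]. now rewrite IH, RtoC_plus. Qed.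

Lemma Cmod_csum_le (a : nat -> C) (b : nat -> R) n :
  (forall k, (k <= n)%nat -> (Cmod (a k) <= b k)%R) -> (Cmod (csum a n) <= sum_f_R0 b n)%R.
Proof.
  induction n as [|n IH]; intros H; simpl.
  - apply H; lia.
  - eapply Rle_trans; [apply Cmod_triangle|]. apply Rplus_le_compat; auto.
Qed.

Lemma Cseries_eq (a : nat -> C) l : cseries a l -> Cseries a = l.
Proof.
  intros H. unfold Cseries. apply the_unique.
  - intros y Hy. apply (ctends_unique eventually (csum a)); auto.
    apply ctends_iff; ev.
    eapply filterlim_ext; [|exact Hy]. intros n. apply csum_sum_n.
  - unfold is_series. eapply filterlim_ext. { intros n. symmetry. apply csum_sum_n. }
    apply (ctends_iff eventually (csum a) l). exact H.
Qed.

Lemma cseries_ext (a b : nat -> C) l : (forall k, a k = b k) -> cseries a l -> cseries b l.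
Proof.
  intros E. apply ctends_ext; ev.
  intros n. apply csum_ext. auto.
Qed.

Lemma cseries_unique (a : nat -> C) l l' : cseries a l -> cseries a l' -> l = l'.
Proof. apply ctends_unique. apply eventually_filter. Qed.

Lemma cseries_plus (a b : nat -> C) (l m : C) :
  cseries a l -> cseries b m -> cseries (fun k => a k + b k) (l + m).
Proof.
  intros H H'. unfold cseries.
  eapply ctends_ext; [apply eventually_filter| intros n; symmetry; apply csum_plus |].
  apply ctends_plus; auto. apply eventually_filter.
Qed.

Lemma cseries_scal (c : C) (a : nat -> C) (l : C) :
  cseries a l -> cseries (fun k => c * a k) (c * l).
Proof.
  intros H. unfold cseries.
  eapply ctends_ext; [apply eventually_filter| intros n; symmetry; apply csum_scal |].
  apply ctends_mult; auto; ev.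
  apply ctends_const. apply eventually_filter.
Qed.

Lemma ctends_S (u : nat -> C) (l : C) : ctends eventually (fun n => u (S n)) l -> ctends eventually u l.
Proof.
  intros H eps He. destruct (H eps He) as [N HN]. exists (S N).
  intros [|n] Hn; [lia|]. apply HN. lia.
Qed.

Lemma ctends_subseq (u : nat -> C) (phi : nat -> nat) (l : C) :
  (forall n, (n <= phi n)%nat) ->
  ctends eventually u l -> ctends eventually (fun n => u (phi n)) l.
Proof.
  intros Hp H eps He. destruct (H eps He) as [N HN]. exists N.
  intros n Hn. apply HN. specialize (Hp n). lia.
Qed.

Lemma cseries_decr (a : nat -> C) (l : C) :
  cseries (fun k => a (S k)) l -> cseries a (a O + l).
Proof.
  intros H. apply ctends_S.
  eapply ctends_ext; [apply eventually_filter| intros n; symmetry; apply csum_shift |].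
  apply ctends_plus; auto; ev.
  apply ctends_const. apply eventually_filter.
Qed.

Lemma ex_cseries (a : nat -> C) (M : nat -> R) :
  (forall k, (Cmod (a k) <= M k)%R) -> ex_series M -> exists l, cseries a l.
Proof.
  intros H HM.
  destruct (ex_series_le (V := C_R_CompleteNormedModule) a M) as [l Hl].
  - intros n. rewrite <- Cmod_norm. apply H.
  - exact HM.
  - exists l. unfold cseries. apply ctends_iff; ev.
    eapply filterlim_ext; [|exact Hl]. intros n. apply csum_sum_n.
Qed.

(** If the bound failed by d, a late partial sum within d of [l] would contradict the termwise
    estimate of [csum a (p + n) - csum a n], whose right side never exceeds the tail of [M]. *)
Lemma cseries_tail (a : nat -> C) (M : nat -> R) (l : C) n :
  (forall k, (Cmod (a k) <= M k)%R) -> ex_series M -> cseries a l ->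
  (Cmod (l - csum a n) <= Series M - sum_f_R0 M n)%R.
Proof.
  intros H HM Hl.
  apply Rnot_lt_le. intros Hlt.
  set (d := (Cmod (l - csum a n) - (Series M - sum_f_R0 M n))%R) in *.
  assert (Hd : (0 < d)%R) by (unfold d; lra).
  destruct (Hl d Hd) as [N HN].
  specialize (HN (N + n)%nat ltac:(lia)).
  assert (HT : forall p, (Cmod (csum a (p + n) - csum a n) <= sum_f_R0 M (p + n) - sum_f_R0 M n)%R).
  { induction p as [|p IH]; simpl.
    - replace (csum a n - csum a n) with (RtoC 0) by ring. rewrite Cmod_0. lra.
    - replace (csum a (p + n) + a (S (p + n)) - csum a n)
        with ((csum a (p + n) - csum a n) + a (S (p + n))) by ring.
      eapply Rle_trans; [apply Cmod_triangle|]. specialize (H (S (p + n))). lra. }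
  specialize (HT N).
  assert (HP : forall k, (0 <= M k)%R).
  { intros k. eapply Rle_trans; [apply Cmod_ge_0|apply H]. }
  assert (HS : (sum_f_R0 M (N + n) <= Series M)%R).
  { rewrite <- sum_n_Reals. apply (is_lim_seq_incr_compare (sum_n M) (Series M)).
    - exact (Series_correct _ HM).
    - intros k. rewrite sum_Sn. unfold plus; simpl. specialize (HP (S k)). lra. }
  assert (Cmod (l - csum a n) <= Cmod (csum a (N + n) - l) + Cmod (csum a (N + n) - csum a n))%R.
  { replace (l - csum a n) with (- (csum a (N + n) - l) + (csum a (N + n) - csum a n)) by ring.
    eapply Rle_trans; [apply Cmod_triangle|]. rewrite Cmod_opp. lra. }
  unfold d in *. lra.
Qed.

Lemma ctends_csum {T} F {FF : Filter F} (f : T -> nat -> C) (l : nat -> C) n :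
  (forall k, ctends F (fun a => f a k) (l k)) -> ctends F (fun a => csum (f a) n) (csum l n).
Proof.
  intros H. induction n as [|n IH]; simpl; auto. apply ctends_plus; auto.
Qed.

(** Dominated convergence for series along any proper filter: the tails are small uniformly in the
    parameter, and a fixed partial sum converges as a finite sum. It serves both for the number of
    factors tending to infinity and for the order tending to a given one. *)
Lemma tannery {T} F {FF : ProperFilter F} (f : T -> nat -> C) (S : T -> C)
  (l : nat -> C) (M : nat -> R) :
  ex_series M ->
  F (fun a => forall k, (Cmod (f a k) <= M k)%R) ->
  (forall k, ctends F (fun a => f a k) (l k)) ->
  F (fun a => cseries (f a) (S a)) ->
  exists L, cseries l L /\ ctends F S L.
Proof.
  intros HM Hb Hl HS.
  assert (FF' : Filter F) by apply FF.
  assert (HlM : forall k, (Cmod (l k) <= M k)%R).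
  { intros k. apply Rnot_lt_le. intros Hlt.
    assert (He : (0 < Cmod (l k) - M k)%R) by lra.
    destruct (filter_ex _ (filter_and _ _ Hb (Hl k _ He))) as [a [H1 H2]].
    specialize (H1 k). rewrite Cmod_sub_sym in H2.
    assert (Cmod (l k) <= Cmod (l k - f a k) + Cmod (f a k))%R; [|lra].
    replace (l k) with ((l k - f a k) + f a k) at 1 by ring. apply Cmod_triangle. }
  destruct (ex_cseries l M HlM HM) as [L HL].
  exists L. split; auto.
  intros eps He.
  assert (He3 : (0 < eps / 3)%R) by lra.
  assert (HT : exists n, (Series M - sum_f_R0 M n < eps / 3)%R).
  { assert (Hs := Series_correct _ HM).
    assert (Hs' : is_lim_seq (sum_n M) (Series M)) by exact Hs.
    clear Hs. rename Hs' into Hs. apply is_lim_seq_spec in Hs.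
    destruct (Hs (mkposreal _ He3)) as [N HN].
    exists N. specialize (HN N (le_n N)).
    simpl in HN.
    rewrite sum_n_Reals in HN. apply Rabs_def2 in HN. lra. }
  destruct HT as [n Hn].
  assert (Hc := ctends_csum F f l n Hl (eps / 3)%R He3).
  generalize (filter_and _ _ (filter_and _ _ Hb HS) Hc). apply filter_imp.
  intros a [[H1 H2] H3].
  assert (T1 := cseries_tail (f a) M (S a) n H1 HM H2).
  assert (T2 := cseries_tail l M L n HlM HM HL).
  rewrite Cmod_sub_sym in T2.
  replace (S a - L) with ((S a - csum (f a) n) + (csum (f a) n - csum l n) + (csum l n - L)) by ring.
  eapply Rle_lt_trans; [apply Cmod_triangle|].
  assert (X := Cmod_triangle (S a - csum (f a) n) (csum (f a) n - csum l n)). lra.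
Qed.

Definition cconv (a b : nat -> C) (n : nat) : C := csum (fun k => a k * b (n - k)%nat) n.

(** Both sides sum [f k j] over the triangle k + j <= n, by antidiagonals on the left and by rows on
    the right. *)
Lemma csum_rev_swap (f : nat -> nat -> C) n :
  csum (fun m => csum (fun k => f k (m - k)%nat) m) n
  = csum (fun k => csum (fun j => f k j) (n - k)) n.
Proof.
  induction n as [|n IH]; [reflexivity|].
  simpl csum at 1. rewrite IH.
  change (csum (fun k => csum (fun j => f k j) (S n - k)) (S n))
    with (csum (fun k => csum (fun j => f k j) (S n - k)) n
          + csum (fun j => f (S n) j) (S n - S n)).
  rewrite Nat.sub_diag. simpl csum at 6.
  rewrite (csum_ext (fun k => csum (fun j => f k j) (S n - k))
     (fun k => csum (fun j => f k j) (n - k) + f k (S n - k)%nat)).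
  2:{ intros k Hk. replace (S n - k)%nat with (S (n - k)) by lia. reflexivity. }
  rewrite csum_plus. change (csum (fun k => f k (S n - k)%nat) (S n))
   with (csum (fun k => f k (S n - k)%nat) n + f (S n) (S n - S n)%nat).
  rewrite Nat.sub_diag. simpl. ring.
Qed.

(** * Cauchy products, exponential and logarithm *)

Lemma csum_cconv (a b : nat -> C) n :
  csum (cconv a b) n = csum (fun k => a k * csum b (n - k)) n.
Proof.
  unfold cconv. rewrite (csum_rev_swap (fun k j => a k * b j) n).
  apply csum_ext. intros k _. now rewrite csum_scal.
Qed.

Lemma Cmod_csum_sub_le (b : nat -> C) n m : (m <= n)%nat ->
  (Cmod (csum b n - csum b m) <= sum_f_R0 (fun k => Cmod (b k)) n - sum_f_R0 (fun k => Cmod (b k)) m)%R.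
Proof.
  intros H. induction H as [|n H IH].
  - replace (csum b m - csum b m) with (RtoC 0) by ring. rewrite Cmod_0. lra.
  - simpl. replace (csum b n + b (S n) - csum b m) with ((csum b n - csum b m) + b (S n)) by ring.
    eapply Rle_trans; [apply Cmod_triangle|]. lra.
Qed.

Lemma cseries_of_abs (a : nat -> C) : ex_series (fun k => Cmod (a k)) -> exists l, cseries a l.
Proof. apply ex_cseries. intros; lra. Qed.

(** The difference between the product of partial sums and the partial sum of the Cauchy product is
    bounded by the same difference formed with the moduli, and that one tends to 0 by the theorem on
    nonnegative real series. *)
Lemma cauchy_product (a b : nat -> C) (la lb : C) :
  cseries a la -> cseries b lb ->
  ex_series (fun k => Cmod (a k)) -> ex_series (fun k => Cmod (b k)) ->
  cseries (cconv a b) (la * lb).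
Proof.
  intros Ha Hb [A HA] [B HB].
  assert (HP := is_series_mult_pos _ _ _ _ HA HB
     (fun n => Cmod_ge_0 (a n)) (fun n => Cmod_ge_0 (b n))).
  set (al := fun k => Cmod (a k)) in *. set (be := fun k => Cmod (b k)) in *.
  set (cv := fun n : nat => sum_f_R0 (fun k : nat => (al k * be (n - k)%nat)%R) n).
  assert (E : forall n, RtoC (sum_f_R0 cv n) = csum (fun k => RtoC (al k) * RtoC (sum_f_R0 be (n - k))) n).
  { intros n. rewrite <- csum_RtoC.
    rewrite (csum_ext _ (cconv (fun k => RtoC (al k)) (fun k => RtoC (be k)))).
    - rewrite csum_cconv. apply csum_ext. intros k _. now rewrite csum_RtoC.
    - intros k _. unfold cv, cconv. rewrite <- csum_RtoC. apply csum_ext.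
      intros j _. now rewrite RtoC_mult. }
  assert (F : forall n, (Cmod (csum a n * csum b n - csum (cconv a b) n)
     <= sum_f_R0 al n * sum_f_R0 be n - sum_f_R0 cv n)%R).
  { intros n. rewrite csum_cconv.
    replace (csum a n * csum b n) with (csum (fun k => a k * csum b n) n).
    2:{ rewrite (csum_ext _ (fun k => csum b n * a k)) by (intros; ring). rewrite csum_scal. ring. }
    replace (csum (fun k => a k * csum b n) n - csum (fun k => a k * csum b (n - k)) n)
      with (csum (fun k => a k * (csum b n - csum b (n - k))) n).
    2:{ rewrite (csum_ext _ (fun k => a k * csum b n + (-1)%R * (a k * csum b (n - k)))).
        2:{ intros k _. replace (RtoC (-1)) with (- RtoC 1) by (now rewrite <- RtoC_opp). ring. }
        rewrite csum_plus, csum_scal.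
        replace (RtoC (-1)) with (- RtoC 1) by (now rewrite <- RtoC_opp). ring. }
    eapply Rle_trans.
    { apply (Cmod_csum_le _ (fun k => al k * (sum_f_R0 be n - sum_f_R0 be (n - k)))%R).
      intros k Hk. rewrite Cmod_mult. apply Rmult_le_compat_l; [apply Cmod_ge_0|].
      apply Cmod_csum_sub_le. lia. }
    (* The real bound is in fact an equality; it is checked after embedding into [C], where the
       [csum] identities apply. *)
    apply Req_le. apply RtoC_inj. rewrite RtoC_minus, E, RtoC_mult, <- csum_RtoC.
    rewrite <- (csum_RtoC al).
    rewrite (csum_ext _ (fun k => RtoC (sum_f_R0 be n) * RtoC (al k)
        + RtoC (-1) * (RtoC (al k) * RtoC (sum_f_R0 be (n - k))))).
    2:{ intros k _. rewrite RtoC_mult, RtoC_minus.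
        replace (RtoC (-1)) with (- RtoC 1) by (now rewrite <- RtoC_opp). ring. }
    rewrite csum_plus, !csum_scal.
    replace (RtoC (-1)) with (- RtoC 1) by (now rewrite <- RtoC_opp). ring. }
  assert (G : ctends eventually (fun n => csum a n * csum b n - csum (cconv a b) n) (RtoC 0)).
  { apply (ctends_dom _ _ _ (fun n => sum_f_R0 al n * sum_f_R0 be n - sum_f_R0 cv n)%R).
    - exists 0%nat. intros n _.
      replace (csum a n * csum b n - csum (cconv a b) n - 0)
        with (csum a n * csum b n - csum (cconv a b) n) by ring. apply F.
    - assert (L : is_lim_seq (fun n => sum_f_R0 al n * sum_f_R0 be n - sum_f_R0 cv n)%R (A * B - A * B)%R).
      { apply is_lim_seq_minus'; [apply is_lim_seq_mult'|].
        - eapply is_lim_seq_ext; [intros n; apply sum_n_Reals|exact HA].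
        - eapply is_lim_seq_ext; [intros n; apply sum_n_Reals|exact HB].
        - eapply is_lim_seq_ext; [intros n; apply sum_n_Reals|exact HP]. }
      replace (A * B - A * B)%R with 0%R in L by ring. exact L. }
  assert (K := ctends_minus eventually _ _ _ _ (ctends_mult eventually _ _ _ _ Ha Hb) G).
  replace (la * lb) with (la * lb - 0) by ring.
  eapply ctends_ext; [apply eventually_filter| |exact K].
  intros n. simpl. ring.
Qed.

Lemma Cexp_plus (a b : C) : Cexp (a + b) = Cexp a * Cexp b.
Proof.
  destruct a as [a a'], b as [b b']. unfold Cexp, RtoC, Cmult, Cplus; simpl.
  rewrite exp_plus, cos_plus, sin_plus. f_equal; ring.
Qed.

Lemma Cexp_0 : Cexp 0 = 1.
Proof. unfold Cexp, RtoC, Cmult; simpl. rewrite exp_0, cos_0, sin_0. f_equal; ring. Qed.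

Lemma Cexp_opp (a : C) : Cexp (- a) = / Cexp a.
Proof.
  assert (E : Cexp a * Cexp (- a) = 1).
  { rewrite <- Cexp_plus. replace (a + - a) with (RtoC 0) by ring. apply Cexp_0. }
  assert (N : Cexp a <> 0).
  { intros H. rewrite H in E. apply C1_nz. rewrite <- E. ring. }
  replace (Cexp (- a)) with (/ Cexp a * (Cexp a * Cexp (- a))) by (field; auto).
  rewrite E. ring.
Qed.

Lemma Cexp_nz (a : C) : Cexp a <> 0.
Proof.
  intros H.
  assert (E : Cexp a * Cexp (- a) = 1).
  { rewrite <- Cexp_plus. replace (a + - a) with (RtoC 0) by ring. apply Cexp_0. }
  rewrite H in E. apply C1_nz. rewrite <- E. ring.
Qed.

Lemma Cexp_minus (a b : C) : Cexp (a - b) = Cexp a / Cexp b.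
Proof. unfold Cminus, Cdiv. now rewrite Cexp_plus, Cexp_opp. Qed.

Lemma Cexp_RtoC (t : R) : Cexp (RtoC t) = RtoC (exp t).
Proof. unfold Cexp, RtoC, Cmult; simpl. rewrite cos_0, sin_0. f_equal; ring. Qed.

Lemma Cmod_Cexp (a : C) : Cmod (Cexp a) = exp (Re a).
Proof.
  unfold Cexp. rewrite Cmod_mult, Cmod_R, Rabs_pos_eq by apply Rlt_le, exp_pos.
  unfold Cmod; simpl. replace (cos (Im a) * (cos (Im a) * 1) + sin (Im a) * (sin (Im a) * 1))%R
    with (Rsqr (sin (Im a)) + Rsqr (cos (Im a)))%R by (unfold Rsqr; ring).
  rewrite sin2_cos2, sqrt_1. ring.
Qed.

Lemma Cexp_INR (n : nat) (a : C) : Cexp (RtoC (INR n) * a) = Cexp a ^ n.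
Proof.
  induction n as [|n IH].
  - simpl. rewrite <- Cexp_0. f_equal. ring.
  - rewrite S_INR, RtoC_plus.
    replace ((RtoC (INR n) + 1) * a) with (a + RtoC (INR n) * a) by ring.
    rewrite Cexp_plus, IH. reflexivity.
Qed.

(** * Derivatives of curves in the complex plane *)

Lemma is_derive_pair (f : R -> C) (x : R) (l : C) :
  is_derive (fun t => Re (f t)) x (Re l) -> is_derive (fun t => Im (f t)) x (Im l) ->
  is_derive (V := C_R_NormedModule) f x l.
Proof.
  intros H1 H2. split. { apply is_linear_scal_l. }
  intros x' Hx'. assert (Ex : x' = x) by (symmetry; apply (is_filter_lim_locally_unique (V := R_NormedModule)), Hx'; intros P HP; exact HP).
  subst x'.
  destruct H1 as [_ H1], H2 as [_ H2].
  specialize (H1 x Hx'). specialize (H2 x Hx').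
  intros eps.
  assert (He : (0 < eps / 2)%R) by (generalize (cond_pos eps); lra).
  specialize (H1 (mkposreal _ He)). specialize (H2 (mkposreal _ He)).
  generalize (filter_and _ _ H1 H2). apply filter_imp. intros y [A B].
  simpl in A, B. rewrite <- Cmod_norm.
  eapply Rle_trans; [apply Cmod_le_add|].
  unfold norm in A, B |- *; simpl in A, B |- *; unfold abs in A, B |- *; simpl in A, B |- *.
  unfold minus, plus, opp, scal in A, B |- *; simpl in A, B |- *.
  unfold mult in A, B |- *; simpl in A, B |- *.
  unfold Re, Im in *. lra.
Qed.

Lemma is_derive_Re (f : R -> C) (x : R) (l : C) :
  is_derive (V := C_R_NormedModule) f x l -> is_derive (fun t => Re (f t)) x (Re l).
Proof.
  intros [_ H]. split. { apply is_linear_scal_l. }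
  intros x' Hx' eps. specialize (H x' Hx' eps). generalize H. apply filter_imp.
  intros y Hy. rewrite <- Cmod_norm in Hy.
  eapply Rle_trans; [|exact Hy]. eapply Rle_trans; [|apply re_le_Cmod]. apply Req_le. reflexivity.
Qed.

Lemma is_derive_Im (f : R -> C) (x : R) (l : C) :
  is_derive (V := C_R_NormedModule) f x l -> is_derive (fun t => Im (f t)) x (Im l).
Proof.
  intros [_ H]. split. { apply is_linear_scal_l. }
  intros x' Hx' eps. specialize (H x' Hx' eps). generalize H. apply filter_imp.
  intros y Hy. rewrite <- Cmod_norm in Hy.
  eapply Rle_trans; [|exact Hy]. eapply Rle_trans; [|apply Im_le_Cmod]. apply Req_le. reflexivity.
Qed.

Notation cderive f x l := (is_derive (K := R_AbsRing) (V := C_R_NormedModule) f x l).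

Lemma cderive_mult (f g : R -> C) (x : R) (l m : C) :
  cderive f x l -> cderive g x m -> cderive (fun t => f t * g t) x (l * g x + f x * m).
Proof.
  intros Hf Hg.
  assert (F1 := is_derive_Re _ _ _ Hf). assert (F2 := is_derive_Im _ _ _ Hf).
  assert (G1 := is_derive_Re _ _ _ Hg). assert (G2 := is_derive_Im _ _ _ Hg).
  apply is_derive_pair.
  - apply (is_derive_ext (fun t => Re (f t) * Re (g t) - Im (f t) * Im (g t))%R). { reflexivity. }
    replace (Re (l * g x + f x * m))
     with ((Re l * Re (g x) + Re (f x) * Re m) - (Im l * Im (g x) + Im (f x) * Im m))%R
      by (simpl; unfold Re, Im; ring).
    refine (is_derive_minus (V := R_NormedModule) _ _ _ _ _ _ _); refine (is_derive_mult _ _ _ _ _ _ _ _); auto; intros; apply Rmult_comm.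
  - apply (is_derive_ext (fun t => Re (f t) * Im (g t) + Im (f t) * Re (g t))%R). { reflexivity. }
    replace (Im (l * g x + f x * m))
     with ((Re l * Im (g x) + Re (f x) * Im m) + (Im l * Re (g x) + Im (f x) * Re m))%R
      by (simpl; unfold Re, Im; ring).
    refine (is_derive_plus (V := R_NormedModule) _ _ _ _ _ _ _); refine (is_derive_mult _ _ _ _ _ _ _ _); auto; intros; apply Rmult_comm.
Qed.

Lemma cderive_const (a : C) (x : R) : cderive (fun _ => a) x (RtoC 0).
Proof. exact (is_derive_const (V := C_R_NormedModule) a x). Qed.

Lemma cderive_plus (f g : R -> C) (x : R) (l m : C) :
  cderive f x l -> cderive g x m -> cderive (fun t => f t + g t) x (l + m).
Proof. intros H H'. exact (is_derive_plus (V := C_R_NormedModule) _ _ _ _ _ H H'). Qed.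

Lemma cderive_minus (f g : R -> C) (x : R) (l m : C) :
  cderive f x l -> cderive g x m -> cderive (fun t => f t - g t) x (l - m).
Proof. intros H H'. exact (is_derive_minus (V := C_R_NormedModule) _ _ _ _ _ H H'). Qed.

Lemma cderive_ext (f g : R -> C) (x : R) (l : C) :
  (forall t, f t = g t) -> cderive f x l -> cderive g x l.
Proof. intros E H. eapply is_derive_ext; [|exact H]. exact E. Qed.

Lemma cderive_eq (f : R -> C) (x : R) (l m : C) : l = m -> cderive f x l -> cderive f x m.
Proof. now intros ->. Qed.

Lemma cderive_scal (a : C) (f : R -> C) (x : R) (l : C) :
  cderive f x l -> cderive (fun t => a * f t) x (a * l).
Proof.
  intros H. replace (a * l) with (0 * f x + a * l) by ring.
  apply (cderive_mult (fun _ => a) f); auto. apply cderive_const.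
Qed.

Lemma cderive_RtoC (f : R -> R) (x l : R) :
  is_derive f x l -> cderive (fun t => RtoC (f t)) x (RtoC l).
Proof. intros H. apply is_derive_pair; simpl; auto. exact (is_derive_const (V := R_NormedModule) 0%R x). Qed.

Lemma cderive_id (x : R) : cderive RtoC x (RtoC 1).
Proof. apply (cderive_RtoC (fun t => t)). exact (is_derive_id (K := R_AbsRing) x). Qed.

Lemma cderive_affine (a b : C) (x : R) : cderive (fun t => a + RtoC t * b) x b.
Proof.
  apply (cderive_eq _ _ (0 + (1 * b + RtoC x * 0))); [ring|].
  apply cderive_plus. apply cderive_const.
  apply (cderive_mult RtoC (fun _ => b)). apply cderive_id. apply cderive_const.
Qed.

Lemma cderive_Cexp (g : R -> C) (x : R) (l : C) :
  cderive g x l -> cderive (fun t => Cexp (g t)) x (l * Cexp (g x)).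
Proof.
  intros H. assert (H1 := is_derive_Re _ _ _ H). assert (H2 := is_derive_Im _ _ _ H).
  unfold Cexp.
  apply (cderive_eq _ _ (RtoC (Re l * exp (Re (g x))) * (cos (Im (g x)), sin (Im (g x)))
      + RtoC (exp (Re (g x))) * ((Im l * - sin (Im (g x)), Im l * cos (Im (g x))) : C)%R)).
  { destruct l. unfold RtoC, Cmult, Cplus; simpl. f_equal; ring. }
  apply (cderive_mult (fun t => RtoC (exp (Re (g t)))) (fun t => (cos (Im (g t)), sin (Im (g t))) : C)).
  - apply (cderive_RtoC (fun t => exp (Re (g t)))). apply (is_derive_comp exp); auto. apply is_derive_Reals. apply derivable_pt_lim_exp.
  - apply is_derive_pair; simpl.
    + apply (is_derive_comp cos); auto. apply is_derive_Reals. apply derivable_pt_lim_cos.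
    + apply (is_derive_comp sin); auto. apply is_derive_Reals. apply derivable_pt_lim_sin.
Qed.

(** The mean value theorem fails for complex values; applied to the real and the imaginary part
    separately it costs the factor 2. *)
Lemma cderive_bound (f df : R -> C) (D x y : R) :
  (forall t, (Rmin x y <= t <= Rmax x y)%R -> cderive f t (df t) /\ (Cmod (df t) <= D)%R) ->
  (Cmod (f y - f x) <= 2 * D * Rabs (y - x))%R.
Proof.
  intros H.
  assert (HR : (Rabs (Re (f y) - Re (f x)) <= D * Rabs (y - x))%R).
  { destruct (MVT_gen (fun t => Re (f t)) x y (fun t => Re (df t))) as [c [Hc Ec]].
    - intros t Ht. apply is_derive_Re, H. lra.
    - intros t Ht. apply continuity_pt_filterlim.
      apply (ex_derive_continuous (fun t => Re (f t))). exists (Re (df t)).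
      apply is_derive_Re, H. lra.
    - rewrite Ec, Rabs_mult. apply Rmult_le_compat_r; [apply Rabs_pos|].
      eapply Rle_trans; [apply re_le_Cmod|]. now apply H. }
  assert (HI : (Rabs (Im (f y) - Im (f x)) <= D * Rabs (y - x))%R).
  { destruct (MVT_gen (fun t => Im (f t)) x y (fun t => Im (df t))) as [c [Hc Ec]].
    - intros t Ht. apply is_derive_Im, H. lra.
    - intros t Ht. apply continuity_pt_filterlim.
      apply (ex_derive_continuous (fun t => Im (f t))). exists (Im (df t)).
      apply is_derive_Im, H. lra.
    - rewrite Ec, Rabs_mult. apply Rmult_le_compat_r; [apply Rabs_pos|].
      eapply Rle_trans; [apply Im_le_Cmod|]. now apply H. }
  eapply Rle_trans; [apply Cmod_le_add|].
  replace (Re (f y - f x)) with (Re (f y) - Re (f x))%R by (destruct (f y), (f x); reflexivity).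
  replace (Im (f y - f x)) with (Im (f y) - Im (f x))%R by (destruct (f y), (f x); reflexivity).
  lra.
Qed.

Lemma cderive_continuous (f : R -> C) (x : R) (l : C) :
  cderive f x l -> ctends (locally x) f (f x).
Proof.
  intros H. apply ctends_pair; try apply locally_filter.
  - apply (ex_derive_continuous (fun t => Re (f t))). exists (Re l). now apply is_derive_Re.
  - apply (ex_derive_continuous (fun t => Im (f t))). exists (Im l). now apply is_derive_Im.
Qed.

Lemma locally'_intro (x : R) (P : R -> Prop) (d : R) : (0 < d)%R ->
  (forall y, y <> x -> (Rabs (y - x) < d)%R -> P y) -> locally' x P.
Proof. intros Hd H. exists (mkposreal d Hd). intros y Hy Hn. apply H; auto. Qed.

Lemma locally_intro (x : R) (P : R -> Prop) (d : R) : (0 < d)%R ->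
  (forall y, (Rabs (y - x) < d)%R -> P y) -> locally x P.
Proof. intros Hd H. exists (mkposreal d Hd). intros y Hy. apply H; auto. Qed.

Global Instance locally'_proper (x : R) : ProperFilter (locally' x).
Proof.
  constructor.
  - intros P [d Hd]. exists (x + d / 2)%R. assert (Hp := cond_pos d). apply Hd.
    + change (Rabs (x + d / 2 - x) < d)%R.
      replace (x + d / 2 - x)%R with (d / 2)%R by ring. rewrite Rabs_pos_eq; lra.
    + lra.
  - apply within_filter, locally_filter.
Qed.

Lemma C_remainder_eq (a b l : C) (y x : R) :
  minus (G := C_R_NormedModule) (minus (G := C_R_NormedModule) a b)
    (scal (V := C_R_NormedModule) (minus (G := R_AbsRing) y x) l) = a - b - RtoC (y - x) * l.
Proof.
  destruct a, b, l. apply injective_projections; simpl;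
  unfold minus, plus, opp, scal; simpl; unfold mult; simpl; ring.
Qed.

Lemma cderive_quotient (f : R -> C) (x : R) (l : C) :
  cderive f x l -> ctends (locally' x) (fun y => (f y - f x) / RtoC (y - x)) l.
Proof.
  intros [_ H] eps He.
  assert (He2 : (0 < eps / 2)%R) by lra.
  specialize (H x (fun P HP => HP) (mkposreal _ He2)).
  destruct H as [d Hd]. exists d. intros y Hy Hn. specialize (Hd y Hy).
  rewrite <- Cmod_norm in Hd. simpl in Hd.
  assert (P : (0 < Rabs (y - x))%R) by (apply Rabs_pos_lt; lra).
  assert (Nz : RtoC (y - x) <> RtoC 0) by (intros E; apply RtoC_inj in E; lra).
  replace ((f y - f x) / RtoC (y - x) - l) with ((f y - f x - RtoC (y - x) * l) / RtoC (y - x)) by (field; auto).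
  rewrite Cmod_div, Cmod_R by auto.
  apply Rmult_lt_reg_r with (Rabs (y - x)); auto.
  unfold Rdiv. rewrite Rmult_assoc, Rinv_l, Rmult_1_r by lra.
  apply Rle_lt_trans with (eps / 2 * Rabs (y - x))%R.
  - eapply Rle_trans; [|exact Hd]. apply Req_le. f_equal. symmetry. apply C_remainder_eq.
  - apply Rmult_lt_compat_r; lra.
Qed.

(** Recasts differentiability as a limit along [locally'], so that termwise differentiation of a
    series becomes an instance of dominated convergence. *)
Lemma cderive_of_quotient (f : R -> C) (x : R) (l : C) :
  ctends (locally' x) (fun y => (f y - f x) / RtoC (y - x)) l -> cderive f x l.
Proof.
  intros H. split. { apply is_linear_scal_l. }
  intros x' Hx'. assert (Ex : x' = x) by (symmetry; apply (is_filter_lim_locally_unique (V := R_NormedModule)), Hx'; intros P HP; exact HP).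
  subst x'. intros eps. destruct (H eps (cond_pos eps)) as [d Hd].
  exists d. intros y Hy. rewrite <- Cmod_norm. simpl.
  replace (Cmod _) with (Cmod (f y - f x - RtoC (y - x) * l)).
  2:{ f_equal. symmetry. apply C_remainder_eq. }
  change (Cmod (f y - f x - RtoC (y - x) * l) <= eps * Rabs (y - x))%R.
  destruct (Req_dec y x) as [E|E].
  - subst y. replace (RtoC (x - x)) with (RtoC 0) by (f_equal; ring).
    replace (f x - f x - 0 * l) with (RtoC 0) by ring. rewrite Cmod_0.
    apply Rmult_le_pos; [apply Rlt_le, cond_pos|apply Rabs_pos].
  - specialize (Hd y Hy E).
    assert (P : (0 < Rabs (y - x))%R) by (apply Rabs_pos_lt; lra).
    assert (Nz : RtoC (y - x) <> RtoC 0) by (intros E'; apply RtoC_inj in E'; lra).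
    replace (f y - f x - RtoC (y - x) * l) with (((f y - f x) / RtoC (y - x) - l) * RtoC (y - x)) by (field; auto).
    rewrite Cmod_mult, Cmod_R. apply Rmult_le_compat_r; lra.
Qed.

(** * The principal logarithm *)

Lemma Clog_unique (l w : C) : Cexp l = w -> (- PI < Im l <= PI)%R -> Clog w = l.
Proof.
  intros <- Hl. assert (Hm := Cmod_Cexp l). unfold Clog. rewrite Hm, ln_exp.
  assert (Hp := exp_pos (Re l)).
  replace l with ((Re l, Im l) : C) at 3 by (destruct l; reflexivity). f_equal.
  unfold Carg. rewrite Hm.
  replace (Re (Cexp l) / exp (Re l))%R with (cos (Im l)).
  2:{ unfold Cexp, RtoC, Cmult; simpl. field. lra. }
  replace (Im (Cexp l)) with (exp (Re l) * sin (Im l))%R by (unfold Cexp, RtoC, Cmult; simpl; ring).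
  (* The sign of sin (Im l) selects the branch of [Carg]. The end point Im l = PI falls into the
     first branch since sin PI = 0, in agreement with the half-open range. *)
  destruct (Rle_dec 0 (exp (Re l) * sin (Im l))) as [H|H].
  - destruct (Rle_lt_dec 0 (Im l)) as [L|L].
    + apply acos_cos. lra.
    + exfalso. assert (sin (Im l) < 0)%R.
      { apply sin_lt_0_var; lra. }
      assert (exp (Re l) * sin (Im l) < 0)%R; [|lra].
      rewrite <- (Rmult_0_r (exp (Re l))). now apply Rmult_lt_compat_l.
  - destruct (Rle_lt_dec 0 (Im l)) as [L|L].
    + exfalso. apply H. apply Rmult_le_pos; [lra|]. apply sin_ge_0; lra.
    + rewrite <- cos_neg. rewrite acos_cos by lra. ring.
Qed.

(** In the right half-plane the argument is atan (b / a), which lies strictly between -PI/2 and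
    PI/2; the strict bounds are what allows doubling it. *)
Lemma exists_log (z : C) : (0 < Re z)%R ->
  exists l, Cexp l = z /\ (- (PI / 2) < Im l < PI / 2)%R.
Proof.
  intros Hz. destruct z as [a b]; simpl in Hz.
  exists ((ln (Cmod (a, b)), atan (b / a)) : C). split.
  2:{ simpl. generalize (atan_bound (b / a)). lra. }
  assert (Hq : (0 < sqrt (1 + Rsqr (b / a)))%R).
  { apply sqrt_lt_R0. generalize (Rle_0_sqr (b / a)). lra. }
  assert (E : Cmod (a, b) = (a * sqrt (1 + Rsqr (b / a)))%R).
  { unfold Cmod; simpl. rewrite <- (sqrt_Rsqr a) at 3 by lra.
    rewrite <- sqrt_mult_alt by apply Rle_0_sqr. f_equal. unfold Rsqr. field. lra. }
  unfold Cexp; simpl. rewrite exp_ln by (rewrite E; apply Rmult_lt_0_compat; lra).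
  rewrite cos_atan, sin_atan, E. unfold RtoC, Cmult; simpl. f_equal; field; lra.
Qed.

Lemma Clog_RtoC (t : R) : (0 < t)%R -> Clog (RtoC t) = RtoC (ln t).
Proof.
  intros Ht. apply Clog_unique.
  - rewrite Cexp_RtoC, exp_ln; auto.
  - simpl. generalize PI_RGT_0. intros; split; lra.
Qed.

(** Doubling an imaginary part below PI/2 in modulus stays in the principal range. This is where Re
    z > 0 matters for the argument z^2 of the G-function. *)
Lemma Clog_sqr (l : C) : (- (PI / 2) < Im l < PI / 2)%R ->
  Clog (Cexp l ^ 2) = 2 * l.
Proof.
  intros H. apply Clog_unique.
  - rewrite <- Cexp_INR. replace (INR 2) with 2%R by (simpl; ring). reflexivity.
  - destruct l as [a b]; simpl in *. generalize PI_RGT_0. intros; split; lra.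
Qed.

(** * The reciprocal Gamma function *)

Definition lstep (m : nat) : R := (ln (INR (S (S m))) - ln (INR (S m)))%R.

(** Quotient of consecutive Euler products: 1 + w/(m+2) comes from the new linear factor, the
    exponential from ((m+1)/(m+2))^w. The terms linear in w cancel up to O(1/m^2). *)
Definition rho (m : nat) (w : C) : C :=
  (1 + RtoC (/ INR (S (S m))) * w) * Cexp (- (RtoC (lstep m) * w)).

Definition drho (m : nat) (w : C) : C :=
  Cexp (- (RtoC (lstep m) * w)) *
  (RtoC (/ INR (S (S m))) - RtoC (lstep m) * (1 + RtoC (/ INR (S (S m))) * w)).

(* [Q m w] is [(w)_{n+1} / (n! n^w)] with [n = m + 1]. *)
Fixpoint Q (m : nat) (w : C) : C :=
  match m with O => w * (w + 1) | S p => Q p w * rho p w end.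

Fixpoint DQ (m : nat) (w : C) : C :=
  match m with O => 2 * w + 1 | S p => DQ p w * rho p w + Q p w * drho p w end.

Definition tinv (m : nat) : R := (/ INR (S m))%R.

Lemma tinv_pos m : (0 < tinv m)%R.
Proof. apply Rinv_0_lt_compat, lt_0_INR. lia. Qed.

Lemma tinv_le1 m : (tinv m <= 1)%R.
Proof.
  unfold tinv. rewrite <- Rinv_1. apply Rinv_le_contravar; [lra|].
  rewrite S_INR. generalize (pos_INR m). lra.
Qed.

(** Replaces the convergence of the sum of 1/m^2 by telescoping: the errors below are phrased
    through the differences [tinv m - tinv (S m)]. *)
Lemma tinv_sqr_le m : (tinv m * tinv m <= 2 * (tinv m - tinv (S m)))%R.
Proof.
  unfold tinv. rewrite !S_INR. assert (H := pos_INR m).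
  apply Rmult_le_reg_r with ((INR m + 1) * (INR m + 1) * (INR m + 1 + 1))%R.
  { repeat apply Rmult_lt_0_compat; lra. }
  field_simplify; nra.
Qed.

Lemma tinv_lim : is_lim_seq tinv 0%R.
Proof.
  unfold tinv. apply (is_lim_seq_incr_1 (fun n => / INR n)%R).
  apply (is_lim_seq_inv INR p_infty); [apply is_lim_seq_INR|discriminate].
Qed.

Lemma ln_le_sub1 x : (0 < x)%R -> (ln x <= x - 1)%R.
Proof.
  intros H. assert (E := exp_ineq1_le (ln x)). rewrite exp_ln in E by auto. lra.
Qed.

(** The inequality ln x <= x - 1, used at (m+2)/(m+1) and at its inverse. *)
Lemma lstep_bounds m : (/ INR (S (S m)) <= lstep m <= tinv m)%R.
Proof.
  unfold lstep, tinv. assert (H := pos_INR m).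
  assert (H1 : (0 < INR (S m))%R) by (apply lt_0_INR; lia).
  assert (H2 : (0 < INR (S (S m)))%R) by (apply lt_0_INR; lia).
  rewrite <- ln_div by auto. split.
  - replace (INR (S (S m)) / INR (S m))%R with (/ (INR (S m) / INR (S (S m))))%R by (field; split; lra).
    rewrite ln_Rinv by (apply Rdiv_lt_0_compat; auto).
    assert (E := ln_le_sub1 (INR (S m) / INR (S (S m))) ltac:(apply Rdiv_lt_0_compat; auto)).
    replace (INR (S m) / INR (S (S m)) - 1)%R with (- / INR (S (S m)))%R in E; [lra|].
    rewrite (S_INR (S m)) in *. field. lra.
  - assert (E := ln_le_sub1 (INR (S (S m)) / INR (S m)) ltac:(apply Rdiv_lt_0_compat; auto)).
    replace (INR (S (S m)) / INR (S m) - 1)%R with (/ INR (S m))%R in E; [lra|].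
    rewrite (S_INR (S m)). field. lra.
Qed.

Lemma cderive_rho m (a b : C) (t : R) :
  cderive (fun s => rho m (a + RtoC s * b)) t (b * drho m (a + RtoC t * b)).
Proof.
  unfold rho.
  eapply cderive_eq; [|apply (cderive_mult (fun s => 1 + RtoC (/ INR (S (S m))) * (a + RtoC s * b))
     (fun s => Cexp (- (RtoC (lstep m) * (a + RtoC s * b)))))].
  2:{ apply cderive_plus; [apply cderive_const|]. apply cderive_scal. apply cderive_affine. }
  2:{ apply (cderive_Cexp (fun s => - (RtoC (lstep m) * (a + RtoC s * b)))).
      apply (cderive_ext (fun s => - RtoC (lstep m) * (a + RtoC s * b))).
      { intros; ring. }
      apply cderive_scal. apply cderive_affine. }
  unfold drho. ring.
Qed.

Lemma cderive_Q m (a b : C) (t : R) :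
  cderive (fun s => Q m (a + RtoC s * b)) t (b * DQ m (a + RtoC t * b)).
Proof.
  revert t. induction m as [|m IH]; intros t; simpl.
  - eapply cderive_eq; [|apply (cderive_mult (fun s => a + RtoC s * b) (fun s => a + RtoC s * b + 1))].
    2: apply cderive_affine.
    2: apply cderive_plus; [apply cderive_affine|apply cderive_const].
    ring.
  - eapply cderive_eq; [|apply (cderive_mult (fun s => Q m (a + RtoC s * b)) (fun s => rho m (a + RtoC s * b)))].
    2: apply IH. 2: apply cderive_rho. ring.
Qed.

Lemma Cmod_exp_le (a : C) : (Cmod (Cexp a) <= exp (Cmod a))%R.
Proof.
  rewrite Cmod_Cexp. assert (H : (Re a <= Cmod a)%R).
  { eapply Rle_trans; [apply Rle_abs|apply re_le_Cmod]. }
  destruct H as [H|H]; [left; now apply exp_increasing|rewrite H; right; reflexivity].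
Qed.

Lemma exp_le x y : (x <= y)%R -> (exp x <= exp y)%R.
Proof. intros [H|H]; [left; now apply exp_increasing|rewrite H; right; reflexivity]. Qed.

(** Constant in |rho - 1| <= Kc B / (m+1)^2 for |w| <= B: the bound (1 + B) exp B for [drho], times
    2 B from [cderive_bound] on the segment from 0 to w, with B enlarged to 1 + B. *)
Definition Kc (B : R) : R := (2 * (1 + B) * (1 + B) * exp B)%R.

Lemma drho_bound m (w : C) (B : R) : (Cmod w <= B)%R ->
  (Cmod (drho m w) <= (1 + B) * exp B * (tinv m * tinv m))%R.
Proof.
  intros H. assert (L := lstep_bounds m). assert (T := tinv_pos m). assert (T1 := tinv_le1 m).
  assert (P := Cmod_ge_0 w).
  assert (P2 : (0 < / INR (S (S m)))%R) by (apply Rinv_0_lt_compat, lt_0_INR; lia).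
  unfold drho. rewrite Cmod_mult.
  replace ((1 + B) * exp B * (tinv m * tinv m))%R with (exp B * ((1 + B) * (tinv m * tinv m)))%R by ring.
  apply Rmult_le_compat; try apply Cmod_ge_0.
  - eapply Rle_trans; [apply Cmod_exp_le|]. apply exp_le. rewrite Cmod_opp, Cmod_mult, Cmod_R.
    rewrite Rabs_pos_eq by lra.
    apply Rle_trans with (1 * Cmod w)%R; [|lra]. apply Rmult_le_compat_r; lra.
  (* Grouped so that the first-order quantities 1/(m+2) and [lstep m] cancel; their difference and
     their product are both at most [tinv m] squared. *)
  - replace (RtoC (/ INR (S (S m))) - RtoC (lstep m) * (1 + RtoC (/ INR (S (S m))) * w))
      with (RtoC (/ INR (S (S m)) - lstep m) + RtoC (- (lstep m * / INR (S (S m)))) * w).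
    2:{ rewrite RtoC_minus, RtoC_opp, RtoC_mult. ring. }
    eapply Rle_trans; [apply Cmod_triangle|]. rewrite Cmod_mult, !Cmod_R.
    rewrite Rabs_Ropp, (Rabs_pos_eq (lstep m * / INR (S (S m)))) by (apply Rmult_le_pos; lra).
    rewrite Rabs_left1 by lra.
    assert (E1 : (tinv m - / INR (S (S m)) <= tinv m * tinv m)%R).
    { unfold tinv. assert (Hm := pos_INR m). rewrite (S_INR (S m)), (S_INR m).
      apply Rmult_le_reg_r with ((INR m + 1) * (INR m + 1) * (INR m + 1 + 1))%R.
      { repeat apply Rmult_lt_0_compat; lra. }
      field_simplify; nra. }
    assert (E2 : (lstep m * / INR (S (S m)) <= tinv m * tinv m)%R).
    { apply Rmult_le_compat; lra. }
    assert (E3 : (lstep m * / INR (S (S m)) * Cmod w <= tinv m * tinv m * B)%R).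
    { apply Rmult_le_compat; try lra. apply Rmult_le_pos; lra. }
    lra.
Qed.

Lemma rho_bound m (w : C) (B : R) : (Cmod w <= B)%R ->
  (Cmod (rho m w - 1) <= Kc B * (tinv m * tinv m))%R.
Proof.
  intros H. assert (P := Cmod_ge_0 w). assert (T := tinv_pos m).
  assert (X := cderive_bound (fun s => rho m (0 + RtoC s * w)) (fun s => w * drho m (0 + RtoC s * w))
     (B * ((1 + B) * exp B * (tinv m * tinv m))) 0 1).
  simpl in X.
  assert (E0 : rho m (0 + 0 * w) = 1).
  { unfold rho. replace (- (RtoC (lstep m) * (0 + 0 * w))) with (RtoC 0) by ring.
    rewrite Cexp_0. ring. }
  rewrite E0 in X.
  replace (0 + 1 * w) with w in X by ring.
  eapply Rle_trans; [apply X|].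
  - intros t Ht. rewrite Rmin_left, Rmax_right in Ht by lra. split; [apply cderive_rho|].
    rewrite Cmod_mult. apply Rmult_le_compat; try apply Cmod_ge_0; auto.
    apply drho_bound. replace (0 + RtoC t * w) with (RtoC t * w) by ring.
    rewrite Cmod_mult, Cmod_R, Rabs_pos_eq by lra.
    apply Rle_trans with (1 * Cmod w)%R; [apply Rmult_le_compat_r; lra|lra].
  - rewrite Rminus_0_r, Rabs_R1, Rmult_1_r. unfold Kc.
    assert (Ee := exp_pos B).
    assert (0 <= exp B * (tinv m * tinv m))%R by (apply Rmult_le_pos; [lra|apply Rmult_le_pos; lra]).
    assert (0 <= (1 + B) * (exp B * (tinv m * tinv m)))%R by (apply Rmult_le_pos; lra).
    lra.
Qed.

Lemma Kc_pos B : (0 <= B)%R -> (0 < Kc B)%R.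
Proof. intros H. unfold Kc. assert (E := exp_pos B). repeat apply Rmult_lt_0_compat; lra. Qed.

(** Discrete Gronwall inequality: the factors 1 + K (tinv m - tinv (m+1)) are bounded by
    exponentials whose exponents telescope to at most K, because [tinv] is at most 1. *)
Lemma growth_bound (S : nat -> R) (K : R) (N : nat) : (0 <= K)%R ->
  (forall m, (0 <= S m)%R) ->
  (forall m, (N <= m)%nat -> (S (1 + m)%nat <= S m * (1 + K * (tinv m - tinv (1 + m))))%R) ->
  forall m, (N <= m)%nat -> (S m <= S N * exp K)%R.
Proof.
  intros HK HS H m Hm.
  assert (G : (S m <= S N * exp (K * (tinv N - tinv m)))%R).
  { induction Hm as [|m Hm IH].
    - replace (K * (tinv N - tinv N))%R with 0%R by ring. rewrite exp_0. lra.
    - eapply Rle_trans; [apply H; auto|].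
      replace (K * (tinv N - tinv (Datatypes.S m)))%R
        with (K * (tinv N - tinv m) + K * (tinv m - tinv (1 + m)))%R by (simpl; ring).
      rewrite exp_plus, <- Rmult_assoc.
      assert (D : (0 <= tinv m - tinv (1 + m))%R).
      { generalize (tinv_sqr_le m). assert (T := tinv_pos m). simpl. nra. }
      apply Rmult_le_compat; auto.
      + assert (0 <= K * (tinv m - tinv (1 + m)))%R by (apply Rmult_le_pos; lra). lra.
      + apply exp_ineq1_le. }
  eapply Rle_trans; [exact G|]. apply Rmult_le_compat_l; auto.
  apply exp_le. assert (T1 := tinv_le1 N). assert (T := tinv_pos m).
  rewrite <- (Rmult_1_r K) at 2. apply Rmult_le_compat_l; lra.
Qed.

Definition KM (B : R) : R := (((B * (B + 1)) + (2 * B + 1)) * exp (4 * Kc B))%R.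

(** The recursion of [DQ] involves [Q], so the sum of both moduli is propagated. [KM] is the bound
    for the starting values w (w + 1) and 2 w + 1 times the Gronwall factor. *)
Lemma Q_bound (B : R) (w : C) : (Cmod w <= B)%R ->
  forall m, (Cmod (Q m w) + Cmod (DQ m w) <= KM B)%R.
Proof.
  intros H m. assert (P := Cmod_ge_0 w). assert (HB : (0 <= B)%R) by lra.
  assert (HK := Kc_pos B HB).
  assert (G := growth_bound (fun m => Cmod (Q m w) + Cmod (DQ m w))%R (4 * Kc B) 0).
  simpl in G. eapply Rle_trans; [apply G; try lia|].
  - lra.
  - intros k. generalize (Cmod_ge_0 (Q k w)) (Cmod_ge_0 (DQ k w)). lra.
  - intros k _.
    assert (R1 := rho_bound k w B H). assert (R2 := drho_bound k w B H).
    assert (R3 := tinv_sqr_le k).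
    assert (A1 := Cmod_ge_0 (Q k w)). assert (A2 := Cmod_ge_0 (DQ k w)).
    assert (T := tinv_pos k).
    assert (X1 : (Cmod (rho k w) <= 1 + Kc B * (tinv k * tinv k))%R).
    { replace (rho k w) with (1 + (rho k w - 1)) by ring.
      eapply Rle_trans; [apply Cmod_triangle|]. rewrite Cmod_1. lra. }
    assert (X2 : (Cmod (drho k w) <= Kc B * (tinv k * tinv k))%R).
    { eapply Rle_trans; [exact R2|]. apply Rmult_le_compat_r; [nra|].
      unfold Kc. assert (Ee := exp_pos B). apply Rmult_le_compat_r; nra. }
    assert (X3 : (Kc B * (tinv k * tinv k) <= 2 * Kc B * (tinv k - tinv (S k)))%R).
    { replace (2 * Kc B * (tinv k - tinv (S k)))%R with (Kc B * (2 * (tinv k - tinv (S k))))%R by ring.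
      apply Rmult_le_compat_l; lra. }
    assert (Y1 : (Cmod (Q k w * rho k w) <= Cmod (Q k w) * (1 + 2 * Kc B * (tinv k - tinv (S k))))%R).
    { rewrite Cmod_mult. apply Rmult_le_compat_l; lra. }
    assert (Y2 : (Cmod (DQ k w * rho k w + Q k w * drho k w) <=
       Cmod (DQ k w) * (1 + 2 * Kc B * (tinv k - tinv (S k))) + Cmod (Q k w) * (2 * Kc B * (tinv k - tinv (S k))))%R).
    { eapply Rle_trans; [apply Cmod_triangle|]. rewrite !Cmod_mult.
      apply Rplus_le_compat; apply Rmult_le_compat_l; lra. }
    assert (0 <= Cmod (DQ k w) * (2 * Kc B * (tinv k - tinv (S k))))%R.
    { apply Rmult_le_pos; auto. nra. }
    lra.
  - unfold KM. apply Rmult_le_compat_r; [left; apply exp_pos|].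
    apply Rplus_le_compat.
    + rewrite Cmod_mult. apply Rmult_le_compat; try apply Cmod_ge_0; auto.
      eapply Rle_trans; [apply Cmod_triangle|]. rewrite Cmod_1. lra.
    + eapply Rle_trans; [apply Cmod_triangle|]. rewrite Cmod_1, Cmod_mult, Cmod_R, Rabs_pos_eq by lra. lra.
Qed.

Lemma C_complete (u : nat -> C) :
  (forall eps, (0 < eps)%R -> exists N, forall p q, (N <= p)%nat -> (N <= q)%nat -> (Cmod (u p - u q) < eps)%R) ->
  exists l, ctends eventually u l.
Proof.
  intros H.
  assert (H1 : ex_finite_lim_seq (fun n => Re (u n))).
  { apply ex_lim_seq_cauchy_corr. intros eps. destruct (H eps (cond_pos eps)) as [N HN].
    exists N. intros p q Hp Hq. eapply Rle_lt_trans; [|apply (HN p q Hp Hq)].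
    replace (Re (u p) - Re (u q))%R with (Re (u p - u q)) by (destruct (u p), (u q); reflexivity).
    apply re_le_Cmod. }
  assert (H2 : ex_finite_lim_seq (fun n => Im (u n))).
  { apply ex_lim_seq_cauchy_corr. intros eps. destruct (H eps (cond_pos eps)) as [N HN].
    exists N. intros p q Hp Hq. eapply Rle_lt_trans; [|apply (HN p q Hp Hq)].
    replace (Im (u p) - Im (u q))%R with (Im (u p - u q)) by (destruct (u p), (u q); reflexivity).
    apply Im_le_Cmod. }
  destruct H1 as [x Hx], H2 as [y Hy]. exists ((x, y) : C).
  apply ctends_pair; [apply eventually_filter|exact Hx|exact Hy].
Qed.

Lemma ctends_le (u : nat -> C) (l a : C) (r : R) N :
  ctends eventually u l -> (forall n, (N <= n)%nat -> (Cmod (u n - a) <= r)%R) -> (Cmod (l - a) <= r)%R.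
Proof.
  intros H Hr. apply Rnot_lt_le. intros Hlt.
  destruct (H (Cmod (l - a) - r)%R ltac:(lra)) as [n0 Hn0].
  specialize (Hn0 (n0 + N)%nat ltac:(lia)). specialize (Hr (n0 + N)%nat ltac:(lia)).
  rewrite Cmod_sub_sym in Hn0.
  assert (Cmod (l - a) <= Cmod (l - u (n0 + N)%nat) + Cmod (u (n0 + N)%nat - a))%R; [|lra].
  replace (l - a) with ((l - u (n0 + N)%nat) + (u (n0 + N)%nat - a)) by ring. apply Cmod_triangle.
Qed.

(** Telescoping gives the Cauchy property and the rate K / (m+1) together; since K depends only on a
    bound for w, the rate makes the limits locally uniform. *)
Lemma tinv_seq_cauchy (u : nat -> C) (K : R) : (0 <= K)%R ->
  (forall m, (Cmod (u (S m) - u m) <= K * (tinv m - tinv (S m)))%R) ->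
  exists l, ctends eventually u l /\ (forall m, (Cmod (l - u m) <= K * tinv m)%R).
Proof.
  intros HK H.
  assert (G : forall m p, (m <= p)%nat -> (Cmod (u p - u m) <= K * (tinv m - tinv p))%R).
  { intros m p Hp. induction Hp as [|p Hp IH].
    - replace (u m - u m) with (RtoC 0) by ring. rewrite Cmod_0. lra.
    - replace (u (S p) - u m) with ((u (S p) - u p) + (u p - u m)) by ring.
      eapply Rle_trans; [apply Cmod_triangle|]. specialize (H p). lra. }
  assert (G' : forall m p, (m <= p)%nat -> (Cmod (u p - u m) <= K * tinv m)%R).
  { intros m p Hp. eapply Rle_trans; [apply G; auto|]. apply Rmult_le_compat_l; auto.
    generalize (tinv_pos p). lra. }
  destruct (C_complete u) as [l Hl].
  - intros eps He.
    assert (L := tinv_lim). apply is_lim_seq_spec in L.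
    assert (He' : (0 < eps / (K + 1) / 2)%R) by (repeat apply Rdiv_lt_0_compat; lra).
    destruct (L (mkposreal _ He')) as [N HN]. specialize (HN N (le_n N)). simpl in HN.
    rewrite Rminus_0_r, Rabs_pos_eq in HN by apply Rlt_le, tinv_pos.
    exists N. intros p q Hp Hq.
    replace (u p - u q) with ((u p - u N) + - (u q - u N)) by ring.
    eapply Rle_lt_trans; [apply Cmod_triangle|]. rewrite Cmod_opp.
    assert (A := G' N p Hp). assert (B := G' N q Hq).
    assert (K * tinv N <= K * (eps / (K + 1) / 2))%R by (apply Rmult_le_compat_l; lra).
    assert (E : (K * (eps / (K + 1) / 2) < eps / 2)%R).
    { replace (K * (eps / (K + 1) / 2))%R with (eps / 2 - eps / (K + 1) / 2)%R by (field; lra). lra. }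
    lra.
  - exists l. split; auto. intros m. apply (ctends_le u l (u m) _ m); auto.
Qed.

Lemma KM_pos B : (0 <= B)%R -> (0 < KM B)%R.
Proof. intros H. unfold KM. apply Rmult_lt_0_compat; [nra|apply exp_pos]. Qed.

Definition KQ (B : R) : R := (4 * KM B * Kc B)%R.

Lemma KQ_pos B : (0 <= B)%R -> (0 < KQ B)%R.
Proof.
  intros H. unfold KQ. assert (A := KM_pos B H). assert (D := Kc_pos B H).
  apply Rmult_lt_0_compat; [apply Rmult_lt_0_compat|]; lra.
Qed.

Lemma Q_step_bound B w m : (Cmod w <= B)%R ->
  (Cmod (Q (S m) w - Q m w) <= KQ B * (tinv m - tinv (S m)))%R /\
  (Cmod (DQ (S m) w - DQ m w) <= KQ B * (tinv m - tinv (S m)))%R.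
Proof.
  intros H. assert (P := Cmod_ge_0 w). assert (HB : (0 <= B)%R) by lra.
  assert (HK := Kc_pos B HB). assert (HM := KM_pos B HB).
  assert (b := Q_bound B w H m).
  assert (A1 := Cmod_ge_0 (Q m w)). assert (A2 := Cmod_ge_0 (DQ m w)).
  assert (R1 := rho_bound m w B H). assert (R2 := drho_bound m w B H).
  assert (R3 := tinv_sqr_le m). assert (T := tinv_pos m).
  assert (X2 : (Cmod (drho m w) <= Kc B * (tinv m * tinv m))%R).
  { eapply Rle_trans; [exact R2|]. apply Rmult_le_compat_r; [nra|].
    unfold Kc. assert (Ee := exp_pos B). apply Rmult_le_compat_r; nra. }
  assert (X3 : (Kc B * (tinv m * tinv m) <= 2 * Kc B * (tinv m - tinv (S m)))%R).
  { replace (2 * Kc B * (tinv m - tinv (S m)))%R with (Kc B * (2 * (tinv m - tinv (S m))))%R by ring.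
    apply Rmult_le_compat_l; lra. }
  assert (X4 : (0 <= 2 * Kc B * (tinv m - tinv (S m)))%R) by nra.
  unfold KQ. simpl. split.
  - replace (Q m w * rho m w - Q m w) with (Q m w * (rho m w - 1)) by ring.
    rewrite Cmod_mult.
    assert (Cmod (Q m w) * Cmod (rho m w - 1) <= KM B * (2 * Kc B * (tinv m - tinv (S m))))%R.
    { apply Rmult_le_compat; try apply Cmod_ge_0; lra. }
    nra.
  - replace (DQ m w * rho m w + Q m w * drho m w - DQ m w)
      with (DQ m w * (rho m w - 1) + Q m w * drho m w) by ring.
    eapply Rle_trans; [apply Cmod_triangle|]. rewrite !Cmod_mult.
    assert (Cmod (DQ m w) * Cmod (rho m w - 1) <= KM B * (2 * Kc B * (tinv m - tinv (S m))))%R.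
    { apply Rmult_le_compat; try apply Cmod_ge_0; lra. }
    assert (Cmod (Q m w) * Cmod (drho m w) <= KM B * (2 * Kc B * (tinv m - tinv (S m))))%R.
    { apply Rmult_le_compat; try apply Cmod_ge_0; lra. }
    lra.
Qed.

(* 1/Gamma and its derivative. *)
Definition Rg (w : C) : C := Clim (fun m => Q m w).
Definition DRg (w : C) : C := Clim (fun m => DQ m w).

Lemma Q_lim (B : R) (w : C) : (Cmod w <= B)%R ->
  ctends eventually (fun m => Q m w) (Rg w) /\ ctends eventually (fun m => DQ m w) (DRg w) /\
  (forall m, (Cmod (Rg w - Q m w) <= KQ B * tinv m)%R) /\
  (forall m, (Cmod (DRg w - DQ m w) <= KQ B * tinv m)%R).
Proof.
  intros H. assert (P := Cmod_ge_0 w). assert (HB : (0 <= B)%R) by lra.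
  assert (HK := KQ_pos B HB).
  destruct (tinv_seq_cauchy (fun m => Q m w) (KQ B)) as [l [Hl Hl']]; [lra| |].
  { intros m. now apply Q_step_bound. }
  destruct (tinv_seq_cauchy (fun m => DQ m w) (KQ B)) as [l2 [Hl2 Hl2']]; [lra| |].
  { intros m. now apply Q_step_bound. }
  assert (E : Rg w = l) by (now apply Clim_eq).
  assert (E2 : DRg w = l2) by (now apply Clim_eq).
  rewrite E, E2. auto.
Qed.

Lemma Q_cv (w : C) : ctends eventually (fun m => Q m w) (Rg w).
Proof. apply (Q_lim (Cmod w)). lra. Qed.

Lemma DQ_cv (w : C) : ctends eventually (fun m => DQ m w) (DRg w).
Proof. apply (Q_lim (Cmod w)). lra. Qed.

Lemma Rg_bound B w : (Cmod w <= B)%R -> (Cmod (Rg w) <= KM B)%R.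
Proof.
  intros H. replace (Rg w) with (Rg w - 0) by ring.
  apply (ctends_le (fun m => Q m w) _ _ _ 0). apply Q_cv.
  intros n _. replace (Q n w - 0) with (Q n w) by ring.
  generalize (Q_bound B w H n) (Cmod_ge_0 (DQ n w)). lra.
Qed.

Lemma DRg_bound B w : (Cmod w <= B)%R -> (Cmod (DRg w) <= KM B)%R.
Proof.
  intros H. replace (DRg w) with (DRg w - 0) by ring.
  apply (ctends_le (fun m => DQ m w) _ _ _ 0). apply DQ_cv.
  intros n _. replace (DQ n w - 0) with (DQ n w) by ring.
  generalize (Q_bound B w H n) (Cmod_ge_0 (Q n w)). lra.
Qed.

Lemma RtoC_nz (x : R) : x <> 0%R -> RtoC x <> RtoC 0.
Proof. intros H E. apply H. now apply RtoC_inj. Qed.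

Lemma C_cancel_r (s a b : C) : s <> RtoC 0 -> a * s = b * s -> a = b.
Proof.
  intros H E. replace a with (a * s * / s) by (field; auto). rewrite E. field; auto.
Qed.

Lemma INR_S_nz m : INR (S m) <> 0%R.
Proof. apply not_0_INR. lia. Qed.

Lemma fact_nz m : RtoC (INR (fact m)) <> RtoC 0.
Proof. apply RtoC_nz, INR_fact_neq_0. Qed.

Lemma Cinv_0 : / RtoC 0 = RtoC 0.
Proof. unfold Cinv, RtoC; simpl. f_equal; unfold Rdiv; ring. Qed.

Lemma Cexp_ln_step m (w : C) :
  Cexp (w * RtoC (ln (INR (S (S m))))) = Cexp (w * RtoC (ln (INR (S m)))) * Cexp (RtoC (lstep m) * w).
Proof.
  rewrite <- Cexp_plus. f_equal. unfold lstep. rewrite RtoC_minus. ring.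
Qed.

Lemma Q_closed m (w : C) :
  Q m w * (RtoC (INR (fact (S m))) * Cexp (w * RtoC (ln (INR (S m))))) = pochhammer w (S (S m)).
Proof.
  induction m as [|m IH].
  - cbn [Q pochhammer fact]. replace (RtoC (ln (INR 1))) with (RtoC 0).
    2:{ simpl. rewrite ln_1. reflexivity. }
    rewrite Cmult_0_r, Cexp_0. simpl. ring.
  - change (pochhammer w (S (S (S m)))) with (pochhammer w (S (S m)) * (w + RtoC (INR (S (S m))))).
    rewrite <- IH. cbn [Q]. unfold rho.
    rewrite Cexp_ln_step, Cexp_opp. rewrite (fact_simpl (S m)), mult_INR, RtoC_mult, RtoC_inv by apply INR_S_nz.
    assert (N1 := Cexp_nz (RtoC (lstep m) * w)).
    assert (N2 : RtoC (INR (S (S m))) <> RtoC 0) by apply RtoC_nz, INR_S_nz.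
    field. auto.
Qed.

Lemma pochhammer_nz (w : C) n : (forall k, w + RtoC (INR k) <> RtoC 0) -> pochhammer w n <> RtoC 0.
Proof.
  intros H. induction n as [|n IH]; simpl.
  - apply C1_nz.
  - apply Cmult_neq_0; auto.
Qed.

Lemma pochhammer_zero (w : C) k n : w + RtoC (INR k) = RtoC 0 -> (k < n)%nat -> pochhammer w n = RtoC 0.
Proof.
  intros H Hn. induction Hn as [|n Hn IH]; simpl.
  - rewrite H. ring.
  - rewrite IH. ring.
Qed.

Lemma Q_scale_nz m (w : C) : RtoC (INR (fact (S m))) * Cexp (w * RtoC (ln (INR (S m)))) <> RtoC 0.
Proof. apply Cmult_neq_0; [apply fact_nz|apply Cexp_nz]. Qed.

Lemma Q_nz m (w : C) : (forall k, w + RtoC (INR k) <> RtoC 0) -> Q m w <> RtoC 0.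
Proof.
  intros H E. apply (pochhammer_nz w (S (S m)) H). rewrite <- Q_closed, E. ring.
Qed.

(** From some index N on, each factor satisfies |rho| >= 1 - 2 Kc (tinv m - tinv (m+1)), and these
    losses total at most 1/2. Hence |Q m| stays above half of |Q N|, which is nonzero because no
    linear factor vanishes. *)
Lemma Rg_lower (w : C) : (forall k, w + RtoC (INR k) <> RtoC 0) -> Rg w <> RtoC 0.
Proof.
  intros Hw. set (B := Cmod w). assert (HB : (0 <= B)%R) by apply Cmod_ge_0.
  assert (HK := Kc_pos B HB).
  assert (L := tinv_lim). apply is_lim_seq_spec in L.
  (* Makes [2 * Kc B * tinv N] at most 1/4, inside the margin 1/2 used below. *)
  assert (He' : (0 < / (8 * Kc B))%R) by (apply Rinv_0_lt_compat; lra).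
  destruct (L (mkposreal _ He')) as [N HN]. specialize (HN N (le_n N)). simpl in HN.
  rewrite Rminus_0_r, Rabs_pos_eq in HN by apply Rlt_le, tinv_pos.
  assert (HN' : (2 * Kc B * tinv N <= / 2)%R).
  { apply Rle_trans with (2 * Kc B * / (8 * Kc B))%R.
    - apply Rmult_le_compat_l; lra.
    - replace (2 * Kc B * / (8 * Kc B))%R with (/ 4)%R by (field; lra). lra. }
  assert (G : forall m, (N <= m)%nat ->
     (Cmod (Q N w) * (1 - 2 * Kc B * (tinv N - tinv m)) <= Cmod (Q m w))%R).
  { intros m Hm. induction Hm as [|m Hm IH].
    - rewrite Rminus_diag. lra.
    - simpl. rewrite Cmod_mult.
      assert (R1 := rho_bound m w B (Rle_refl _)). assert (R3 := tinv_sqr_le m).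
      assert (X : (1 - 2 * Kc B * (tinv m - tinv (S m)) <= Cmod (rho m w))%R).
      { assert (1 <= Cmod (rho m w) + Cmod (rho m w - 1))%R.
        { rewrite <- Cmod_1 at 1. rewrite <- (Cmod_opp (rho m w - 1)).
          replace (RtoC 1) with (rho m w + - (rho m w - 1)) at 1 by ring. apply Cmod_triangle. }
        assert (Kc B * (tinv m * tinv m) <= Kc B * (2 * (tinv m - tinv (S m))))%R.
        { apply Rmult_le_compat_l; lra. }
        lra. }
      assert (A1 := Cmod_ge_0 (Q N w)). assert (A2 := Cmod_ge_0 (Q m w)).
      assert (T := tinv_pos m). assert (T2 := tinv_pos (S m)).
      assert (Tm : (tinv m <= tinv N)%R).
      { unfold tinv. apply Rinv_le_contravar; [apply lt_0_INR; lia|apply le_INR; lia]. }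
      assert (Tm2 : (0 <= tinv m - tinv (S m))%R) by nra.
      set (x := (2 * Kc B * (tinv N - tinv m))%R) in *.
      set (y := (2 * Kc B * (tinv m - tinv (S m)))%R) in *.
      assert (Hx : (0 <= x)%R) by (unfold x; apply Rmult_le_pos; lra).
      assert (Hy : (0 <= y)%R) by (unfold y; apply Rmult_le_pos; lra).
      assert (Hxy : (x + y <= / 2)%R).
      { unfold x, y. replace (2 * Kc B * (tinv N - tinv m) + 2 * Kc B * (tinv m - tinv (S m)))%R
         with (2 * Kc B * tinv N - 2 * Kc B * tinv (S m))%R by ring.
        assert (0 <= 2 * Kc B * tinv (S m))%R by (apply Rmult_le_pos; lra). lra. }
      replace (2 * Kc B * (tinv N - tinv (S m)))%R with (x + y)%R by (unfold x, y; ring).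
      apply Rle_trans with (Cmod (Q N w) * (1 - x) * (1 - y))%R.
      + rewrite Rmult_assoc. apply Rmult_le_compat_l; auto. nra.
      + apply Rmult_le_compat; auto; try lra. apply Rmult_le_pos; lra. }
  assert (PN : (0 < Cmod (Q N w))%R).
  { apply Cmod_gt_0. now apply Q_nz. }
  intros E. assert (H := Q_cv w). rewrite E in H.
  destruct (H (Cmod (Q N w) / 2)%R ltac:(lra)) as [n Hn].
  specialize (Hn (n + N)%nat ltac:(lia)). specialize (G (n + N)%nat ltac:(lia)).
  replace (Q (n + N) w - 0) with (Q (n + N) w) in Hn by ring.
  assert (T := tinv_pos (n + N)).
  assert (2 * Kc B * (tinv N - tinv (n + N)) <= / 2)%R.
  { assert (0 <= 2 * Kc B * tinv (n + N))%R by (apply Rmult_le_pos; lra). lra. }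
  nra.
Qed.

Lemma Q_zero m k (w : C) : w + RtoC (INR k) = RtoC 0 -> (k <= m)%nat -> Q m w = RtoC 0.
Proof.
  intros H Hk. assert (E := Q_closed m w). rewrite (pochhammer_zero w k) in E by (auto; lia).
  destruct (Ceq_dec (Q m w) 0) as [D|D]; auto. exfalso.
  apply (Cmult_neq_0 _ _ D (Q_scale_nz m w)). exact E.
Qed.

Lemma Rg_zero k (w : C) : w + RtoC (INR k) = RtoC 0 -> Rg w = RtoC 0.
Proof.
  intros H. apply (ctends_unique eventually (fun m => Q m w)). { apply Q_cv. }
  apply ctends_ext_loc with (fun _ => RtoC 0); ev.
  - exists k. intros n Hn. symmetry. eapply Q_zero; eauto.
  - apply ctends_const, eventually_filter.
Qed.

(** True at the poles too: there [Rg] and almost all [Q m] vanish, and the convention / 0 = 0 yields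
    0 on both sides. *)
Lemma Gamma_eq (w : C) : Gamma w = / Rg w.
Proof.
  (* [Q m] belongs to the index n = m + 1, so the term n = 0 of Euler's sequence is dropped. *)
  unfold Gamma. apply Clim_eq. apply ctends_S.
  apply ctends_ext with (fun m => / Q m w); ev.
  { intros m. unfold Cpower. rewrite Clog_RtoC by (apply lt_0_INR; lia).
    rewrite <- Q_closed. assert (N := Q_scale_nz m w).
    destruct (Ceq_dec (Q m w) 0) as [D|D].
    - rewrite D. unfold Cdiv. rewrite Cmult_0_l, Cinv_0. ring.
    - assert (N1 := fact_nz (S m)). assert (N2 := Cexp_nz (w * RtoC (ln (INR (S m))))). field. auto. }
  destruct (classic (exists k, w + RtoC (INR k) = RtoC 0)) as [[k Hk]|Hk].
  - rewrite (Rg_zero k w Hk), Cinv_0.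
    apply ctends_ext_loc with (fun _ => RtoC 0); ev.
    + exists k. intros n Hn. rewrite (Q_zero n k w); auto. now rewrite Cinv_0.
    + apply ctends_const, eventually_filter.
  - apply ctends_inv; [apply eventually_filter| |apply Q_cv].
    apply Rg_lower. intros k E. apply Hk. now exists k.
Qed.

Lemma pochhammer_left (w : C) n : pochhammer w (S n) = w * pochhammer (w + 1) n.
Proof.
  induction n as [|n IH]. { simpl. ring. }
  change (pochhammer w (S (S n))) with (pochhammer w (S n) * (w + RtoC (INR (S n)))).
  rewrite IH. change (pochhammer (w + 1) (S n)) with (pochhammer (w + 1) n * (w + 1 + RtoC (INR n))).
  rewrite S_INR, RtoC_plus. ring.
Qed.

(** Finite form of the functional equation of 1/Gamma: the extra factor (w + m + 2) / (m + 1) tends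
    to 1 in the limit, but is kept exact for the later shift estimates of the approximants. *)
Lemma Q_succ m (w : C) :
  w * Q m (w + 1) * RtoC (INR (S m)) = Q m w * (w + RtoC (INR (S (S m)))).
Proof.
  assert (N := Q_scale_nz m w).
  assert (E1 := Q_closed m w). assert (E2 := Q_closed m (w + 1)).
  assert (E : w * pochhammer (w + 1) (S (S m)) = pochhammer w (S (S m)) * (w + RtoC (INR (S (S m))))).
  { rewrite <- pochhammer_left. reflexivity. }
  rewrite <- E1, <- E2 in E.
  replace ((w + 1) * RtoC (ln (INR (S m)))) with (w * RtoC (ln (INR (S m))) + RtoC (ln (INR (S m)))) in E by ring.
  rewrite Cexp_plus, Cexp_RtoC, exp_ln in E by (apply lt_0_INR; lia).
  set (s := RtoC (INR (fact (S m))) * Cexp (w * RtoC (ln (INR (S m))))) in *.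
  apply (C_cancel_r s); auto. rewrite <- Cmult_assoc, (Cmult_comm (RtoC (INR (S m)))).
  transitivity (w * (Q m (w + 1) *
     (RtoC (INR (fact (S m))) * (Cexp (w * RtoC (ln (INR (S m)))) * RtoC (INR (S m)))))).
  { unfold s. ring. }
  rewrite E. ring.
Qed.

Lemma ctends_tinv : ctends eventually (fun m => RtoC (tinv m)) 0.
Proof. apply ctends_RtoC; [apply eventually_filter|]. exact tinv_lim. Qed.

Lemma Rg_rec (w : C) : Rg w = w * Rg (w + 1).
Proof.
  apply (ctends_unique eventually (fun m => w * Q m (w + 1))).
  2:{ apply ctends_mult; ev.
      apply ctends_const, eventually_filter. apply Q_cv. }
  apply ctends_ext with (fun m => Q m w * (1 + (w + 1) * RtoC (tinv m))); ev.
  { intros m. assert (N : RtoC (INR (S m)) <> RtoC 0) by apply RtoC_nz, INR_S_nz.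
    apply (C_cancel_r (RtoC (INR (S m)))); auto. rewrite Q_succ.
    unfold tinv. rewrite RtoC_inv by apply INR_S_nz. rewrite (S_INR (S m)), RtoC_plus. field. auto. }
  replace (Rg w) with (Rg w * (1 + (w + 1) * 0)) by ring.
  apply ctends_mult; ev. { apply Q_cv. }
  apply ctends_plus; ev. { apply ctends_const, eventually_filter. }
  apply ctends_mult; ev; [apply ctends_const, eventually_filter|apply ctends_tinv].
Qed.

Lemma Cmod_seg (a b : C) (B t : R) : (Cmod a <= B)%R -> (Cmod b <= B)%R -> (0 <= t <= 1)%R ->
  (Cmod (a + RtoC t * (b - a)) <= B)%R.
Proof.
  intros Ha Hb Ht. replace (a + RtoC t * (b - a)) with (RtoC (1 - t) * a + RtoC t * b).
  2:{ rewrite RtoC_minus. ring. }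
  eapply Rle_trans; [apply Cmod_triangle|]. rewrite !Cmod_mult, !Cmod_R, !Rabs_pos_eq by lra.
  assert ((1 - t) * Cmod a <= (1 - t) * B)%R by (apply Rmult_le_compat_l; lra).
  assert (t * Cmod b <= t * B)%R by (apply Rmult_le_compat_l; lra). lra.
Qed.

Lemma Rg_lipschitz (B : R) (a b : C) : (Cmod a <= B)%R -> (Cmod b <= B)%R ->
  (Cmod (Rg b - Rg a) <= 2 * KM B * Cmod (b - a))%R.
Proof.
  intros Ha Hb.
  assert (G : forall m, (Cmod (Q m b - Q m a) <= 2 * KM B * Cmod (b - a))%R).
  { intros m. assert (X := cderive_bound (fun s => Q m (a + RtoC s * (b - a)))
      (fun s => (b - a) * DQ m (a + RtoC s * (b - a))) (Cmod (b - a) * KM B) 0 1).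
    simpl in X. replace (a + 0 * (b - a)) with a in X by ring.
    replace (a + 1 * (b - a)) with b in X by ring.
    eapply Rle_trans; [apply X|].
    - intros t Ht. rewrite Rmin_left, Rmax_right in Ht by lra. split; [apply cderive_Q|].
      rewrite Cmod_mult. apply Rmult_le_compat_l; [apply Cmod_ge_0|].
      generalize (Q_bound B _ (Cmod_seg a b B t Ha Hb Ht) m)
        (Cmod_ge_0 (Q m (a + RtoC t * (b - a)))). lra.
    - rewrite Rminus_0_r, Rabs_R1. lra. }
  replace (Rg b - Rg a) with (Rg b - Rg a - 0) by ring.
  apply (ctends_le (fun m => Q m b - Q m a) _ _ _ 0).
  - apply ctends_minus; ev; apply Q_cv.
  - intros n _. replace (Q n b - Q n a - 0) with (Q n b - Q n a) by ring. apply G.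
Qed.

(** The Lipschitz constant of [Rg - Q m] is O(1/m): the derivative of [Q p - Q m] is small by the
    rate for [DQ], and then p tends to infinity. *)
Lemma Qdiff_lipschitz (B : R) (a b : C) m : (Cmod a <= B)%R -> (Cmod b <= B)%R ->
  (Cmod ((Rg b - Rg a) - (Q m b - Q m a)) <= 4 * KQ B * tinv m * Cmod (b - a))%R.
Proof.
  intros Ha Hb. assert (HB : (0 <= B)%R) by (generalize (Cmod_ge_0 a); lra).
  assert (HK := KQ_pos B HB).
  assert (G : forall p, (Cmod ((Q p b - Q p a) - (Q m b - Q m a)) <= 4 * KQ B * (tinv m + tinv p) * Cmod (b - a))%R).
  { intros p. assert (X := cderive_bound (fun s => Q p (a + RtoC s * (b - a)) - Q m (a + RtoC s * (b - a)))
      (fun s => (b - a) * DQ p (a + RtoC s * (b - a)) - (b - a) * DQ m (a + RtoC s * (b - a)))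
       (Cmod (b - a) * (KQ B * (tinv m + tinv p))) 0 1).
    simpl in X. replace (a + 0 * (b - a)) with a in X by ring.
    replace (a + 1 * (b - a)) with b in X by ring.
    replace ((Q p b - Q p a) - (Q m b - Q m a)) with ((Q p b - Q m b) - (Q p a - Q m a)) by ring.
    eapply Rle_trans; [apply X|].
    - intros t Ht. rewrite Rmin_left, Rmax_right in Ht by lra. split.
      + apply cderive_minus; apply cderive_Q.
      + set (w := a + RtoC t * (b - a)).
        replace ((b - a) * DQ p w - (b - a) * DQ m w) with ((b - a) * ((DRg w - DQ m w) - (DRg w - DQ p w))) by ring.
        rewrite Cmod_mult. apply Rmult_le_compat_l; [apply Cmod_ge_0|].
        destruct (Q_lim B w (Cmod_seg a b B t Ha Hb Ht)) as [_ [_ [_ D]]].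
        unfold Cminus at 1. eapply Rle_trans; [apply Cmod_triangle|]. rewrite Cmod_opp.
        assert (D1 := D m). assert (D2 := D p). lra.
    - rewrite Rminus_0_r, Rabs_R1.
      assert (0 <= Cmod (b - a) * (KQ B * (tinv m + tinv p)))%R.
      { apply Rmult_le_pos; [apply Cmod_ge_0|]. apply Rmult_le_pos; [lra|].
        generalize (tinv_pos m) (tinv_pos p). lra. }
      lra. }
  apply Rnot_lt_le. intros Hlt.
  set (d := (Cmod (Rg b - Rg a - (Q m b - Q m a)) - 4 * KQ B * tinv m * Cmod (b - a))%R).
  assert (Hd : (0 < d / 3)%R) by (unfold d; lra).
  assert (L : ctends eventually (fun p => (Q p b - Q p a) - (Q m b - Q m a)) ((Rg b - Rg a) - (Q m b - Q m a))).
  { apply ctends_minus; ev; [|apply ctends_const, eventually_filter].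
    apply ctends_minus; ev; apply Q_cv. }
  assert (L2 : ctends eventually (fun p => RtoC (4 * KQ B * Cmod (b - a)) * RtoC (tinv p)) (RtoC (4 * KQ B * Cmod (b - a)) * 0)).
  { apply ctends_mult; ev; [apply ctends_const, eventually_filter|apply ctends_tinv]. }
  destruct (L _ Hd) as [N1 H1]. destruct (L2 _ Hd) as [N2 H2].
  specialize (H1 (N1 + N2)%nat ltac:(lia)). specialize (H2 (N1 + N2)%nat ltac:(lia)).
  specialize (G (N1 + N2)%nat). set (p := (N1 + N2)%nat) in *.
  replace (RtoC (4 * KQ B * Cmod (b - a)) * RtoC (tinv p) - RtoC (4 * KQ B * Cmod (b - a)) * 0)
    with (RtoC (4 * KQ B * Cmod (b - a) * tinv p)) in H2 by (rewrite RtoC_mult; ring).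
  rewrite Cmod_R in H2. apply Rabs_def2 in H2. rewrite Cmod_sub_sym in H1.
  assert (Cmod (Rg b - Rg a - (Q m b - Q m a)) <=
     Cmod (Rg b - Rg a - (Q m b - Q m a) - (Q p b - Q p a - (Q m b - Q m a))) + Cmod (Q p b - Q p a - (Q m b - Q m a)))%R.
  { eapply Rle_trans; [|apply Cmod_triangle]. apply Req_le. f_equal. ring. }
  unfold d in *. lra.
Qed.

(** The difference quotients of [Rg] and [Q m] differ by the Lipschitz constant of [Rg - Q m],
    whatever the increment. So m is fixed first, and only then is the increment made small for the
    differentiable function [Q m]. *)
Lemma cderive_Rg (a b : C) (t : R) :
  cderive (fun s => Rg (a + RtoC s * b)) t (b * DRg (a + RtoC t * b)).
Proof.
  apply cderive_of_quotient. intros eps He.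
  set (B := (Cmod a + (Rabs t + 1) * Cmod b)%R).
  assert (HBs : forall s, (Rabs (s - t) < 1)%R -> (Cmod (a + RtoC s * b) <= B)%R).
  { intros s Hs. unfold B. eapply Rle_trans; [apply Cmod_triangle|]. apply Rplus_le_compat_l.
    rewrite Cmod_mult, Cmod_R. apply Rmult_le_compat_r; [apply Cmod_ge_0|].
    replace s with (t + (s - t))%R by ring. eapply Rle_trans; [apply Rabs_triang|]. lra. }
  assert (Ht := HBs t ltac:(rewrite Rminus_diag, Rabs_R0; lra)).
  assert (HB : (0 <= B)%R) by (generalize (Cmod_ge_0 (a + RtoC t * b)); lra).
  assert (HK := KQ_pos B HB).
  set (K := (4 * KQ B * (Cmod b + 1))%R).
  assert (Pb := Cmod_ge_0 b).
  assert (PK : (0 < K)%R) by (unfold K; apply Rmult_lt_0_compat; lra).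
  assert (L := tinv_lim). apply is_lim_seq_spec in L.
  assert (He' : (0 < eps / 4 / K)%R) by (repeat apply Rdiv_lt_0_compat; lra).
  destruct (L (mkposreal _ He')) as [m Hm]. specialize (Hm m (le_n m)). simpl in Hm.
  rewrite Rminus_0_r, Rabs_pos_eq in Hm by apply Rlt_le, tinv_pos.
  assert (Hm' : (K * tinv m <= eps / 4)%R).
  { replace (eps / 4)%R with (K * (eps / 4 / K))%R by (field; lra). apply Rmult_le_compat_l; lra. }
  assert (D := cderive_quotient _ _ _ (cderive_Q m a b t)).
  destruct (D (eps / 4)%R ltac:(lra)) as [d Hd].
  assert (Hmin : (0 < Rmin d 1)%R) by (apply Rmin_pos; [apply cond_pos|lra]).
  apply (locally'_intro _ _ (Rmin d 1)); auto. intros s Hn Hs.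
  assert (Hs1 : (Rabs (s - t) < d)%R) by (eapply Rlt_le_trans; [exact Hs|apply Rmin_l]).
  assert (Hs2 : (Rabs (s - t) < 1)%R) by (eapply Rlt_le_trans; [exact Hs|apply Rmin_r]).
  specialize (Hd s Hs1 Hn).
  assert (X := Qdiff_lipschitz B _ _ m Ht (HBs s Hs2)).
  assert (Nz : RtoC (s - t) <> RtoC 0) by (apply RtoC_nz; lra).
  assert (Pst : (0 < Rabs (s - t))%R) by (apply Rabs_pos_lt; lra).
  set (w1 := a + RtoC s * b) in *. set (w0 := a + RtoC t * b) in *.
  destruct (Q_lim B w0 Ht) as [_ [_ [_ D0]]]. specialize (D0 m).
  replace ((Rg w1 - Rg w0) / RtoC (s - t) - b * DRg w0)
   with ((Rg w1 - Rg w0 - (Q m w1 - Q m w0)) / RtoC (s - t)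
     + ((Q m w1 - Q m w0) / RtoC (s - t) - b * DQ m w0) + - (b * (DRg w0 - DQ m w0))) by (field; auto).
  eapply Rle_lt_trans; [apply Cmod_triangle|]. rewrite Cmod_opp.
  assert (Y := Cmod_triangle ((Rg w1 - Rg w0 - (Q m w1 - Q m w0)) / RtoC (s - t)) ((Q m w1 - Q m w0) / RtoC (s - t) - b * DQ m w0)).
  assert (Z1 : (Cmod ((Rg w1 - Rg w0 - (Q m w1 - Q m w0)) / RtoC (s - t)) <= eps / 4)%R).
  { rewrite Cmod_div, Cmod_R by auto. apply Rmult_le_reg_r with (Rabs (s - t)); auto.
    unfold Rdiv at 1. rewrite Rmult_assoc, Rinv_l, Rmult_1_r by lra.
    eapply Rle_trans; [exact X|].
    replace (w1 - w0) with (RtoC (s - t) * b) by (unfold w1, w0; rewrite RtoC_minus; ring).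
    rewrite Cmod_mult, Cmod_R.
    assert (T := tinv_pos m).
    replace (4 * KQ B * tinv m * (Rabs (s - t) * Cmod b))%R with (4 * KQ B * Cmod b * tinv m * Rabs (s - t))%R by ring.
    apply Rmult_le_compat_r; [lra|]. eapply Rle_trans; [|exact Hm'].
    apply Rmult_le_compat_r; [lra|]. unfold K. apply Rmult_le_compat_l; lra. }
  assert (Z2 : (Cmod (b * (DRg w0 - DQ m w0)) <= eps / 4)%R).
  { rewrite Cmod_mult. eapply Rle_trans; [|exact Hm'].
    assert (T := tinv_pos m).
    apply Rle_trans with (Cmod b * (KQ B * tinv m))%R; [apply Rmult_le_compat_l; lra|].
    replace (Cmod b * (KQ B * tinv m))%R with (KQ B * Cmod b * tinv m)%R by ring.
    apply Rmult_le_compat_r; [lra|]. unfold K.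
    assert (0 <= KQ B * Cmod b)%R by (apply Rmult_le_pos; lra). lra. }
  lra.
Qed.

Lemma ctends_Cexp {T} F {FF : Filter F} (f : T -> C) (l : C) :
  ctends F f l -> ctends F (fun a => Cexp (f a)) (Cexp l).
Proof.
  intros H. assert (H1 := ctends_Re F f l H). assert (H2 := ctends_Im F f l H).
  assert (E : filterlim (fun a => exp (Re (f a))) F (locally (exp (Re l)))).
  { eapply filterlim_comp; [exact H1|]. apply (ex_derive_continuous exp). exists (exp (Re l)).
    apply is_derive_Reals, derivable_pt_lim_exp. }
  assert (E2 : filterlim (fun a => cos (Im (f a))) F (locally (cos (Im l)))).
  { eapply filterlim_comp; [exact H2|]. apply continuous_cos. }
  assert (E3 : filterlim (fun a => sin (Im (f a))) F (locally (sin (Im l)))).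
  { eapply filterlim_comp; [exact H2|]. apply continuous_sin. }
  unfold Cexp. apply ctends_mult; auto; [now apply ctends_RtoC|].
  apply (ctends_pair F (fun a => (cos (Im (f a)), sin (Im (f a))) : C)); auto.
Qed.

Lemma ctends_DQ m {T} F {FF : Filter F} (f : T -> C) (l : C) :
  ctends F f l -> ctends F (fun a => Q m (f a)) (Q m l) /\ ctends F (fun a => DQ m (f a)) (DQ m l).
Proof.
  intros H. induction m as [|m [IH1 IH2]].
  - simpl. split; repeat (apply ctends_mult || apply ctends_plus || apply ctends_const); auto.
  - assert (E : ctends F (fun a => Cexp (- (RtoC (lstep m) * f a))) (Cexp (- (RtoC (lstep m) * l)))).
    { apply ctends_Cexp; auto. apply ctends_opp; auto. apply ctends_mult; auto. apply ctends_const; auto. }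
    assert (E1 : ctends F (fun a => 1 + RtoC (/ INR (S (S m))) * f a) (1 + RtoC (/ INR (S (S m))) * l)).
    { apply ctends_plus; auto. apply ctends_const; auto. apply ctends_mult; auto. apply ctends_const; auto. }
    assert (E2 : ctends F (fun a => rho m (f a)) (rho m l)).
    { unfold rho. apply ctends_mult; auto. }
    assert (E3 : ctends F (fun a => drho m (f a)) (drho m l)).
    { unfold drho. apply ctends_mult; auto. apply ctends_minus; auto. apply ctends_const; auto.
      apply ctends_mult; auto. apply ctends_const; auto. }
    split.
    + apply (ctends_mult F (fun a => Q m (f a)) (fun a => rho m (f a))); auto.
    + apply (ctends_plus F (fun a => DQ m (f a) * rho m (f a)) (fun a => Q m (f a) * drho m (f a))); auto;
      apply ctends_mult; auto.
Qed.

Lemma ctends_Rg {T} F {FF : Filter F} (f : T -> C) (l : C) :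
  ctends F f l -> ctends F (fun a => Rg (f a)) (Rg l).
Proof.
  intros H. set (B := (Cmod l + 1)%R). assert (HB : (0 <= B)%R) by (unfold B; generalize (Cmod_ge_0 l); lra).
  assert (HM := KM_pos B HB). intros eps He.
  assert (He' : (0 < eps / (2 * KM B))%R) by (apply Rdiv_lt_0_compat; lra).
  generalize (filter_and _ _ (ctends_bounded F f l H) (H _ He')). apply filter_imp.
  intros a [Ha Hb].
  eapply Rle_lt_trans; [apply (Rg_lipschitz B)|]; auto. { unfold B. lra. }
  apply Rmult_lt_reg_r with (/ (2 * KM B))%R; [apply Rinv_0_lt_compat; lra|].
  replace (2 * KM B * Cmod (f a - l) * / (2 * KM B))%R with (Cmod (f a - l)) by (field; lra).
  exact Hb.
Qed.

Lemma ctends_DRg {T} F {FF : Filter F} (f : T -> C) (l : C) :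
  ctends F f l -> ctends F (fun a => DRg (f a)) (DRg l).
Proof.
  intros H. set (B := (Cmod l + 1)%R). assert (HB : (0 <= B)%R) by (unfold B; generalize (Cmod_ge_0 l); lra).
  assert (HK := KQ_pos B HB). intros eps He.
  assert (L := tinv_lim). apply is_lim_seq_spec in L.
  assert (He' : (0 < eps / 3 / KQ B)%R) by (repeat apply Rdiv_lt_0_compat; lra).
  destruct (L (mkposreal _ He')) as [m Hm]. specialize (Hm m (le_n m)). simpl in Hm.
  rewrite Rminus_0_r, Rabs_pos_eq in Hm by apply Rlt_le, tinv_pos.
  assert (Hm' : (KQ B * tinv m < eps / 3)%R).
  { replace (eps / 3)%R with (KQ B * (eps / 3 / KQ B))%R by (field; lra). apply Rmult_lt_compat_l; lra. }
  destruct (ctends_DQ m F f l H) as [_ D].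
  generalize (filter_and _ _ (ctends_bounded F f l H) (D (eps / 3)%R ltac:(lra))). apply filter_imp.
  intros a [Ha Hb].
  destruct (Q_lim B (f a) Ha) as [_ [_ [_ D1]]].
  destruct (Q_lim B l ltac:(unfold B; lra)) as [_ [_ [_ D2]]].
  specialize (D1 m). specialize (D2 m). rewrite Cmod_sub_sym in D2.
  replace (DRg (f a) - DRg l) with ((DRg (f a) - DQ m (f a)) + (DQ m (f a) - DQ m l) + (DQ m l - DRg l)) by ring.
  eapply Rle_lt_trans; [apply Cmod_triangle|].
  assert (Y := Cmod_triangle (DRg (f a) - DQ m (f a)) (DQ m (f a) - DQ m l)). lra.
Qed.

(** * The reflection formula *)

Definition rg (t : R) : R := Re (Rg (RtoC t)).
Definition drg (t : R) : R := Re (DRg (RtoC t)).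

Lemma rho_real m t : exists x y, rho m (RtoC t) = RtoC x /\ drho m (RtoC t) = RtoC y.
Proof.
  exists ((1 + / INR (S (S m)) * t) * exp (- (lstep m * t)))%R.
  exists (exp (- (lstep m * t)) * (/ INR (S (S m)) - lstep m * (1 + / INR (S (S m)) * t)))%R.
  unfold rho, drho.
  replace (- (RtoC (lstep m) * RtoC t)) with (RtoC (- (lstep m * t))) by (now rewrite RtoC_opp, RtoC_mult).
  rewrite Cexp_RtoC. rewrite !RtoC_mult, RtoC_minus, RtoC_plus, !RtoC_mult, RtoC_plus, !RtoC_mult. auto.
Qed.

Lemma Q_real m t : Q m (RtoC t) = RtoC (Re (Q m (RtoC t))) /\ DQ m (RtoC t) = RtoC (Re (DQ m (RtoC t))).
Proof.
  assert (H : exists x y, Q m (RtoC t) = RtoC x /\ DQ m (RtoC t) = RtoC y).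
  { induction m as [|m [x [y [H1 H2]]]].
    - exists (t * (t + 1))%R, (2 * t + 1)%R. simpl. now rewrite RtoC_mult, !RtoC_plus, RtoC_mult.
    - destruct (rho_real m t) as [a [b [H3 H4]]]. simpl. rewrite H1, H2, H3, H4.
      exists (x * a)%R, (y * a + x * b)%R. now rewrite RtoC_plus, !RtoC_mult. }
  destruct H as [x [y [-> ->]]]. auto.
Qed.

Lemma ctends_real (u : nat -> C) (l : C) :
  (forall n, u n = RtoC (Re (u n))) -> ctends eventually u l -> l = RtoC (Re l).
Proof.
  intros H Hl. apply (ctends_unique eventually u); auto.
  eapply ctends_ext; [ev| intros n; symmetry; apply H |].
  apply ctends_RtoC; ev. apply (ctends_Re eventually u l Hl).
Qed.

Lemma Rg_real t : Rg (RtoC t) = RtoC (rg t).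
Proof. apply (ctends_real (fun m => Q m (RtoC t))); [|apply Q_cv]. intros n. apply Q_real. Qed.

Lemma DRg_real t : DRg (RtoC t) = RtoC (drg t).
Proof. apply (ctends_real (fun m => DQ m (RtoC t))); [|apply DQ_cv]. intros n. apply Q_real. Qed.

Lemma is_derive_rg t : is_derive rg t (drg t).
Proof.
  assert (H := is_derive_Re _ _ _ (cderive_Rg 0 1 t)).
  replace (Re (1 * DRg (0 + RtoC t * 1))) with (drg t) in H.
  2:{ unfold drg. rewrite Cmult_1_l, Cmult_1_r, Cplus_0_l. reflexivity. }
  eapply is_derive_ext; [|exact H]. intros s. unfold rg. rewrite Cmult_1_r, Cplus_0_l. reflexivity.
Qed.

Lemma rg_rec t : rg t = (t * rg (t + 1))%R.
Proof.
  apply RtoC_inj. rewrite RtoC_mult, <- !Rg_real, RtoC_plus. apply Rg_rec.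
Qed.

Lemma drg_rec t : drg t = (rg (t + 1) + t * drg (t + 1))%R.
Proof.
  assert (H := is_derive_rg t).
  assert (H' : is_derive (fun s => (s * rg (s + 1))%R) t (rg (t + 1) + t * drg (t + 1))%R).
  { replace (rg (t + 1) + t * drg (t + 1))%R with (1 * rg (t + 1) + t * (1 * drg (t + 1)))%R by ring.
    refine (is_derive_mult (fun s => s) (fun s => rg (s + 1)) _ _ _ _ _ _).
    - exact (is_derive_id (K := R_AbsRing) t).
    - refine (is_derive_comp rg (fun s => s + 1)%R t (drg (t + 1)) 1%R _ _). apply is_derive_rg.
      auto_derive; auto.
    - intros; apply Rmult_comm. }
  apply is_derive_unique in H'. rewrite <- H'. symmetry. apply is_derive_unique.
  eapply is_derive_ext; [|exact H]. intros s. apply rg_rec.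
Qed.

Lemma rg_nz t : (forall k, t + INR k <> 0)%R -> rg t <> 0%R.
Proof.
  intros H E. apply (Rg_lower (RtoC t)).
  - intros k. rewrite <- RtoC_plus. apply RtoC_nz, H.
  - now rewrite Rg_real, E.
Qed.

Lemma rg_nz_pos t : (0 < t)%R -> rg t <> 0%R.
Proof. intros H. apply rg_nz. intros k. generalize (pos_INR k). lra. Qed.

Lemma rg_1 : rg 1 = 1%R.
Proof.
  apply RtoC_inj. rewrite <- Rg_real. apply (ctends_unique eventually (fun m => Q m 1)). { apply Q_cv. }
  apply ctends_ext with (fun m => 1 + RtoC (tinv m)); ev.
  - intros m. assert (H := Q_closed m 1).
    rewrite Cmult_1_l, Cexp_RtoC, exp_ln in H by (apply lt_0_INR; lia).
    assert (E : forall n, pochhammer 1 n = RtoC (INR (fact n))).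
    { induction n as [|n IH]. { reflexivity. }
      change (pochhammer 1 (S n)) with (pochhammer 1 n * (1 + RtoC (INR n))).
      rewrite IH, fact_simpl, mult_INR, S_INR, RtoC_mult, RtoC_plus. ring. }
    rewrite E in H. rewrite (fact_simpl (S m)), mult_INR, RtoC_mult in H.
    assert (N1 := fact_nz (S m)). assert (N2 : RtoC (INR (S m)) <> RtoC 0) by apply RtoC_nz, INR_S_nz.
    apply (C_cancel_r (RtoC (INR (fact (S m))) * RtoC (INR (S m)))). { apply Cmult_neq_0; auto. }
    rewrite H. unfold tinv. rewrite RtoC_inv by apply INR_S_nz. rewrite (S_INR (S m)), RtoC_plus. field. auto.
  - assert (X : ctends eventually (fun m => 1 + RtoC (tinv m)) (1 + 0)).
    { apply ctends_plus; ev; [apply ctends_const; ev|apply ctends_tinv]. }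
    now rewrite Cplus_0_r in X.
Qed.

(* Integration by parts gives a recurrence in [n] for these integrals, which produces Euler's sine product
   without any complex analysis. *)
Definition Wal (t : R) (n : nat) : R := RInt (fun s => cos (2 * t * s) * cos s ^ (2 * n))%R 0 (PI / 2).

Lemma Wal_cont t n : forall a b, ex_RInt (fun s => cos (2 * t * s) * cos s ^ (2 * n))%R a b.
Proof.
  intros a b. apply (ex_RInt_continuous (V := R_CompleteNormedModule)). intros s _.
  apply (ex_derive_continuous (fun s => cos (2 * t * s) * cos s ^ (2 * n))%R).
  auto_derive. auto.
Qed.

Lemma Wal_rec t n :
  ((2 * INR (S n) * INR (S n) - 2 * t * t) * Wal t (S n) = INR (S n) * (2 * INR (S n) - 1) * Wal t n)%R.
Proof.
  set (N := INR (S n)).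
  (* Primitive of [g] collected from the integrations by parts. It vanishes at 0 through the sines
     and at PI/2 through the powers of the cosine, so the integral of [g] is 0. *)
  set (F := fun s => (t * (sin (2 * t * s) * cos s ^ (2 * n + 2)) - N * (cos (2 * t * s) * (cos s ^ (2 * n + 1) * sin s)))%R).
  set (g := fun s => (N * (2 * N - 1) * (cos (2 * t * s) * cos s ^ (2 * n))
     - (2 * N * N - 2 * t * t) * (cos (2 * t * s) * cos s ^ (2 * S n)))%R).
  assert (H1 : is_RInt g 0 (PI / 2) (minus (F (PI / 2)%R) (F 0%R))).
  { apply (is_RInt_derive (V := R_CompleteNormedModule) F g).
    - intros s _. unfold F, g. auto_derive; auto.
      replace (n + (n + 0) + 2)%nat with (2 * n + 2)%nat by lia.
      replace (n + (n + 0) + 1)%nat with (2 * n + 1)%nat by lia.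
      replace (n + S (n + 0))%nat with (2 * n + 1)%nat by lia.
      replace (n + (n + 0))%nat with (2 * n)%nat by lia.
      replace (Nat.pred (2 * n + 2)) with (2 * n + 1)%nat by lia.
      replace (Nat.pred (2 * n + 1)) with (2 * n)%nat by lia.
      replace (2 * S n)%nat with (2 * n + 2)%nat by lia.
      replace (INR (2 * n + 2)) with (2 * N)%R by (unfold N; rewrite S_INR, plus_INR, mult_INR; simpl; ring).
      replace (INR (2 * n + 1)) with (2 * N - 1)%R by (unfold N; rewrite S_INR, plus_INR, mult_INR; simpl; ring).
      replace (cos s ^ (2 * n + 2))%R with (cos s ^ (2 * n) * (cos s * cos s))%R by (rewrite pow_add; simpl; ring).
      replace (cos s ^ (2 * n + 1))%R with (cos s ^ (2 * n) * cos s)%R by (rewrite pow_add; simpl; ring).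
      set (c2 := (cos s ^ (2 * n))%R).
      assert (E : (sin s * sin s = 1 - cos s * cos s)%R) by (generalize (sin2_cos2 s); unfold Rsqr; lra).
      transitivity ((N * (2 * N - 1) * cos (2 * t * s) * (sin s * sin s) - N * cos (2*t*s) * cos s * cos s + 2 * t * t * cos (2 * t * s) * cos s * cos s) * c2)%R.
      { ring. } rewrite E. ring.
    - intros s _. unfold g. apply (ex_derive_continuous g). unfold g. auto_derive. auto. }
  replace (minus (F (PI / 2)%R) (F 0%R)) with 0%R in H1.
  2:{ unfold F, minus, plus, opp; simpl. rewrite cos_PI2, !Rmult_0_r, sin_0.
      rewrite !pow_ne_zero by lia. ring. }
  assert (H2 : is_RInt g 0 (PI / 2) (N * (2 * N - 1) * Wal t n - (2 * N * N - 2 * t * t) * Wal t (S n))%R).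
  { unfold g. apply (is_RInt_minus (V := R_NormedModule)).
    - apply (is_RInt_scal (V := R_NormedModule)), (RInt_correct (V := R_CompleteNormedModule)), Wal_cont.
    - apply (is_RInt_scal (V := R_NormedModule)), (RInt_correct (V := R_CompleteNormedModule)), Wal_cont. }
  apply (is_RInt_unique (V := R_CompleteNormedModule)) in H1. apply (is_RInt_unique (V := R_CompleteNormedModule)) in H2. rewrite H1 in H2. lra.
Qed.

Lemma Wal_0 t : (2 * t * Wal t 0 = sin (PI * t))%R.
Proof.
  assert (H : is_RInt (fun s => 2 * t * (cos (2 * t * s) * cos s ^ (2 * 0)))%R 0 (PI / 2) (minus (sin (2 * t * (PI / 2))) (sin (2 * t * 0)))).
  { apply (is_RInt_derive (V := R_CompleteNormedModule) (fun s => sin (2 * t * s))).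
    - intros s _. auto_derive; auto. simpl. ring.
    - intros s _. apply (ex_derive_continuous (fun s => 2 * t * (cos (2 * t * s) * cos s ^ (2 * 0)))%R). auto_derive. auto. }
  assert (H2 : is_RInt (fun s => 2 * t * (cos (2 * t * s) * cos s ^ (2 * 0)))%R 0 (PI / 2) (2 * t * Wal t 0)%R).
  { apply (is_RInt_scal (V := R_NormedModule)), (RInt_correct (V := R_CompleteNormedModule)), Wal_cont. }
  apply (is_RInt_unique (V := R_CompleteNormedModule)) in H. apply (is_RInt_unique (V := R_CompleteNormedModule)) in H2. rewrite H in H2. rewrite <- H2.
  unfold minus, plus, opp; simpl. rewrite Rmult_0_r, sin_0.
  replace (2 * t * (PI / 2))%R with (PI * t)%R by field. ring.
Qed.

Lemma Wal_00 : Wal 0 0 = (PI / 2)%R.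
Proof.
  unfold Wal. rewrite (RInt_ext _ (fun _ => 1%R)).
  - rewrite RInt_const. unfold scal; simpl; unfold mult; simpl. ring.
  - intros s _. rewrite Rmult_0_r, Rmult_0_l, cos_0. simpl. ring.
Qed.

Lemma Wal_pos n : (0 < Wal 0 n)%R.
Proof.
  induction n as [|n IH].
  - rewrite Wal_00. generalize PI_RGT_0. lra.
  - assert (H := Wal_rec 0 n). assert (P := pos_INR n). rewrite S_INR in H.
    assert (E : Wal 0 (S n) = ((2 * (INR n + 1) - 1) / (2 * (INR n + 1)) * Wal 0 n)%R).
    { apply Rmult_eq_reg_l with (2 * (INR n + 1) * (INR n + 1))%R; [|nra].
      transitivity ((INR n + 1) * (2 * (INR n + 1) - 1) * Wal 0 n)%R; [rewrite <- H; ring|field; lra]. }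
    rewrite E. apply Rmult_lt_0_compat; auto. apply Rdiv_lt_0_compat; lra.
Qed.

(** The derivative of sin s - s cos s is s sin s >= 0; in other words s <= tan s. *)
Lemma x_cos_le_sin s : (0 <= s <= PI / 2)%R -> (s * cos s <= sin s)%R.
Proof.
  intros [H1 H2].
  destruct (MVT_gen (fun s => sin s - s * cos s)%R 0 s (fun s => s * sin s)%R) as [c [Hc Ec]].
  - intros x _. auto_derive; auto. ring.
  - intros x _. apply continuity_pt_filterlim. apply (ex_derive_continuous (fun s => sin s - s * cos s)%R). auto_derive; auto.
  - rewrite sin_0, Rmult_0_l in Ec. rewrite Rmin_left, Rmax_right in Hc by lra.
    assert (0 <= c * sin c * (s - 0))%R.
    { apply Rmult_le_pos; [|lra]. apply Rmult_le_pos; [lra|]. apply sin_ge_0; lra. }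
    lra.
Qed.

Lemma Rabs_sin_le x : (Rabs (sin x) <= Rabs x)%R.
Proof.
  destruct (Rle_lt_dec 0 x) as [H|H].
  - assert (A : (forall y, 0 <= y -> -y <= sin y <= y)%R).
    { intros y Hy. split.
      - destruct (Rle_lt_dec y PI) as [K|K]; [|generalize (SIN_bound y) PI2_1; lra].
        assert (0 <= sin y)%R by (apply sin_ge_0; lra). lra.
      - destruct Hy as [Hy|<-]; [left; now apply sin_lt_x|rewrite sin_0; lra]. }
    rewrite (Rabs_pos_eq x) by auto. apply Rabs_le. now apply A.
  - rewrite <- (Rabs_Ropp x), <- (Rabs_Ropp (sin x)), <- sin_neg.
    assert (A : (forall y, 0 <= y -> -y <= sin y <= y)%R).
    { intros y Hy. split.
      - destruct (Rle_lt_dec y PI) as [K|K]; [|generalize (SIN_bound y) PI2_1; lra].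
        assert (0 <= sin y)%R by (apply sin_ge_0; lra). lra.
      - destruct Hy as [Hy|<-]; [left; now apply sin_lt_x|rewrite sin_0; lra]. }
    rewrite (Rabs_pos_eq (- x)) by lra. apply Rabs_le. apply A. lra.
Qed.

(** Pointwise, 1 - cos(2 t s) = 2 sin(t s)^2 <= 2 t^2 s^2, and s cos s <= sin s turns s^2 cos(s)^2
    into 1 - cos(s)^2, which is exactly the factor between consecutive powers of cosine. *)
Lemma Wal_close t n : (Rabs (Wal t (S n) - Wal 0 (S n)) <= 2 * t * t * (Wal 0 n - Wal 0 (S n)))%R.
Proof.
  assert (HP := PI_RGT_0).
  assert (E1 : is_RInt (fun s => cos (2 * t * s) * cos s ^ (2 * S n) - cos (2 * 0 * s) * cos s ^ (2 * S n))%R 0 (PI / 2) (Wal t (S n) - Wal 0 (S n))%R).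
  { apply (is_RInt_minus (V := R_NormedModule)); apply (RInt_correct (V := R_CompleteNormedModule)), Wal_cont. }
  assert (E2 : is_RInt (fun s => 2 * t * t * (cos (2 * 0 * s) * cos s ^ (2 * n) - cos (2 * 0 * s) * cos s ^ (2 * S n)))%R 0 (PI / 2) (2 * t * t * (Wal 0 n - Wal 0 (S n)))%R).
  { apply (is_RInt_scal (V := R_NormedModule)). apply (is_RInt_minus (V := R_NormedModule)); apply (RInt_correct (V := R_CompleteNormedModule)), Wal_cont. }
  eapply (norm_RInt_le (V := R_NormedModule)) with (3 := E1) (4 := E2); [lra|].
  intros s Hs. unfold norm; simpl; unfold abs; simpl.
  rewrite Rmult_0_r, Rmult_0_l, cos_0, !Rmult_1_l.
  replace (cos s ^ (n + S (n + 0)))%R with (cos s ^ (2 * n) * cos s)%R.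
  2:{ replace (n + S (n + 0))%nat with (2 * n + 1)%nat by lia. rewrite pow_add. simpl. ring. }
  replace (n + (n + 0))%nat with (2 * n)%nat by lia.
  assert (Cs : (0 <= cos s)%R) by (apply cos_ge_0; lra).
  assert (P0 : (0 <= cos s ^ (2 * n))%R) by now apply pow_le.
  replace (cos (2 * t * s) * (cos s * (cos s ^ (2 * n) * cos s)) - cos s * (cos s ^ (2 * n) * cos s))%R
    with (- (2 * Rsqr (sin (t * s)) * (cos s * cos s) * cos s ^ (2 * n)))%R.
  2:{ replace (2 * t * s)%R with (2 * (t * s))%R by ring. rewrite cos_2a_sin. unfold Rsqr. ring. }
  rewrite Rabs_Ropp, Rabs_pos_eq.
  2:{ apply Rmult_le_pos; [apply Rmult_le_pos; [apply Rmult_le_pos; [lra|apply Rle_0_sqr]|nra]|auto]. }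
  replace (2 * t * t * (cos s ^ (2 * n) - cos s * (cos s ^ (2 * n) * cos s)))%R
    with (2 * t * t * (1 - cos s * cos s) * cos s ^ (2 * n))%R by ring.
  apply Rmult_le_compat_r; auto.
  replace (1 - cos s * cos s)%R with (Rsqr (sin s)) by (generalize (sin2_cos2 s); unfold Rsqr; lra).
  assert (A : (Rsqr (sin (t * s)) <= Rsqr (t * s))%R).
  { apply Rsqr_le_abs_1, Rabs_sin_le. }
  assert (B : (Rsqr (s * cos s) <= Rsqr (sin s))%R).
  { apply Rsqr_incr_1; [apply x_cos_le_sin; lra| |apply sin_ge_0; lra]. apply Rmult_le_pos; lra. }
  apply Rle_trans with (2 * Rsqr (t * s) * (cos s * cos s))%R.
  - apply Rmult_le_compat_r; [nra|]. lra.
  - replace (2 * Rsqr (t * s) * (cos s * cos s))%R with (2 * t * t * Rsqr (s * cos s))%R by (unfold Rsqr; ring).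
    apply Rmult_le_compat_l; [nra|exact B].
Qed.

(** By the recurrence at t = 0 the drop [Wal 0 n - Wal 0 (S n)] is at most [tinv n * Wal 0 (S n)],
    so [Wal_close] becomes a relative error O(1/n). *)
Lemma Wal_ratio t : is_lim_seq (fun n => Wal t n / Wal 0 n)%R 1%R.
Proof.
  apply is_lim_seq_incr_1.
  apply (is_lim_seq_le_le (fun n => 1 - 2 * t * t * tinv n)%R _ (fun n => 1 + 2 * t * t * tinv n)%R).
  - intros n. assert (P := Wal_pos n). assert (P1 := Wal_pos (S n)).
    assert (H := Wal_close t n). assert (R0 := Wal_rec 0 n).
    assert (X : (Wal 0 n - Wal 0 (S n) <= tinv n * Wal 0 (S n))%R).
    { unfold tinv. rewrite S_INR in *. assert (Q := pos_INR n).
      apply Rmult_le_reg_l with ((INR n + 1) * (2 * (INR n + 1) - 1))%R; [nra|].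
      rewrite Rmult_minus_distr_l, <- R0.
      replace ((INR n + 1) * (2 * (INR n + 1) - 1) * (/ (INR n + 1) * Wal 0 (S n)))%R
        with ((2 * (INR n + 1) - 1) * Wal 0 (S n))%R by (field; lra).
      nra. }
    assert (Y : (Rabs (Wal t (S n) - Wal 0 (S n)) <= 2 * t * t * tinv n * Wal 0 (S n))%R).
    { eapply Rle_trans; [exact H|]. rewrite (Rmult_assoc (2 * t * t)). apply Rmult_le_compat_l; [nra|exact X]. }
    apply Rabs_le_between in Y. split.
    + apply Rmult_le_reg_r with (Wal 0 (S n)); auto. unfold Rdiv. rewrite (Rmult_assoc (Wal t (S n))), Rinv_l, Rmult_1_r by lra. lra.
    + apply Rmult_le_reg_r with (Wal 0 (S n)); auto. unfold Rdiv. rewrite (Rmult_assoc (Wal t (S n))), Rinv_l, Rmult_1_r by lra. lra.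
  - replace (Finite 1) with (Finite (1 - 2 * t * t * 0)) by (f_equal; ring).
    apply is_lim_seq_minus'; [apply is_lim_seq_const|]. apply (is_lim_seq_scal_l tinv (2 * t * t) 0%R), tinv_lim.
  - replace (Finite 1) with (Finite (1 + 2 * t * t * 0)) by (f_equal; ring).
    apply is_lim_seq_plus'; [apply is_lim_seq_const|]. apply (is_lim_seq_scal_l tinv (2 * t * t) 0%R), tinv_lim.
Qed.

Fixpoint sprod (t : R) (n : nat) : R :=
  match n with O => 1%R | S m => (sprod t m * (1 - t * t / (INR (S m) * INR (S m))))%R end.

(** The left side is invariant in n: by [Wal_rec] the ratio of the integrals changes by exactly the
    inverse of the new factor of [sprod]. Its value at n = 0 is an elementary integral. Together
    with [Wal_ratio] this is Euler's sine product. *)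
Lemma sprod_Wal t n : (t * sprod t n * (Wal t n / Wal 0 n) = sin (PI * t) / PI)%R.
Proof.
  induction n as [|n IH].
  - simpl. assert (H := Wal_0 t). rewrite Wal_00. rewrite <- H. field. apply PI_neq0.
  - rewrite <- IH. cbn [sprod]. assert (H := Wal_rec t n). assert (H0 := Wal_rec 0 n).
    assert (P := Wal_pos n). assert (P1 := Wal_pos (S n)). assert (Pn := pos_INR n).
    rewrite S_INR in *. set (N := (INR n + 1)%R) in *. assert (HN : (1 <= N)%R) by (unfold N; lra).
    assert (E0 : Wal 0 (S n) = ((2 * N - 1) / (2 * N) * Wal 0 n)%R).
    { apply Rmult_eq_reg_l with (2 * N * N)%R; [|nra].
      transitivity (N * (2 * N - 1) * Wal 0 n)%R; [rewrite <- H0; ring|field; lra]. }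
    assert (E : ((1 - t * t / (N * N)) * Wal t (S n) = (2 * N - 1) / (2 * N) * Wal t n)%R).
    { apply Rmult_eq_reg_l with (2 * N * N)%R; [|nra].
      transitivity (N * (2 * N - 1) * Wal t n)%R; [rewrite <- H; field; lra|field; lra]. }
    transitivity (t * sprod t n * (((1 - t * t / (N * N)) * Wal t (S n)) / Wal 0 (S n)))%R.
    { field. split; lra. }
    rewrite E, E0. field. repeat split; lra.
Qed.

Lemma poch_sprod (t : R) n :
  pochhammer (RtoC t) (S n) * pochhammer (1 - RtoC t) n
  = RtoC (t * sprod t n * (INR (fact n) * INR (fact n))).
Proof.
  induction n as [|n IH].
  - simpl. rewrite Rmult_1_r, Rmult_1_r, Rmult_1_r. ring.
  - change (pochhammer (RtoC t) (S (S n))) with (pochhammer (RtoC t) (S n) * (RtoC t + RtoC (INR (S n)))).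
    change (pochhammer (1 - RtoC t) (S n)) with (pochhammer (1 - RtoC t) n * (1 - RtoC t + RtoC (INR n))).
    transitivity (pochhammer (RtoC t) (S n) * pochhammer (1 - RtoC t) n * ((RtoC t + RtoC (INR (S n))) * (1 - RtoC t + RtoC (INR n)))).
    { ring. }
    rewrite IH. rewrite <- RtoC_minus, <- !RtoC_plus, <- !RtoC_mult. f_equal.
    cbn [sprod]. rewrite fact_simpl, mult_INR. assert (H := INR_S_nz n). rewrite S_INR in *. field. lra.
Qed.

(** The product of the approximants at t and 1 - t is the partial Euler product up to the factor 1 +
    (1 - t)/(m + 1), and [Wal_ratio] supplies the limit. *)
Lemma rg_reflection (t : R) : (rg t * rg (1 - t) = sin (PI * t) / PI)%R.
Proof.
  apply RtoC_inj. rewrite RtoC_mult, <- !Rg_real.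
  set (w := fun n => (Wal t n / Wal 0 n)%R).
  assert (L1 : ctends eventually (fun m => RtoC (w (S m))) 1).
  { apply ctends_RtoC; ev. exact (proj1 (is_lim_seq_incr_1 w 1%R) (Wal_ratio t)). }
  assert (L2 : ctends eventually (fun m => Q m (RtoC t) * Q m (RtoC (1 - t)) * RtoC (w (S m)))
      (Rg (RtoC t) * Rg (RtoC (1 - t)) * 1)).
  { apply ctends_mult; ev; auto. apply ctends_mult; ev; apply Q_cv. }
  rewrite Cmult_1_r in L2.
  apply (ctends_unique eventually (fun m => Q m (RtoC t) * Q m (RtoC (1 - t)) * RtoC (w (S m)))); auto.
  apply ctends_ext with (fun m => RtoC (sin (PI * t) / PI) * (1 + RtoC (1 - t) * RtoC (tinv m))); ev.
  - intros m. assert (H1 := Q_closed m (RtoC t)). assert (H2 := Q_closed m (RtoC (1 - t))).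
    assert (N1 := Q_scale_nz m (RtoC t)). assert (N2 := Q_scale_nz m (RtoC (1 - t))).
    rewrite <- (sprod_Wal t (S m)). fold (w (S m)).
    assert (H3 := poch_sprod t (S m)).
    assert (H4 : Q m (RtoC t) * Q m (RtoC (1 - t)) * RtoC (INR (S m)) = RtoC (t * sprod t (S m)) * RtoC (1 - t + INR (S m))).
    { apply (C_cancel_r (RtoC (INR (fact (S m))) * RtoC (INR (fact (S m))))).
      { apply Cmult_neq_0; apply fact_nz. }
      transitivity (pochhammer (RtoC t) (S (S m)) * pochhammer (RtoC (1 - t)) (S (S m))).
      - rewrite <- H1, <- H2. rewrite RtoC_minus.
        replace (RtoC (INR (S m))) with (Cexp (RtoC t * RtoC (ln (INR (S m)))) * Cexp ((1 - RtoC t) * RtoC (ln (INR (S m))))) at 1.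
        2:{ rewrite <- Cexp_plus. replace (RtoC t * RtoC (ln (INR (S m))) + (1 - RtoC t) * RtoC (ln (INR (S m)))) with (RtoC (ln (INR (S m)))) by ring.
            rewrite Cexp_RtoC, exp_ln; auto. apply lt_0_INR; lia. }
        ring.
      - change (pochhammer (RtoC (1 - t)) (S (S m))) with (pochhammer (RtoC (1 - t)) (S m) * (RtoC (1 - t) + RtoC (INR (S m)))).
        rewrite Cmult_assoc, RtoC_minus, H3, <- RtoC_minus, <- RtoC_plus, !RtoC_mult. ring. }
    assert (N3 : RtoC (INR (S m)) <> RtoC 0) by apply RtoC_nz, INR_S_nz.
    apply (C_cancel_r (RtoC (INR (S m)))); auto.
    transitivity (Q m (RtoC t) * Q m (RtoC (1 - t)) * RtoC (INR (S m)) * RtoC (w (S m))); [|ring].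
    rewrite H4, (RtoC_mult (t * sprod t (S m))), (RtoC_plus (1 - t)). unfold tinv. rewrite RtoC_inv by apply INR_S_nz.
    field. auto.
  - assert (X : ctends eventually (fun m => RtoC (sin (PI * t) / PI) * (1 + RtoC (1 - t) * RtoC (tinv m)))
       (RtoC (sin (PI * t) / PI) * (1 + RtoC (1 - t) * 0))); [|now rewrite Cmult_0_r, Cplus_0_r, Cmult_1_r in X].
    apply ctends_mult; ev; [apply ctends_const; ev|]. apply ctends_plus; ev; [apply ctends_const; ev|].
    apply ctends_mult; ev; [apply ctends_const; ev|apply ctends_tinv].
Qed.

(** * The duplication formula *)

Lemma RtoC_half : RtoC (1 / 2) = 1 / 2.
Proof. rewrite RtoC_div by lra. reflexivity. Qed.

Lemma C2_nz : RtoC 2 <> RtoC 0.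
Proof. apply RtoC_nz. lra. Qed.

Lemma poch_dup (w : C) n :
  pochhammer w n * pochhammer (w + 1 / 2) n * 4 ^ n = pochhammer (2 * w) (2 * n).
Proof.
  induction n as [|n IH]. { simpl. ring. }
  replace (2 * S n)%nat with (S (S (2 * n))) by lia.
  cbn [pochhammer]. rewrite <- IH. rewrite (S_INR (2 * n)), mult_INR, RtoC_plus, RtoC_mult.
  replace (RtoC (INR 2)) with (RtoC 2) by (f_equal; simpl; ring).
  change (4 ^ S n) with (4 * 4 ^ n). replace (RtoC 4) with (RtoC 2 * RtoC 2) at 1 by (rewrite <- RtoC_mult; f_equal; ring).
  field; try apply C2_nz.
Qed.

(** Logarithm of the quotient of the two values of n, 2 m + 3 and m + 1, that occur in
    [Q (2 * m + 2)] and [Q m]; it tends to ln 2. *)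
Definition lam (m : nat) : R := (ln (INR (2 * m + 3)) - ln (INR (S m)))%R.

(** Both sides come from the duplication of Pochhammer symbols with m + 2 and 2 m + 4 factors, hence
    the index 2 m + 2. The constant, which depends on m only, is eliminated by comparing with the
    case w = 1/2. *)
Lemma Q_dup (w : C) m :
  Q m w * Q m (w + 1 / 2) * (Q (2 * m + 2) 1 * Cexp (RtoC (lam m)))
  = Q m (1 / 2) * Q m 1 * (Q (2 * m + 2) (2 * w) * Cexp (2 * w * RtoC (lam m))).
Proof.
  set (f := RtoC (INR (fact (S m)))). set (l := RtoC (ln (INR (S m)))).
  set (p := (2 * m + 2)%nat). set (g := RtoC (INR (fact (S p)))). set (l' := RtoC (ln (INR (S p)))).
  assert (El : RtoC (lam m) = l' - l).
  { unfold lam, l, l', p. rewrite <- RtoC_minus. do 4 f_equal. lia. }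
  assert (G : forall w, Q m w * Q m (w + 1 / 2) * (f * f * Cexp (l / 2) * 4 ^ (S (S m)))
     = Q p (2 * w) * (g * Cexp (2 * w * (l' - l)))).
  { clear w. intros w. assert (H1 := Q_closed m w). assert (H2 := Q_closed m (w + 1 / 2)).
    assert (H3 := Q_closed p (2 * w)). fold f l in H1, H2. fold g l' in H3.
    apply (C_cancel_r (Cexp (2 * w * l))). { apply Cexp_nz. }
    transitivity (pochhammer w (S (S m)) * pochhammer (w + 1 / 2) (S (S m)) * 4 ^ (S (S m))).
    - rewrite <- H1, <- H2. replace ((w + 1 / 2) * l) with (w * l + l / 2) by (field; apply C2_nz).
      replace (2 * w * l) with (w * l + w * l) by ring. rewrite !Cexp_plus. ring.
    - rewrite poch_dup. replace (2 * S (S m))%nat with (S (S p)) by (unfold p; lia). rewrite <- H3.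
      replace (2 * w * (l' - l)) with (2 * w * l' - 2 * w * l) by ring.
      rewrite Cexp_minus. field. apply Cexp_nz. }
  assert (Nz : f * f * Cexp (l / 2) * 4 ^ (S (S m)) <> RtoC 0).
  { apply Cmult_neq_0; [|apply Cpow_nz, RtoC_nz; lra].
    apply Cmult_neq_0; [|apply Cexp_nz]. apply Cmult_neq_0; apply fact_nz. }
  assert (E1 := G w). assert (E2 := G (1 / 2)).
  replace (2 * (1 / 2)) with (RtoC 1) in E2 by (field; apply C2_nz).
  replace (1 / 2 + 1 / 2) with (RtoC 1) in E2 by (field; apply C2_nz).
  rewrite Cmult_1_l in E2. rewrite El.
  apply (C_cancel_r ((f * f * Cexp (l / 2) * 4 ^ (S (S m))) * g)). { apply Cmult_neq_0; auto. apply fact_nz. }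
  transitivity ((Q m w * Q m (w + 1 / 2) * (f * f * Cexp (l / 2) * 4 ^ S (S m))) * (Q p 1 * (g * Cexp (l' - l)))).
  { ring. }
  rewrite E1, <- E2. ring.
Qed.

Lemma lam_lim : is_lim_seq lam (ln 2).
Proof.
  apply is_lim_seq_ext with (fun m => ln (2 + tinv m)).
  - intros m. unfold lam, tinv. rewrite <- ln_div by (apply lt_0_INR; lia). f_equal.
    rewrite plus_INR, mult_INR, S_INR. simpl. field. generalize (pos_INR m). lra.
  - apply (is_lim_seq_continuous ln (fun m => 2 + tinv m)%R).
    + apply continuity_pt_filterlim. apply (ex_derive_continuous ln). auto_derive. lra.
    + assert (X : is_lim_seq (fun m => 2 + tinv m)%R (2 + 0)%R).
      { apply is_lim_seq_plus'; [apply is_lim_seq_const|apply tinv_lim]. }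
      now rewrite Rplus_0_r in X.
Qed.

Lemma rg_duplication (t : R) : (2 * (rg t * rg (t + 1 / 2)) = rg (1 / 2) * rg (2 * t) * exp (2 * t * ln 2))%R.
Proof.
  apply RtoC_inj. rewrite !RtoC_mult, <- !Rg_real, RtoC_plus, RtoC_half, RtoC_mult.
  rewrite <- Cexp_RtoC.
  assert (Sub : forall w, ctends eventually (fun m => Q (2 * m + 2) w) (Rg w)).
  { intros w. apply (ctends_subseq (fun m => Q m w) (fun m => (2 * m + 2)%nat)); [intros; lia|apply Q_cv]. }
  assert (Ll : ctends eventually (fun m => RtoC (lam m)) (RtoC (ln 2))).
  { apply ctends_RtoC; ev. exact lam_lim. }
  assert (E : Rg (RtoC t) * Rg (RtoC t + 1 / 2) * (Rg 1 * Cexp (RtoC (ln 2)))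
     = Rg (1 / 2) * Rg 1 * (Rg (2 * RtoC t) * Cexp (2 * RtoC t * RtoC (ln 2)))).
  { apply (ctends_unique eventually (fun m => Q m (RtoC t) * Q m (RtoC t + 1 / 2) * (Q (2 * m + 2) 1 * Cexp (RtoC (lam m))))).
    - apply ctends_mult; ev; [apply ctends_mult; ev; apply Q_cv|].
      apply ctends_mult; ev; [apply Sub|]. apply ctends_Cexp; ev; auto.
    - eapply ctends_ext; [ev|intros m; symmetry; apply Q_dup|].
      apply ctends_mult; ev; [apply ctends_mult; ev; apply Q_cv|].
      apply ctends_mult; ev; [apply Sub|]. apply ctends_Cexp; ev.
      apply ctends_mult; ev; auto. apply ctends_const; ev. }
  rewrite (Rg_real 1), rg_1, (Cexp_RtoC (ln 2)), exp_ln in E by lra.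
  transitivity (Rg (RtoC t) * Rg (RtoC t + 1 / 2) * (1 * 2)); [ring|]. rewrite E. rewrite (RtoC_mult (2 * t)), (RtoC_mult 2 t). ring.
Qed.

(** Reflection at 1/2 determines only the square; the sign comes from the approximants, which are
    quotients of nonnegative numbers there. *)
Lemma rg_half : (rg (1 / 2) = / sqrt PI)%R.
Proof.
  assert (H := rg_reflection (1 / 2)). replace (1 - 1 / 2)%R with (1 / 2)%R in H by field.
  replace (PI * (1 / 2))%R with (PI / 2)%R in H by field. rewrite sin_PI2 in H.
  assert (P := PI_RGT_0).
  assert (Ps : (0 < rg (1 / 2))%R).
  { assert (D := rg_duplication 1).
    assert (E : forall k, (0 <= Re (Q k (RtoC (1 / 2))))%R).
    { intros k. assert (C1 := Q_closed k (RtoC (1 / 2))).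
      destruct (Q_real k (1 / 2)) as [-> _]. simpl (Re _).
      destruct (Q_real k (1 / 2)) as [E1 _]. rewrite E1 in C1.
      replace (RtoC (1 / 2) * RtoC (ln (INR (S k)))) with (RtoC (1 / 2 * ln (INR (S k)))) in C1 by apply RtoC_mult.
      rewrite Cexp_RtoC in C1.
      assert (PP : forall n, exists y, (0 <= y)%R /\ pochhammer (RtoC (1 / 2)) n = RtoC y).
      { induction n as [|n [y [Hy Ey]]].
        - exists 1%R. split; [lra|reflexivity].
        - exists (y * (1 / 2 + INR n))%R. split. apply Rmult_le_pos; auto. generalize (pos_INR n); lra.
          simpl. rewrite Ey, RtoC_mult, RtoC_plus. reflexivity. }
      destruct (PP (S (S k))) as [y [Hy Ey]]. rewrite Ey, <- !RtoC_mult in C1. apply RtoC_inj in C1.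
      assert (F1 := INR_fact_lt_0 (S k)). assert (F2 := exp_pos (1 / 2 * ln (INR (S k)))).
      apply Rnot_lt_le. intros Hlt. simpl in Hlt.
      assert (Re (Q k (RtoC (1 / 2))) * (INR (fact (S k)) * exp (1 / 2 * ln (INR (S k)))) < 0)%R; [|lra].
      rewrite <- (Rmult_0_l (INR (fact (S k)) * exp (1 / 2 * ln (INR (S k))))).
      apply Rmult_lt_compat_r; auto. now apply Rmult_lt_0_compat. }
    assert (L := ctends_Re eventually _ _ (Q_cv (RtoC (1 / 2)))).
    assert (0 <= rg (1 / 2))%R.
    { apply (is_lim_seq_le (fun _ => 0%R) (fun m => Re (Q m (RtoC (1 / 2)))) 0%R (rg (1 / 2))); auto.
      apply is_lim_seq_const. }
    assert (N := rg_nz_pos (1 / 2) ltac:(lra)). lra. }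
  assert (Q0 := sqrt_lt_R0 PI P). assert (Q1 := sqrt_sqrt PI ltac:(lra)).
  assert (E : (rg (1 / 2) * sqrt PI = 1)%R).
  { assert (K : (Rsqr (rg (1 / 2) * sqrt PI) = Rsqr 1)%R).
    { unfold Rsqr. replace (rg (1 / 2) * sqrt PI * (rg (1 / 2) * sqrt PI))%R
       with (rg (1 / 2) * rg (1 / 2) * (sqrt PI * sqrt PI))%R by ring. rewrite H, Q1. field. lra. }
    apply Rsqr_inj in K; try lra. apply Rmult_le_pos; lra. }
  apply Rmult_eq_reg_r with (sqrt PI); [|lra]. rewrite E. field. lra.
Qed.

(** Logarithmic derivative of 1/Gamma, that is, minus the digamma function. *)
Definition dl (t : R) : R := (drg t / rg t)%R.

Lemma dl_rec t : (0 < t)%R -> dl t = (/ t + dl (t + 1))%R.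
Proof.
  intros H. unfold dl. rewrite drg_rec. rewrite (rg_rec t).
  assert (N := rg_nz_pos (t + 1) ltac:(lra)). field. split; auto; lra.
Qed.

(** Derivative of the duplication formula at t = 1/2. Euler's constant drops out of the difference,
    and 2 ln 2 is the amount that later turns log(z^2) into 2 log(z/2) in the residue at 0. *)
Lemma dl_half : (dl (1 / 2) - dl 1 = 2 * ln 2)%R.
Proof.
  assert (D1 : is_derive (fun t => 2 * (rg t * rg (t + 1 / 2)))%R (1 / 2)%R
     (2 * (drg (1 / 2) * rg 1 + rg (1 / 2) * drg 1))%R).
  { assert (H1 := is_derive_rg (1 / 2)%R).
    assert (H2 : is_derive (fun t => rg (t + 1 / 2)%R) (1 / 2)%R (1 * drg (1 / 2 + 1 / 2))%R).
    { refine (is_derive_comp rg (fun s => s + 1 / 2)%R (1 / 2)%R (drg (1 / 2 + 1 / 2)) 1%R _ _). apply is_derive_rg.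
      auto_derive; auto. }
    assert (E1 : (1 / 2 + 1 / 2 = 1)%R) by field.
    assert (H3 := is_derive_mult _ _ _ _ _ H1 H2 Rmult_comm).
    assert (H4 := is_derive_scal _ _ 2%R _ H3). unfold plus, mult in H4; simpl in H4.
    rewrite E1, Rmult_1_l in H4. exact H4. }
  assert (D2 : is_derive (fun t => rg (1 / 2) * rg (2 * t) * exp (2 * t * ln 2))%R (1 / 2)%R
     (rg (1 / 2) * (2 * drg 1 * 2 + rg 1 * (2 * ln 2 * 2)))%R).
  { assert (H2 : is_derive (fun t => rg (2 * t)%R) (1 / 2)%R (2 * drg (2 * (1 / 2)))%R).
    { refine (is_derive_comp rg (fun s => 2 * s)%R (1 / 2)%R (drg (2 * (1 / 2))) 2%R _ _). apply is_derive_rg.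
      auto_derive; auto. ring. }
    assert (H3 : is_derive (fun t => exp (2 * t * ln 2)) (1 / 2)%R (2 * ln 2 * 2)%R).
    { auto_derive; auto. replace (2 * (1 / 2) * ln 2)%R with (ln 2) by field. rewrite exp_ln by lra. ring. }
    assert (H4 := is_derive_mult _ _ _ _ _ H2 H3 Rmult_comm).
    assert (H5 := is_derive_scal _ _ (rg (1 / 2)) _ H4). unfold plus, mult in H5; simpl in H5.
    replace (2 * (1 / 2))%R with 1%R in H5 by field. rewrite Rmult_1_l, exp_ln in H5 by lra.
    eapply is_derive_ext; [|exact H5]. intros t. simpl. ring. }
  apply is_derive_unique in D1. apply is_derive_unique in D2.
  rewrite (Derive_ext _ _ _ rg_duplication) in D1. assert (D := eq_trans (eq_sym D1) D2). clear D1 D2. rename D into D2.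
  assert (N := rg_nz_pos (1 / 2) ltac:(lra)). unfold dl. rewrite rg_1 in *.
  apply Rmult_eq_reg_l with (2 * rg (1 / 2))%R; [|lra].
  transitivity (2 * (drg (1 / 2) * 1 + rg (1 / 2) * drg 1) - 4 * rg (1 / 2) * drg 1)%R; [field; auto|].
  rewrite D2. ring.
Qed.

Lemma DQ_sum m (w : C) : (forall k, w + RtoC (INR k) <> RtoC 0) ->
  DQ m w = Q m w * (csum (fun k => / (w + RtoC (INR k))) (S m) - RtoC (ln (INR (S m)))).
Proof.
  intros H. induction m as [|m IH].
  - simpl. rewrite ln_1. assert (H0 := H 0%nat). assert (H1 := H 1%nat). simpl in H0, H1.
    rewrite Cplus_0_r in *. field. auto.
  - change (csum (fun k => / (w + RtoC (INR k))) (S (S m)))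
     with (csum (fun k => / (w + RtoC (INR k))) (S m) + / (w + RtoC (INR (S (S m))))).
    cbn [DQ Q]. rewrite IH. assert (Hm := H (S (S m))).
    assert (E : drho m w = rho m w * (/ (w + RtoC (INR (S (S m)))) - RtoC (lstep m))).
    { unfold drho, rho. assert (N : RtoC (INR (S (S m))) <> RtoC 0) by apply RtoC_nz, INR_S_nz.
      rewrite RtoC_inv by apply INR_S_nz. field. auto. }
    rewrite E. unfold lstep. rewrite RtoC_minus. ring.
Qed.

(** Euler's limit for minus the digamma function; it identifies the harmonic sums in the residue at
    0. *)
Lemma digamma_lim (w : C) : (forall k, w + RtoC (INR k) <> RtoC 0) ->
  ctends eventually (fun m => csum (fun k => / (w + RtoC (INR k))) (S m) - RtoC (ln (INR (S m)))) (DRg w / Rg w).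
Proof.
  intros H. apply ctends_ext with (fun m => DQ m w * / Q m w); ev.
  - intros m. rewrite DQ_sum by auto. assert (N := Q_nz m w H). field. auto.
  - apply ctends_mult; ev; [apply DQ_cv|]. apply ctends_inv; ev; [now apply Rg_lower|apply Q_cv].
Qed.

(** * Formal Bessel series *)

Definition fps := nat -> C.
Definition fadd (a b : fps) : fps := fun n => a n + b n.
Definition fopp (a : fps) : fps := fun n => - a n.
Definition fsub (a b : fps) : fps := fun n => a n - b n.
Definition fconst (c : C) : fps := fun n => match n with O => c | _ => RtoC 0 end.
Definition fmul (a b : fps) : fps := cconv a b.
Definition fX : fps := fun n => match n with S O => RtoC 1 | _ => RtoC 0 end.
(** The Euler operator x d/dx, a derivation for the Cauchy product; it acts on coefficients by
    multiplication with the index, so differential equations become recurrences. *)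
Definition theta (a : fps) : fps := fun n => RtoC (INR n) * a n.

Lemma csum_rev (f : nat -> C) n : csum (fun k => f (n - k)%nat) n = csum f n.
Proof.
  revert f. induction n as [|n IH]; intros f; [reflexivity|].
  rewrite csum_shift, Nat.sub_0_r. simpl (csum f (S n)). rewrite <- (IH f).
  rewrite Cplus_comm. f_equal.
Qed.

Lemma csum_zero (f : nat -> C) n : (forall k, (k <= n)%nat -> f k = RtoC 0) -> csum f n = RtoC 0.
Proof.
  intros H. induction n as [|n IH]; simpl; [apply H; lia|].
  rewrite IH, H by (intros; auto || lia). ring.
Qed.

Lemma fmul_comm a b : fmul a b = fmul b a.
Proof.
  apply functional_extensionality. intros n. unfold fmul, cconv.
  rewrite <- (csum_rev (fun k => b k * a (n - k)%nat)). apply csum_ext. intros k Hk.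
  replace (n - (n - k))%nat with k by lia. ring.
Qed.

Lemma fmul_assoc a b c : fmul a (fmul b c) = fmul (fmul a b) c.
Proof.
  apply functional_extensionality. intros n. unfold fmul, cconv.
  transitivity (csum (fun k => csum (fun j => a k * b j * c (n - k - j)%nat) (n - k)) n).
  - apply csum_ext. intros k _. rewrite <- csum_scal. apply csum_ext. intros; ring.
  - rewrite <- (csum_rev_swap (fun k j => a k * b j * c (n - k - j)%nat)). apply csum_ext. intros m _.
    rewrite Cmult_comm, <- csum_scal. apply csum_ext. intros k Hk.
    replace (n - k - (m - k))%nat with (n - m)%nat by lia. ring.
Qed.

Lemma fmul_distr a b c : fmul (fadd a b) c = fadd (fmul a c) (fmul b c).
Proof.
  apply functional_extensionality. intros n. unfold fmul, cconv, fadd.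
  rewrite <- csum_plus. apply csum_ext. intros; ring.
Qed.

Lemma fconst_mul c a n : fmul (fconst c) a n = c * a n.
Proof.
  unfold fmul, cconv. destruct n as [|n]; [reflexivity|].
  rewrite csum_shift, csum_zero. simpl. ring.
  intros; simpl; ring.
Qed.

Lemma fX_mul_S a n : fmul fX a (S n) = a n.
Proof.
  unfold fmul, cconv. destruct n as [|n]; [simpl; ring|].
  rewrite !csum_shift, csum_zero by (intros; simpl; ring). simpl. rewrite ?Nat.sub_0_r. ring.
Qed.

Lemma fX_mul_0 a : fmul fX a 0%nat = RtoC 0.
Proof. unfold fmul, cconv. simpl. ring. Qed.

(** Registered as a ring, formal series let the tactic [ring] carry out the manipulation of
    differential equations; functional extensionality makes their equality plain equality. *)
Lemma fps_ring : ring_theory (fconst 0) (fconst 1) fadd fmul fsub fopp eq.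
Proof.
  constructor; intros.
  - apply functional_extensionality. intros n. unfold fadd. destruct n; simpl; ring.
  - apply functional_extensionality. intros n. unfold fadd. ring.
  - apply functional_extensionality. intros n. unfold fadd. ring.
  - apply functional_extensionality. intros n. rewrite fconst_mul. ring.
  - apply fmul_comm.
  - apply fmul_assoc.
  - apply fmul_distr.
  - reflexivity.
  - apply functional_extensionality. intros n. unfold fadd, fopp. destruct n; simpl; ring.
Qed.

Add Ring fps_ring_instance : fps_ring.

Declare Scope fps_scope.
Delimit Scope fps_scope with fps.
Infix "+" := fadd : fps_scope.
Infix "-" := fsub : fps_scope.
Infix "*" := fmul : fps_scope.

Lemma theta_add a b : theta (fadd a b) = fadd (theta a) (theta b).
Proof. apply functional_extensionality. intros n. unfold theta, fadd. ring. Qed.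

Lemma theta_sub a b : theta (fsub a b) = fsub (theta a) (theta b).
Proof. apply functional_extensionality. intros n. unfold theta, fsub. ring. Qed.

Lemma theta_mul a b : theta (fmul a b) = fadd (fmul (theta a) b) (fmul a (theta b)).
Proof.
  apply functional_extensionality. intros n. unfold theta, fadd, fmul, cconv.
  rewrite <- csum_scal, <- csum_plus. apply csum_ext. intros k Hk.
  replace (INR n) with (INR k + INR (n - k))%R by (rewrite <- plus_INR; f_equal; lia).
  rewrite RtoC_plus. ring.
Qed.

Lemma theta_const c : theta (fconst c) = fconst 0.
Proof. apply functional_extensionality. intros [|n]; unfold theta; simpl; ring. Qed.

(* Normalised Bessel coefficients: the series of (z/2)^(-nu) Gamma(nu+1) J_nu(z) in (z/2)^2. *)
Definition bes (nu : C) : fps :=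
  fun k => (- (1)) ^ k / (RtoC (INR (fact k)) * pochhammer (nu + 1) k).

(** Despite the name this says that w is one of -1, -2, -3, ...: the orders at which denominators of
    [bes] vanish. *)
Definition nonneg_int (w : C) : Prop := exists k, w + RtoC (INR (S k)) = RtoC 0.

Lemma shifted_nz (nu : C) : ~ nonneg_int nu -> forall k, nu + 1 + RtoC (INR k) <> RtoC 0.
Proof.
  intros H k E. apply H. exists k. rewrite S_INR, RtoC_plus. rewrite <- E. ring.
Qed.

Lemma bes_0 nu : bes nu 0%nat = RtoC 1.
Proof. unfold bes. simpl. field; try apply C1_nz. Qed.

Lemma bes_S nu k : ~ nonneg_int nu ->
  RtoC (INR (S k)) * (RtoC (INR (S k)) + nu) * bes nu (S k) = - bes nu k.
Proof.
  intros H. assert (H' := shifted_nz nu H). unfold bes.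
  cbn [pochhammer]. rewrite fact_simpl, mult_INR, RtoC_mult.
  assert (N1 := fact_nz k). assert (N2 : RtoC (INR (S k)) <> RtoC 0) by apply RtoC_nz, INR_S_nz.
  assert (N3 := pochhammer_nz (nu + 1) k H'). assert (N4 := H' k).
  change ((- (1)) ^ S k) with (- (1) * (- (1)) ^ k).
  replace (RtoC (INR (S k)) + nu) with (nu + 1 + RtoC (INR k)) by (rewrite S_INR, RtoC_plus; ring).
  field. auto.
Qed.

(** Bessel's equation for z^(-nu) J_nu(z) in the variable x = (z/2)^2, where it reads theta^2 u + nu
    theta u + x u = 0. *)
Lemma bes_ode nu : ~ nonneg_int nu ->
  theta (theta (bes nu)) = fopp (fadd (fmul (fconst nu) (theta (bes nu))) (fmul fX (bes nu))).
Proof.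
  intros H. apply functional_extensionality. intros n. unfold fadd, fopp. rewrite fconst_mul.
  destruct n as [|n].
  - rewrite fX_mul_0. unfold theta. simpl. ring.
  - rewrite fX_mul_S. unfold theta. replace (bes nu n) with (- - bes nu n) by ring. rewrite <- (bes_S nu n H). ring.
Qed.

Fixpoint hsum (nu : C) (k : nat) : C :=
  match k with O => RtoC 0 | S j => hsum nu j + / (nu + RtoC (INR (S j))) end.

(* [bes_e] is the nu-derivative of [bes]; [bes_a] is the series of the 2F3, and [bes_b] that of the
   residues of the G-integrand at s = 1, 2, 3, ... *)
Definition bes_e (nu : C) : fps := fun k => - (bes nu k * hsum nu k).
Definition bes_a (nu : C) : fps := fun k => nu * fmul (bes nu) (bes nu) k / (nu + RtoC (INR k)).
Definition bes_b (nu : C) : fps :=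
  fun k => match k with O => RtoC 0 | S j => fmul (bes nu) (bes (- nu)) k / RtoC (INR k) end.

(** The derivative of the equation of [bes] with respect to nu, which explains the additional term
    [theta (bes nu)]. *)
Lemma bes_e_ode nu : ~ nonneg_int nu ->
  theta (theta (bes_e nu)) = fopp (fadd (fadd (theta (bes nu)) (fmul (fconst nu) (theta (bes_e nu)))) (fmul fX (bes_e nu))).
Proof.
  intros H. apply functional_extensionality. intros n. unfold fadd, fopp. rewrite fconst_mul.
  destruct n as [|n].
  - rewrite fX_mul_0. unfold theta. simpl. ring.
  - rewrite fX_mul_S. unfold theta, bes_e. cbn [hsum].
    assert (N := shifted_nz nu H n).
    replace (nu + 1 + RtoC (INR n)) with (nu + RtoC (INR (S n))) in N by (rewrite S_INR, RtoC_plus; ring).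
    assert (E := bes_S nu n H).
    replace (bes nu n) with (- (RtoC (INR (S n)) * (RtoC (INR (S n)) + nu) * bes nu (S n))).
    2:{ rewrite E. ring. }
    field. auto.
Qed.

(** The equation multiplies the coefficient of index n + 1 by (n + 1)(n + 1 + nu), nonzero here, so
    a formal solution is determined by its constant term. *)
Lemma fps_ode_zero (nu : C) (f : fps) : ~ nonneg_int nu -> f 0%nat = RtoC 0 ->
  theta (theta f) = fopp (fadd (fmul (fconst nu) (theta f)) (fmul fX f)) -> forall n, f n = RtoC 0.
Proof.
  intros H H0 E n. induction n as [|n IH]; auto.
  assert (En := f_equal (fun g : fps => g (S n)) E). unfold fopp, fadd in En. cbv beta in En.
  rewrite fconst_mul, fX_mul_S, IH in En. unfold theta in En.
  assert (N := shifted_nz nu H n).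
  replace (nu + 1 + RtoC (INR n)) with (nu + RtoC (INR (S n))) in N by (rewrite S_INR, RtoC_plus; ring).
  assert (N2 : RtoC (INR (S n)) <> RtoC 0) by apply RtoC_nz, INR_S_nz.
  apply (C_cancel_r (RtoC (INR (S n)) * (nu + RtoC (INR (S n))))). { apply Cmult_neq_0; auto. }
  transitivity (RtoC (INR (S n)) * (RtoC (INR (S n)) * f (S n)) + nu * (RtoC (INR (S n)) * f (S n))); [ring|].
  rewrite En. ring.
Qed.

Lemma theta_zero_const (f : fps) : theta f = fconst 0 -> f = fconst (f 0%nat).
Proof.
  intros E. apply functional_extensionality. intros [|n]; [reflexivity|].
  assert (En := f_equal (fun g : fps => g (S n)) E). unfold theta in En. simpl fconst in En.
  assert (N2 : RtoC (INR (S n)) <> RtoC 0) by apply RtoC_nz, INR_S_nz.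
  simpl fconst. apply (C_cancel_r (RtoC (INR (S n)))); auto. rewrite Cmult_comm, En. ring.
Qed.

Lemma fopp_const c : fopp (fconst c) = fconst (- c).
Proof. apply functional_extensionality. intros [|n]; unfold fopp; simpl; ring. Qed.

(** Abel's argument: the difference of both sides up to the constant is annihilated by [theta],
    hence equals its value -nu at x = 0. The term nu u v appears because the powers z^nu and z^(-nu)
    have been split off. *)
Lemma bes_wronskian nu : ~ nonneg_int nu -> ~ nonneg_int (- nu) ->
  fsub (fmul (bes nu) (theta (bes (- nu)))) (fmul (bes (- nu)) (theta (bes nu)))
  = fsub (fmul (fconst nu) (fmul (bes nu) (bes (- nu)))) (fconst nu).
Proof.
  intros H H'.
  set (u := bes nu). set (v := bes (- nu)).
  assert (Hu : theta (theta u) = fopp (fadd (fmul (fconst nu) (theta u)) (fmul fX u))) by now apply bes_ode.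
  assert (Hv : theta (theta v) = fopp (fadd (fmul (fopp (fconst nu)) (theta v)) (fmul fX v))).
  { rewrite fopp_const. now apply bes_ode. }
  set (W := fsub (fsub (fmul u (theta v)) (fmul v (theta u))) (fmul (fconst nu) (fmul u v))).
  assert (HW : theta W = fconst 0).
  { unfold W. rewrite !theta_sub, !theta_mul, theta_const, Hu, Hv. ring. }
  apply theta_zero_const in HW.
  assert (E0 : W 0%nat = - nu).
  { unfold W, fsub. rewrite fconst_mul. unfold fmul, cconv, theta. simpl. unfold u, v. rewrite !bes_0. ring. }
  rewrite E0, <- fopp_const in HW.
  transitivity (fadd W (fmul (fconst nu) (fmul u v))). { unfold W. ring. }
  rewrite HW. ring.
Qed.

(* Both sides, multiplied by z^nu, solve the inhomogeneous Bessel equation satisfied by the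
   nu-derivative of J_nu, with the same leading coefficient. *)
Lemma bes_identity nu : ~ nonneg_int nu -> ~ nonneg_int (- nu) -> nu <> RtoC 0 -> forall n,
  2 * nu * bes_e nu n = bes nu n - fmul (bes (- nu)) (bes_a nu) n + nu * fmul (bes nu) (bes_b nu) n.
Proof.
  intros H H' Hnu n.
  set (u := bes nu). set (v := bes (- nu)). set (e := bes_e nu). set (a := bes_a nu). set (b := bes_b nu).
  assert (Hu : theta (theta u) = fopp (fadd (fmul (fconst nu) (theta u)) (fmul fX u))) by now apply bes_ode.
  assert (Hv : theta (theta v) = fopp (fadd (fmul (fopp (fconst nu)) (theta v)) (fmul fX v))).
  { rewrite fopp_const. now apply bes_ode. }
  assert (He : theta (theta e) = fopp (fadd (fadd (theta u) (fmul (fconst nu) (theta e))) (fmul fX e))) by now apply bes_e_ode.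
  assert (HW := bes_wronskian nu H H'). fold u v in HW.
  assert (Ha : theta a = fsub (fmul (fconst nu) (fmul u u)) (fmul (fconst nu) a)).
  { apply functional_extensionality. intros k. unfold fsub. rewrite !fconst_mul. unfold theta, a, bes_a. fold u.
    assert (N : nu + RtoC (INR k) <> RtoC 0).
    { destruct k as [|k]; [simpl; now rewrite Cplus_0_r|]. intros E. apply H. now exists k. }
    field. auto. }
  assert (Hb : theta b = fsub (fmul u v) (fconst 1)).
  { apply functional_extensionality. intros [|k]; unfold theta, b, bes_b, fsub; fold u v.
    - simpl. unfold fmul, cconv. simpl. unfold u, v. rewrite !bes_0. ring.
    - assert (N2 : RtoC (INR (S k)) <> RtoC 0) by apply RtoC_nz, INR_S_nz. simpl fconst. field. auto. }
  set (two := fadd (fconst 1) (fconst 1)).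
  set (E := fsub (fadd (fsub (fmul two (fmul (fconst nu) e)) u) (fmul v a)) (fmul (fconst nu) (fmul u b))).
  assert (HE : theta (theta E) = fopp (fadd (fmul (fconst nu) (theta E)) (fmul fX E))).
  { unfold E, two.
    repeat (rewrite ?theta_sub, ?theta_add, ?theta_mul, ?theta_const, ?Ha, ?Hb).
    rewrite Hu, Hv, He.
    assert (HW' : fmul u (theta v) = fadd (fmul v (theta u)) (fsub (fmul (fconst nu) (fmul u v)) (fconst nu))).
    { rewrite <- HW. ring. }
    (* The defect of [E] in the homogeneous equation is a multiple of the Wronskian relation, so
       [HW'] makes it vanish. *)
    transitivity (fsub (fopp (fadd (fmul (fconst nu) (theta E)) (fmul fX E)))
        (fmul (fmul (fconst nu) u) (fsub (fsub (fsub (fmul v (theta u)) (fmul u (theta v))) (fopp (fmul (fconst nu) (fmul u v)))) (fconst nu)))).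
    - unfold E, two. repeat (rewrite ?theta_sub, ?theta_add, ?theta_mul, ?theta_const, ?Ha, ?Hb). ring.
    - rewrite HW'. unfold E, two.  repeat (rewrite ?theta_sub, ?theta_add, ?theta_mul, ?theta_const, ?Ha, ?Hb). ring. }
  assert (E0 : E 0%nat = RtoC 0).
  { unfold E, fsub, fadd. rewrite !fconst_mul. unfold two. rewrite fmul_distr. unfold fadd. rewrite !fconst_mul.
    unfold e, bes_e. simpl hsum. unfold fmul, cconv. simpl. unfold a, bes_a, b, bes_b, u, v, fmul, cconv. simpl.
    rewrite !bes_0. field. rewrite ?Cplus_0_r. auto. }
  assert (Z := fps_ode_zero nu E H E0 HE n).
  unfold E, fsub, fadd in Z. rewrite !fconst_mul in Z. unfold two in Z. rewrite fmul_distr in Z. unfold fadd in Z.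
  rewrite !fconst_mul in Z.
  transitivity (2 * nu * e n - (1 * (nu * e n) + 1 * (nu * e n) - u n + fmul v a n - nu * fmul u b n)).
  { rewrite Z. ring. }
  ring.
Qed.

(** * Binomial series and the product of two Bessel series *)

Fixpoint ff (X : C) (n : nat) : C :=
  match n with O => RtoC 1 | S k => ff X k * (X - RtoC (INR k)) end.

Definition fbin (X : C) : fps := fun n => ff X n / RtoC (INR (fact n)).

Lemma fbin_S X n : RtoC (INR (S n)) * fbin X (S n) = (X - RtoC (INR n)) * fbin X n.
Proof.
  unfold fbin. cbn [ff]. rewrite fact_simpl, mult_INR, RtoC_mult.
  assert (N1 := fact_nz n). assert (N2 : RtoC (INR (S n)) <> RtoC 0) by apply RtoC_nz, INR_S_nz.
  field. auto.
Qed.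

Lemma fbin_ode X : theta (fbin X) = fmul fX (fsub (fmul (fconst X) (fbin X)) (theta (fbin X))).
Proof.
  apply functional_extensionality. intros [|n].
  - rewrite fX_mul_0. unfold theta. simpl. ring.
  - rewrite fX_mul_S. unfold fsub. rewrite fconst_mul. unfold theta. rewrite fbin_S. ring.
Qed.

(** The product of the two binomial series satisfies the first-order equation of (1 + x)^(X + Y),
    whose recurrence fixes every coefficient from the constant one. *)
Lemma vandermonde X Y n : fmul (fbin X) (fbin Y) n = fbin (X + Y) n.
Proof.
  set (P := fmul (fbin X) (fbin Y)).
  assert (HP : theta P = fmul fX (fsub (fmul (fadd (fconst X) (fconst Y)) P) (theta P))).
  { unfold P. rewrite theta_mul.
    transitivity (fadd
      (fmul (fmul fX (fsub (fmul (fconst X) (fbin X)) (theta (fbin X)))) (fbin Y))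
      (fmul (fbin X) (fmul fX (fsub (fmul (fconst Y) (fbin Y)) (theta (fbin Y)))))).
    - now rewrite <- !fbin_ode.
    - ring. }
  induction n as [|n IH].
  - unfold P, fmul, cconv, fbin. simpl. field; try apply C1_nz.
  - assert (N2 : RtoC (INR (S n)) <> RtoC 0) by apply RtoC_nz, INR_S_nz.
    apply (C_cancel_r (RtoC (INR (S n)))); auto. rewrite (Cmult_comm (fbin _ _)), fbin_S, <- IH.
    assert (En := f_equal (fun g : fps => g (S n)) HP). cbv beta in En. rewrite fX_mul_S in En.
    unfold theta at 1 in En. rewrite Cmult_comm, En. unfold fsub. rewrite fmul_distr. unfold fadd.
    rewrite !fconst_mul. unfold theta. ring.
Qed.

Lemma ff_succ X n : ff (X + 1) (S n) = (X + 1) * ff X n.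
Proof.
  induction n as [|n IH]. { simpl. ring. }
  change (ff (X + 1) (S (S n))) with (ff (X + 1) (S n) * (X + 1 - RtoC (INR (S n)))).
  rewrite IH. cbn [ff]. rewrite S_INR, RtoC_plus. ring.
Qed.

Lemma poch_ff mu j n : pochhammer (mu + 1) (j + n) = pochhammer (mu + 1) j * ff (mu + RtoC (INR (j + n))) n.
Proof.
  induction n as [|n IH].
  - rewrite Nat.add_0_r. simpl. ring.
  - rewrite Nat.add_succ_r. cbn [pochhammer]. rewrite IH. rewrite S_INR, RtoC_plus.
    replace (mu + (RtoC (INR (j + n)) + RtoC 1)) with (mu + RtoC (INR (j + n)) + 1) by ring.
    rewrite ff_succ. ring.
Qed.

(** Read from the top, the Pochhammer symbols up to k are falling factorials of mu + k and nu + k;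
    the convolution thus becomes a Vandermonde sum. *)
Lemma bes_product mu nu k : ~ nonneg_int mu -> ~ nonneg_int nu ->
  fmul (bes mu) (bes nu) k = (- (1)) ^ k * pochhammer (mu + nu + RtoC (INR k) + 1) k
    / (RtoC (INR (fact k)) * (pochhammer (mu + 1) k * pochhammer (nu + 1) k)).
Proof.
  intros Hm Hn.
  assert (Pm := fun n => pochhammer_nz (mu + 1) n (shifted_nz mu Hm)).
  assert (Pn := fun n => pochhammer_nz (nu + 1) n (shifted_nz nu Hn)).
  transitivity ((- (1)) ^ k / (pochhammer (mu + 1) k * pochhammer (nu + 1) k) *
    fmul (fbin (nu + RtoC (INR k))) (fbin (mu + RtoC (INR k))) k).
  - unfold fmul, cconv. rewrite <- csum_scal. apply csum_ext. intros j Hj.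
    unfold bes, fbin.
    replace (pochhammer (mu + 1) k) with (pochhammer (mu + 1) (j + (k - j))) by (f_equal; lia).
    replace (pochhammer (nu + 1) k) with (pochhammer (nu + 1) ((k - j) + j)) by (f_equal; lia).
    rewrite !poch_ff.
    replace (j + (k - j))%nat with k by lia. replace (k - j + j)%nat with k by lia.
    assert (F1 : ff (mu + RtoC (INR k)) (k - j) <> RtoC 0).
    { assert (E := poch_ff mu j (k - j)). replace (j + (k - j))%nat with k in E by lia.
      intros Z. apply (Pm k). rewrite E, Z. ring. }
    assert (F2 : ff (nu + RtoC (INR k)) j <> RtoC 0).
    { assert (E := poch_ff nu (k - j) j). replace (k - j + j)%nat with k in E by lia.
      intros Z. apply (Pn k). rewrite E, Z. ring. }
    replace ((- (1)) ^ k) with ((- (1)) ^ j * (- (1)) ^ (k - j)).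
    2:{ rewrite <- Cpow_add_r. f_equal. lia. }
    assert (A1 := fact_nz j). assert (A2 := fact_nz (k - j)). assert (A3 := Pm j). assert (A4 := Pn (k - j)%nat).
    field. repeat split; auto.
  - rewrite vandermonde. unfold fbin.
    replace (mu + nu + RtoC (INR k) + 1) with (mu + nu + RtoC (INR k) + 1) by ring.
    assert (E := poch_ff (mu + nu + RtoC (INR k)) 0 k). simpl (0 + k)%nat in E. cbn [pochhammer] in E.
    rewrite E.
    replace (nu + RtoC (INR k) + (mu + RtoC (INR k))) with (mu + nu + RtoC (INR k) + RtoC (INR k)) by ring.
    assert (A1 := fact_nz k). assert (A3 := Pm k). assert (A4 := Pn k). field. auto.
Qed.

(** * Loop integrals *)

Definition ccont (f : R -> C) : Prop := forall t, ctends (locally t) f (f t).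

(** Built from real integrals of the two components, so that real integration theory applies; for
    continuous [f] it is the library integral. *)
Definition cint (f : R -> C) (a b : R) : C :=
  (RInt (fun t => Re (f t)) a b, RInt (fun t => Im (f t)) a b).

Lemma ccont_Re f a b : ccont f -> ex_RInt (fun t => Re (f t)) a b.
Proof.
  intros H. apply (ex_RInt_continuous (V := R_CompleteNormedModule)). intros t _.
  apply (ctends_Re (locally t) f (f t)). apply H.
Qed.

Lemma ccont_Im f a b : ccont f -> ex_RInt (fun t => Im (f t)) a b.
Proof.
  intros H. apply (ex_RInt_continuous (V := R_CompleteNormedModule)). intros t _.
  apply (ctends_Im (locally t) f (f t)). apply H.
Qed.

Lemma is_RInt_cint f a b : ccont f -> is_RInt (V := C_R_NormedModule) f a b (cint f a b).
Proof.
  intros H. apply is_RInt_fct_extend_pair.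
  - apply (RInt_correct (V := R_CompleteNormedModule)). now apply ccont_Re.
  - apply (RInt_correct (V := R_CompleteNormedModule)). now apply ccont_Im.
Qed.

Lemma ccont_ext f g : (forall t, f t = g t) -> ccont f -> ccont g.
Proof. intros E H t. rewrite <- E. apply ctends_ext with f; auto. apply locally_filter. Qed.

Lemma ccont_const c : ccont (fun _ => c).
Proof. intros t. apply ctends_const, locally_filter. Qed.

Lemma ccont_plus f g : ccont f -> ccont g -> ccont (fun t => f t + g t).
Proof. intros H H' t. apply ctends_plus; auto. apply locally_filter. Qed.

Lemma ccont_minus f g : ccont f -> ccont g -> ccont (fun t => f t - g t).
Proof. intros H H' t. apply ctends_minus; auto. apply locally_filter. Qed.

Lemma ccont_mult f g : ccont f -> ccont g -> ccont (fun t => f t * g t).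
Proof. intros H H' t. apply ctends_mult; auto. apply locally_filter. Qed.

Lemma ccont_div f g : ccont f -> ccont g -> (forall t, g t <> RtoC 0) -> ccont (fun t => f t / g t).
Proof.
  intros H H' N t. apply ctends_mult; auto; try apply locally_filter.
  apply ctends_inv; auto. apply locally_filter.
Qed.

Lemma ccont_derive f df : (forall t, cderive f t (df t)) -> ccont f.
Proof. intros H t. exact (cderive_continuous f t _ (H t)). Qed.

Lemma cint_ext f g a b : (forall t, (Rmin a b < t < Rmax a b)%R -> f t = g t) -> cint f a b = cint g a b.
Proof.
  intros H. unfold cint. f_equal; apply RInt_ext; intros t Ht; now rewrite H.
Qed.

Lemma cint_lin (c : C) f g a b : ccont f -> ccont g ->
  cint (fun t => c * f t + g t) a b = c * cint f a b + cint g a b.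
Proof.
  intros Hf Hg. unfold cint.
  assert (F1 := ccont_Re f a b Hf). assert (F2 := ccont_Im f a b Hf).
  assert (G1 := ccont_Re g a b Hg). assert (G2 := ccont_Im g a b Hg).
  apply (RInt_correct (V := R_CompleteNormedModule)) in F1. apply (RInt_correct (V := R_CompleteNormedModule)) in F2. apply (RInt_correct (V := R_CompleteNormedModule)) in G1. apply (RInt_correct (V := R_CompleteNormedModule)) in G2.
  apply injective_projections; simpl; apply is_RInt_unique.
  - apply (is_RInt_ext (fun t => (Re c * Re (f t) - Im c * Im (f t)) + Re (g t))%R). { reflexivity. }
    apply (is_RInt_plus (V := R_NormedModule)); auto.
    apply (is_RInt_minus (V := R_NormedModule)); apply (is_RInt_scal (V := R_NormedModule)); auto.
  - apply (is_RInt_ext (fun t => (Re c * Im (f t) + Im c * Re (f t)) + Im (g t))%R). { reflexivity. }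
    apply (is_RInt_plus (V := R_NormedModule)); auto.
    apply (is_RInt_plus (V := R_NormedModule)); apply (is_RInt_scal (V := R_NormedModule)); auto.
Qed.

Lemma cint_zero a b : cint (fun _ => RtoC 0) a b = RtoC 0.
Proof.
  unfold cint. apply injective_projections; simpl; rewrite RInt_const; unfold scal; simpl; unfold mult; simpl; ring.
Qed.

Lemma cint_minus f g a b : ccont f -> ccont g ->
  cint (fun t => f t - g t) a b = cint f a b - cint g a b.
Proof.
  intros Hf Hg. assert (H := cint_lin (- (1)) g f a b Hg Hf).
  rewrite (cint_ext _ (fun t => - (1) * g t + f t)) by (intros; ring). rewrite H. ring.
Qed.

Lemma cint_chasles f a b c : ccont f -> cint f a b + cint f b c = cint f a c.
Proof.
  intros H. unfold cint. apply injective_projections; simpl.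
  - apply (RInt_Chasles (V := R_CompleteNormedModule)); now apply ccont_Re.
  - apply (RInt_Chasles (V := R_CompleteNormedModule)); now apply ccont_Im.
Qed.

Lemma cint_le f g a b : (a <= b)%R -> ccont f -> ex_RInt g a b ->
  (forall t, (a <= t <= b)%R -> (Cmod (f t) <= g t)%R) -> (Cmod (cint f a b) <= RInt g a b)%R.
Proof.
  intros Hab Hf Hg H. rewrite Cmod_norm.
  apply (norm_RInt_le (V := C_R_NormedModule) f g a b); auto.
  - intros t Ht. rewrite <- Cmod_norm. now apply H.
  - now apply is_RInt_cint.
  - now apply (RInt_correct (V := R_CompleteNormedModule)).
Qed.

Lemma cint_bound f (M : R) a b : (a <= b)%R -> ccont f ->
  (forall t, (a <= t <= b)%R -> (Cmod (f t) <= M)%R) -> (Cmod (cint f a b) <= M * (b - a))%R.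
Proof.
  intros Hab Hf H. eapply Rle_trans; [apply (cint_le f (fun _ => M))|]; auto.
  - apply ex_RInt_const.
  - rewrite RInt_const. unfold scal; simpl; unfold mult; simpl. lra.
Qed.

Lemma cint_FTC (G g : R -> C) a b : (forall t, cderive G t (g t)) -> ccont g ->
  cint g a b = G b - G a.
Proof.
  intros H Hg. unfold cint. apply injective_projections; simpl.
  - apply is_RInt_unique. apply (is_RInt_derive (V := R_CompleteNormedModule) (fun t => Re (G t)) (fun t => Re (g t))).
    + intros t _. now apply is_derive_Re.
    + intros t _. apply (ctends_Re (locally t) g (g t)). apply Hg.
  - apply is_RInt_unique. apply (is_RInt_derive (V := R_CompleteNormedModule) (fun t => Im (G t)) (fun t => Im (g t))).
    + intros t _. now apply is_derive_Im.
    + intros t _. apply (ctends_Im (locally t) g (g t)). apply Hg.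
Qed.

Notation pinf := (Rbar_locally p_infty).

Lemma RInt_exp_neg M s T : ex_RInt (fun t => M * exp (- t))%R s T /\
  RInt (fun t => M * exp (- t))%R s T = (M * exp (- s) - M * exp (- T))%R.
Proof.
  assert (H : is_RInt (fun t => M * exp (- t))%R s T (minus (- (M * exp (- T))) (- (M * exp (- s))))%R).
  { apply (is_RInt_derive (V := R_CompleteNormedModule) (fun t => - (M * exp (- t)))%R).
    - intros t _. auto_derive; auto. ring.
    - intros t _. apply (ex_derive_continuous (fun t => M * exp (- t))%R). auto_derive. auto. }
  split. { eexists; exact H. }
  apply (is_RInt_unique (V := R_CompleteNormedModule)) in H. rewrite H. unfold minus, plus, opp; simpl. ring.
Qed.

Lemma cint_tail f M s T : ccont f -> (s <= T)%R ->
  (forall t, (s <= t)%R -> (Cmod (f t) <= M * exp (- t))%R) -> (Cmod (cint f s T) <= M * exp (- s))%R.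
Proof.
  intros Hf HT H. destruct (RInt_exp_neg M s T) as [E1 E2].
  eapply Rle_trans; [apply (cint_le f (fun t => M * exp (- t))%R)|]; auto.
  - intros t Ht. apply H. lra.
  - rewrite E2. assert (0 <= M * exp (- T))%R; [|lra].
    eapply Rle_trans; [apply Cmod_ge_0|]. apply (H T). lra.
Qed.

Lemma exp_neg_small (M eps : R) : (0 < eps)%R -> exists T0, forall T, (T0 <= T)%R -> (M * exp (- T) < eps)%R.
Proof.
  intros He. destruct (Rle_lt_dec M 0) as [HM|HM].
  - exists 0%R. intros T _. assert (P := exp_pos (- T)). apply Rle_lt_trans with 0%R; auto.
    rewrite <- (Rmult_0_l (exp (- T))). apply Rmult_le_compat_r; lra.
  - exists (M / eps)%R. intros T HT.
    assert (P := exp_pos T). rewrite exp_Ropp.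
    apply Rmult_lt_reg_r with (exp T); auto. rewrite Rmult_assoc, Rinv_l, Rmult_1_r by lra.
    assert (X := exp_ineq1_le T).
    apply Rlt_le_trans with (eps * (1 + T))%R; [|apply Rmult_le_compat_l; lra].
    apply Rmult_lt_reg_r with (/ eps)%R; [now apply Rinv_0_lt_compat|].
    replace (eps * (1 + T) * / eps)%R with (1 + T)%R by (field; lra). unfold Rdiv in HT. lra.
Qed.

Definition hint (f : R -> C) (c : R) (l : C) : Prop := ctends pinf (fun T => cint f c T) l.

Lemma hint_tail f c M l : ccont f -> (forall t, (c <= t)%R -> (Cmod (f t) <= M * exp (- t))%R) ->
  hint f c l -> forall T, (c <= T)%R -> (Cmod (l - cint f c T) <= M * exp (- T))%R.
Proof.
  intros Hf Hb Hl T HT. apply Rnot_lt_le. intros Hlt.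
  set (d := (Cmod (l - cint f c T) - M * exp (- T))%R).
  assert (Hd : (0 < d)%R) by (unfold d; lra).
  destruct (Hl d Hd) as [N HN]. set (S := (Rmax N T + 1)%R).
  assert (S1 : (N < S)%R) by (unfold S; generalize (Rmax_l N T); lra).
  assert (S2 : (T <= S)%R) by (unfold S; generalize (Rmax_r N T); lra).
  specialize (HN S S1).
  assert (X := cint_tail f M T S Hf S2 (fun t Ht => Hb t (Rle_trans _ _ _ HT Ht))).
  rewrite <- (cint_chasles f c T S Hf) in HN. rewrite Cmod_sub_sym in HN.
  assert (Cmod (l - cint f c T) <= Cmod (l - (cint f c T + cint f T S)) + Cmod (cint f T S))%R.
  { eapply Rle_trans; [|apply Cmod_triangle]. apply Req_le. f_equal. ring. }
  unfold d in *. lra.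
Qed.

Lemma hint_exists f c M : ccont f -> (forall t, (c <= t)%R -> (Cmod (f t) <= M * exp (- t))%R) ->
  exists l, hint f c l.
Proof.
  intros Hf Hb.
  assert (G : forall s T, (c <= s)%R -> (s <= T)%R -> (Cmod (cint f c T - cint f c s) <= M * exp (- s))%R).
  { intros s T Hs HT. rewrite <- (cint_chasles f c s T Hf).
    replace (cint f c s + cint f s T - cint f c s) with (cint f s T) by ring.
    apply cint_tail; auto. intros t Ht. apply Hb. lra. }
  assert (HF : forall F : (R -> Prop) -> Prop, True) by auto.
  assert (CC : forall eps, (0 < eps)%R -> exists N, forall s T, (N <= s)%R -> (N <= T)%R ->
     (Cmod (cint f c T - cint f c s) < eps)%R).
  { intros eps He. destruct (exp_neg_small M (eps / 2) ltac:(lra)) as [T0 HT0].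
    set (N := Rmax c T0). assert (N1 := Rmax_l c T0). assert (N2 := Rmax_r c T0). fold N in N1, N2.
    exists N. intros s T Hs HT.
    assert (A := G N s N1 Hs). assert (B := G N T N1 HT). specialize (HT0 N N2).
    replace (cint f c T - cint f c s) with ((cint f c T - cint f c N) + - (cint f c s - cint f c N)) by ring.
    eapply Rle_lt_trans; [apply Cmod_triangle|]. rewrite Cmod_opp. lra. }
  (* Completeness is applied along the integers; the Cauchy estimate [CC] then extends the limit to
     all real upper ends. *)
  assert (SQ : exists l, ctends eventually (fun n => cint f c (INR n)) l).
  { destruct (filterlim_locally_cauchy (U := C_R_CompleteNormedModule) (F := eventually) (fun n => cint f c (INR n))) as [H _].
    assert (X : exists l, filterlim (fun n => cint f c (INR n)) eventually (locally (T := C_R_CompleteNormedModule) l)).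
    { apply H. intros eps. destruct (CC eps (cond_pos eps)) as [N HN].
      destruct (nfloor_ex (Rmax N 0)) as [n0 [_ Hn0]]. { apply Rmax_r. }
      exists (fun n => (S n0 <= n)%nat). split. { exists (S n0). auto. }
      intros u v Hu Hv.
      assert (X1 : (N <= INR u)%R).
      { apply le_INR in Hu. rewrite S_INR in Hu. generalize (Rmax_l N 0). lra. }
      assert (X2 : (N <= INR v)%R).
      { apply le_INR in Hv. rewrite S_INR in Hv. generalize (Rmax_l N 0). lra. }
      apply (norm_compat1 (V := C_R_NormedModule)). specialize (HN _ _ X1 X2). rewrite Cmod_norm in HN. exact HN. }
    destruct X as [l Hl]. exists l. apply (ctends_iff eventually); ev. exact Hl. }
  destruct SQ as [l Hl]. exists l. intros eps He.
  destruct (CC (eps / 2)%R ltac:(lra)) as [N HN].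
  destruct (Hl (eps / 2)%R ltac:(lra)) as [n1 Hn1].
  destruct (nfloor_ex (Rmax N 0)) as [n0 [_ Hn0]]. { apply Rmax_r. }
  set (n := (n1 + S n0)%nat).
  assert (X1 : (N <= INR n)%R).
  { unfold n. rewrite plus_INR, S_INR. generalize (Rmax_l N 0) (pos_INR n1). lra. }
  specialize (Hn1 n ltac:(unfold n; lia)).
  exists N. intros T HT. specialize (HN (INR n) T X1 ltac:(lra)).
  replace (cint f c T - l) with ((cint f c T - cint f c (INR n)) + (cint f c (INR n) - l)) by ring.
  eapply Rle_lt_trans; [apply Cmod_triangle|]. lra.
Qed.

Lemma hint_unique f c l l' : hint f c l -> hint f c l' -> l = l'.
Proof. apply ctends_unique. apply Rbar_locally_filter. Qed.

Lemma hint_is_RInt_gen f c l : ccont f -> hint f c l ->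
  is_RInt_gen (V := C_R_NormedModule) f (at_point c) pinf l.
Proof.
  intros Hf Hl P HP.
  assert (H : filterlim (fun T => cint f c T) pinf (locally (T := C_R_NormedModule) l)).
  { apply ctends_iff; auto. apply Rbar_locally_filter. }
  specialize (H P HP). unfold filtermapi.
  apply Filter_prod with (fun a => a = c) (fun T => P (cint f c T)).
  - reflexivity.
  - exact H.
  - intros a T -> HT. exists (cint f c T). split; auto. now apply is_RInt_cint.
Qed.

Lemma hint_lin (a : C) f g c l m : ccont f -> ccont g -> hint f c l -> hint g c m ->
  hint (fun t => a * f t + g t) c (a * l + m).
Proof.
  intros Hf Hg Hl Hm. unfold hint.
  apply ctends_ext with (fun T => a * cint f c T + cint g c T). { apply Rbar_locally_filter. }
  - intros T. now rewrite cint_lin.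
  - apply ctends_plus; [apply Rbar_locally_filter| |exact Hm].
    apply ctends_mult; [apply Rbar_locally_filter| |exact Hl]. apply ctends_const, Rbar_locally_filter.
Qed.

(** Dominated convergence on a half-line: the integrals up to a fixed S converge uniformly, and the
    tails are at most M exp(-S) for all parameters and for the limit. *)
Lemma hint_limit {T} (F : (T -> Prop) -> Prop) {FF : ProperFilter F} (f : T -> R -> C) (g : R -> C) c M (l : T -> C) :
  ccont g -> F (fun a => ccont (f a)) ->
  F (fun a => forall t, (c <= t)%R -> (Cmod (f a t) <= M * exp (- t))%R) ->
  (forall S eps, (0 < eps)%R -> F (fun a => forall t, (c <= t <= S)%R -> (Cmod (f a t - g t) <= eps)%R)) ->
  F (fun a => hint (f a) c (l a)) ->
  exists m, hint g c m /\ ctends F l m.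
Proof.
  intros Hg Hf Hb Hu Hl.
  assert (FF' : Filter F) by apply FF.
  assert (Hbg : forall t, (c <= t)%R -> (Cmod (g t) <= M * exp (- t))%R).
  { intros t Ht. apply Rnot_lt_le. intros Hlt.
    destruct (filter_ex _ (filter_and _ _ Hb (Hu t ((Cmod (g t) - M * exp (- t)) / 2)%R ltac:(lra)))) as [a [H1 H2]].
    specialize (H1 t Ht). specialize (H2 t ltac:(lra)). rewrite Cmod_sub_sym in H2.
    assert (Cmod (g t) <= Cmod (g t - f a t) + Cmod (f a t))%R; [|lra].
    eapply Rle_trans; [|apply Cmod_triangle]. apply Req_le. f_equal. ring. }
  destruct (hint_exists g c M Hg Hbg) as [m Hm]. exists m. split; auto.
  intros eps He. destruct (exp_neg_small M (eps / 4) ltac:(lra)) as [T0 HT0].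
  set (S := (Rmax c T0 + 1)%R). assert (N1 := Rmax_l c T0). assert (N2 := Rmax_r c T0).
  assert (S1 : (c < S)%R) by (unfold S; lra). assert (S2 : (T0 <= S)%R) by (unfold S; lra).
  specialize (HT0 S S2).
  assert (He' : (0 < eps / 4 / (S - c))%R) by (apply Rdiv_lt_0_compat; lra).
  generalize (filter_and _ _ (filter_and _ _ Hf Hb) (filter_and _ _ (Hu S _ He') Hl)).
  apply filter_imp. intros a [[A1 A2] [A3 A4]].
  assert (X1 := hint_tail (f a) c M (l a) A1 A2 A4 S ltac:(lra)).
  assert (X2 := hint_tail g c M m Hg Hbg Hm S ltac:(lra)).
  assert (X3 : (Cmod (cint (f a) c S - cint g c S) <= eps / 4 / (S - c) * (S - c))%R).
  { rewrite <- cint_minus by auto. apply cint_bound; [lra| |exact A3].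
    now apply ccont_minus. }
  replace (eps / 4 / (S - c) * (S - c))%R with (eps / 4)%R in X3 by (field; lra).
  rewrite Cmod_sub_sym in X2.
  replace (l a - m) with ((l a - cint (f a) c S) + (cint (f a) c S - cint g c S) + (cint g c S - m)) by ring.
  eapply Rle_lt_trans; [apply Cmod_triangle|].
  assert (Y := Cmod_triangle (l a - cint (f a) c S) (cint (f a) c S - cint g c S)). lra.
Qed.

Lemma cint_limit {T} (F : (T -> Prop) -> Prop) {FF : ProperFilter F} (f : T -> R -> C) (g : R -> C) a b :
  (a < b)%R -> ccont g -> F (fun x => ccont (f x)) ->
  (forall eps, (0 < eps)%R -> F (fun x => forall t, (a <= t <= b)%R -> (Cmod (f x t - g t) <= eps)%R)) ->
  ctends F (fun x => cint (f x) a b) (cint g a b).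
Proof.
  intros Hab Hg Hf Hu eps He.
  assert (FF' : Filter F) by apply FF.
  assert (He' : (0 < eps / 2 / (b - a))%R) by (apply Rdiv_lt_0_compat; lra).
  generalize (filter_and _ _ Hf (Hu _ He')). apply filter_imp. intros x [H1 H2].
  rewrite <- cint_minus by auto.
  eapply Rle_lt_trans; [apply (cint_bound _ (eps / 2 / (b - a))); [lra|now apply ccont_minus|exact H2]|].
  replace (eps / 2 / (b - a) * (b - a))%R with (eps / 2)%R by (field; lra). lra.
Qed.

(** * Loop integrals around a half-strip *)

Definition lines_cont (f : C -> C) (c h1 h2 : R) : Prop :=
  ccont (fun t => f (t, h1)) /\ ccont (fun t => f (t, h2)) /\ ccont (fun t => f (c, t)).

Definition loopval (f : C -> C) (c h1 h2 : R) (v : C) : Prop :=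
  exists l1 l2, hint (fun t => f (t, h1)) c l1 /\ hint (fun t => f (t, h2)) c l2 /\
   v = - l1 + cint (fun t => f (c, t) * Ci) h1 h2 + l2.

Lemma ccont_side (f : C -> C) c : ccont (fun t => f (c, t)) -> ccont (fun t => f (c, t) * Ci).
Proof. intros H. apply ccont_mult; auto. apply ccont_const. Qed.

Lemma loopval_is_loop_integral f g c h1 h2 v : lines_cont g c h1 h2 ->
  (forall t, f (t, h1) = g (t, h1)) -> (forall t, f (t, h2) = g (t, h2)) -> (forall t, f (c, t) = g (c, t)) ->
  loopval g c h1 h2 v -> is_loop_integral f c h1 h2 v.
Proof.
  intros [C1 [C2 C3]] E1 E2 E3 [l1 [l2 [H1 [H2 ->]]]].
  exists l1, (cint (fun t => g (c, t) * Ci) h1 h2), l2. repeat split.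
  - apply hint_is_RInt_gen. { eapply ccont_ext; [|exact C1]. intros; now rewrite E1. }
    unfold hint. eapply ctends_ext; [apply Rbar_locally_filter| |exact H1].
    intros T. apply cint_ext. intros; now rewrite E1.
  - eapply is_RInt_ext; [|apply is_RInt_cint; apply ccont_side; exact C3].
    intros t _. cbv beta. now rewrite E3.
  - apply hint_is_RInt_gen. { eapply ccont_ext; [|exact C2]. intros; now rewrite E2. }
    unfold hint. eapply ctends_ext; [apply Rbar_locally_filter| |exact H2].
    intros T. apply cint_ext. intros; now rewrite E2.
Qed.

Lemma is_loop_integral_unique f c h1 h2 v w :
  is_loop_integral f c h1 h2 v -> is_loop_integral f c h1 h2 w -> v = w.
Proof.
  intros [a [b [d [H1 [H2 [H3 ->]]]]]] [a' [b' [d' [H1' [H2' [H3' ->]]]]]].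
  assert (P1 : ProperFilter' (at_point c)) by (apply Proper_StrongProper, at_point_filter).
  assert (P2 : ProperFilter' pinf) by (apply Proper_StrongProper, Rbar_locally_filter).
  assert (E1 : a = a').
  { rewrite <- (is_RInt_gen_unique (V := C_R_CompleteNormedModule) _ _ H1).
    exact (is_RInt_gen_unique (V := C_R_CompleteNormedModule) _ _ H1'). }
  assert (E3 : d = d').
  { rewrite <- (is_RInt_gen_unique (V := C_R_CompleteNormedModule) _ _ H3).
    exact (is_RInt_gen_unique (V := C_R_CompleteNormedModule) _ _ H3'). }
  assert (E2 : b = b').
  { rewrite <- (is_RInt_unique (V := C_R_CompleteNormedModule) _ _ _ _ H2).
    exact (is_RInt_unique (V := C_R_CompleteNormedModule) _ _ _ _ H2'). }
  now rewrite E1, E2, E3.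
Qed.

Lemma loopval_lin (a : C) f g c h1 h2 v w : lines_cont f c h1 h2 -> lines_cont g c h1 h2 ->
  loopval f c h1 h2 v -> loopval g c h1 h2 w -> loopval (fun s => a * f s + g s) c h1 h2 (a * v + w).
Proof.
  intros [A1 [A2 A3]] [B1 [B2 B3]] [l1 [l2 [H1 [H2 ->]]]] [m1 [m2 [H3 [H4 ->]]]].
  exists (a * l1 + m1), (a * l2 + m2). split; [|split].
  - now apply (hint_lin a (fun t => f (t, h1)) (fun t => g (t, h1))).
  - now apply (hint_lin a (fun t => f (t, h2)) (fun t => g (t, h2))).
  - rewrite (cint_ext (fun t => (a * f (c, t) + g (c, t)) * Ci) (fun t => a * (f (c, t) * Ci) + g (c, t) * Ci)) by (intros; ring).
    rewrite cint_lin by (now apply ccont_side). ring.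
Qed.

Lemma loopval_ext f g c h1 h2 v :
  (forall t, f (t, h1) = g (t, h1)) -> (forall t, f (t, h2) = g (t, h2)) -> (forall t, f (c, t) = g (c, t)) ->
  loopval f c h1 h2 v -> loopval g c h1 h2 v.
Proof.
  intros E1 E2 E3 [l1 [l2 [H1 [H2 ->]]]]. exists l1, l2. split; [|split].
  - eapply ctends_ext; [apply Rbar_locally_filter| |exact H1].
    intros T. apply cint_ext. intros; now rewrite E1.
  - eapply ctends_ext; [apply Rbar_locally_filter| |exact H2].
    intros T. apply cint_ext. intros; now rewrite E2.
  - do 2 f_equal. apply cint_ext. intros; now rewrite E3.
Qed.

Lemma lines_cont_ext f g c h1 h2 :
  (forall t, f (t, h1) = g (t, h1)) -> (forall t, f (t, h2) = g (t, h2)) -> (forall t, f (c, t) = g (c, t)) ->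
  lines_cont f c h1 h2 -> lines_cont g c h1 h2.
Proof.
  intros E1 E2 E3 [A1 [A2 A3]]. split; [|split].
  - apply (ccont_ext (fun t => f (t, h1))); auto.
  - apply (ccont_ext (fun t => f (t, h2))); auto.
  - apply (ccont_ext (fun t => f (c, t))); auto.
Qed.

Lemma loop_limit {T} (F : (T -> Prop) -> Prop) {FF : ProperFilter F} (f : T -> C -> C) (g : C -> C) c h1 h2 M (v : T -> C) :
  (h1 < h2)%R -> lines_cont g c h1 h2 -> F (fun a => lines_cont (f a) c h1 h2) ->
  F (fun a => forall t, (c <= t)%R -> (Cmod (f a (t, h1)) <= M * exp (- t))%R /\ (Cmod (f a (t, h2)) <= M * exp (- t))%R) ->
  (forall S eps, (0 < eps)%R -> F (fun a => forall t, (c <= t <= S)%R ->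
     (Cmod (f a (t, h1) - g (t, h1)) <= eps)%R /\ (Cmod (f a (t, h2) - g (t, h2)) <= eps)%R)) ->
  (forall eps, (0 < eps)%R -> F (fun a => forall t, (h1 <= t <= h2)%R -> (Cmod (f a (c, t) - g (c, t)) <= eps)%R)) ->
  F (fun a => loopval (f a) c h1 h2 (v a)) ->
  exists w, loopval g c h1 h2 w /\ ctends F v w.
Proof.
  intros Hh [G1 [G2 G3]] Hc Hb Hu Hs Hv.
  assert (FF' : Filter F) by apply FF.
  (* [loopval] only asserts that the half-line integrals exist; choice turns them into functions of
     the parameter whose limits can be taken. *)
  set (L1 := fun a => epsilon (inhabits (RtoC 0)) (fun l => hint (fun t => f a (t, h1)) c l)).
  set (L2 := fun a => epsilon (inhabits (RtoC 0)) (fun l => hint (fun t => f a (t, h2)) c l)).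
  assert (HL : F (fun a => hint (fun t => f a (t, h1)) c (L1 a) /\ hint (fun t => f a (t, h2)) c (L2 a) /\
     v a = - L1 a + cint (fun t => f a (c, t) * Ci) h1 h2 + L2 a)).
  { generalize Hv. apply filter_imp. intros a [l1 [l2 [H1 [H2 E]]]].
    assert (K1 : hint (fun t => f a (t, h1)) c (L1 a)) by (apply epsilon_spec; eauto).
    assert (K2 : hint (fun t => f a (t, h2)) c (L2 a)) by (apply epsilon_spec; eauto).
    rewrite (hint_unique _ _ _ _ K1 H1), (hint_unique _ _ _ _ K2 H2). auto. }
  destruct (hint_limit F (fun a t => f a (t, h1)) (fun t => g (t, h1)) c M L1) as [m1 [M1 T1]]; auto.
  { generalize Hc. apply filter_imp. now intros a [A _]. }
  { generalize Hb. apply filter_imp. intros a A t Ht. now apply A. }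
  { intros S eps He. generalize (Hu S eps He). apply filter_imp. intros a A t Ht. now apply A. }
  { generalize HL. apply filter_imp. now intros a [A _]. }
  destruct (hint_limit F (fun a t => f a (t, h2)) (fun t => g (t, h2)) c M L2) as [m2 [M2 T2]]; auto.
  { generalize Hc. apply filter_imp. now intros a [_ [A _]]. }
  { generalize Hb. apply filter_imp. intros a A t Ht. now apply A. }
  { intros S eps He. generalize (Hu S eps He). apply filter_imp. intros a A t Ht. now apply A. }
  { generalize HL. apply filter_imp. now intros a [_ [A _]]. }
  exists (- m1 + cint (fun t => g (c, t) * Ci) h1 h2 + m2). split. { now exists m1, m2. }
  apply ctends_ext_loc with (fun a => - L1 a + cint (fun t => f a (c, t) * Ci) h1 h2 + L2 a); auto.
  { generalize HL. apply filter_imp. now intros a [_ [_ ->]]. }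
  apply ctends_plus; auto. apply ctends_plus; auto. { now apply ctends_opp. }
  apply cint_limit; auto. { now apply ccont_side. }
  { generalize Hc. apply filter_imp. intros a [_ [_ A]]. now apply ccont_side. }
  intros eps He. generalize (Hs eps He). apply filter_imp. intros a A t Ht.
  replace (f a (c, t) * Ci - g (c, t) * Ci) with ((f a (c, t) - g (c, t)) * Ci) by ring.
  rewrite Cmod_mult, Cmod_Ci, Rmult_1_r. now apply A.
Qed.

Lemma Cexp_sub1_bound (y : C) : (Cmod (Cexp y - 1) <= 2 * Cmod y * exp (Cmod y))%R.
Proof.
  assert (X := cderive_bound (fun s => Cexp (RtoC s * y)) (fun s => y * Cexp (RtoC s * y))
     (Cmod y * exp (Cmod y)) 0 1).
  simpl in X. rewrite Cmult_1_l, Cmult_0_l, Cexp_0 in X.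
  eapply Rle_trans; [apply X|rewrite Rminus_0_r, Rabs_R1; lra].
  intros t Ht. rewrite Rmin_left, Rmax_right in Ht by lra. split.
  - apply (cderive_Cexp (fun s => RtoC s * y)).
    apply (cderive_ext (fun s => 0 + RtoC s * y)); [intros; ring|]. apply cderive_affine.
  - rewrite Cmod_mult. apply Rmult_le_compat_l; [apply Cmod_ge_0|].
    eapply Rle_trans; [apply Cmod_exp_le|]. apply exp_le. rewrite Cmod_mult, Cmod_R, Rabs_pos_eq by lra.
    generalize (Cmod_ge_0 y). nra.
Qed.

(** Second-order remainder of the exponential, from [Cexp_sub1_bound] by the mean value estimate on
    the segment from 0 to y. *)
Lemma Cexp_sub2_bound (y : C) : (Cmod (Cexp y - 1 - y) <= 4 * Cmod y * Cmod y * exp (Cmod y))%R.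
Proof.
  assert (P := Cmod_ge_0 y).
  assert (X := cderive_bound (fun s => Cexp (RtoC s * y) - (1 + RtoC s * y)) (fun s => y * Cexp (RtoC s * y) - y)
     (Cmod y * (2 * Cmod y * exp (Cmod y))) 0 1).
  simpl in X. rewrite Cmult_1_l, Cmult_0_l, Cexp_0 in X.
  replace (Cexp y - 1 - y) with (Cexp y - (1 + y) - (1 - (1 + 0))) by ring.
  eapply Rle_trans; [apply X|rewrite Rminus_0_r, Rabs_R1; lra].
  intros t Ht. rewrite Rmin_left, Rmax_right in Ht by lra. split.
  - apply (cderive_minus (fun s => Cexp (RtoC s * y)) (fun s => 1 + RtoC s * y)); [|apply cderive_affine].
    apply (cderive_Cexp (fun s => RtoC s * y)).
    apply (cderive_ext (fun s => 0 + RtoC s * y)); [intros; ring|]. apply cderive_affine.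
  - replace (y * Cexp (RtoC t * y) - y) with (y * (Cexp (RtoC t * y) - 1)) by ring.
    rewrite Cmod_mult. apply Rmult_le_compat_l; auto.
    eapply Rle_trans; [apply Cexp_sub1_bound|].
    assert (Q : (Cmod (RtoC t * y) <= Cmod y)%R).
    { rewrite Cmod_mult, Cmod_R, Rabs_pos_eq by lra. nra. }
    apply Rmult_le_compat; [| |lra|now apply exp_le].
    + assert (Z := Cmod_ge_0 (RtoC t * y)). lra.
    + apply Rlt_le, exp_pos.
Qed.

Lemma cderive_inv (g : R -> C) (x : R) (l : C) : g x <> RtoC 0 ->
  cderive g x l -> cderive (fun t => / g t) x (- l / (g x * g x)).
Proof.
  intros Hx Hg. apply cderive_of_quotient.
  assert (Hc := cderive_continuous g x l Hg).
  assert (Hc' : ctends (locally' x) g (g x)).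
  { apply (ctends_filter_le _ (locally x)); auto. apply filter_le_within. }
  assert (Hq := cderive_quotient g x l Hg).
  assert (Nz : locally' x (fun y => g y <> RtoC 0)).
  { assert (P : (0 < Cmod (g x))%R) by now apply Cmod_gt_0.
    generalize (Hc' _ P). apply filter_imp. intros y Hy E. rewrite E in Hy.
    replace (0 - g x) with (- g x) in Hy by ring. rewrite Cmod_opp in Hy. lra. }
  assert (Ny : locally' x (fun y => y <> x)).
  { apply (locally'_intro _ _ 1); [lra|]. auto. }
  apply ctends_ext_loc with (fun y => - ((g y - g x) / RtoC (y - x)) * / (g y * g x)); try apply locally'_proper.
  - generalize (filter_and _ _ Nz Ny). apply filter_imp. intros y [H1 H2].
    assert (N : RtoC (y - x) <> RtoC 0) by (apply RtoC_nz; lra). field. auto.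
  - apply ctends_mult; try apply locally'_proper.
    + apply ctends_opp; auto. apply locally'_proper.
    + apply ctends_inv; try apply locally'_proper. { now apply Cmult_neq_0. }
      apply ctends_mult; try apply locally'_proper; auto. apply ctends_const, locally'_proper.
Qed.

Lemma pair_h (t h : R) : ((t, h) : C) = (0, h) + RtoC t * 1.
Proof. unfold RtoC, Cplus, Cmult; simpl. f_equal; ring. Qed.

Lemma pair_v (c t : R) : ((c, t) : C) = (c, 0) + RtoC t * Ci.
Proof. unfold RtoC, Ci, Cplus, Cmult; simpl. f_equal; ring. Qed.

Lemma cderive_h (h t : R) : cderive (fun t => (t, h) : C) t (RtoC 1).
Proof.
  apply (cderive_ext (fun t => (0, h) + RtoC t * 1)); [intros; symmetry; apply pair_h|]. apply cderive_affine.
Qed.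

Lemma cderive_v (c t : R) : cderive (fun t => (c, t) : C) t Ci.
Proof.
  apply (cderive_ext (fun t => (c, 0) + RtoC t * Ci)); [intros; symmetry; apply pair_v|]. apply cderive_affine.
Qed.

Lemma cderive_exp_path (g : R -> C) (t : R) (d : C) (L p : C) : cderive g t d ->
  cderive (fun t => Cexp (- (L * (g t - p)))) t (- (L * d) * Cexp (- (L * (g t - p)))).
Proof.
  intros H. apply (cderive_Cexp (fun t => - (L * (g t - p)))).
  apply (cderive_ext (fun t => - L * (g t - p))); [intros; ring|].
  apply (cderive_eq _ _ (- L * (d - 0))); [ring|]. apply cderive_scal.
  apply cderive_minus; auto. apply cderive_const.
Qed.

Lemma ccont_path_h h : ccont (fun t => (t, h) : C).
Proof. apply (ccont_derive _ (fun _ => RtoC 1)). intros; apply cderive_h. Qed.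

Lemma ccont_path_v c : ccont (fun t => (c, t) : C).
Proof. apply (ccont_derive _ (fun _ => Ci)). intros; apply cderive_v. Qed.

Lemma nz_h (p t h : R) : h <> 0%R -> ((t, h) : C) - RtoC p <> RtoC 0.
Proof. intros H E. apply H. apply (f_equal Im) in E. simpl in E. lra. Qed.

Lemma nz_v (p t c : R) : c <> p -> ((c, t) : C) - RtoC p <> RtoC 0.
Proof. intros H E. apply H. apply (f_equal Re) in E. simpl in E. lra. Qed.

(** * Clockwise integrals over rectangles *)

Definition rect (f : C -> C) (c T h1 h2 : R) : C :=
  - cint (fun t => f (t, h1)) c T + cint (fun t => f (c, t) * Ci) h1 h2
  + cint (fun t => f (t, h2)) c T - cint (fun t => f (T, t) * Ci) h1 h2.

Definition rcont (f : C -> C) (c T h1 h2 : R) : Prop :=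
  lines_cont f c h1 h2 /\ ccont (fun t => f (T, t)).

Lemma rect_lin (a : C) f g c T h1 h2 : rcont f c T h1 h2 -> rcont g c T h1 h2 ->
  rect (fun s => a * f s + g s) c T h1 h2 = a * rect f c T h1 h2 + rect g c T h1 h2.
Proof.
  intros [[A1 [A2 A3]] A4] [[B1 [B2 B3]] B4]. unfold rect.
  rewrite (cint_ext (fun t => (a * f (c, t) + g (c, t)) * Ci) (fun t => a * (f (c, t) * Ci) + g (c, t) * Ci)) by (intros; ring).
  rewrite (cint_ext (fun t => (a * f (T, t) + g (T, t)) * Ci) (fun t => a * (f (T, t) * Ci) + g (T, t) * Ci)) by (intros; ring).
  rewrite (cint_lin a (fun t => f (t, h1)) (fun t => g (t, h1))), (cint_lin a (fun t => f (t, h2)) (fun t => g (t, h2))) by auto.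
  rewrite !cint_lin by (now apply ccont_side). ring.
Qed.

Lemma rect_bound f c T h1 h2 M : (c <= T)%R -> (h1 <= h2)%R -> rcont f c T h1 h2 ->
  (forall t, (c <= t <= T)%R -> (Cmod (f (t, h1)) <= M)%R /\ (Cmod (f (t, h2)) <= M)%R) ->
  (forall t, (h1 <= t <= h2)%R -> (Cmod (f (c, t)) <= M)%R /\ (Cmod (f (T, t)) <= M)%R) ->
  (Cmod (rect f c T h1 h2) <= M * (2 * (T - c) + 2 * (h2 - h1)))%R.
Proof.
  intros HT Hh [[A1 [A2 A3]] A4] H1 H2. unfold rect, Cminus.
  assert (B1 := cint_bound (fun t => f (t, h1)) M c T HT A1 (fun t Ht => proj1 (H1 t Ht))).
  assert (B2 := cint_bound (fun t => f (t, h2)) M c T HT A2 (fun t Ht => proj2 (H1 t Ht))).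
  assert (B3 := cint_bound (fun t => f (c, t) * Ci) M h1 h2 Hh (ccont_side f c A3)).
  assert (B4 := cint_bound (fun t => f (T, t) * Ci) M h1 h2 Hh (ccont_side f T A4)).
  lapply B3; [clear B3; intros B3|]. 2:{ intros t Ht. rewrite Cmod_mult, Cmod_Ci, Rmult_1_r. now apply H2. }
  lapply B4; [clear B4; intros B4|]. 2:{ intros t Ht. rewrite Cmod_mult, Cmod_Ci, Rmult_1_r. now apply H2. }
  set (x1 := cint (fun t => f (t, h1)) c T) in *. set (x2 := cint (fun t => f (t, h2)) c T) in *.
  set (x3 := cint (fun t => f (c, t) * Ci) h1 h2) in *. set (x4 := cint (fun t => f (T, t) * Ci) h1 h2) in *.
  assert (Y1 := Cmod_triangle (- x1 + x3 + x2) (- x4)). assert (Y2 := Cmod_triangle (- x1 + x3) x2).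
  assert (Y3 := Cmod_triangle (- x1) x3). rewrite Cmod_opp in *. lra.
Qed.

Lemma rect_exact (G g : C -> C) c T h1 h2 : rcont g c T h1 h2 ->
  (forall t, cderive (fun t => G (t, h1)) t (g (t, h1))) ->
  (forall t, cderive (fun t => G (t, h2)) t (g (t, h2))) ->
  (forall t, cderive (fun t => G (c, t)) t (g (c, t) * Ci)) ->
  (forall t, cderive (fun t => G (T, t)) t (g (T, t) * Ci)) ->
  rect g c T h1 h2 = RtoC 0.
Proof.
  intros [[A1 [A2 A3]] A4] H1 H2 H3 H4. unfold rect.
  rewrite (cint_FTC (fun t => G (t, h1)) (fun t => g (t, h1))) by auto.
  rewrite (cint_FTC (fun t => G (t, h2)) (fun t => g (t, h2))) by auto.
  rewrite (cint_FTC (fun t => G (c, t)) (fun t => g (c, t) * Ci)) by (auto; now apply ccont_side).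
  rewrite (cint_FTC (fun t => G (T, t)) (fun t => g (T, t) * Ci)) by (auto; now apply ccont_side).
  ring.
Qed.

Lemma rect_ext f g c T h1 h2 : (forall s, f s = g s) -> rect f c T h1 h2 = rect g c T h1 h2.
Proof.
  intros E. unfold rect.
  rewrite (cint_ext (fun t => f (t, h1)) (fun t => g (t, h1))) by (intros; now rewrite E).
  rewrite (cint_ext (fun t => f (t, h2)) (fun t => g (t, h2))) by (intros; now rewrite E).
  rewrite (cint_ext (fun t => f (c, t) * Ci) (fun t => g (c, t) * Ci)) by (intros; now rewrite E).
  rewrite (cint_ext (fun t => f (T, t) * Ci) (fun t => g (T, t) * Ci)) by (intros; now rewrite E).
  reflexivity.
Qed.

Section Pole.
Variables (p c T h1 h2 : R).
Hypothesis (Hc : (c < p)%R) (HT : (p < T)%R) (Hh1 : (h1 < 0)%R) (Hh2 : (0 < h2)%R).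

Lemma pole_rcont (L : C) : rcont (fun s => Cexp (- (L * (s - RtoC p))) / (s - RtoC p)) c T h1 h2.
Proof.
  assert (E : forall g d, (forall t, cderive g t (d t)) -> (forall t, g t - RtoC p <> RtoC 0) ->
    ccont (fun t : R => Cexp (- (L * (g t - RtoC p))) / (g t - RtoC p))).
  { intros g d H N. apply ccont_div; auto.
    - apply (ccont_derive _ (fun t => - (L * d t) * Cexp (- (L * (g t - RtoC p))))). intros t. now apply cderive_exp_path.
    - apply ccont_minus; [|apply ccont_const]. now apply (ccont_derive g d). }
  repeat split.
  - apply (E (fun t => (t, h1) : C) (fun _ => RtoC 1)). intros; apply cderive_h. intros; apply nz_h; lra.
  - apply (E (fun t => (t, h2) : C) (fun _ => RtoC 1)). intros; apply cderive_h. intros; apply nz_h; lra.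
  - apply (E (fun t => (c, t) : C) (fun _ => Ci)). intros; apply cderive_v. intros; apply nz_v; lra.
  - apply (E (fun t => (T, t) : C) (fun _ => Ci)). intros; apply cderive_v. intros; apply nz_v; lra.
Qed.

Lemma exp_rcont (L : C) : rcont (fun s => Cexp (- (L * (s - RtoC p)))) c T h1 h2.
Proof.
  assert (E : forall g d, (forall t, cderive g t (d t)) -> ccont (fun t : R => Cexp (- (L * (g t - RtoC p))))).
  { intros g d H. apply (ccont_derive _ (fun t => - (L * d t) * Cexp (- (L * (g t - RtoC p))))).
    intros t. now apply cderive_exp_path. }
  split; [split; [|split]|].
  - apply (E (fun t => (t, h1) : C) (fun _ => RtoC 1)). intros; apply cderive_h.
  - apply (E (fun t => (t, h2) : C) (fun _ => RtoC 1)). intros; apply cderive_h.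
  - apply (E (fun t => (c, t) : C) (fun _ => Ci)). intros; apply cderive_v.
  - apply (E (fun t => (T, t) : C) (fun _ => Ci)). intros; apply cderive_v.
Qed.

Lemma exp_rect (L : C) : L <> RtoC 0 -> rect (fun s => Cexp (- (L * (s - RtoC p)))) c T h1 h2 = RtoC 0.
Proof.
  intros HL. apply (rect_exact (fun s => - / L * Cexp (- (L * (s - RtoC p))))); [apply exp_rcont| | | |]; intros t.
  - eapply cderive_eq; [|apply cderive_scal, cderive_exp_path, cderive_h]. cbv beta. field. auto.
  - eapply cderive_eq; [|apply cderive_scal, cderive_exp_path, cderive_h]. cbv beta. field. auto.
  - eapply cderive_eq; [|apply cderive_scal, cderive_exp_path, cderive_v]. cbv beta. field. auto.
  - eapply cderive_eq; [|apply cderive_scal, cderive_exp_path, cderive_v]. cbv beta. field. auto.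
Qed.

Lemma one_rect : rect (fun _ => RtoC 1) c T h1 h2 = RtoC 0.
Proof.
  apply (rect_exact (fun s => s)).
  - repeat split; apply ccont_const.
  - intros; apply cderive_h.
  - intros; apply cderive_h.
  - intros; eapply cderive_eq; [|apply cderive_v]; ring.
  - intros; eapply cderive_eq; [|apply cderive_v]; ring.
Qed.

Lemma exp_rect' (L : C) : rect (fun s => Cexp (- (L * (s - RtoC p)))) c T h1 h2 = RtoC 0.
Proof.
  destruct (Ceq_dec L 0) as [->|H]; [|now apply exp_rect].
  transitivity (rect (fun _ => RtoC 1) c T h1 h2); [|apply one_rect]. apply rect_ext. intros s.
  replace (- (RtoC 0 * (s - RtoC p))) with (RtoC 0) by ring. apply Cexp_0.
Qed.

(** Deforms the integrand from 1/(s - p) at x = 0 to exp(-L (s - p))/(s - p) at x = 1.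
    Differentiation in x removes the pole and leaves an exponential, which has a primitive. *)
Definition K (L : C) (x : R) : C := rect (fun s => Cexp (- (RtoC x * L * (s - RtoC p))) / (s - RtoC p)) c T h1 h2.

Definition Rad : R := (Rabs (c - p) + Rabs (T - p) + Rabs h1 + Rabs h2)%R.

Lemma box_bound (a b : R) : (c <= a <= T)%R -> (h1 <= b <= h2)%R -> (Cmod ((a, b) - RtoC p) <= Rad)%R.
Proof.
  intros Ha Hb. eapply Rle_trans; [apply Cmod_le_add|]. unfold Rad. simpl.
  assert (Rabs (a + - p) <= Rabs (c - p) + Rabs (T - p))%R.
  { apply Rabs_le. split; [apply Rle_trans with (c - p)%R|apply Rle_trans with (T - p)%R]; try lra.
    - generalize (Rle_abs (- (c - p))) (Rabs_pos (T - p)). rewrite Rabs_Ropp. lra.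
    - generalize (Rle_abs (T - p)) (Rabs_pos (c - p)). lra. }
  assert (Rabs (b + - 0) <= Rabs h1 + Rabs h2)%R.
  { apply Rabs_le. split; [apply Rle_trans with h1|apply Rle_trans with h2]; try lra.
    - generalize (Rle_abs (- h1)) (Rabs_pos h2). rewrite Rabs_Ropp. lra.
    - generalize (Rle_abs h2) (Rabs_pos h1). lra. }
  lra.
Qed.

Lemma Rad_pos : (0 <= Rad)%R.
Proof. unfold Rad. generalize (Rabs_pos (c - p)) (Rabs_pos (T - p)) (Rabs_pos h1) (Rabs_pos h2). lra. Qed.

Definition KB (L : C) : R := (exp (Cmod L * Rad) * (4 * Cmod L * Cmod L * Rad * exp (Cmod L * Rad)) * (2 * (T - c) + 2 * (h2 - h1)))%R.

(** Adding the first-order term, an exponential whose rectangle integral is 0, leaves an integrand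
    with numerator exp(w) - 1 - w, where w is proportional to (y - x)(s - p); it is of second order
    in y - x, and one factor s - p cancels the pole. *)
Lemma K_diff (L : C) (x y : R) : (0 <= x <= 1)%R -> (0 <= y <= 1)%R ->
  (Cmod (K L y - K L x) <= KB L * ((y - x) * (y - x)))%R.
Proof.
  intros Hx Hy.
  set (r := fun s => (Cexp (- (RtoC y * L * (s - RtoC p))) / (s - RtoC p) - Cexp (- (RtoC x * L * (s - RtoC p))) / (s - RtoC p))
     + RtoC (y - x) * L * Cexp (- (RtoC x * L * (s - RtoC p)))).
  assert (CY := pole_rcont (RtoC y * L)). assert (CX := pole_rcont (RtoC x * L)). assert (CE := exp_rcont (RtoC x * L)).
  assert (Er : K L y - K L x = rect r c T h1 h2).
  { set (fy := fun s => Cexp (- (RtoC y * L * (s - RtoC p))) / (s - RtoC p)).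
    set (fx := fun s => Cexp (- (RtoC x * L * (s - RtoC p))) / (s - RtoC p)).
    set (fe := fun s => Cexp (- (RtoC x * L * (s - RtoC p)))).
    assert (E1 := rect_lin (- (1)) fx fy c T h1 h2 CX CY).
    assert (C1 : rcont (fun s => - (1) * fx s + fy s) c T h1 h2).
    { destruct CX as [[A1 [A2 A3]] A4], CY as [[B1 [B2 B3]] B4].
      repeat split; (apply ccont_plus; [apply ccont_mult; [apply ccont_const|]|]); assumption. }
    assert (E2 := rect_lin (RtoC (y - x) * L) fe (fun s => - (1) * fx s + fy s) c T h1 h2 CE C1).
    unfold fe in E2 at 2. rewrite exp_rect' in E2.
    transitivity (rect (fun s => RtoC (y - x) * L * fe s + (- (1) * fx s + fy s)) c T h1 h2).
    - rewrite E2, E1. unfold K. fold fy fx. ring.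
    - apply rect_ext. intros s. unfold r, fe. fold (fx s) (fy s). ring. }
  assert (HR := Rad_pos). assert (HL := Cmod_ge_0 L).
  assert (Hr : forall a b, (c <= a <= T)%R -> (h1 <= b <= h2)%R -> ((a, b) : C) - RtoC p <> RtoC 0 ->
    (Cmod (r (a, b)) <= exp (Cmod L * Rad) * (4 * Cmod L * Cmod L * Rad * exp (Cmod L * Rad)) * ((y - x) * (y - x)))%R).
  { intros a b Ha Hb Nz. unfold r. set (u := ((a, b) : C) - RtoC p) in *.
    assert (Hu : (Cmod u <= Rad)%R) by now apply box_bound.
    assert (Pu := Cmod_ge_0 u).
    set (w := - (RtoC (y - x) * L * u)).
    replace (Cexp (- (RtoC y * L * u)) / u - Cexp (- (RtoC x * L * u)) / u + RtoC (y - x) * L * Cexp (- (RtoC x * L * u)))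
      with (Cexp (- (RtoC x * L * u)) * (Cexp w - 1 - w) / u).
    2:{ replace (- (RtoC y * L * u)) with (- (RtoC x * L * u) + w) by (unfold w; rewrite RtoC_minus; ring).
        rewrite Cexp_plus. unfold w. field. auto. }
    assert (Ew : Cmod w = (Rabs (y - x) * (Cmod L * Cmod u))%R).
    { unfold w. rewrite Cmod_opp, !Cmod_mult, Cmod_R. ring. }
    assert (Hxy : (Rabs (y - x) <= 1)%R) by (apply Rabs_le; lra).
    assert (LR : (Cmod L * Cmod u <= Cmod L * Rad)%R) by (apply Rmult_le_compat_l; auto).
    assert (P1 : (0 <= Cmod L * Cmod u)%R) by (apply Rmult_le_pos; auto).
    assert (Hw : (Cmod w <= Cmod L * Rad)%R).
    { rewrite Ew. apply Rle_trans with (1 * (Cmod L * Cmod u))%R; [apply Rmult_le_compat_r; auto|lra]. }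
    rewrite Cmod_div, Cmod_mult by auto.
    assert (Pu' : (0 < Cmod u)%R) by now apply Cmod_gt_0.
    apply Rmult_le_reg_r with (Cmod u); auto. unfold Rdiv. rewrite Rmult_assoc, Rinv_l, Rmult_1_r by lra.
    apply Rle_trans with (exp (Cmod L * Rad) * (4 * Cmod w * Cmod w * exp (Cmod L * Rad)))%R.
    - apply Rmult_le_compat; try apply Cmod_ge_0.
      + eapply Rle_trans; [apply Cmod_exp_le|]. apply exp_le. rewrite Cmod_opp, !Cmod_mult, Cmod_R, Rabs_pos_eq by lra.
        rewrite Rmult_assoc. apply Rle_trans with (1 * (Cmod L * Cmod u))%R; [apply Rmult_le_compat_r; lra|lra].
      + eapply Rle_trans; [apply Cexp_sub2_bound|]. apply Rmult_le_compat_l; [|now apply exp_le].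
        assert (Z := Cmod_ge_0 w). nra.
    - rewrite Ew.
      assert (Sq : (Rabs (y - x) * Rabs (y - x) = (y - x) * (y - x))%R).
      { rewrite <- Rabs_mult. apply Rabs_pos_eq. exact (Rle_0_sqr (y - x)). }
      replace (4 * (Rabs (y - x) * (Cmod L * Cmod u)) * (Rabs (y - x) * (Cmod L * Cmod u)))%R
        with (4 * Cmod L * Cmod L * (Rabs (y - x) * Rabs (y - x)) * Cmod u * Cmod u)%R by ring.
      rewrite Sq.
      assert (Pe := exp_pos (Cmod L * Rad)). assert (P2 : (0 <= (y - x) * (y - x))%R) by exact (Rle_0_sqr (y - x)).
      replace (exp (Cmod L * Rad) * (4 * Cmod L * Cmod L * ((y - x) * (y - x)) * Cmod u * Cmod u * exp (Cmod L * Rad)))%R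
       with ((exp (Cmod L * Rad) * exp (Cmod L * Rad) * (4 * Cmod L * Cmod L * ((y - x) * (y - x)) * Cmod u)) * Cmod u)%R by ring.
      replace (exp (Cmod L * Rad) * (4 * Cmod L * Cmod L * Rad * exp (Cmod L * Rad)) * ((y - x) * (y - x)) * Cmod u)%R
       with ((exp (Cmod L * Rad) * exp (Cmod L * Rad) * (4 * Cmod L * Cmod L * ((y - x) * (y - x)) * Cmod u)) * Rad)%R by ring.
      apply Rmult_le_compat_l; auto.
      apply Rmult_le_pos; [apply Rmult_le_pos; lra|]. apply Rmult_le_pos; [|auto]. apply Rmult_le_pos; [|auto]. apply Rmult_le_pos; [|auto]. lra. }
  rewrite Er. unfold KB.
  replace (exp (Cmod L * Rad) * (4 * Cmod L * Cmod L * Rad * exp (Cmod L * Rad)) * (2 * (T - c) + 2 * (h2 - h1)) * ((y - x) * (y - x)))%R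
   with (exp (Cmod L * Rad) * (4 * Cmod L * Cmod L * Rad * exp (Cmod L * Rad)) * ((y - x) * (y - x)) * (2 * (T - c) + 2 * (h2 - h1)))%R by ring.
  apply rect_bound; try lra.
  - destruct CX as [[A1 [A2 A3]] A4], CY as [[B1 [B2 B3]] B4], CE as [[D1 [D2 D3]] D4].
    repeat split; (apply ccont_plus; [apply ccont_minus|apply ccont_mult; [apply ccont_const|]]); assumption.
  - intros t Ht. split; apply Hr; try lra; apply nz_h; lra.
  - intros t Ht. split; apply Hr; try lra; apply nz_v; lra.
Qed.

(** A function with increments of second order is constant: n + 1 equal steps contribute O(1/n) in
    total. *)
Lemma K_const (L : C) : K L 1 = K L 0.
Proof.
  assert (G : forall n, (Cmod (K L 1 - K L 0) <= KB L * tinv n)%R).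
  { intros n. assert (Pn : (0 < INR (S n))%R) by (apply lt_0_INR; lia).
    assert (H : forall k, (k <= S n)%nat -> (Cmod (K L (INR k / INR (S n)) - K L 0) <= INR k * (KB L * (tinv n * tinv n)))%R).
    { induction k as [|k IH]; intros Hk.
      - simpl (INR 0). unfold Rdiv. rewrite !Rmult_0_l. replace (K L 0 - K L 0) with (RtoC 0) by ring. rewrite Cmod_0. lra.
      - specialize (IH ltac:(lia)).
        assert (D : forall j, (j <= S n)%nat -> (0 <= INR j / INR (S n) <= 1)%R).
        { intros j Hj. apply le_INR in Hj. split.
          - apply Rdiv_le_0_compat; auto. apply pos_INR.
          - apply Rmult_le_reg_r with (INR (S n)); auto. unfold Rdiv. rewrite Rmult_assoc, Rinv_l; lra. }
        assert (X := K_diff L (INR k / INR (S n)) (INR (S k) / INR (S n)) (D k ltac:(lia)) (D (S k) Hk)).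
        replace (INR (S k) / INR (S n) - INR k / INR (S n))%R with (tinv n) in X.
        2:{ unfold tinv. rewrite (S_INR k). field. lra. }
        replace (K L (INR (S k) / INR (S n)) - K L 0)
          with ((K L (INR (S k) / INR (S n)) - K L (INR k / INR (S n))) + (K L (INR k / INR (S n)) - K L 0)) by ring.
        eapply Rle_trans; [apply Cmod_triangle|]. set (q := (KB L * (tinv n * tinv n))%R) in *.
        assert (Qk : (INR (S k) * q = INR k * q + q)%R) by (rewrite S_INR; ring). rewrite Qk. lra. }
    specialize (H (S n) (le_n _)). unfold Rdiv in H. rewrite Rinv_r in H by lra.
    eapply Rle_trans; [exact H|]. unfold tinv. right. field. lra. }
  assert (Z : ctends eventually (fun _ : nat => K L 1) (K L 0)).
  { apply (ctends_dom _ _ _ (fun n => KB L * tinv n)%R).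
    - exists 0%nat. intros n _. apply G.
    - assert (X := is_lim_seq_scal_l tinv (KB L) 0%R tinv_lim). simpl in X. rewrite Rmult_0_r in X. exact X. }
  apply (ctends_unique eventually (fun _ : nat => K L 1)); auto. apply ctends_const; ev.
Qed.

(** Each side has its own primitive of 1/(s - p) made of a real logarithm and an arctangent. The
    logarithms cancel at the corners, and the arctangents pair off by atan x + atan (1/x) = PI/2,
    once per corner, to the clockwise angle -2 PI. *)
Lemma K_zero (L : C) : K L 0 = RtoC (- (2 * PI)) * Ci.
Proof.
  assert (CX := pole_rcont (RtoC 0 * L)). destruct CX as [[A1 [A2 A3]] A4].
  unfold K, rect.
  assert (FH : forall h, h <> 0%R -> ccont (fun t => Cexp (- (RtoC 0 * L * ((t, h) - RtoC p))) / ((t, h) - RtoC p)) ->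
    cint (fun t => Cexp (- (RtoC 0 * L * ((t, h) - RtoC p))) / ((t, h) - RtoC p)) c T
     = ((/ 2 * ln ((T - p) * (T - p) + h * h), - atan ((T - p) / h))%R : C) - ((/ 2 * ln ((c - p) * (c - p) + h * h), - atan ((c - p) / h))%R : C)).
  { intros h Hh Hcont. apply (cint_FTC (fun t => (/ 2 * ln ((t - p) * (t - p) + h * h), - atan ((t - p) / h))%R : C)); auto.
    assert (Hq0 : forall t, (0 < (t - p) * (t - p) + h * h)%R).
    { intros t. assert (Hp := Rsqr_pos_lt h Hh). assert (Hs := Rle_0_sqr (t - p)). unfold Rsqr in *. lra. }
    assert (EQ : forall t : R, (((t - p) / ((t - p) * (t - p) + h * h), - h / ((t - p) * (t - p) + h * h))%R : C)
       = Cexp (- (RtoC 0 * L * ((t, h) - RtoC p))) / ((t, h) - RtoC p)).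
    { intros t. assert (Hq := Hq0 t). replace (- (RtoC 0 * L * ((t, h) - RtoC p))) with (RtoC 0) by ring. rewrite Cexp_0.
      unfold Cdiv, Cinv, Cmult, RtoC, Cminus, Cplus, Copp; simpl.
      apply injective_projections; simpl; field; nra. }
    intros t. apply (cderive_eq _ _ _ _ (EQ t)).
    apply is_derive_pair; simpl.
    - clear Hcont. assert (D : forall t : R, is_derive (fun t : R => / 2 * ln ((t - p) * (t - p) + h * h))%R t ((t - p) / ((t - p) * (t - p) + h * h))%R).
      { intros u. assert (Hu := Hq0 u). auto_derive; [exact Hu|field; lra]. }
      exact (D t).
    - clear Hcont. assert (D : forall t : R, is_derive (fun t : R => - atan ((t - p) / h))%R t (- h / ((t - p) * (t - p) + h * h))%R).
      { intros u. assert (Hu := Hq0 u). auto_derive; [auto|]. field. repeat split; auto; try lra;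
        intros Z; apply (Rlt_irrefl 0); rewrite <- Z at 2; lra. }
      exact (D t). }
  assert (FV : forall a, a <> p -> ccont (fun t => Cexp (- (RtoC 0 * L * ((a, t) - RtoC p))) / ((a, t) - RtoC p)) ->
    cint (fun t => Cexp (- (RtoC 0 * L * ((a, t) - RtoC p))) / ((a, t) - RtoC p) * Ci) h1 h2
     = ((/ 2 * ln ((a - p) * (a - p) + h2 * h2), atan (h2 / (a - p)))%R : C) - ((/ 2 * ln ((a - p) * (a - p) + h1 * h1), atan (h1 / (a - p)))%R : C)).
  { intros a Ha Hcont. apply (cint_FTC (fun t => (/ 2 * ln ((a - p) * (a - p) + t * t), atan (t / (a - p)))%R : C)).
    2:{ now apply ccont_mult; [|apply ccont_const]. }
    assert (Hq0 : forall t, (0 < (a - p) * (a - p) + t * t)%R).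
    { intros t. assert (Hp := Rsqr_pos_lt (a - p) (Rminus_eq_contra _ _ Ha)). assert (Hs := Rle_0_sqr t). unfold Rsqr in *. lra. }
    assert (EQ : forall t : R, ((t / ((a - p) * (a - p) + t * t), (a - p) / ((a - p) * (a - p) + t * t))%R : C)
       = Cexp (- (RtoC 0 * L * ((a, t) - RtoC p))) / ((a, t) - RtoC p) * Ci).
    { intros t. assert (Hq := Hq0 t). replace (- (RtoC 0 * L * ((a, t) - RtoC p))) with (RtoC 0) by ring. rewrite Cexp_0.
      unfold Cdiv, Cinv, Cmult, RtoC, Ci, Cminus, Cplus, Copp; simpl.
      apply injective_projections; simpl; field; nra. }
    intros t. apply (cderive_eq _ _ _ _ (EQ t)).
    apply is_derive_pair; simpl.
    - clear Hcont. assert (D : forall t : R, is_derive (fun t : R => / 2 * ln ((a - p) * (a - p) + t * t))%R t (t / ((a - p) * (a - p) + t * t))%R).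
      { intros u. assert (Hu := Hq0 u). auto_derive; [exact Hu|field; lra]. }
      exact (D t).
    - clear Hcont. assert (D : forall t : R, is_derive (fun t : R => atan (t / (a - p)))%R t ((a - p) / ((a - p) * (a - p) + t * t))%R).
      { intros u. assert (Hu := Hq0 u). auto_derive; [auto|]. field. repeat split; auto; try lra;
        intros Z; apply (Rlt_irrefl 0); rewrite <- Z at 2; lra. }
      exact (D t). }
  rewrite !FH, !FV by (auto; lra).
  assert (AT : forall x, (0 < x)%R -> (atan x + atan (/ x) = PI / 2)%R).
  { intros x Hx. rewrite atan_inv by auto. ring. }
  assert (I1 := AT ((T - p) / h2)%R ltac:(apply Rdiv_lt_0_compat; lra)).
  assert (I2 := AT ((p - c) / h2)%R ltac:(apply Rdiv_lt_0_compat; lra)).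
  assert (I3 := AT ((T - p) / (- h1))%R ltac:(apply Rdiv_lt_0_compat; lra)).
  assert (I4 := AT ((p - c) / (- h1))%R ltac:(apply Rdiv_lt_0_compat; lra)).
  replace (/ ((T - p) / h2))%R with (h2 / (T - p))%R in I1 by (field; lra).
  replace (/ ((p - c) / h2))%R with (- (h2 / (c - p)))%R in I2 by (field; lra).
  replace ((p - c) / h2)%R with (- ((c - p) / h2))%R in I2 by (field; lra).
  replace (/ ((T - p) / - h1))%R with (- (h1 / (T - p)))%R in I3 by (field; lra).
  replace ((T - p) / - h1)%R with (- ((T - p) / h1))%R in I3 by (field; lra).
  replace (/ ((p - c) / - h1))%R with (h1 / (c - p))%R in I4 by (field; lra).
  replace ((p - c) / - h1)%R with ((c - p) / h1)%R in I4 by (field; lra).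
  rewrite !atan_opp in *.
  unfold RtoC, Ci, Cmult, Cminus, Cplus, Copp; simpl. apply injective_projections; simpl; lra.
Qed.

Lemma pole_rect (L : C) : rect (fun s => Cexp (- (L * (s - RtoC p))) / (s - RtoC p)) c T h1 h2 = RtoC (- (2 * PI)) * Ci.
Proof.
  rewrite <- (K_zero L), <- K_const. unfold K. apply rect_ext. intros s. now rewrite Cmult_1_l.
Qed.

End Pole.

(** * Partial fractions *)

Lemma loopval_exact (G g : C -> C) c h1 h2 : lines_cont g c h1 h2 ->
  (forall t, cderive (fun t => G (t, h1)) t (g (t, h1))) ->
  (forall t, cderive (fun t => G (t, h2)) t (g (t, h2))) ->
  (forall t, cderive (fun t => G (c, t)) t (g (c, t) * Ci)) ->
  ctends pinf (fun t => G (t, h1)) (RtoC 0) -> ctends pinf (fun t => G (t, h2)) (RtoC 0) ->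
  loopval g c h1 h2 0.
Proof.
  intros [A1 [A2 A3]] H1 H2 H3 L1 L2.
  assert (FF : Filter pinf) by apply Rbar_locally_filter.
  exists (0 - G (c, h1)), (0 - G (c, h2)). split; [|split].
  - unfold hint. apply ctends_ext with (fun T => G (T, h1) - G (c, h1)); auto.
    + intros T. symmetry. now apply (cint_FTC (fun t => G (t, h1)) (fun t => g (t, h1))).
    + apply ctends_minus; auto. apply ctends_const; auto.
  - unfold hint. apply ctends_ext with (fun T => G (T, h2) - G (c, h2)); auto.
    + intros T. symmetry. now apply (cint_FTC (fun t => G (t, h2)) (fun t => g (t, h2))).
    + apply ctends_minus; auto. apply ctends_const; auto.
  - rewrite (cint_FTC (fun t => G (c, t)) (fun t => g (c, t) * Ci)) by (auto; now apply ccont_side). ring.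
Qed.

Section PoleLoop.
Variables (p c h1 h2 : R) (L : C).
Hypothesis (Hc : (c < p)%R) (Hh1 : (h1 < 0)%R) (Hh2 : (0 < h2)%R) (HL : (1 <= Re L)%R).

(** Constant for bounds by exp(-t) on horizontal lines: one unit of Re L gives exp(p - t), the
    remaining Re L - 1 is worst at t = c, the imaginary part of L meets a bounded height, and d is a
    lower bound for the distance to the pole. *)
Definition PM (d : R) : R := (exp (p - (Re L - 1) * (c - p) + Rabs (Im L) * (Rabs h1 + Rabs h2)) / d)%R.

Lemma exp_line_bound (t h : R) : (c <= t)%R -> (Rabs h <= Rabs h1 + Rabs h2)%R ->
  (Cmod (Cexp (- (L * ((t, h) - RtoC p)))) <= PM 1 * exp (- t))%R.
Proof.
  intros Ht Hh. rewrite Cmod_Cexp. unfold PM, Rdiv. rewrite Rinv_1, Rmult_1_r, <- exp_plus. apply exp_le.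
  destruct L as [a b]. simpl in *.
  assert (b * h <= Rabs b * (Rabs h1 + Rabs h2))%R.
  { apply Rle_trans with (Rabs (b * h))%R; [apply Rle_abs|]. rewrite Rabs_mult.
    apply Rmult_le_compat_l; auto. apply Rabs_pos. }
  assert (0 <= (a - 1) * (t - c))%R by (apply Rmult_le_pos; lra).
  nra.
Qed.

Lemma PM_pos d : (0 < d)%R -> (0 < PM d)%R.
Proof. intros H. unfold PM. apply Rdiv_lt_0_compat; auto. apply exp_pos. Qed.

Lemma pole_line_bound (t h d : R) : (c <= t)%R -> (Rabs h <= Rabs h1 + Rabs h2)%R ->
  (0 < d)%R -> (d <= Cmod ((t, h) - RtoC p))%R ->
  (Cmod (Cexp (- (L * ((t, h) - RtoC p))) / ((t, h) - RtoC p)) <= PM d * exp (- t))%R.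
Proof.
  intros Ht Hh Hd Hn.
  assert (Nz : ((t, h) : C) - RtoC p <> RtoC 0) by (apply Cmod_gt_0; lra).
  rewrite Cmod_div by auto.
  apply Rmult_le_reg_r with (Cmod ((t, h) - RtoC p)); [lra|].
  unfold Rdiv. rewrite Rmult_assoc, Rinv_l, Rmult_1_r by lra.
  eapply Rle_trans; [apply (exp_line_bound t h Ht Hh)|].
  assert (P1 := PM_pos 1 Rlt_0_1). assert (Pe := exp_pos (- t)).
  replace (PM 1 * exp (- t))%R with (PM d * exp (- t) * d)%R by (unfold PM; field; lra).
  apply Rmult_le_compat_l; auto. left. apply Rmult_lt_0_compat; auto. now apply PM_pos.
Qed.

(** The rectangle integral does not depend on its right side T, while the far side and the two
    omitted tails are O(exp(-T)). *)
Lemma pole_loop : loopval (fun s => Cexp (- (L * (s - RtoC p))) / (s - RtoC p)) c h1 h2 (RtoC (- (2 * PI)) * Ci).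
Proof.
  set (f := fun s => Cexp (- (L * (s - RtoC p))) / (s - RtoC p)).
  destruct (pole_rcont p c (p + 1) h1 h2 Hc ltac:(lra) Hh1 Hh2 L) as [[A1 [A2 A3]] _].
  fold f in A1, A2, A3.
  assert (D1 : (0 < Rabs h1)%R) by (apply Rabs_pos_lt; lra).
  assert (D2 : (0 < Rabs h2)%R) by (apply Rabs_pos_lt; lra).
  assert (M1 : forall t, (c <= t)%R -> (Cmod (f (t, h1)) <= PM (Rabs h1) * exp (- t))%R).
  { intros t Ht. refine (pole_line_bound t h1 (Rabs h1) Ht _ D1 _); [lra|].
    eapply Rle_trans; [|apply Im_le_Cmod]. simpl. right. f_equal. ring. }
  assert (M2 : forall t, (c <= t)%R -> (Cmod (f (t, h2)) <= PM (Rabs h2) * exp (- t))%R).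
  { intros t Ht. refine (pole_line_bound t h2 (Rabs h2) Ht _ D2 _); [lra|].
    eapply Rle_trans; [|apply Im_le_Cmod]. simpl. right. f_equal. ring. }
  destruct (hint_exists _ c _ A1 M1) as [l1 H1]. destruct (hint_exists _ c _ A2 M2) as [l2 H2].
  exists l1, l2. split; [exact H1|split; [exact H2|]].
  set (v := - l1 + cint (fun t => f (c, t) * Ci) h1 h2 + l2).
  set (M := (PM (Rabs h1) + PM (Rabs h2) + PM 1 * (h2 - h1))%R).
  assert (G : forall T, (p + 1 <= T)%R -> (Cmod (v - RtoC (- (2 * PI)) * Ci) <= M * exp (- T))%R).
  { intros T HT. rewrite <- (pole_rect p c T h1 h2 Hc ltac:(lra) Hh1 Hh2 L). fold f.
    destruct (pole_rcont p c T h1 h2 Hc ltac:(lra) Hh1 Hh2 L) as [_ A4]. fold f in A4.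
    assert (B1 : (Cmod (l1 - cint (fun t => f (t, h1)) c T) <= PM (Rabs h1) * exp (- T))%R) by (apply (hint_tail _ c _ l1 A1 M1 H1); lra).
    assert (B2 : (Cmod (l2 - cint (fun t => f (t, h2)) c T) <= PM (Rabs h2) * exp (- T))%R) by (apply (hint_tail _ c _ l2 A2 M2 H2); lra).
    assert (B3 : (Cmod (cint (fun t => (f (T, t) * Ci)%C) h1 h2) <= PM 1 * exp (- T) * (h2 - h1))%R).
    { apply cint_bound; [lra|now apply ccont_side|].
      intros y Hy. rewrite Cmod_mult, Cmod_Ci, Rmult_1_r. refine (pole_line_bound T y 1 _ _ _ _); try lra.
      - apply Rabs_le. split; [apply Rle_trans with h1|apply Rle_trans with h2]; try lra.
        + generalize (Rle_abs (- h1)). rewrite Rabs_Ropp. lra.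
        + generalize (Rle_abs h2). lra.
      - eapply Rle_trans; [|apply re_le_Cmod]. simpl. rewrite Rabs_pos_eq; lra. }
    unfold v, rect.
    replace (- l1 + cint (fun t => f (c, t) * Ci) h1 h2 + l2 -
      (- cint (fun t => f (t, h1)) c T + cint (fun t => f (c, t) * Ci) h1 h2 +
       cint (fun t => f (t, h2)) c T - cint (fun t => f (T, t) * Ci) h1 h2))
     with (- (l1 - cint (fun t => f (t, h1)) c T) + (l2 - cint (fun t => f (t, h2)) c T) + cint (fun t => f (T, t) * Ci) h1 h2) by ring.
    eapply Rle_trans; [apply Cmod_triangle|].
    eapply Rle_trans; [apply Rplus_le_compat_r, Cmod_triangle|]. rewrite Cmod_opp. unfold M. lra. }
  symmetry. apply (ctends_unique pinf (fun _ : R => v)).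
  - apply ctends_const, Rbar_locally_filter.
  - intros eps He. destruct (exp_neg_small M eps He) as [T0 HT0].
    exists (Rmax T0 (p + 1)). intros T HT.
    assert (X1 := Rmax_l T0 (p + 1)). assert (X2 := Rmax_r T0 (p + 1)).
    specialize (G T ltac:(lra)). specialize (HT0 T ltac:(lra)). lra.
Qed.

Lemma pole_lines_cont : lines_cont (fun s => Cexp (- (L * (s - RtoC p))) / (s - RtoC p)) c h1 h2.
Proof. apply (pole_rcont p c (p + 1) h1 h2 Hc ltac:(lra) Hh1 Hh2 L). Qed.

End PoleLoop.

Lemma ccont_line_const_mult (a : C) f c h1 h2 : lines_cont f c h1 h2 -> lines_cont (fun s => a * f s) c h1 h2.
Proof.
  intros [A1 [A2 A3]]. repeat split; (apply ccont_mult; [apply ccont_const|assumption]).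
Qed.

Lemma lines_cont_plus f g c h1 h2 : lines_cont f c h1 h2 -> lines_cont g c h1 h2 -> lines_cont (fun s => f s + g s) c h1 h2.
Proof. intros [A1 [A2 A3]] [B1 [B2 B3]]. repeat split; apply ccont_plus; assumption. Qed.

Lemma lines_cont_lin a f g c h1 h2 : lines_cont f c h1 h2 -> lines_cont g c h1 h2 -> lines_cont (fun s => a * f s + g s) c h1 h2.
Proof. intros A B. apply lines_cont_plus; auto. now apply ccont_line_const_mult. Qed.

Lemma loopval_zero c h1 h2 : loopval (fun _ => RtoC 0) c h1 h2 0 /\ lines_cont (fun _ => RtoC 0) c h1 h2.
Proof.
  split.
  - exists 0, 0. assert (H : hint (fun _ => RtoC 0) c 0).
    { unfold hint. apply ctends_ext with (fun _ => RtoC 0); [apply Rbar_locally_filter| |apply ctends_const, Rbar_locally_filter].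
      intros T. now rewrite cint_zero. }
    repeat split; auto. rewrite (cint_ext _ (fun _ => RtoC 0)) by (intros; ring). rewrite cint_zero. ring.
  - repeat split; apply ccont_const.
Qed.

Lemma loopval_scal a f c h1 h2 v : lines_cont f c h1 h2 -> loopval f c h1 h2 v -> loopval (fun s => a * f s) c h1 h2 (a * v).
Proof.
  intros A H. destruct (loopval_zero c h1 h2) as [Z1 Z2].
  assert (X := loopval_lin a f _ c h1 h2 v 0 A Z2 H Z1). rewrite Cplus_0_r in X.
  eapply loopval_ext; [| | |exact X]; intros; cbv beta; ring.
Qed.

Lemma exp_loop (L : C) (p c h1 h2 : R) : (c < p)%R -> (h1 < 0)%R -> (0 < h2)%R -> (1 <= Re L)%R ->
  lines_cont (fun s => Cexp (- (L * s)) / (s - RtoC p)) c h1 h2 /\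
  loopval (fun s => Cexp (- (L * s)) / (s - RtoC p)) c h1 h2 (RtoC (- (2 * PI)) * Ci * Cexp (- (L * RtoC p))).
Proof.
  intros Hc Hh1 Hh2 HL.
  assert (E : forall s, Cexp (- (L * RtoC p)) * (Cexp (- (L * (s - RtoC p))) / (s - RtoC p)) = Cexp (- (L * s)) / (s - RtoC p)).
  { intros s. unfold Cdiv. rewrite Cmult_assoc, <- Cexp_plus. do 2 f_equal. ring. }
  assert (A := pole_lines_cont p c h1 h2 L Hc Hh1 Hh2).
  split.
  - apply (lines_cont_ext (fun s => Cexp (- (L * RtoC p)) * (Cexp (- (L * (s - RtoC p))) / (s - RtoC p)))); auto.
    now apply ccont_line_const_mult.
  - rewrite Cmult_comm.
    apply (loopval_ext (fun s => Cexp (- (L * RtoC p)) * (Cexp (- (L * (s - RtoC p))) / (s - RtoC p)))); auto.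
    apply loopval_scal; auto. now apply pole_loop.
Qed.

(** The derivative of -exp(-L s)/s is L exp(-L s)/s + exp(-L s)/s^2, and its loop integral is 0;
    this reduces the double pole to the simple one. *)
Lemma exp_loop_double (L : C) (c h1 h2 : R) : (c < 0)%R -> (h1 < 0)%R -> (0 < h2)%R -> (1 <= Re L)%R ->
  lines_cont (fun s => Cexp (- (L * s)) / (s * s)) c h1 h2 /\
  loopval (fun s => Cexp (- (L * s)) / (s * s)) c h1 h2 (- L * (RtoC (- (2 * PI)) * Ci)).
Proof.
  intros Hc Hh1 Hh2 HL.
  assert (Nh1 : forall t, ((t, h1) : C) <> RtoC 0) by (intros t E; apply (f_equal Im) in E; simpl in E; lra).
  assert (Nh2 : forall t, ((t, h2) : C) <> RtoC 0) by (intros t E; apply (f_equal Im) in E; simpl in E; lra).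
  assert (Nc : forall t, ((c, t) : C) <> RtoC 0) by (intros t E; apply (f_equal Re) in E; simpl in E; lra).
  destruct (exp_loop L 0 c h1 h2 Hc Hh1 Hh2 HL) as [A B].
  assert (E0 : forall s, Cexp (- (L * s)) / (s - RtoC 0) = Cexp (- (L * s)) / s).
  { intros s. do 2 f_equal. ring. }
  apply (lines_cont_ext _ (fun s => Cexp (- (L * s)) / s)) in A; auto.
  apply (loopval_ext _ (fun s => Cexp (- (L * s)) / s)) in B; auto.
  rewrite Cmult_0_r in B. replace (- RtoC 0) with (RtoC 0) in B by ring. rewrite Cexp_0, Cmult_1_r in B.
  assert (DE : forall (g : R -> C) (t : R) (d : C), cderive g t d -> g t <> RtoC 0 ->
     cderive (fun t => - (Cexp (- (L * g t)) / g t)) t (d * (L * (Cexp (- (L * g t)) / g t) + Cexp (- (L * g t)) / (g t * g t)))).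
  { intros g t d Hg Ng.
    assert (X1 := cderive_exp_path g t d L 0 Hg). assert (X2 := cderive_inv g t d Ng Hg).
    assert (X := cderive_scal (- (1)) _ _ _ (cderive_mult _ _ _ _ _ X1 X2)).
    eapply cderive_ext; [|eapply cderive_eq; [|exact X]].
    - intros s. cbv beta. unfold Cdiv. replace (- (L * (g s - 0))) with (- (L * g s)) by ring. ring.
    - cbv beta. replace (- (L * (g t - 0))) with (- (L * g t)) by ring. field. auto. }
  assert (C2 : lines_cont (fun s => Cexp (- (L * s)) / (s * s)) c h1 h2).
  { destruct A as [A1 [A2 A3]]. repeat split.
    - apply (ccont_ext (fun t => Cexp (- (L * (t, h1))) / (t, h1) / (t, h1))).
      { intros t. specialize (Nh1 t). field. auto. }
      apply ccont_div; auto. apply ccont_path_h.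
    - apply (ccont_ext (fun t => Cexp (- (L * (t, h2))) / (t, h2) / (t, h2))).
      { intros t. specialize (Nh2 t). field. auto. }
      apply ccont_div; auto. apply ccont_path_h.
    - apply (ccont_ext (fun t => Cexp (- (L * (c, t))) / (c, t) / (c, t))).
      { intros t. specialize (Nc t). field. auto. }
      apply ccont_div; auto. apply ccont_path_v. }
  split; auto.
  assert (Lim : forall h, h <> 0%R -> ctends pinf (fun t => - (Cexp (- (L * (t, h))) / (t, h))) (RtoC 0)).
  { intros h Hh eps He.
    destruct (exp_neg_small (PM 0 c h h L (Rabs h)) eps He) as [T0 HT0].
    exists (Rmax T0 c). intros T HT. assert (X1 := Rmax_l T0 c). assert (X2 := Rmax_r T0 c).
    replace (- (Cexp (- (L * (T, h))) / (T, h)) - 0) with (- (Cexp (- (L * (T, h))) / (T, h))) by ring.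
    rewrite Cmod_opp. specialize (HT0 T ltac:(lra)). eapply Rle_lt_trans; [|exact HT0].
    rewrite <- E0.
    replace (- (L * (T, h))) with (- (L * ((T, h) - RtoC 0))) by ring.
    apply pole_line_bound; try lra.
    - generalize (Rabs_pos h). lra.
    - now apply Rabs_pos_lt.
    - eapply Rle_trans; [|apply Im_le_Cmod]. simpl. right. f_equal. ring. }
  assert (LH : forall h t : R, ((t, h) : C) <> RtoC 0 -> cderive (fun t => - (Cexp (- (L * (t, h))) / (t, h))) t
     (L * (Cexp (- (L * (t, h))) / (t, h)) + Cexp (- (L * (t, h))) / ((t, h) * (t, h)))).
  { intros h t N. assert (D := DE (fun t => (t, h) : C) t 1 (cderive_h h t) N). cbv beta in D. rewrite Cmult_1_l in D. exact D. }
  assert (LV : forall t : R, cderive (fun t => - (Cexp (- (L * (c, t))) / (c, t))) t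
     ((L * (Cexp (- (L * (c, t))) / (c, t)) + Cexp (- (L * (c, t))) / ((c, t) * (c, t))) * Ci)).
  { intros t. assert (D := DE (fun t => (c, t) : C) t Ci (cderive_v c t) (Nc t)). cbv beta in D. rewrite Cmult_comm in D. exact D. }
  assert (X : loopval (fun s => L * (Cexp (- (L * s)) / s) + Cexp (- (L * s)) / (s * s)) c h1 h2 0).
  { apply (loopval_exact (fun s => - (Cexp (- (L * s)) / s))).
    - now apply lines_cont_lin.
    - intros t. exact (LH h1 t (Nh1 t)).
    - intros t. exact (LH h2 t (Nh2 t)).
    - intros t. exact (LV t).
    - apply Lim. lra.
    - apply Lim. lra. }
  assert (Y := loopval_lin (- L) _ _ c h1 h2 _ _ A (lines_cont_lin L _ _ _ _ _ A C2) B X).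
  rewrite Cplus_0_r in Y. eapply loopval_ext; [| | |exact Y]; intros; cbv beta; ring.
Qed.

(** * Finite products and partial fractions *)

Definition lprod {A} (f : A -> C) (l : list A) : C := fold_right (fun k acc => f k * acc) (RtoC 1) l.
Definition lsum {A} (f : A -> C) (l : list A) : C := fold_right (fun k acc => f k + acc) (RtoC 0) l.

Lemma lprod_cons {A} (f : A -> C) x l : lprod f (x :: l) = f x * lprod f l.
Proof. reflexivity. Qed.

Lemma lsum_cons {A} (f : A -> C) x l : lsum f (x :: l) = f x + lsum f l.
Proof. reflexivity. Qed.

Lemma lprod_app {A} (f : A -> C) l l' : lprod f (l ++ l') = lprod f l * lprod f l'.
Proof. induction l as [|x l IH]; simpl; [ring|]. rewrite IH. ring. Qed.

Lemma lsum_app {A} (f : A -> C) l l' : lsum f (l ++ l') = lsum f l + lsum f l'.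
Proof. induction l as [|x l IH]; simpl; [ring|]. rewrite IH. ring. Qed.

Lemma lprod_map {A B} (f : B -> C) (g : A -> B) l : lprod f (map g l) = lprod (fun x => f (g x)) l.
Proof. induction l as [|x l IH]; simpl; auto. now rewrite IH. Qed.

Lemma lsum_map {A B} (f : B -> C) (g : A -> B) l : lsum f (map g l) = lsum (fun x => f (g x)) l.
Proof. induction l as [|x l IH]; simpl; auto. now rewrite IH. Qed.

Lemma lprod_ext {A} (f g : A -> C) l : (forall x, In x l -> f x = g x) -> lprod f l = lprod g l.
Proof.
  induction l as [|x l IH]; intros H; simpl; auto. rewrite IH, H; auto.
  - now left. - intros y Hy. apply H. now right.
Qed.

Lemma lsum_ext {A} (f g : A -> C) l : (forall x, In x l -> f x = g x) -> lsum f l = lsum g l.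
Proof.
  induction l as [|x l IH]; intros H; simpl; auto. rewrite IH, H; auto.
  - now left. - intros y Hy. apply H. now right.
Qed.

Lemma lsum_scal {A} c (f : A -> C) l : lsum (fun x => c * f x) l = c * lsum f l.
Proof. induction l as [|x l IH]; simpl; [ring|]. rewrite IH. ring. Qed.

Lemma lsum_plus {A} (f g : A -> C) l : lsum (fun x => f x + g x) l = lsum f l + lsum g l.
Proof. induction l as [|x l IH]; simpl; [ring|]. rewrite IH. ring. Qed.

Lemma lprod_nz {A} (f : A -> C) l : (forall x, In x l -> f x <> RtoC 0) -> lprod f l <> RtoC 0.
Proof.
  induction l as [|x l IH]; intros H; simpl. { apply C1_nz. }
  apply Cmult_neq_0; [apply H; now left|]. apply IH. intros y Hy. apply H. now right.
Qed.

(* A zero and a pole of a rational function. *)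
Notation zp := (C * R)%type.
Definition zp_factor (s : C) (q : zp) : C := (s - fst q) / (s - RtoC (snd q)).
(** Factor contributed to the residue at p: the entry whose own pole is p keeps only its
    numerator. *)
Definition zp_res (p : R) (q : zp) : C :=
  if Req_EM_T (snd q) p then RtoC p - fst q else (RtoC p - fst q) / (RtoC p - RtoC (snd q)).

(** For f(s) = (s - a0)/s^2 times the product of the factors, [pf_beta] is the value of s^2 f(s) at
    0 and [pf_ratio] its logarithmic derivative there; their product is the coefficient of 1/s. *)
Definition pf_beta (a0 : C) (l : list zp) : C := - a0 * lprod (fun q => fst q / RtoC (snd q)) l.
Definition pf_ratio (a0 : C) (l : list zp) : C :=
  - / a0 + lsum (fun q => / RtoC (snd q) - / fst q) l.

(** Induction on the factors: the new one, (s - a)/(s - p), is multiplied into the expansion at s,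
    and the coefficient at the new pole p is found from the induction hypothesis evaluated at s =
    p. *)
Lemma partial_fraction (a0 : C) (l : list zp) (s : C) :
  a0 <> RtoC 0 -> (forall q, In q l -> fst q <> RtoC 0 /\ snd q <> 0%R) -> NoDup (map snd l) ->
  s <> RtoC 0 -> (forall q, In q l -> s <> RtoC (snd q)) ->
  (s - a0) / (s * s) * lprod (zp_factor s) l
  = pf_beta a0 l * pf_ratio a0 l / s + pf_beta a0 l / (s * s)
    + lsum (fun q => (RtoC (snd q) - a0) / (RtoC (snd q) * RtoC (snd q)) * lprod (zp_res (snd q)) l / (s - RtoC (snd q))) l.
Proof.
  intros Ha0. revert s. induction l as [|[a p] l IH]; intros s Hl Hnd Hs Hsp.
  - unfold pf_beta, pf_ratio. simpl. field. auto.
  - assert (Ha : a <> RtoC 0) by (apply (Hl (a, p)); now left).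
    assert (Hp : p <> 0%R) by (apply (Hl (a, p)); now left).
    assert (Hp' : RtoC p <> RtoC 0) by now apply RtoC_nz.
    assert (Hsp' : s - RtoC p <> RtoC 0).
    { intros E. apply (Hsp (a, p)); [now left|]. simpl. replace s with (s - RtoC p + RtoC p) by ring. rewrite E. ring. }
    inversion Hnd as [|x l' Hnin Hnd' Ex]. subst x l'. simpl in Hnin.
    assert (Hl' : forall q, In q l -> fst q <> RtoC 0 /\ snd q <> 0%R) by (intros q Hq; apply Hl; now right).
    assert (Hpq : forall q, In q l -> p <> snd q).
    { intros q Hq E. apply Hnin. rewrite E. now apply in_map. }
    assert (IHs := IH s Hl' Hnd' Hs (fun q Hq => Hsp q (or_intror Hq))).
    assert (IHp := IH (RtoC p) Hl' Hnd' Hp' (fun q Hq E => Hpq q Hq (RtoC_inj _ _ E))).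
    assert (R1 : lprod (zp_res p) l = lprod (zp_factor (RtoC p)) l).
    { apply lprod_ext. intros q Hq. unfold zp_res, zp_factor.
      destruct (Req_EM_T (snd q) p) as [E|E]; auto. exfalso. apply (Hpq q Hq). auto. }
    rewrite lsum_cons, !lprod_cons. cbn [fst snd].
    replace (zp_res p (a, p)) with (RtoC p - a).
    2:{ unfold zp_res; simpl. destruct (Req_EM_T p p); auto. contradiction. }
    replace (zp_factor s (a, p)) with ((s - a) / (s - RtoC p)) by reflexivity.
    replace ((s - a0) / (s * s) * ((s - a) / (s - RtoC p) * lprod (zp_factor s) l))
      with ((s - a) / (s - RtoC p) * ((s - a0) / (s * s) * lprod (zp_factor s) l)) by (field; auto).
    rewrite IHs.
    rewrite (lsum_ext (fun q : zp => (RtoC (snd q) - a0) / (RtoC (snd q) * RtoC (snd q)) * lprod (zp_res (snd q)) ((a, p) :: l) / (s - RtoC (snd q)))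
       (fun q => (s - a) / (s - RtoC p) * ((RtoC (snd q) - a0) / (RtoC (snd q) * RtoC (snd q)) * lprod (zp_res (snd q)) l / (s - RtoC (snd q)))
          + - ((RtoC p - a) / (s - RtoC p)) * ((RtoC (snd q) - a0) / (RtoC (snd q) * RtoC (snd q)) * lprod (zp_res (snd q)) l / (RtoC p - RtoC (snd q))))).
    2:{ intros q Hq. rewrite lprod_cons. unfold zp_res at 1. cbn [fst snd].
        destruct (Req_EM_T p (snd q)) as [E|E]; [exfalso; now apply (Hpq q Hq)|].
        assert (N1 : RtoC (snd q) <> RtoC 0) by (apply RtoC_nz; now apply Hl').
        assert (N2 : s - RtoC (snd q) <> RtoC 0).
        { intros Z. apply (Hsp q); [now right|]. replace s with (s - RtoC (snd q) + RtoC (snd q)) by ring. rewrite Z. ring. }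
        assert (N3 : RtoC p - RtoC (snd q) <> RtoC 0) by (rewrite <- RtoC_minus; apply RtoC_nz; lra).
        assert (N4 : RtoC (snd q) - RtoC p <> RtoC 0) by (rewrite <- RtoC_minus; apply RtoC_nz; lra).
        field. repeat split; auto. }
    rewrite lsum_plus, !lsum_scal.
    set (S1 := lsum (fun q : zp => (RtoC (snd q) - a0) / (RtoC (snd q) * RtoC (snd q)) * lprod (zp_res (snd q)) l / (s - RtoC (snd q))) l) in *.
    set (S2 := lsum (fun q : zp => (RtoC (snd q) - a0) / (RtoC (snd q) * RtoC (snd q)) * lprod (zp_res (snd q)) l / (RtoC p - RtoC (snd q))) l) in *.
    replace S2 with ((RtoC p - a0) / (RtoC p * RtoC p) * lprod (zp_factor (RtoC p)) l - (pf_beta a0 l * pf_ratio a0 l / RtoC p + pf_beta a0 l / (RtoC p * RtoC p))).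
    2:{ rewrite IHp. assert (Qx : forall X Y : C, X + Y - X = Y) by (intros; ring). apply Qx. }
    rewrite R1.
    replace (pf_beta a0 ((a, p) :: l)) with (pf_beta a0 l * (a / RtoC p)).
    2:{ unfold pf_beta. simpl. ring. }
    replace (pf_ratio a0 ((a, p) :: l)) with (pf_ratio a0 l + (/ RtoC p - / a)).
    2:{ unfold pf_ratio. simpl. ring. }
    field. auto.
Qed.

(** At the double pole the exponential contributes its own logarithmic derivative -L next to
    [pf_ratio]; the constant -2 PI i reflects the clockwise orientation. *)
Lemma partial_fraction_loop (a0 L : C) (l : list zp) (c h1 h2 : R) :
  a0 <> RtoC 0 -> (forall q, In q l -> fst q <> RtoC 0 /\ (0 < snd q)%R) -> NoDup (map snd l) ->
  (c < 0)%R -> (h1 < 0)%R -> (0 < h2)%R -> (1 <= Re L)%R ->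
  lines_cont (fun s => Cexp (- (L * s)) * ((s - a0) / (s * s) * lprod (zp_factor s) l)) c h1 h2 /\
  loopval (fun s => Cexp (- (L * s)) * ((s - a0) / (s * s) * lprod (zp_factor s) l)) c h1 h2
   (RtoC (- (2 * PI)) * Ci * (pf_beta a0 l * (pf_ratio a0 l - L)
     + lsum (fun q => (RtoC (snd q) - a0) / (RtoC (snd q) * RtoC (snd q)) * lprod (zp_res (snd q)) l * Cexp (- (L * RtoC (snd q)))) l)).
Proof.
  intros Ha0 Hl Hnd Hc Hh1 Hh2 HL.
  set (w := fun q : zp => (RtoC (snd q) - a0) / (RtoC (snd q) * RtoC (snd q)) * lprod (zp_res (snd q)) l).
  set (E := fun s => Cexp (- (L * s))).
  set (g := fun l0 s => lsum (fun q : zp => w q * (E s / (s - RtoC (snd q)))) l0).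
  assert (Hg : forall l0, (forall q, In q l0 -> (0 < snd q)%R) ->
    lines_cont (g l0) c h1 h2 /\ loopval (g l0) c h1 h2 (lsum (fun q => w q * (RtoC (- (2 * PI)) * Ci * Cexp (- (L * RtoC (snd q))))) l0)).
  { induction l0 as [|q l0 IH]; intros H0.
    - unfold g. simpl. destruct (loopval_zero c h1 h2). auto.
    - destruct (IH (fun q Hq => H0 q (or_intror Hq))) as [I1 I2].
      assert (Hq : (0 < snd q)%R) by (apply H0; now left).
      destruct (exp_loop L (snd q) c h1 h2 ltac:(lra) Hh1 Hh2 HL) as [J1 J2].
      split.
      + apply (lines_cont_lin (w q)); auto.
      + apply (loopval_lin (w q)); auto. }
  destruct (Hg l (fun q Hq => proj2 (Hl q Hq))) as [G1 G2]. clear Hg.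
  destruct (exp_loop L 0 c h1 h2 Hc Hh1 Hh2 HL) as [A1 A2].
  rewrite Cmult_0_r in A2. replace (- RtoC 0) with (RtoC 0) in A2 by ring. rewrite Cexp_0, Cmult_1_r in A2.
  destruct (exp_loop_double L c h1 h2 Hc Hh1 Hh2 HL) as [B1 B2].
  set (f := fun s => pf_beta a0 l * pf_ratio a0 l * (E s / (s - RtoC 0)) + (pf_beta a0 l * (E s / (s * s)) + g l s)).
  assert (Ef : forall s, s <> RtoC 0 -> (forall q, In q l -> s <> RtoC (snd q)) ->
    f s = E s * ((s - a0) / (s * s) * lprod (zp_factor s) l)).
  { intros s Hs Hsp. rewrite partial_fraction; auto.
    2:{ intros q Hq. destruct (Hl q Hq). split; auto. lra. }
    unfold f. replace (s - RtoC 0) with s by ring.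
    replace (g l s) with (E s * lsum (fun q => w q / (s - RtoC (snd q))) l).
    2:{ unfold g. rewrite <- lsum_scal. apply lsum_ext. intros q Hq. unfold Cdiv. ring. }
    fold w. unfold w. field. auto. }
  assert (Nh : forall t h, h <> 0%R -> ((t, h) : C) <> RtoC 0 /\ (forall q, In q l -> ((t, h) : C) <> RtoC (snd q))).
  { intros t h Hh. split; [|intros q _]; intros Z; apply (f_equal Im) in Z; simpl in Z; lra. }
  assert (Nc : forall t, ((c, t) : C) <> RtoC 0 /\
    (forall q, In q l -> ((c, t) : C) <> RtoC (snd q))).
  { intros t. split; [|intros q Hq]; intros Z; apply (f_equal Re) in Z; simpl in Z; try lra. destruct (Hl q Hq). lra. }
  assert (Cf : lines_cont f c h1 h2).
  { apply lines_cont_lin; auto. apply lines_cont_lin; auto. }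
  split.
  - eapply lines_cont_ext; [| | |exact Cf]; intros t; apply Ef; try (apply Nh; lra); apply Nc.
  - eapply loopval_ext; [intros t; apply Ef; apply Nh; lra|intros t; apply Ef; apply Nh; lra|intros t; apply Ef; apply Nc|].
    rewrite Cmult_plus_distr_l, <- lsum_scal.
    rewrite (lsum_ext _ (fun q => w q * (RtoC (- (2 * PI)) * Ci * Cexp (- (L * RtoC (snd q)))))) by (intros; unfold w; ring).
    replace (RtoC (- (2 * PI)) * Ci * (pf_beta a0 l * (pf_ratio a0 l - L)))
      with (pf_beta a0 l * pf_ratio a0 l * (RtoC (- (2 * PI)) * Ci) + pf_beta a0 l * (- L * (RtoC (- (2 * PI)) * Ci))) by ring.
    rewrite <- Cplus_assoc. unfold f.
    apply (loopval_lin (pf_beta a0 l * pf_ratio a0 l)); auto.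
    + apply lines_cont_lin; auto.
    + apply (loopval_lin (pf_beta a0 l)); auto.
Qed.

(** * Approximants of the integrand *)

Lemma Cpow_m1_sqr n : (- (1)) ^ n * (- (1)) ^ n = RtoC 1.
Proof. rewrite <- Cpow_mult_l. replace (- (1) * - (1)) with (RtoC 1) by ring. apply Cpow_1_l. Qed.

Lemma Cpow_m1_nz n : (- (1)) ^ n <> RtoC 0.
Proof. apply Cpow_nz. intros E. apply C1_nz. replace (RtoC 1) with (- - (1)) by ring. rewrite E. ring. Qed.

Lemma lprod_seq_S (f : nat -> C) a n : lprod f (seq a (S n)) = lprod f (seq a n) * f (a + n)%nat.
Proof. rewrite seq_S, lprod_app. simpl. ring. Qed.

Lemma lsum_seq_S (f : nat -> C) a n : lsum f (seq a (S n)) = lsum f (seq a n) + f (a + n)%nat.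
Proof. rewrite seq_S, lsum_app. simpl. ring. Qed.

Lemma lsum_csum (f : nat -> C) n : lsum f (seq 0 (S n)) = csum f n.
Proof. induction n as [|n IH]. { simpl. ring. } rewrite lsum_seq_S, IH. reflexivity. Qed.

Lemma lprod_poch (w : C) n : lprod (fun k => w + RtoC (INR k)) (seq 0 n) = pochhammer w n.
Proof. induction n as [|n IH]. { reflexivity. } rewrite lprod_seq_S, IH. reflexivity. Qed.

Lemma lprod_div {A} (f g : A -> C) l : (forall x, In x l -> g x <> RtoC 0) ->
  lprod (fun x => f x / g x) l = lprod f l / lprod g l.
Proof.
  intros H. induction l as [|x l IH]; simpl. { field; try apply C1_nz. }
  rewrite IH by (intros; apply H; now right).
  assert (N1 := H x (or_introl eq_refl)). assert (N2 := lprod_nz g l (fun y Hy => H y (or_intror Hy))).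
  fold (lprod f l). field. auto.
Qed.

Lemma lprod_opp (f : nat -> C) a n : lprod (fun k => - f k) (seq a n) = (- (1)) ^ n * lprod f (seq a n).
Proof.
  induction n as [|n IH]. { simpl. ring. } rewrite !lprod_seq_S, IH. rewrite Cpow_S. ring.
Qed.

Lemma lprod_rev_poch (p w : C) n : lprod (fun k => p - (w + RtoC (INR k))) (seq 0 n) = (- (1)) ^ n * pochhammer (w - p) n.
Proof.
  rewrite <- lprod_poch, <- lprod_opp. apply lprod_ext. intros k _. ring.
Qed.

(** The factor k - i of the denominator at the pole k, with the vanishing one at i = k replaced by
    1. *)
Definition del (k i : nat) : C := if Nat.eq_dec i k then RtoC 1 else RtoC (INR k) - RtoC (INR i).

Lemma del_prod k n : (k <= n)%nat ->
  lprod (del k) (seq 0 (S n)) = (- (1)) ^ (n - k) * (RtoC (INR (fact k)) * RtoC (INR (fact (n - k)))).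
Proof.
  intros Hn. induction Hn as [|n Hn IH].
  - rewrite Nat.sub_diag, lprod_seq_S. simpl (0 + k)%nat. unfold del at 2.
    destruct (Nat.eq_dec k k) as [_|N]; [|contradiction].
    (* The factors of index below k form a falling factorial: after j of them the product is k!/(k -
       j)!. *)
    assert (G : forall j, (j <= k)%nat -> lprod (del k) (seq 0 j) * RtoC (INR (fact (k - j))) = RtoC (INR (fact k))).
    { induction j as [|j IHj]; intros Hj.
      - rewrite Nat.sub_0_r. simpl. ring.
      - rewrite lprod_seq_S. simpl (0 + j)%nat. rewrite <- IHj by lia.
        replace (k - j)%nat with (S (k - S j)) by lia. rewrite (fact_simpl (k - S j)), mult_INR, RtoC_mult.
        unfold del at 2. destruct (Nat.eq_dec j k) as [E|_]; [lia|].
        replace (INR (S (k - S j))) with (INR k - INR j)%R.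
        2:{ rewrite <- minus_INR by lia. f_equal. lia. }
        rewrite RtoC_minus. ring. }
    specialize (G k (le_n k)). rewrite Nat.sub_diag in G. simpl fact in *. simpl INR in *. simpl Cpow.
    rewrite <- G. ring.
  - rewrite lprod_seq_S, IH. simpl (0 + S n)%nat. unfold del.
    destruct (Nat.eq_dec (S n) k) as [E|_]; [lia|].
    replace (S n - k)%nat with (S (n - k)) by lia. rewrite (fact_simpl (n - k)), mult_INR, RtoC_mult, Cpow_S.
    replace (INR (S (n - k))) with (INR (S n) - INR k)%R.
    2:{ rewrite <- minus_INR by lia. f_equal. lia. }
    rewrite RtoC_minus. ring.
Qed.

Lemma del_nz k i : del k i <> RtoC 0.
Proof.
  unfold del. destruct (Nat.eq_dec i k) as [_|N]; [apply C1_nz|].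
  rewrite <- RtoC_minus. apply RtoC_nz. intros E. apply N. apply INR_eq. lra.
Qed.

Section Approximant.
Variables (nu : R) (lx : C).
Hypothesis (Hnu : (0 < nu)%R) (Hnn : forall k, nu <> INR k).

(** The G-integrand with every 1/Gamma replaced by its approximant: an exponential times a rational
    function with finitely many poles. The prefactor -1/s is Gamma(-s)/Gamma(1 - s). *)
Definition Fapp (m : nat) (s : C) : C :=
  - / s * (Q m (1 + RtoC nu + s) * Q m (1 / 2 - s)) / (Q m (- s) * Q m (RtoC nu - s)) * Cexp (s * lx).

Definition lnn (m : nat) : C := RtoC (ln (INR (S m))).
(** The powers of n = m + 1 in the four [Q] collect to n^(-3/2 - 2 s). The part n^(-2 s) joins exp(s
    lx) to form exp(-Lap s); n^(-3/2) goes, with a sign, into [Kap]. *)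
Definition Lap (m : nat) : C := 2 * lnn m - lx.
Definition Kap (m : nat) : C := (- (1)) ^ (S m) * Cexp (- (3 / 2 * lnn m)).
Definition zp1 (k : nat) : C * R := (RtoC (INR k) + 1 / 2, INR k).
Definition zp2 (k : nat) : C * R := (- (1) - RtoC nu - RtoC (INR k), (nu + INR k)%R).
(** The first family starts at k = 1 because its pair for k = 0 is written separately: the pole 0
    meets that of -1/s, giving the factor (s - 1/2)/s^2. *)
Definition lap (m : nat) : list (C * R) := map zp1 (seq 1 (S m)) ++ map zp2 (seq 0 (S (S m))).

Lemma lap_pos m q : In q (lap m) -> fst q <> RtoC 0 /\ (0 < snd q)%R.
Proof.
  unfold lap. intros H. apply in_app_or in H. destruct H as [H|H]; apply in_map_iff in H; destruct H as [k [<- Hk]]; apply in_seq in Hk.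
  - simpl. assert (Pk : (1 <= INR k)%R) by (apply (le_INR 1); lia). split; [|lra].
    intros E. apply (f_equal Re) in E. simpl in E. lra.
  - simpl. assert (Pk := pos_INR k). split; [|lra].
    intros E. apply (f_equal Re) in E. simpl in E. lra.
Qed.

(** The poles of each family are distinct by themselves; a coincidence between the families would
    make nu a natural number. *)
Lemma lap_nodup m : NoDup (map snd (lap m)).
Proof.
  unfold lap. rewrite map_app, !map_map.
  apply NoDup_app.
  - apply FinFun.Injective_map_NoDup; [|apply seq_NoDup]. intros a b. apply INR_eq.
  - apply FinFun.Injective_map_NoDup; [|apply seq_NoDup]. intros a b E. cbn [snd zp2] in E. apply INR_eq. lra.
  - intros y H1 H2. apply in_map_iff in H1. apply in_map_iff in H2.
    destruct H1 as [a [<- Ha]]. destruct H2 as [b [E Hb]]. cbn [snd zp1 zp2] in E.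
    destruct (le_lt_dec b a) as [L|L].
    + apply (Hnn (a - b)). rewrite minus_INR by auto. lra.
    + assert (INR a < INR b)%R by now apply lt_INR. lra.
Qed.

Lemma Q_div m w : Q m w = pochhammer w (S (S m)) / (RtoC (INR (fact (S m))) * Cexp (w * lnn m)).
Proof.
  rewrite <- Q_closed. unfold lnn. field. split; [apply Cexp_nz|apply fact_nz].
Qed.

Lemma Fapp_eq m s : s <> RtoC 0 -> (forall k, s <> RtoC (INR k)) -> (forall k, s <> RtoC (nu + INR k)) ->
  Fapp m s = Kap m * (Cexp (- (Lap m * s)) * ((s - 1 / 2) / (s * s) * lprod (zp_factor s) (lap m))).
Proof.
  intros Hs H1 H2. unfold Fapp, lap.
  rewrite lprod_app, !lprod_map.
  set (n := S m).
  assert (P1 : pochhammer (- s) (S n) <> RtoC 0).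
  { apply pochhammer_nz. intros k E. apply (H1 k). replace s with (s + (- s + RtoC (INR k))) by (rewrite E; ring). ring. }
  assert (P2 : pochhammer (RtoC nu - s) (S n) <> RtoC 0).
  { apply pochhammer_nz. intros k E. apply (H2 k). rewrite RtoC_plus. replace s with (s + (RtoC nu - s + RtoC (INR k))) by (rewrite E; ring). ring. }
  assert (N1 : forall k, s - RtoC (INR k) <> RtoC 0).
  { intros k E. apply (H1 k). replace s with (s - RtoC (INR k) + RtoC (INR k)) by ring. rewrite E. ring. }
  assert (N2 : forall k, s - RtoC (nu + INR k) <> RtoC 0).
  { intros k E. apply (H2 k). replace s with (s - RtoC (nu + INR k) + RtoC (nu + INR k)) by ring. rewrite E. ring. }
  assert (E1 : (s - 1 / 2) / s * lprod (fun x => zp_factor s (zp1 x)) (seq 1 n)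
    = pochhammer (1 / 2 - s) (S n) / pochhammer (- s) (S n)).
  { transitivity (lprod (fun k => (s - (1 / 2 + RtoC (INR k))) / (s - (0 + RtoC (INR k)))) (seq 0 (S n))).
    - change (seq 0 (S n)) with (0%nat :: seq 1 n). rewrite lprod_cons. f_equal.
      + simpl (INR 0). field. auto.
      + apply lprod_ext. intros k _. unfold zp_factor, zp1. simpl. f_equal; [ring|f_equal; ring].
    - rewrite lprod_div. 2:{ intros k _. rewrite Cplus_0_l. apply N1. }
      rewrite !lprod_rev_poch. replace (0 - s) with (- s) by ring.
      field. split; auto. apply Cpow_m1_nz. }
  assert (E2 : lprod (fun x => zp_factor s (zp2 x)) (seq 0 (S n))
    = (- (1)) ^ (S n) * (pochhammer (1 + RtoC nu + s) (S n) / pochhammer (RtoC nu - s) (S n))).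
  { transitivity (lprod (fun k => ((1 + RtoC nu + s) + RtoC (INR k)) / (s - (RtoC nu + RtoC (INR k)))) (seq 0 (S n))).
    - apply lprod_ext. intros k _. unfold zp_factor, zp2. simpl. f_equal; [ring|f_equal]. now rewrite RtoC_plus.
    - rewrite lprod_div. 2:{ intros k _. rewrite <- RtoC_plus. apply N2. }
      rewrite lprod_rev_poch, lprod_poch.
      apply (C_cancel_r ((- (1)) ^ (S n) * pochhammer (RtoC nu - s) (S n))). { apply Cmult_neq_0; auto. apply Cpow_m1_nz. }
      transitivity (pochhammer (1 + RtoC nu + s) (S n)); [field; split; auto; apply Cpow_m1_nz|].
      transitivity ((- (1)) ^ S n * (- (1)) ^ S n * pochhammer (1 + RtoC nu + s) (S n)); [rewrite Cpow_m1_sqr; ring|].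
      field; auto. }
  replace ((s - 1 / 2) / (s * s) * (lprod (fun x => zp_factor s (zp1 x)) (seq 1 n) * lprod (fun x => zp_factor s (zp2 x)) (seq 0 (S n))))
    with (((s - 1 / 2) / s * lprod (fun x => zp_factor s (zp1 x)) (seq 1 n)) * lprod (fun x => zp_factor s (zp2 x)) (seq 0 (S n)) / s).
  2:{ field. auto. }
  rewrite E1, E2, !Q_div. fold n. unfold Kap. fold n. rewrite Cpow_S.
  set (f := RtoC (INR (fact n))). assert (Nf : f <> RtoC 0) by apply fact_nz.
  replace (Cexp ((1 + RtoC nu + s) * lnn m)) with (Cexp (lnn m) * Cexp (RtoC nu * lnn m) * Cexp (s * lnn m)).
  2:{ rewrite <- !Cexp_plus. f_equal. ring. }
  replace (Cexp ((1 / 2 - s) * lnn m)) with (Cexp (1 / 2 * lnn m) / Cexp (s * lnn m)).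
  2:{ rewrite <- Cexp_minus. f_equal. ring. }
  replace (Cexp (- s * lnn m)) with (/ Cexp (s * lnn m)).
  2:{ rewrite <- Cexp_opp. f_equal. ring. }
  replace (Cexp ((RtoC nu - s) * lnn m)) with (Cexp (RtoC nu * lnn m) / Cexp (s * lnn m)).
  2:{ rewrite <- Cexp_minus. f_equal. ring. }
  replace (Cexp (- (3 / 2 * lnn m))) with (/ (Cexp (lnn m) * Cexp (1 / 2 * lnn m))).
  2:{ rewrite <- Cexp_plus, <- Cexp_opp. f_equal. field; try (apply RtoC_nz; lra). }
  replace (Cexp (- (Lap m * s))) with (Cexp (s * lx) / (Cexp (s * lnn m) * Cexp (s * lnn m))).
  2:{ rewrite <- Cexp_plus, <- Cexp_minus. f_equal. unfold Lap. ring. }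
  assert (Z1 := Cexp_nz (lnn m)). assert (Z2 := Cexp_nz (1 / 2 * lnn m)). assert (Z3 := Cexp_nz (RtoC nu * lnn m)).
  assert (Z4 := Cexp_nz (s * lnn m)).
  assert (Sg := Cpow_m1_sqr n). set (sg := (- (1)) ^ n) in *.
  set (A := pochhammer (1 + RtoC nu + s) (S n)). set (B := pochhammer (1 / 2 - s) (S n)).
  set (D1 := pochhammer (- s) (S n)) in *. set (D2 := pochhammer (RtoC nu - s) (S n)) in *.
  set (e1 := Cexp (lnn m)) in *. set (e2 := Cexp (1 / 2 * lnn m)) in *. set (e3 := Cexp (RtoC nu * lnn m)) in *.
  set (e4 := Cexp (s * lnn m)) in *. set (ex := Cexp (s * lx)).
  transitivity (- (sg * sg) * (A * B * ex) / (s * D1 * D2 * (e1 * e2 * e4 * e4))).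
  - rewrite Sg. field. repeat split; auto.
  - field. repeat split; auto.
Qed.

(** Residue weight at b1 + k, with (b1, b2) = (0, nu) for the poles k and (nu, 0) for the poles nu +
    k. The sign over k! and the middle factor, which tends to 1, are the residue of 1/Q at its pole
    -k. *)
Definition wres (b1 b2 : R) (m k : nat) : C :=
  (- (1)) ^ k / RtoC (INR (fact k)) *
  (RtoC (INR (fact (S m))) / (RtoC (INR (S m)) ^ k * RtoC (INR (fact (S m - k))))) *
  (Q m (1 / 2 - RtoC (b1 + INR k)) * Q m (1 + RtoC nu + RtoC (b1 + INR k)) / Q m (RtoC b2 - RtoC (b1 + INR k))).

(** Algebra common to both pole families: the powers of n hidden in [Kap], [Lap] and the [Q] cancel,
    except for n^k in the weight. *)
Lemma res_scale (b1 b2 : R) m k : (k <= S m)%nat -> (b1 + b2 = nu)%R -> (0 < b1 + INR k)%R ->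
  (forall i, (b2 - (b1 + INR k) + INR i)%R <> 0%R) ->
  Kap m * (lprod (fun i => RtoC (b1 + INR k) - (1 / 2 + RtoC (INR i))) (seq 0 (S (S m)))
    * lprod (fun i => 1 + RtoC nu + RtoC (b1 + INR k) + RtoC (INR i)) (seq 0 (S (S m)))
    / (RtoC (b1 + INR k) * lprod (del k) (seq 0 (S (S m))) * lprod (fun i => RtoC (b1 + INR k) - (RtoC b2 + RtoC (INR i))) (seq 0 (S (S m)))))
   * Cexp (- (Lap m * RtoC (b1 + INR k)))
  = wres b1 b2 m k / RtoC (b1 + INR k) * Cexp (RtoC (b1 + INR k) * lx).
Proof.
  intros Hk Hb Hp Hi.
  rewrite !lprod_rev_poch, lprod_poch, del_prod by auto.
  set (n := S m) in *. set (p := RtoC (b1 + INR k)).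
  assert (Np : p <> RtoC 0) by (apply RtoC_nz; lra).
  unfold wres. fold n p. rewrite !Q_div. fold n.
  assert (P2 : pochhammer (RtoC b2 - p) (S n) <> RtoC 0).
  { apply pochhammer_nz. intros i. unfold p. rewrite <- RtoC_minus, <- RtoC_plus. apply RtoC_nz, Hi. }
  set (A := pochhammer (1 / 2 - p) (S n)). set (B := pochhammer (1 + RtoC nu + p) (S n)). set (D := pochhammer (RtoC b2 - p) (S n)) in *.
  unfold Kap. fold n.
  assert (Nf := fact_nz n). assert (Nf1 := fact_nz k). assert (Nf2 := fact_nz (n - k)).
  set (f := RtoC (INR (fact n))) in *. set (f1 := RtoC (INR (fact k))) in *. set (f2 := RtoC (INR (fact (n - k)))) in *.
  replace (Cexp ((1 / 2 - p) * lnn m)) with (Cexp (1 / 2 * lnn m) / Cexp (p * lnn m)).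
  2:{ rewrite <- Cexp_minus. f_equal. ring. }
  replace (Cexp ((1 + RtoC nu + p) * lnn m)) with (Cexp (lnn m) * Cexp (RtoC nu * lnn m) * Cexp (p * lnn m)).
  2:{ rewrite <- !Cexp_plus. f_equal. ring. }
  replace (RtoC (INR n) ^ k) with (Cexp (p * lnn m) * Cexp (RtoC b2 * lnn m) / Cexp (RtoC nu * lnn m)).
  2:{ rewrite <- Cexp_plus, <- Cexp_minus.
      replace (p * lnn m + RtoC b2 * lnn m - RtoC nu * lnn m) with (RtoC (INR k) * lnn m).
      2:{ unfold p. rewrite <- Hb, !RtoC_plus. ring. }
      rewrite Cexp_INR. f_equal. unfold lnn. fold n. rewrite Cexp_RtoC, exp_ln; auto. apply lt_0_INR. unfold n; lia. }
  replace (Cexp ((RtoC b2 - p) * lnn m)) with (Cexp (RtoC b2 * lnn m) / Cexp (p * lnn m)).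
  2:{ rewrite <- Cexp_minus. f_equal. ring. }
  replace (Cexp (- (3 / 2 * lnn m))) with (/ (Cexp (lnn m) * Cexp (1 / 2 * lnn m))).
  2:{ rewrite <- Cexp_plus, <- Cexp_opp. f_equal. field; try (apply RtoC_nz; lra). }
  replace (Cexp (- (Lap m * p))) with (Cexp (p * lx) / (Cexp (p * lnn m) * Cexp (p * lnn m))).
  2:{ rewrite <- Cexp_plus, <- Cexp_minus. f_equal. unfold Lap. ring. }
  assert (Z1 := Cexp_nz (lnn m)). assert (Z2 := Cexp_nz (1 / 2 * lnn m)). assert (Z3 := Cexp_nz (RtoC nu * lnn m)).
  assert (Z4 := Cexp_nz (p * lnn m)). assert (Z5 := Cexp_nz (RtoC b2 * lnn m)).
  replace ((- (1)) ^ n) with ((- (1)) ^ k * (- (1)) ^ (n - k)).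
  2:{ rewrite <- Cpow_add_r. f_equal. lia. }
  assert (Z6 := Cpow_m1_nz (n - k)). assert (Z7 := Cpow_m1_nz (S n)).
  field. repeat split; auto.
Qed.

Lemma wres1_eq m k : (1 <= k <= S m)%nat ->
  Kap m * ((RtoC (snd (zp1 k)) - 1 / 2) / (RtoC (snd (zp1 k)) * RtoC (snd (zp1 k))) * lprod (zp_res (snd (zp1 k))) (lap m) * Cexp (- (Lap m * RtoC (snd (zp1 k)))))
  = wres 0 nu m k / RtoC (0 + INR k) * Cexp (RtoC (0 + INR k) * lx).
Proof.
  intros Hk. assert (Pk : (1 <= INR k)%R) by (apply (le_INR 1); lia).
  assert (Hi : forall i, (nu - (0 + INR k) + INR i)%R <> 0%R).
  { intros i E. destruct (le_lt_dec i k) as [L|L].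
    - apply (Hnn (k - i)). rewrite minus_INR by auto. lra.
    - assert (INR k < INR i)%R by now apply lt_INR. lra. }
  rewrite <- (res_scale 0 nu m k) by (auto; try lia; lra). simpl (snd (zp1 k)).
  replace (0 + INR k)%R with (INR k) in * by ring.
  rewrite !Cmult_assoc. f_equal. rewrite <- !Cmult_assoc. f_equal.
  unfold lap. rewrite lprod_app, !lprod_map.
  assert (Np : RtoC (INR k) <> RtoC 0) by (apply RtoC_nz; lra).
  assert (E1 : (RtoC (INR k) - 1 / 2) / RtoC (INR k) * lprod (fun x => zp_res (INR k) (zp1 x)) (seq 1 (S m))
    = lprod (fun i => RtoC (INR k) - (1 / 2 + RtoC (INR i))) (seq 0 (S (S m))) / lprod (del k) (seq 0 (S (S m)))).
  { rewrite <- lprod_div by (intros; apply del_nz).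
    change (seq 0 (S (S m))) with (0%nat :: seq 1 (S m)). rewrite lprod_cons. f_equal.
    - unfold del. destruct (Nat.eq_dec 0 k) as [E|_]; [lia|]. simpl (INR 0). f_equal; [ring|f_equal; ring].
    - apply lprod_ext. intros i _. unfold zp_res, zp1, del. simpl.
      destruct (Req_EM_T (INR i) (INR k)) as [E|E]; destruct (Nat.eq_dec i k) as [E'|E'].
      + field; try apply C1_nz.
      + exfalso. apply E'. now apply INR_eq.
      + exfalso. apply E. now rewrite E'.
      + f_equal. ring. }
  assert (E2 : lprod (fun x => zp_res (INR k) (zp2 x)) (seq 0 (S (S m)))
    = lprod (fun i => 1 + RtoC nu + RtoC (INR k) + RtoC (INR i)) (seq 0 (S (S m)))
      / lprod (fun i => RtoC (INR k) - (RtoC nu + RtoC (INR i))) (seq 0 (S (S m)))).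
  { rewrite <- lprod_div.
    - apply lprod_ext. intros i _. unfold zp_res, zp2. simpl.
      destruct (Req_EM_T (nu + INR i) (INR k)) as [E|E]; [exfalso; apply (Hi i); lra|].
      rewrite RtoC_plus. f_equal. ring.
    - intros i _. rewrite <- RtoC_plus, <- RtoC_minus. apply RtoC_nz. specialize (Hi i). lra. }
  rewrite E2.
  replace ((RtoC (INR k) - 1 / 2) / (RtoC (INR k) * RtoC (INR k)) *
    (lprod (fun x => zp_res (INR k) (zp1 x)) (seq 1 (S m)) * (lprod (fun i => 1 + RtoC nu + RtoC (INR k) + RtoC (INR i)) (seq 0 (S (S m))) / lprod (fun i => RtoC (INR k) - (RtoC nu + RtoC (INR i))) (seq 0 (S (S m))))))
   with (((RtoC (INR k) - 1 / 2) / RtoC (INR k) * lprod (fun x => zp_res (INR k) (zp1 x)) (seq 1 (S m))) * (lprod (fun i => 1 + RtoC nu + RtoC (INR k) + RtoC (INR i)) (seq 0 (S (S m))) / lprod (fun i => RtoC (INR k) - (RtoC nu + RtoC (INR i))) (seq 0 (S (S m)))) / RtoC (INR k)).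
  2:{ assert (N : lprod (fun i => RtoC (INR k) - (RtoC nu + RtoC (INR i))) (seq 0 (S (S m))) <> RtoC 0).
      { apply lprod_nz. intros i _. rewrite <- RtoC_plus, <- RtoC_minus. apply RtoC_nz. specialize (Hi i). lra. }
      field. auto. }
  rewrite E1.
  assert (N : lprod (fun i => RtoC (INR k) - (RtoC nu + RtoC (INR i))) (seq 0 (S (S m))) <> RtoC 0).
  { apply lprod_nz. intros i _. rewrite <- RtoC_plus, <- RtoC_minus. apply RtoC_nz. specialize (Hi i). lra. }
  assert (N' := lprod_nz (del k) (seq 0 (S (S m))) (fun i _ => del_nz k i)).
  field. auto.
Qed.

Lemma wres2_eq m k : (k <= S m)%nat ->
  Kap m * ((RtoC (snd (zp2 k)) - 1 / 2) / (RtoC (snd (zp2 k)) * RtoC (snd (zp2 k))) * lprod (zp_res (snd (zp2 k))) (lap m) * Cexp (- (Lap m * RtoC (snd (zp2 k)))))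
  = wres nu 0 m k / RtoC (nu + INR k) * Cexp (RtoC (nu + INR k) * lx).
Proof.
  intros Hk. assert (Pk := pos_INR k).
  assert (Hi : forall i, (0 - (nu + INR k) + INR i)%R <> 0%R).
  { intros i E. destruct (le_lt_dec k i) as [L|L].
    - apply (Hnn (i - k)). rewrite minus_INR by auto. lra.
    - assert (INR i < INR k)%R by now apply lt_INR. lra. }
  rewrite <- (res_scale nu 0 m k) by (auto; try lia; lra). simpl (snd (zp2 k)).
  set (p := RtoC (nu + INR k)).
  rewrite !Cmult_assoc. f_equal. rewrite <- !Cmult_assoc. f_equal.
  unfold lap. rewrite lprod_app, !lprod_map.
  assert (Np : p <> RtoC 0) by (apply RtoC_nz; lra).
  assert (Npi : forall i, p - (0 + RtoC (INR i)) <> RtoC 0).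
  { intros i. unfold p. rewrite Cplus_0_l, <- RtoC_minus. apply RtoC_nz. specialize (Hi i). lra. }
  assert (E1 : (p - 1 / 2) / p * lprod (fun x => zp_res (nu + INR k) (zp1 x)) (seq 1 (S m))
    = lprod (fun i => p - (1 / 2 + RtoC (INR i))) (seq 0 (S (S m))) / lprod (fun i => p - (RtoC 0 + RtoC (INR i))) (seq 0 (S (S m)))).
  { rewrite <- lprod_div by (intros; apply Npi).
    change (seq 0 (S (S m))) with (0%nat :: seq 1 (S m)). rewrite lprod_cons. f_equal.
    - simpl (INR 0). f_equal; [ring|f_equal; ring].
    - apply lprod_ext. intros i _. unfold zp_res, zp1. simpl.
      destruct (Req_EM_T (INR i) (nu + INR k)) as [E|E]; [exfalso; apply (Hi i); lra|].
      fold p. f_equal; [ring|f_equal; ring]. }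
  assert (E2 : lprod (fun x => zp_res (nu + INR k) (zp2 x)) (seq 0 (S (S m)))
    = lprod (fun i => 1 + RtoC nu + p + RtoC (INR i)) (seq 0 (S (S m))) / lprod (del k) (seq 0 (S (S m)))).
  { rewrite <- lprod_div by (intros; apply del_nz).
    apply lprod_ext. intros i _. unfold zp_res, zp2, del. simpl. fold p.
    destruct (Req_EM_T (nu + INR i) (nu + INR k)) as [E|E]; destruct (Nat.eq_dec i k) as [E'|E'].
    - field; try apply C1_nz.
    - exfalso. apply E'. apply INR_eq. lra.
    - exfalso. apply E. now rewrite E'.
    - f_equal; [ring|]. unfold p. rewrite !RtoC_plus. ring. }
  rewrite E2.
  assert (N : lprod (fun i => p - (RtoC 0 + RtoC (INR i))) (seq 0 (S (S m))) <> RtoC 0).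
  { apply lprod_nz. intros i _. apply Npi. }
  assert (N' := lprod_nz (del k) (seq 0 (S (S m))) (fun i _ => del_nz k i)).
  transitivity (((p - 1 / 2) / p * lprod (fun x => zp_res (nu + INR k) (zp1 x)) (seq 1 (S m))) * (lprod (fun i => 1 + RtoC nu + p + RtoC (INR i)) (seq 0 (S (S m))) / lprod (del k) (seq 0 (S (S m)))) / p).
  { field. auto. }
  rewrite E1. field. auto.
Qed.

Lemma Kap_beta m : Kap m * pf_beta (1 / 2) (lap m) = Q m (1 / 2) * Q m (1 + RtoC nu) / Q m (RtoC nu).
Proof.
  unfold pf_beta, lap. rewrite lprod_app, !lprod_map. set (n := S m).
  assert (Nn : forall k, RtoC nu + RtoC (INR k) <> RtoC 0).
  { intros k. rewrite <- RtoC_plus. apply RtoC_nz. generalize (pos_INR k). lra. }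
  assert (E1 : 1 / 2 * lprod (fun x => fst (zp1 x) / RtoC (snd (zp1 x))) (seq 1 n) = pochhammer (1 / 2) (S n) / RtoC (INR (fact n))).
  { assert (F : forall j, lprod (fun k => RtoC (INR k)) (seq 1 j) = RtoC (INR (fact j))).
    { induction j as [|j IH]. { reflexivity. }
      rewrite lprod_seq_S, IH, (fact_simpl j), mult_INR, RtoC_mult. simpl (1 + j)%nat. ring. }
    rewrite <- F, <- (lprod_poch (1 / 2)). change (seq 0 (S n)) with (0%nat :: seq 1 n). rewrite lprod_cons.
    rewrite lprod_div.
    - simpl (INR 0). rewrite Cplus_0_r. rewrite (lprod_ext (fun x => fst (zp1 x)) (fun k => 1 / 2 + RtoC (INR k))) by (intros; simpl; ring).
      unfold Cdiv. simpl snd. ring.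
    - intros k Hk. apply in_seq in Hk. simpl. apply RtoC_nz, not_0_INR. lia. }
  assert (E2 : lprod (fun x => fst (zp2 x) / RtoC (snd (zp2 x))) (seq 0 (S n)) = (- (1)) ^ S n * (pochhammer (1 + RtoC nu) (S n) / pochhammer (RtoC nu) (S n))).
  { rewrite <- !lprod_poch, <- lprod_div by (intros; apply Nn). rewrite <- lprod_opp. apply lprod_ext.
    intros k _. simpl. rewrite RtoC_plus. field. apply Nn. }
  replace (- (1 / 2) * (lprod (fun x => fst (zp1 x) / RtoC (snd (zp1 x))) (seq 1 n) * lprod (fun x => fst (zp2 x) / RtoC (snd (zp2 x))) (seq 0 (S n))))
   with (- (1 / 2 * lprod (fun x => fst (zp1 x) / RtoC (snd (zp1 x))) (seq 1 n)) * lprod (fun x => fst (zp2 x) / RtoC (snd (zp2 x))) (seq 0 (S n))) by ring.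
  rewrite E1, E2. rewrite !Q_div. fold n. unfold Kap. fold n.
  replace (Cexp ((1 + RtoC nu) * lnn m)) with (Cexp (lnn m) * Cexp (RtoC nu * lnn m)).
  2:{ rewrite <- !Cexp_plus. f_equal. ring. }
  replace (Cexp (- (3 / 2 * lnn m))) with (/ (Cexp (lnn m) * Cexp (1 / 2 * lnn m))).
  2:{ rewrite <- Cexp_plus, <- Cexp_opp. f_equal. field; try (apply RtoC_nz; lra). }
  assert (Z1 := Cexp_nz (lnn m)). assert (Z2 := Cexp_nz (1 / 2 * lnn m)). assert (Z3 := Cexp_nz (RtoC nu * lnn m)).
  assert (Nf := fact_nz n). assert (P := pochhammer_nz (RtoC nu) (S n) Nn).
  assert (Sg := Cpow_m1_sqr n). rewrite Cpow_S. set (sg := (- (1)) ^ n) in *.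
  transitivity ((sg * sg) * (pochhammer (1 / 2) (S n) * pochhammer (1 + RtoC nu) (S n)) / (pochhammer (RtoC nu) (S n) * RtoC (INR (fact n)) * Cexp (lnn m) * Cexp (1 / 2 * lnn m))).
  - field. repeat split; auto.
  - rewrite Sg. field. repeat split; auto.
Qed.

Definition hdig (w : C) (m : nat) : C := csum (fun k => / (w + RtoC (INR k))) (S m) - RtoC (ln (INR (S m))).

(** Four harmonic sums with their logarithms: the signs leave -2 ln n, which is the logarithmic part
    of [- Lap m]. The first family has one term fewer, so the last term 1/(m + 2) of [hdig 1 m] is
    subtracted. *)
Lemma pf_ratio_eq m : pf_ratio (1 / 2) (lap m) - Lap m
  = lx + (hdig 1 m - RtoC (tinv (S m))) - hdig (1 / 2) m + hdig (RtoC nu) m + hdig (1 + RtoC nu) m.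
Proof.
  unfold pf_ratio, lap. rewrite lsum_app, !lsum_map.
  assert (E1 : - / (1 / 2) + lsum (fun x => / RtoC (snd (zp1 x)) - / fst (zp1 x)) (seq 1 (S m))
    = csum (fun k => / (1 + RtoC (INR k))) (S m) - RtoC (tinv (S m)) - csum (fun k => / (1 / 2 + RtoC (INR k))) (S m)).
  { assert (G : forall j, - / (1 / 2) + lsum (fun x => / RtoC (snd (zp1 x)) - / fst (zp1 x)) (seq 1 (S j))
    = csum (fun k => / (1 + RtoC (INR k))) j - csum (fun k => / (1 / 2 + RtoC (INR k))) (S j)).
    { induction j as [|j IH].
      - simpl. rewrite Cplus_0_r. field.
      - rewrite lsum_seq_S, Cplus_assoc, IH. simpl (1 + S j)%nat.
        change (csum (fun k => / (1 / 2 + RtoC (INR k))) (S (S j))) with (csum (fun k => / (1 / 2 + RtoC (INR k))) (S j) + / (1 / 2 + RtoC (INR (S (S j))))).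
        change (csum (fun k => / (1 + RtoC (INR k))) (S j)) with (csum (fun k => / (1 + RtoC (INR k))) j + / (1 + RtoC (INR (S j)))).
        unfold zp1. cbn [fst snd].
        replace (1 + RtoC (INR (S j))) with (RtoC (INR (S (S j)))) by (rewrite (S_INR (S j)), RtoC_plus; ring).
        rewrite (Cplus_comm (RtoC (INR (S (S j)))) (1 / 2)). ring. }
    rewrite G.
    change (csum (fun k => / (1 + RtoC (INR k))) (S m)) with (csum (fun k => / (1 + RtoC (INR k))) m + / (1 + RtoC (INR (S m)))).
    unfold tinv. rewrite RtoC_inv by apply INR_S_nz. rewrite (S_INR (S m)), RtoC_plus.
    replace (RtoC (INR (S m)) + RtoC 1) with (1 + RtoC (INR (S m))) by ring. ring. }
  assert (E2 : lsum (fun x => / RtoC (snd (zp2 x)) - / fst (zp2 x)) (seq 0 (S (S m)))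
    = csum (fun k => / (RtoC nu + RtoC (INR k))) (S m) + csum (fun k => / (1 + RtoC nu + RtoC (INR k))) (S m)).
  { rewrite lsum_csum, <- csum_plus. apply csum_ext. intros k _. simpl. rewrite RtoC_plus.
    assert (N1 : RtoC nu + RtoC (INR k) <> RtoC 0) by (rewrite <- RtoC_plus; apply RtoC_nz; generalize (pos_INR k); lra).
    assert (N2 : 1 + RtoC nu + RtoC (INR k) <> RtoC 0) by (rewrite <- !RtoC_plus; apply RtoC_nz; generalize (pos_INR k); lra).
    assert (N3 : - (1) - RtoC nu - RtoC (INR k) <> RtoC 0).
    { intros E. apply N2. replace (1 + RtoC nu + RtoC (INR k)) with (- (- (1) - RtoC nu - RtoC (INR k))) by ring. rewrite E. ring. }
    assert (N4 : RtoC (-1) - RtoC nu - RtoC (INR k) <> RtoC 0).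
    { rewrite <- !RtoC_minus. apply RtoC_nz. generalize (pos_INR k). lra. }
    field. cbv beta. auto. }
  rewrite Cplus_assoc, E1, E2. unfold hdig, Lap, lnn. ring.
Qed.

(** Minus the sum of the residues of [Fapp], since the loop is clockwise: the double pole 0, the
    poles 1, ..., m + 1, and the poles nu, ..., nu + m + 1. *)
Definition Gapp (m : nat) : C :=
  - (Q m (1 / 2) * Q m (1 + RtoC nu) / Q m (RtoC nu)
     * (lx + (hdig 1 m - RtoC (tinv (S m))) - hdig (1 / 2) m + hdig (RtoC nu) m + hdig (1 + RtoC nu) m))
  - csum (fun k => wres 0 nu m (S k) / RtoC (0 + INR (S k)) * Cexp (RtoC (0 + INR (S k)) * lx)) m
  - csum (fun k => wres nu 0 m k / RtoC (nu + INR k) * Cexp (RtoC (nu + INR k) * lx)) (S m).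

Lemma Fapp_loop m c h1 h2 : (c < 0)%R -> (h1 < 0)%R -> (0 < h2)%R -> (1 <= Re (Lap m))%R ->
  lines_cont (Fapp m) c h1 h2 /\ loopval (Fapp m) c h1 h2 (2 * RtoC PI * Ci * Gapp m).
Proof.
  intros Hc Hh1 Hh2 HL.
  assert (Nhalf : 1 / 2 <> RtoC 0).
  { intros E. apply (f_equal Re) in E. simpl in E. lra. }
  destruct (partial_fraction_loop (1 / 2) (Lap m) (lap m) c h1 h2 Nhalf (lap_pos m) (lap_nodup m) Hc Hh1 Hh2 HL) as [A B].
  assert (Eh : forall t h, h <> 0%R -> Kap m * (Cexp (- (Lap m * (t, h))) * (((t, h) - 1 / 2) / ((t, h) * (t, h)) * lprod (zp_factor (t, h)) (lap m))) = Fapp m (t, h)).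
  { intros t h Hh. symmetry. apply Fapp_eq; [|intros k|intros k]; intros E; apply (f_equal Im) in E; simpl in E; lra. }
  assert (Ec : forall t, Kap m * (Cexp (- (Lap m * (c, t))) * (((c, t) - 1 / 2) / ((c, t) * (c, t)) * lprod (zp_factor (c, t)) (lap m))) = Fapp m (c, t)).
  { intros t. symmetry. apply Fapp_eq; [|intros k|intros k]; intros E; apply (f_equal Re) in E; simpl in E; try (generalize (pos_INR k)); lra. }
  split.
  - apply (lines_cont_ext (fun s => Kap m * (Cexp (- (Lap m * s)) * ((s - 1 / 2) / (s * s) * lprod (zp_factor s) (lap m)))));
      [intros t; apply Eh; lra|intros t; apply Eh; lra|apply Ec|].
    now apply (ccont_line_const_mult (Kap m)).
  - apply (loopval_ext (fun s => Kap m * (Cexp (- (Lap m * s)) * ((s - 1 / 2) / (s * s) * lprod (zp_factor s) (lap m)))));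
      [intros t; apply Eh; lra|intros t; apply Eh; lra|apply Ec|].
    replace (2 * RtoC PI * Ci * Gapp m) with (Kap m * (RtoC (- (2 * PI)) * Ci * (pf_beta (1 / 2) (lap m) * (pf_ratio (1 / 2) (lap m) - Lap m)
     + lsum (fun q => (RtoC (snd q) - 1 / 2) / (RtoC (snd q) * RtoC (snd q)) * lprod (zp_res (snd q)) (lap m) * Cexp (- (Lap m * RtoC (snd q)))) (lap m)))).
    { now apply loopval_scal. }
    set (W := fun q : C * R => (RtoC (snd q) - 1 / 2) / (RtoC (snd q) * RtoC (snd q)) * lprod (zp_res (snd q)) (lap m) * Cexp (- (Lap m * RtoC (snd q)))).
    transitivity (- (2 * RtoC PI * Ci) * (Kap m * pf_beta (1 / 2) (lap m) * (pf_ratio (1 / 2) (lap m) - Lap m) + lsum (fun q => Kap m * W q) (lap m))).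
    { rewrite lsum_scal, RtoC_opp, RtoC_mult. ring. }
    rewrite Kap_beta, pf_ratio_eq. unfold lap at 1. rewrite lsum_app, !lsum_map.
    rewrite (lsum_ext (fun x => Kap m * W (zp1 x)) (fun k => wres 0 nu m k / RtoC (0 + INR k) * Cexp (RtoC (0 + INR k) * lx))).
    2:{ intros k Hk. apply in_seq in Hk. unfold W. apply wres1_eq. lia. }
    rewrite (lsum_ext (fun x => Kap m * W (zp2 x)) (fun k => wres nu 0 m k / RtoC (nu + INR k) * Cexp (RtoC (nu + INR k) * lx))).
    2:{ intros k Hk. apply in_seq in Hk. unfold W. apply wres2_eq. lia. }
    rewrite lsum_csum.
    rewrite <- (seq_shift (S m) 0), lsum_map, lsum_csum. unfold Gapp. ring.
Qed.

End Approximant.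

(** * Uniform convergence on compact pieces of the contour *)

Definition unif {T} (F : (T -> Prop) -> Prop) (D : R -> Prop) (f : T -> R -> C) (g : R -> C) : Prop :=
  (forall eps, (0 < eps)%R -> F (fun a => forall t, D t -> (Cmod (f a t - g t) <= eps)%R)) /\
  (exists M, forall t, D t -> (Cmod (g t) <= M)%R).

Lemma unif_const {T} F {FF : Filter F} D (g : R -> C) M : (forall t, D t -> (Cmod (g t) <= M)%R) ->
  unif F D (fun _ : T => g) g.
Proof.
  intros H. split; [|now exists M]. intros eps He. apply filter_forall. intros _ t _.
  replace (g t - g t) with (RtoC 0) by ring. rewrite Cmod_0. lra.
Qed.

Lemma unif_mult {T} F {FF : Filter F} D (f f' : T -> R -> C) g g' :
  unif F D f g -> unif F D f' g' -> unif F D (fun a t => f a t * f' a t) (fun t => g t * g' t).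
Proof.
  intros [H [M HM]] [H' [M' HM']]. split.
  2:{ exists (M * M')%R. intros t Ht. rewrite Cmod_mult. apply Rmult_le_compat; try apply Cmod_ge_0; auto. }
  intros eps He.
  set (m := (Rmax M 0 + 1)%R). set (m' := (Rmax M' 0 + 1)%R).
  assert (X1 := Rmax_l M 0). assert (X2 := Rmax_r M 0). assert (X3 := Rmax_l M' 0). assert (X4 := Rmax_r M' 0).
  assert (Pm : (1 <= m)%R) by (unfold m; lra). assert (Pm' : (1 <= m')%R) by (unfold m'; lra).
  assert (He1 : (0 < eps / 2 / (m' + 1))%R) by (repeat apply Rdiv_lt_0_compat; lra).
  assert (He2 : (0 < Rmin 1 (eps / 2 / m))%R).
  { apply Rmin_pos; [lra|]. repeat apply Rdiv_lt_0_compat; lra. }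
  generalize (filter_and _ _ (H _ He1) (H' _ He2)). apply filter_imp. intros a [A B] t Ht.
  specialize (A t Ht). specialize (B t Ht).
  assert (B1 : (Cmod (f' a t - g' t) <= 1)%R) by (eapply Rle_trans; [exact B|apply Rmin_l]).
  assert (B2 : (Cmod (f' a t - g' t) <= eps / 2 / m)%R) by (eapply Rle_trans; [exact B|apply Rmin_r]).
  replace (f a t * f' a t - g t * g' t) with ((f a t - g t) * f' a t + g t * (f' a t - g' t)) by ring.
  eapply Rle_trans; [apply Cmod_triangle|]. rewrite !Cmod_mult.
  assert (C1 : (Cmod (f' a t) <= m' + 1)%R).
  { replace (f' a t) with ((f' a t - g' t) + g' t) by ring. eapply Rle_trans; [apply Cmod_triangle|].
    specialize (HM' t Ht). unfold m'. lra. }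
  assert (C2 : (Cmod (g t) <= m)%R) by (specialize (HM t Ht); unfold m; lra).
  assert (D1 : (Cmod (f a t - g t) * Cmod (f' a t) <= eps / 2 / (m' + 1) * (m' + 1))%R).
  { apply Rmult_le_compat; try apply Cmod_ge_0; auto. }
  assert (D2 : (Cmod (g t) * Cmod (f' a t - g' t) <= m * (eps / 2 / m))%R).
  { apply Rmult_le_compat; try apply Cmod_ge_0; auto. }
  replace (eps / 2 / (m' + 1) * (m' + 1))%R with (eps / 2)%R in D1 by (field; lra).
  replace (m * (eps / 2 / m))%R with (eps / 2)%R in D2 by (field; lra). lra.
Qed.

Lemma unif_inv {T} F {FF : Filter F} D (f : T -> R -> C) g d : (0 < d)%R -> (forall t, D t -> (d <= Cmod (g t))%R) ->
  unif F D f g -> unif F D (fun a t => / f a t) (fun t => / g t).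
Proof.
  intros Hd Hg [H _]. split.
  2:{ exists (/ d)%R. intros t Ht. specialize (Hg t Ht). rewrite Cmod_inv.
      - apply Rinv_le_contravar; auto.
      - apply Cmod_gt_0. lra. }
  intros eps He.
  assert (He' : (0 < Rmin (d / 2) (eps * (d * d) / 2))%R).
  { apply Rmin_pos; [lra|]. assert (0 < eps * (d * d))%R by (repeat apply Rmult_lt_0_compat; lra). lra. }
  generalize (H _ He'). apply filter_imp. intros a A t Ht. specialize (A t Ht). specialize (Hg t Ht).
  assert (A1 : (Cmod (f a t - g t) <= d / 2)%R) by (eapply Rle_trans; [exact A|apply Rmin_l]).
  assert (A2 : (Cmod (f a t - g t) <= eps * (d * d) / 2)%R) by (eapply Rle_trans; [exact A|apply Rmin_r]).
  assert (B : (d / 2 <= Cmod (f a t))%R).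
  { assert (Cmod (g t) <= Cmod (f a t) + Cmod (f a t - g t))%R; [|lra].
    rewrite <- (Cmod_opp (f a t - g t)). eapply Rle_trans; [|apply Cmod_triangle]. apply Req_le. f_equal. ring. }
  assert (N1 : f a t <> RtoC 0) by (apply Cmod_gt_0; lra).
  assert (N2 : g t <> RtoC 0) by (apply Cmod_gt_0; lra).
  replace (/ f a t - / g t) with (- (f a t - g t) / (f a t * g t)) by (field; auto).
  rewrite Cmod_div by (apply Cmult_neq_0; auto). rewrite Cmod_opp, Cmod_mult.
  apply Rmult_le_reg_r with (Cmod (f a t) * Cmod (g t))%R; [apply Rmult_lt_0_compat; lra|].
  unfold Rdiv. rewrite Rmult_assoc, Rinv_l, Rmult_1_r.
  2:{ apply Rgt_not_eq, Rmult_lt_0_compat; lra. }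
  eapply Rle_trans; [exact A2|].
  assert (d / 2 * d <= Cmod (f a t) * Cmod (g t))%R by (apply Rmult_le_compat; lra).
  assert (eps * (d / 2 * d) <= eps * (Cmod (f a t) * Cmod (g t)))%R by (apply Rmult_le_compat_l; lra). lra.
Qed.

Lemma unif_ext {T} F {FF : Filter F} D (f f' : T -> R -> C) g g' :
  (forall a t, f a t = f' a t) -> (forall t, g t = g' t) -> unif F D f g -> unif F D f' g'.
Proof.
  intros E E' [H [M HM]]. split.
  - intros eps He. generalize (H eps He). apply filter_imp. intros a A t Ht. rewrite <- E, <- E'. auto.
  - exists M. intros t Ht. rewrite <- E'. auto.
Qed.

Lemma ccont_Cmod_pt (g : R -> C) t : ccont g -> continuity_pt (fun t => Cmod (g t)) t.
Proof.
  intros H. apply continuity_pt_filterlim. intros P [eps HP]. unfold filtermap.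
  generalize (H t eps (cond_pos eps)). apply filter_imp. intros s Hs. apply HP.
  change (Rabs (Cmod (g s) - Cmod (g t)) < eps)%R.
  eapply Rle_lt_trans; [|exact Hs]. apply Rabs_le. split.
  - assert (Cmod (g t) <= Cmod (g s) + Cmod (g s - g t))%R; [|lra].
    rewrite <- (Cmod_opp (g s - g t)). eapply Rle_trans; [|apply Cmod_triangle]. apply Req_le. f_equal. ring.
  - assert (Cmod (g s) <= Cmod (g t) + Cmod (g s - g t))%R; [|lra].
    eapply Rle_trans; [|apply Cmod_triangle]. apply Req_le. f_equal. ring.
Qed.

Lemma ccont_bounded (g : R -> C) a b : ccont g -> exists M, forall t, (a <= t <= b)%R -> (Cmod (g t) <= M)%R.
Proof.
  intros H. destruct (Rle_lt_dec a b) as [L|L].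
  - destruct (continuity_ab_maj (fun t => Cmod (g t)) a b L (fun t _ => ccont_Cmod_pt g t H)) as [x [Hx _]].
    exists (Cmod (g x)). exact Hx.
  - exists 0%R. intros t Ht. lra.
Qed.

Lemma ccont_lower (g : R -> C) a b : ccont g -> (forall t, (a <= t <= b)%R -> g t <> RtoC 0) ->
  exists d, (0 < d)%R /\ forall t, (a <= t <= b)%R -> (d <= Cmod (g t))%R.
Proof.
  intros H N. destruct (Rle_lt_dec a b) as [L|L].
  - destruct (continuity_ab_min (fun t => Cmod (g t)) a b L (fun t _ => ccont_Cmod_pt g t H)) as [x [Hx Hx']].
    exists (Cmod (g x)). split; auto. apply Cmod_gt_0. now apply N.
  - exists 1%R. split; [lra|]. intros t Ht. lra.
Qed.

Lemma ccont_Rg (w : R -> C) : ccont w -> ccont (fun t => Rg (w t)).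
Proof. intros H t. apply ctends_Rg; auto. apply locally_filter. Qed.

Lemma unif_Q (w : R -> C) a b : ccont w ->
  unif eventually (fun t => (a <= t <= b)%R) (fun m t => Q m (w t)) (fun t => Rg (w t)).
Proof.
  intros Hw. destruct (ccont_bounded w a b Hw) as [B HB].
  split; [|destruct (ccont_bounded _ a b (ccont_Rg w Hw)) as [M HM]; now exists M].
  intros eps He.
  set (B' := Rmax B 0). assert (X1 := Rmax_l B 0). assert (X2 := Rmax_r B 0). fold B' in X1, X2.
  assert (HK := KQ_pos B' X2).
  assert (L := tinv_lim). apply is_lim_seq_spec in L.
  assert (He' : (0 < eps / KQ B')%R) by (apply Rdiv_lt_0_compat; lra).
  destruct (L (mkposreal _ He')) as [N HN]. exists N. intros m Hm t Ht. specialize (HN m Hm). simpl in HN.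
  rewrite Rminus_0_r, Rabs_pos_eq in HN by apply Rlt_le, tinv_pos.
  destruct (Q_lim B' (w t)) as [_ [_ [D _]]]. { specialize (HB t Ht). lra. }
  rewrite Cmod_sub_sym. eapply Rle_trans; [apply D|].
  replace eps with (KQ B' * (eps / KQ B'))%R by (field; lra). apply Rmult_le_compat_l; lra.
Qed.

Lemma unif_Rg_shift (w : R -> C) (nu0 : R) a b : ccont w ->
  unif (locally nu0) (fun t => (a <= t <= b)%R) (fun nu t => Rg (RtoC nu + w t)) (fun t => Rg (RtoC nu0 + w t)).
Proof.
  intros Hw. destruct (ccont_bounded w a b Hw) as [B HB].
  split.
  2:{ destruct (ccont_bounded (fun t => Rg (RtoC nu0 + w t)) a b) as [M HM]; [|now exists M].
      apply ccont_Rg. apply ccont_plus; auto. apply ccont_const. }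
  intros eps He.
  set (B' := (Rmax B 0 + Rabs nu0 + 1)%R). assert (X1 := Rmax_l B 0). assert (X2 := Rmax_r B 0). assert (X3 := Rabs_pos nu0).
  assert (HM := KM_pos B' ltac:(unfold B'; lra)).
  assert (He' : (0 < eps / (2 * KM B'))%R) by (apply Rdiv_lt_0_compat; lra).
  apply (locally_intro nu0 _ (Rmin 1 (eps / (2 * KM B')))). { apply Rmin_pos; lra. }
  intros nu Hnu t Ht.
  assert (H1 : (Rabs (nu - nu0) < 1)%R) by (eapply Rlt_le_trans; [exact Hnu|apply Rmin_l]).
  assert (H2 : (Rabs (nu - nu0) < eps / (2 * KM B'))%R) by (eapply Rlt_le_trans; [exact Hnu|apply Rmin_r]).
  specialize (HB t Ht).
  eapply Rle_trans; [apply (Rg_lipschitz B')|].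
  - eapply Rle_trans; [apply Cmod_triangle|]. rewrite Cmod_R. unfold B'. lra.
  - eapply Rle_trans; [apply Cmod_triangle|]. rewrite Cmod_R.
    assert (Rabs nu <= Rabs nu0 + Rabs (nu - nu0))%R.
    { replace nu with (nu0 + (nu - nu0))%R at 1 by ring. apply Rabs_triang. }
    unfold B'. lra.
  - replace (RtoC nu + w t - (RtoC nu0 + w t)) with (RtoC (nu - nu0)) by (rewrite RtoC_minus; ring).
    rewrite Cmod_R. replace eps with (2 * KM B' * (eps / (2 * KM B')))%R by (field; lra).
    apply Rmult_le_compat_l; lra.
Qed.

(* The G-integrand at [x = exp lx]: one factor Gamma(-s) is cancelled against Gamma(1-s) = -s Gamma(-s). *)
Definition Ff (nu : R) (lx s : C) : C :=
  - / s * (Rg (1 + RtoC nu + s) * Rg (1 / 2 - s)) / (Rg (- s) * Rg (RtoC nu - s)) * Cexp (s * lx).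

Definition good_path (nu : R) (g : R -> C) : Prop :=
  ccont g /\ (forall t, g t <> RtoC 0) /\ (forall t k, - g t + RtoC (INR k) <> RtoC 0) /\
  (forall t k, RtoC nu - g t + RtoC (INR k) <> RtoC 0).

Lemma good_path_h nu h : h <> 0%R -> good_path nu (fun t => (t, h) : C).
Proof.
  intros Hh. split; [apply ccont_path_h|]. repeat split; intros t; [|intros k|intros k]; intros E; apply (f_equal Im) in E; simpl in E; lra.
Qed.

Lemma good_path_v nu c : (0 < nu)%R -> (c < 0)%R -> good_path nu (fun t => (c, t) : C).
Proof.
  intros Hnu Hc. split; [apply ccont_path_v|].
  repeat split; intros t; [|intros k|intros k]; intros E; apply (f_equal Re) in E; simpl in E; try (assert (Pk := pos_INR k)); lra.
Qed.

Lemma ccont_Cexp (w : R -> C) : ccont w -> ccont (fun t => Cexp (w t)).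
Proof. intros H t. apply ctends_Cexp; auto. apply locally_filter. Qed.

Lemma ccont_opp (w : R -> C) : ccont w -> ccont (fun t => - w t).
Proof. intros H t. apply ctends_opp; auto. apply locally_filter. Qed.

Section Path.
Variables (nu : R) (lx : C) (g : R -> C).
Hypothesis (Hg : good_path nu g).

Let Hc : ccont g := proj1 Hg.
Lemma path_c1 : ccont (fun t => 1 + RtoC nu + g t). Proof. apply ccont_plus; auto. apply ccont_const. Qed.
Lemma path_c2 : ccont (fun t => 1 / 2 - g t). Proof. apply ccont_minus; auto. apply ccont_const. Qed.
Lemma path_c3 : ccont (fun t => - g t). Proof. now apply ccont_opp. Qed.
Lemma path_c4 : ccont (fun t => RtoC nu - g t). Proof. apply ccont_minus; auto. apply ccont_const. Qed.
Lemma path_c5 : ccont (fun t => Cexp (g t * lx)). Proof. apply ccont_Cexp, ccont_mult; auto. apply ccont_const. Qed.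
Lemma path_n3 t : Rg (- g t) <> RtoC 0. Proof. apply Rg_lower. apply Hg. Qed.
Lemma path_n4 t : Rg (RtoC nu - g t) <> RtoC 0. Proof. apply Rg_lower. apply Hg. Qed.

Lemma Ff_cont : ccont (fun t => Ff nu lx (g t)).
Proof.
  unfold Ff. apply ccont_mult; [|apply path_c5]. apply ccont_div.
  - apply ccont_mult.
    + apply ccont_opp. apply (ccont_ext (fun t => 1 / g t)); [intros; unfold Cdiv; ring|].
      apply ccont_div; [apply ccont_const|auto|apply Hg].
    + apply ccont_mult; apply ccont_Rg; [apply path_c1|apply path_c2].
  - apply ccont_mult; apply ccont_Rg; [apply path_c3|apply path_c4].
  - intros t. apply Cmult_neq_0; [apply path_n3|apply path_n4].
Qed.

(** Shared by two limits, n to infinity at fixed order and the order tending to nu; in both only the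
    four factors 1/Gamma move. The denominators are bounded away from 0 on compact pieces of a path
    that avoids the poles. *)
Lemma unif_frame {T} (F : (T -> Prop) -> Prop) {FF : Filter F} a b (A B D1 D2 : T -> R -> C) :
  unif F (fun t => (a <= t <= b)%R) A (fun t => Rg (1 + RtoC nu + g t)) ->
  unif F (fun t => (a <= t <= b)%R) B (fun t => Rg (1 / 2 - g t)) ->
  unif F (fun t => (a <= t <= b)%R) D1 (fun t => Rg (- g t)) ->
  unif F (fun t => (a <= t <= b)%R) D2 (fun t => Rg (RtoC nu - g t)) ->
  unif F (fun t => (a <= t <= b)%R) (fun x t => - / g t * (A x t * B x t) / (D1 x t * D2 x t) * Cexp (g t * lx)) (fun t => Ff nu lx (g t)).
Proof.
  intros HA HB H1 H2.
  destruct (ccont_lower (fun t => Rg (- g t)) a b (ccont_Rg _ path_c3) (fun t _ => path_n3 t)) as [d1 [P1 L1]].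
  destruct (ccont_lower (fun t => Rg (RtoC nu - g t)) a b (ccont_Rg _ path_c4) (fun t _ => path_n4 t)) as [d2 [P2 L2]].
  assert (I1 := unif_inv F _ _ _ d1 P1 L1 H1). assert (I2 := unif_inv F _ _ _ d2 P2 L2 H2).
  destruct (ccont_bounded (fun t => - / g t) a b) as [M1 HM1].
  { apply ccont_opp. apply (ccont_ext (fun t => 1 / g t)); [intros; unfold Cdiv; ring|].
    apply ccont_div; [apply ccont_const|auto|apply Hg]. }
  destruct (ccont_bounded _ a b path_c5) as [M2 HM2].
  assert (U1 := unif_const (T := T) F (fun t => (a <= t <= b)%R) (fun t => - / g t) M1 HM1).
  assert (U2 := unif_const (T := T) F (fun t => (a <= t <= b)%R) (fun t => Cexp (g t * lx)) M2 HM2).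
  assert (U3 := unif_mult F _ _ _ _ _ (unif_mult F _ _ _ _ _ U1 (unif_mult F _ _ _ _ _ HA HB)) I1).
  assert (U4 := unif_mult F _ _ _ _ _ (unif_mult F _ _ _ _ _ U3 I2) U2).
  (* Valid for vanishing factors as well by / 0 = 0, so nothing has to be assumed about [D1] and
     [D2] before the limit. *)
  assert (EI : forall x y : C, / (x * y) = / x * / y).
  { intros x y. destruct (Ceq_dec x 0) as [->|Hx]. { rewrite Cmult_0_l, Cinv_0. ring. }
    destruct (Ceq_dec y 0) as [->|Hy]. { rewrite Cmult_0_r, Cinv_0. ring. }
    field. auto. }
  eapply unif_ext; [auto| | |exact U4].
  - intros x t. cbv beta. unfold Cdiv. rewrite EI. ring.
  - intros t. cbv beta. unfold Ff, Cdiv. rewrite EI. ring.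
Qed.

Lemma Fapp_unif a b : unif eventually (fun t => (a <= t <= b)%R) (fun m t => Fapp nu lx m (g t)) (fun t => Ff nu lx (g t)).
Proof.
  unfold Fapp. apply (unif_frame eventually a b (fun m t => Q m (1 + RtoC nu + g t)) (fun m t => Q m (1 / 2 - g t))
    (fun m t => Q m (- g t)) (fun m t => Q m (RtoC nu - g t))).
  - apply (unif_Q (fun t => 1 + RtoC nu + g t)), path_c1.
  - apply (unif_Q (fun t => 1 / 2 - g t)), path_c2.
  - apply (unif_Q (fun t => - g t)), path_c3.
  - apply (unif_Q (fun t => RtoC nu - g t)), path_c4.
Qed.

Lemma Ff_unif a b : unif (locally nu) (fun t => (a <= t <= b)%R) (fun mu t => Ff mu lx (g t)) (fun t => Ff nu lx (g t)).
Proof.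
  assert (FF : Filter (locally nu)) by apply locally_filter.
  apply (unif_frame (locally nu) a b (fun mu t => Rg (1 + RtoC mu + g t)) (fun mu t => Rg (1 / 2 - g t))
    (fun mu t => Rg (- g t)) (fun mu t => Rg (RtoC mu - g t))).
  - eapply unif_ext; [auto| | |apply (unif_Rg_shift (fun t => 1 + g t))].
    + intros x t. cbv beta. f_equal. ring.
    + intros t. cbv beta. f_equal. ring.
    + apply ccont_plus; auto. apply ccont_const.
  - destruct (ccont_bounded _ a b (ccont_Rg _ path_c2)) as [M HM]. now apply (unif_const (locally nu) _ _ M).
  - destruct (ccont_bounded _ a b (ccont_Rg _ path_c3)) as [M HM]. now apply (unif_const (locally nu) _ _ M).
  - eapply unif_ext; [auto| | |apply (unif_Rg_shift (fun t => - g t))].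
    + intros x t. reflexivity.
    + intros t. reflexivity.
    + apply path_c3.
Qed.

End Path.

(** * Exponential decay along the horizontal lines *)

Lemma Q_shift_down m (w : C) : w + RtoC (INR (S (S m))) <> RtoC 0 ->
  Q m w = Q m (w + 1) * (w * RtoC (INR (S m))) / (w + RtoC (INR (S (S m)))).
Proof.
  intros H. apply (C_cancel_r (w + RtoC (INR (S (S m))))); auto. rewrite <- Q_succ. field. auto.
Qed.

Lemma Q_shift_up m (w : C) : w <> RtoC 0 ->
  Q m (w + 1) = Q m w * (w + RtoC (INR (S (S m)))) / (w * RtoC (INR (S m))).
Proof.
  intros H. assert (N : RtoC (INR (S m)) <> RtoC 0) by apply RtoC_nz, INR_S_nz.
  apply (C_cancel_r (w * RtoC (INR (S m)))). { now apply Cmult_neq_0. }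
  transitivity (w * Q m (w + 1) * RtoC (INR (S m))); [ring|]. rewrite Q_succ. field. auto.
Qed.

(** Each [Q] changes by an explicit linear quotient under s -> s + 1, so the ratio of the
    approximants is an elementary function of s and m. The fractions are arranged into groups that
    are bounded separately. *)
Lemma Fapp_succ nu lx m s : Im s <> 0%R ->
  Fapp nu lx m (s + 1) = - Fapp nu lx m s *
   (s / (s + 1) * ((s + 1 / 2) / (s + 1)) * ((RtoC (INR (S m)) - s) / (RtoC (INR (S m)) + 1 / 2 - s))
    * ((1 + RtoC nu + s + RtoC (INR (S (S m)))) * (RtoC (INR (S m)) + RtoC nu - s)
       / (RtoC (INR (S m)) * RtoC (INR (S m)) * (1 + RtoC nu + s) * (s + 1 - RtoC nu))) * Cexp lx).
Proof.
  intros Hs.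
  assert (NI : forall (a : R), s + RtoC a <> RtoC 0).
  { intros a E. apply Hs. apply (f_equal Im) in E. unfold Im in *. simpl in E. lra. }
  assert (NI' : forall (a : R), RtoC a - s <> RtoC 0).
  { intros a E. apply Hs. apply (f_equal Im) in E. unfold Im in *. simpl in E. lra. }
  assert (n1 : s <> RtoC 0) by (rewrite <- (Cplus_0_r s); apply NI).
  assert (n2 := NI 1%R).
  assert (n3 : 1 + RtoC nu + s <> RtoC 0).
  { rewrite <- RtoC_plus, Cplus_comm. apply NI. }
  assert (n4 : s + 1 - RtoC nu <> RtoC 0).
  { replace (s + 1 - RtoC nu) with (s + RtoC (1 - nu)) by (rewrite RtoC_minus; ring). apply NI. }
  assert (n5 := NI' (INR (S m))).
  assert (n6 : RtoC (INR (S m)) + 1 / 2 - s <> RtoC 0).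
  { rewrite <- RtoC_half, <- RtoC_plus. apply NI'. }
  assert (n7 : RtoC (INR (S m)) + RtoC nu - s <> RtoC 0).
  { rewrite <- RtoC_plus. apply NI'. }
  assert (n8 : RtoC (INR (S m)) <> RtoC 0) by apply RtoC_nz, INR_S_nz.
  assert (SS : RtoC (INR (S (S m))) = RtoC (INR (S m)) + 1) by (rewrite (S_INR (S m)), RtoC_plus; reflexivity).
  unfold Fapp.
  replace (1 + RtoC nu + (s + 1)) with ((1 + RtoC nu + s) + 1) by ring.
  rewrite (Q_shift_up m (1 + RtoC nu + s) n3).
  rewrite (Q_shift_down m (1 / 2 - (s + 1))).
  2:{ rewrite SS. replace (1 / 2 - (s + 1) + (RtoC (INR (S m)) + 1)) with (RtoC (INR (S m)) + 1 / 2 - s) by ring. auto. }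
  rewrite (Q_shift_down m (- (s + 1))).
  2:{ rewrite SS. replace (- (s + 1) + (RtoC (INR (S m)) + 1)) with (RtoC (INR (S m)) - s) by ring. auto. }
  rewrite (Q_shift_down m (RtoC nu - (s + 1))).
  2:{ rewrite SS. replace (RtoC nu - (s + 1) + (RtoC (INR (S m)) + 1)) with (RtoC (INR (S m)) + RtoC nu - s) by ring. auto. }
  replace (1 / 2 - (s + 1) + 1) with (1 / 2 - s) by ring.
  replace (- (s + 1) + 1) with (- s) by ring.
  replace (RtoC nu - (s + 1) + 1) with (RtoC nu - s) by ring.
  replace ((s + 1) * lx) with (s * lx + lx) by ring. rewrite Cexp_plus.
  replace (1 / 2 - (s + 1) + RtoC (INR (S (S m)))) with (RtoC (INR (S m)) + 1 / 2 - s) by (rewrite SS; ring).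
  replace (- (s + 1) + RtoC (INR (S (S m)))) with (RtoC (INR (S m)) - s) by (rewrite SS; ring).
  replace (RtoC nu - (s + 1) + RtoC (INR (S (S m)))) with (RtoC (INR (S m)) + RtoC nu - s) by (rewrite SS; ring).
  replace (1 / 2 - (s + 1)) with (- (s + 1 / 2)) by (field; apply RtoC_nz; lra).
  replace (RtoC nu - (s + 1)) with (- (s + 1 - RtoC nu)) by ring.
  assert (q1 : Q m (- s) <> RtoC 0).
  { apply Q_nz. intros k E. apply (NI (- INR k)%R). rewrite RtoC_opp. replace (s + - RtoC (INR k)) with (- (- s + RtoC (INR k))) by ring. rewrite E. ring. }
  assert (q2 : Q m (RtoC nu - s) <> RtoC 0).
  { apply Q_nz. intros k E. apply (NI (- (nu + INR k))%R). rewrite RtoC_opp, RtoC_plus. replace (s + - (RtoC nu + RtoC (INR k))) with (- (RtoC nu - s + RtoC (INR k))) by ring. rewrite E. ring. }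
  set (N := RtoC (INR (S m))) in *. set (A := Q m (1 + RtoC nu + s)). set (B := Q m (1 / 2 - s)).
  set (D1 := Q m (- s)) in *. set (D2 := Q m (RtoC nu - s)) in *. set (h := s + 1 / 2).
  replace (N + 1 / 2 - s) with (N + (1 / 2 - s)) in * by ring. set (r := 1 / 2 - s) in *.
  set (x := 1 + RtoC nu + s) in *. set (y := s + 1 - RtoC nu) in *. set (u := N + RtoC nu - s) in *.
  set (v := s + 1) in *. set (W := N - s) in *. set (Z := N + r) in *.
  field. repeat split; auto.
Qed.

Lemma Cmod_div_le (x y : C) (k : R) : y <> RtoC 0 -> (Cmod x <= k * Cmod y)%R -> (Cmod (x / y) <= k)%R.
Proof.
  intros Hy H. assert (P : (0 < Cmod y)%R) by now apply Cmod_gt_0.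
  rewrite Cmod_div by auto. apply Rmult_le_reg_r with (Cmod y); auto.
  unfold Rdiv. rewrite Rmult_assoc, Rinv_l, Rmult_1_r by lra. exact H.
Qed.

Lemma Cmod_mono (x y h : R) : (0 <= x)%R -> (x <= y)%R -> (Cmod (x, h) <= Cmod (y, h))%R.
Proof. intros Hx Hy. unfold Cmod. simpl. apply sqrt_le_1_alt. nra. Qed.

Lemma tinv_small eps : (0 < eps)%R -> exists N, forall m, (N <= m)%nat -> (tinv m <= eps)%R.
Proof.
  intros He. assert (L := tinv_lim). apply is_lim_seq_spec in L.
  destruct (L (mkposreal _ He)) as [N HN]. exists N. intros m Hm. specialize (HN m Hm). simpl in HN.
  rewrite Rminus_0_r, Rabs_pos_eq in HN by apply Rlt_le, tinv_pos. lra.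
Qed.

(** Two factors of the ratio are at most 1, one is at most [c1], and the last is at most 8 eps
    because (m + 3 + nu1 + |s|)/((m + 1)|s|) is small as soon as m and |s| are both large, whichever
    dominates. The thresholds are uniform in nu up to nu1. *)
Lemma Fapp_ratio (nu1 h : R) (lx : C) : (0 < nu1)%R -> h <> 0%R ->
  exists T1 N, forall nu, (0 < nu <= nu1)%R -> forall m, (N <= m)%nat -> forall t, (T1 <= t)%R ->
   (Cmod (Fapp nu lx m (t + 1, h)%R) <= exp (- (1)) * Cmod (Fapp nu lx m (t, h)))%R.
Proof.
  intros Hnu1 Hh.
  set (eta := Rabs h). assert (Pe : (0 < eta)%R) by now apply Rabs_pos_lt.
  (* In (n - s)/(n + 1/2 - s) the denominator may be as small as |h| when t is near n + 1/2, so this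
     quotient is only bounded by 1 + 1/(2 |h|). *)
  set (c1 := (1 + / (2 * eta))%R).
  assert (Pc1 : (1 <= c1)%R).
  { unfold c1. assert (0 < / (2 * eta))%R by (apply Rinv_0_lt_compat; lra). lra. }
  set (X := Cmod (Cexp lx)). assert (PX : (0 < X)%R) by (apply Cmod_gt_0, Cexp_nz).
  set (E := exp (- (1))). assert (PE : (0 < E)%R) by apply exp_pos.
  set (eps := Rmin 1 (E / (8 * c1 * X))).
  assert (P8 : (0 < 8 * c1 * X)%R) by (apply Rmult_lt_0_compat; lra).
  assert (Peps : (0 < eps)%R). { unfold eps. apply Rmin_pos; [lra|]. now apply Rdiv_lt_0_compat. }
  assert (Heps1 : (eps <= 1)%R) by apply Rmin_l.
  assert (Heps2 : (8 * c1 * X * eps <= E)%R).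
  { assert (Y := Rmin_r 1 (E / (8 * c1 * X))). fold eps in Y.
    apply Rle_trans with (8 * c1 * X * (E / (8 * c1 * X)))%R; [apply Rmult_le_compat_l; lra|].
    right. field. split; lra. }
  destruct (tinv_small eps Peps) as [N HN].
  (* The first bound keeps |s + 1 - nu| above |s|/2, the second gives 3 + nu1 <= eps |s|. *)
  set (T1 := Rmax (2 * (1 + nu1)) ((3 + nu1) / eps)).
  exists T1, N. intros nu Hnu m Hm t Ht.
  assert (Ht1 : (2 * (1 + nu1) <= t)%R) by (eapply Rle_trans; [apply Rmax_l|exact Ht]).
  assert (Ht2 : ((3 + nu1) / eps <= t)%R) by (eapply Rle_trans; [apply Rmax_r|exact Ht]).
  specialize (HN m Hm).
  set (s := (t, h) : C).
  replace ((t + 1, h)%R : C) with (s + 1).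
  2:{ unfold s, RtoC, Cplus; simpl. f_equal; ring. }
  rewrite Fapp_succ by exact Hh.
  set (n := RtoC (INR (S m))).
  assert (NI : forall (a : R), s + RtoC a <> RtoC 0).
  { intros a K. apply Hh. apply (f_equal Im) in K. simpl in K. lra. }
  assert (NI' : forall (a : R), RtoC a - s <> RtoC 0).
  { intros a K. apply Hh. apply (f_equal Im) in K. simpl in K. lra. }
  set (sig := Cmod s).
  assert (Hsig : (t <= sig)%R).
  { unfold sig. eapply Rle_trans; [apply Rle_abs|]. apply (re_le_Cmod s). }
  assert (Psig : (0 < sig)%R) by lra.
  assert (A1 : (Cmod (s / (s + 1)) <= 1)%R).
  { apply Cmod_div_le; [apply NI|]. rewrite Rmult_1_l. unfold s, RtoC, Cplus; simpl.
    rewrite Rplus_0_r. apply Cmod_mono; lra. }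
  assert (A2 : (Cmod ((s + 1 / 2) / (s + 1)) <= 1)%R).
  { apply Cmod_div_le; [apply NI|]. rewrite Rmult_1_l, <- RtoC_half. unfold s, RtoC, Cplus; simpl.
    rewrite !Rplus_0_r. apply Cmod_mono; lra. }
  assert (A3 : (Cmod ((n - s) / (n + 1 / 2 - s)) <= c1)%R).
  { apply Cmod_div_le. { unfold n. rewrite <- RtoC_half, <- RtoC_plus. apply NI'. }
    assert (Q1 : (eta <= Cmod (n + 1 / 2 - s))%R).
    { eapply Rle_trans; [|apply Im_le_Cmod]. unfold n, s, eta. rewrite <- RtoC_half. simpl. right.
      rewrite <- Rabs_Ropp. f_equal. ring. }
    assert (Q2 : (Cmod (n - s) <= Cmod (n + 1 / 2 - s) + 1 / 2)%R).
    { replace (n - s) with ((n + 1 / 2 - s) + - (1 / 2)) by ring.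
      eapply Rle_trans; [apply Cmod_triangle|]. rewrite Cmod_opp, <- RtoC_half, Cmod_R, Rabs_pos_eq; lra. }
    unfold c1. assert (Q3 : (1 / 2 <= / (2 * eta) * Cmod (n + 1 / 2 - s))%R).
    { apply Rle_trans with (/ (2 * eta) * eta)%R; [right; field; lra|].
      apply Rmult_le_compat_l; auto. left. apply Rinv_0_lt_compat. lra. }
    lra. }
  assert (Pn : (1 <= INR (S m))%R) by (apply (le_INR 1); lia).
  assert (Hn : (/ INR (S m) <= eps)%R) by exact HN.
  set (nn := INR (S m)) in *.
  assert (A4 : (Cmod ((1 + RtoC nu + s + RtoC (INR (S (S m)))) * (n + RtoC nu - s)
       / (n * n * (1 + RtoC nu + s) * (s + 1 - RtoC nu))) <= 8 * eps)%R).
  { assert (B1 : (Cmod (1 + RtoC nu + s + RtoC (INR (S (S m)))) <= nn + 2 + nu1 + sig)%R).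
    { rewrite (S_INR (S m)). fold nn. replace (1 + RtoC nu + s + RtoC (nn + 1)) with (RtoC (nn + 2 + nu) + s).
      2:{ rewrite !RtoC_plus. replace (RtoC 2) with (RtoC 1 + RtoC 1) by (rewrite <- RtoC_plus; f_equal; ring). ring. }
      eapply Rle_trans; [apply Cmod_triangle|]. rewrite Cmod_R, Rabs_pos_eq by lra. fold sig. lra. }
    assert (B2 : (Cmod (n + RtoC nu - s) <= nn + 2 + nu1 + sig)%R).
    { unfold n. rewrite <- RtoC_plus. unfold Cminus. eapply Rle_trans; [apply Cmod_triangle|].
      rewrite Cmod_opp, Cmod_R, Rabs_pos_eq by lra. fold sig. lra. }
    assert (B3 : (sig <= Cmod (1 + RtoC nu + s))%R).
    { unfold sig, s, RtoC, Cplus; simpl. rewrite Rplus_0_l, Rplus_0_l. apply Cmod_mono; lra. }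
    assert (B4 : (sig / 2 <= Cmod (s + 1 - RtoC nu))%R).
    { assert (sig <= Cmod (s + 1 - RtoC nu) + Rabs (nu - 1))%R.
      { unfold sig. rewrite <- Cmod_R. eapply Rle_trans; [|apply Cmod_triangle]. right. f_equal.
        rewrite RtoC_minus. ring. }
      assert (Rabs (nu - 1) <= 1 + nu1)%R by (apply Rabs_le; lra). lra. }
    assert (C1 : n <> RtoC 0) by (apply RtoC_nz; unfold nn in *; lra).
    assert (C2 : 1 + RtoC nu + s <> RtoC 0) by (apply Cmod_gt_0; lra).
    assert (C3 : s + 1 - RtoC nu <> RtoC 0) by (apply Cmod_gt_0; lra).
    apply Cmod_div_le. { repeat apply Cmult_neq_0; auto. }
    rewrite !Cmod_mult. unfold n. rewrite Cmod_R, Rabs_pos_eq by lra. fold nn. fold n.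
    set (Y := (nn + 2 + nu1 + sig)%R) in *.
    assert (HY : (Y <= 2 * eps * (nn * sig))%R).
    { assert (D1 : ((3 + nu1) <= eps * sig)%R).
      { apply Rle_trans with (eps * ((3 + nu1) / eps))%R; [right; field; lra|]. apply Rmult_le_compat_l; lra. }
      assert (D2 : (1 <= eps * nn)%R).
      { apply Rle_trans with (/ nn * nn)%R; [right; field; lra|]. apply Rmult_le_compat_r; lra. }
      unfold Y. assert (sig <= eps * nn * sig)%R by nra.
      assert ((3 + nu1) * nn <= eps * sig * nn)%R by (apply Rmult_le_compat_r; lra). nra. }
    apply Rle_trans with (Y * Y)%R.
    { apply Rmult_le_compat; try apply Cmod_ge_0; auto. }
    assert (PY : (0 <= Y)%R) by (unfold Y; lra).
    assert (Z1 : (Y * Y <= (2 * eps * (nn * sig)) * (2 * eps * (nn * sig)))%R) by (apply Rmult_le_compat; auto).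
    assert (Z2 : (sig * (sig / 2) <= Cmod (1 + RtoC nu + s) * Cmod (s + 1 - RtoC nu))%R).
    { apply Rmult_le_compat; lra. }
    assert (Z3 : (2 * eps * (nn * sig) * (2 * eps * (nn * sig)) <= 8 * eps * (nn * nn * (sig * (sig / 2))))%R).
    { replace (2 * eps * (nn * sig) * (2 * eps * (nn * sig)))%R with (eps * (4 * eps * (nn * nn * (sig * sig))))%R by ring.
      replace (8 * eps * (nn * nn * (sig * (sig / 2))))%R with (1 * (4 * eps * (nn * nn * (sig * sig))))%R by field.
      apply Rmult_le_compat_r; auto. apply Rmult_le_pos; [lra|]. apply Rmult_le_pos; nra. }
    assert (Z4 : (8 * eps * (nn * nn * (sig * (sig / 2))) <= 8 * eps * (nn * nn * (Cmod (1 + RtoC nu + s) * Cmod (s + 1 - RtoC nu))))%R).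
    { apply Rmult_le_compat_l; [lra|]. apply Rmult_le_compat_l; [nra|auto]. }
    lra. }
  rewrite Cmod_mult, Cmod_opp, Rmult_comm. apply Rmult_le_compat_r; [apply Cmod_ge_0|].
  rewrite !Cmod_mult. fold X.
  assert (G : (Cmod (s / (s + 1)) * Cmod ((s + 1 / 2) / (s + 1)) * Cmod ((n - s) / (n + 1 / 2 - s)) *
    Cmod ((1 + RtoC nu + s + RtoC (INR (S (S m)))) * (n + RtoC nu - s) / (n * n * (1 + RtoC nu + s) * (s + 1 - RtoC nu))) * X
    <= 1 * 1 * c1 * (8 * eps) * X)%R).
  { apply Rmult_le_compat_r; [lra|].
    repeat (apply Rmult_le_compat; [repeat apply Rmult_le_pos; apply Cmod_ge_0|apply Cmod_ge_0| |]); auto. }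
  eapply Rle_trans; [exact G|]. lra.
Qed.

(** Unit steps to the left bring any t into the initial interval, each one gaining a factor
    exp(-1). *)
Lemma geom_dom (g : R -> R) (c T1 M0 : R) : (0 <= M0)%R ->
  (forall t, (T1 <= t)%R -> (g (t + 1) <= exp (- (1)) * g t)%R) ->
  (forall t, (c <= t <= T1 + 1)%R -> (g t <= M0)%R) -> (c <= T1)%R ->
  forall t, (c <= t)%R -> (g t <= M0 * exp (T1 + 1) * exp (- t))%R.
Proof.
  intros HM Hr Hb HcT.
  assert (G : forall j t, (c <= t <= T1 + 1 + INR j)%R -> (g t <= M0 * exp (T1 + 1) * exp (- t))%R).
  { induction j as [|j IH]; intros t Ht.
    - simpl in Ht. eapply Rle_trans; [apply Hb; lra|]. rewrite Rmult_assoc, <- exp_plus.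
      rewrite <- (Rmult_1_r M0) at 1. apply Rmult_le_compat_l; auto.
      apply Rle_trans with (exp 0); [rewrite exp_0; lra|apply exp_le; lra].
    - rewrite S_INR in Ht. destruct (Rle_lt_dec t (T1 + 1)) as [L|L].
      + apply IH. generalize (pos_INR j). lra.
      + replace t with ((t - 1) + 1)%R at 1 by ring. eapply Rle_trans; [apply Hr; lra|].
        assert (X := IH (t - 1)%R ltac:(lra)).
        apply Rle_trans with (exp (- (1)) * (M0 * exp (T1 + 1) * exp (- (t - 1))))%R.
        * apply Rmult_le_compat_l; auto. left; apply exp_pos.
        * right. replace (exp (- (t - 1)))%R with (exp (- t) * exp 1)%R by (rewrite <- exp_plus; f_equal; ring). rewrite (exp_Ropp 1). field.
          apply Rgt_not_eq, exp_pos. }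
  intros t Ht. destruct (Rle_lt_dec t (T1 + 1)) as [L|L].
  - apply (G 0%nat). simpl. lra.
  - destruct (nfloor_ex (t - (T1 + 1))%R ltac:(lra)) as [j [_ Hj]].
    apply (G (S j)). rewrite S_INR. lra.
Qed.

Lemma unif_bounded {T} F {FF : Filter F} (D : R -> Prop) (f : T -> R -> C) g : unif F D f g ->
  exists M, (0 <= M)%R /\ F (fun a => forall t, D t -> (Cmod (f a t) <= M)%R).
Proof.
  intros [H [M HM]]. exists (Rmax M 0 + 1)%R. assert (X1 := Rmax_l M 0). assert (X2 := Rmax_r M 0). split; [lra|].
  generalize (H 1%R Rlt_0_1). apply filter_imp. intros a A t Ht. specialize (A t Ht). specialize (HM t Ht).
  replace (f a t) with ((f a t - g t) + g t) by ring. eapply Rle_trans; [apply Cmod_triangle|]. lra.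
Qed.

Lemma Fapp_dominated nu lx c h : (0 < nu)%R -> h <> 0%R ->
  exists M, eventually (fun m => forall t, (c <= t)%R -> (Cmod (Fapp nu lx m (t, h)) <= M * exp (- t))%R).
Proof.
  intros Hnu Hh. destruct (Fapp_ratio nu h lx Hnu Hh) as [T1 [N HN]].
  set (T2 := Rmax T1 c). assert (Y1 := Rmax_l T1 c). assert (Y2 := Rmax_r T1 c). fold T2 in Y1, Y2.
  destruct (unif_bounded eventually _ _ _ (Fapp_unif nu lx _ (good_path_h nu h Hh) c (T2 + 1))) as [M0 [PM [N2 HM]]].
  exists (M0 * exp (T2 + 1))%R. exists (N + N2)%nat. intros m Hm t Ht.
  apply (geom_dom (fun t => Cmod (Fapp nu lx m (t, h))) c T2 M0); auto.
  - intros u Hu. apply HN; [lra|lia|lra].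
  - intros u Hu. apply HM; [lia|auto].
Qed.

Lemma Ff_pointwise nu lx g t : good_path nu g -> ctends eventually (fun m => Fapp nu lx m (g t)) (Ff nu lx (g t)).
Proof.
  intros Hg eps He. destruct (Fapp_unif nu lx g Hg t t) as [H _].
  destruct (H (eps / 2)%R ltac:(lra)) as [N HN]. exists N. intros m Hm. specialize (HN m Hm t ltac:(lra)). lra.
Qed.

(** The contraction under t -> t + 1 passes from the approximants to their limit. Its threshold is
    the same for all orders up to nu0 + 1, whence one majorant for a whole neighbourhood of nu0. *)
Lemma Ff_dominated nu0 lx c h : (0 < nu0)%R -> h <> 0%R ->
  exists M, locally nu0 (fun nu => forall t, (c <= t)%R -> (Cmod (Ff nu lx (t, h)) <= M * exp (- t))%R).
Proof.
  intros Hnu Hh. destruct (Fapp_ratio (nu0 + 1) h lx ltac:(lra) Hh) as [T1 [N HN]].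
  set (T2 := Rmax T1 c). assert (Y1 := Rmax_l T1 c). assert (Y2 := Rmax_r T1 c). fold T2 in Y1, Y2.
  assert (FF : Filter (locally nu0)) by apply locally_filter.
  destruct (unif_bounded (locally nu0) _ _ _ (Ff_unif nu0 lx _ (good_path_h nu0 h Hh) c (T2 + 1))) as [M0 [PM HM]].
  exists (M0 * exp (T2 + 1))%R.
  assert (HI : locally nu0 (fun nu => (0 < nu <= nu0 + 1)%R)).
  { apply (locally_intro nu0 _ (Rmin nu0 1)). { apply Rmin_pos; lra. }
    intros nu Hn. assert (Z1 := Rmin_l nu0 1). assert (Z2 := Rmin_r nu0 1).
    apply Rabs_def2 in Hn. lra. }
  generalize (filter_and _ _ HM HI). apply filter_imp. intros nu [HM' Hnu'] t Ht.
  apply (geom_dom (fun t => Cmod (Ff nu lx (t, h))) c T2 M0); auto.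
  intros u Hu. apply Rnot_lt_le. intros Hlt.
  set (d := (Cmod (Ff nu lx (u + 1, h)%R) - exp (- (1)) * Cmod (Ff nu lx (u, h)))%R).
  assert (Hd : (0 < d / 4)%R) by (unfold d; lra).
  destruct (Ff_pointwise nu lx _ (u + 1)%R (good_path_h nu h Hh) _ Hd) as [N1 H1].
  destruct (Ff_pointwise nu lx _ u (good_path_h nu h Hh) _ Hd) as [N2 H2].
  specialize (H1 (N + N1 + N2)%nat ltac:(lia)). specialize (H2 (N + N1 + N2)%nat ltac:(lia)).
  specialize (HN nu Hnu' (N + N1 + N2)%nat ltac:(lia) u ltac:(lra)).
  set (m := (N + N1 + N2)%nat) in *.
  rewrite Cmod_sub_sym in H1.
  assert (E1 : (Cmod (Ff nu lx (u + 1, h)%R) <= Cmod (Ff nu lx (u + 1, h)%R - Fapp nu lx m (u + 1, h)%R) + Cmod (Fapp nu lx m (u + 1, h)%R))%R).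
  { eapply Rle_trans; [|apply Cmod_triangle]. right. f_equal. ring. }
  assert (E2 : (Cmod (Fapp nu lx m (u, h)) <= Cmod (Fapp nu lx m (u, h) - Ff nu lx (u, h)) + Cmod (Ff nu lx (u, h)))%R).
  { eapply Rle_trans; [|apply Cmod_triangle]. right. f_equal. ring. }
  assert (Pe := exp_pos (- (1))).
  assert (Pe1 : (exp (- (1)) <= 1)%R) by (apply Rle_trans with (exp 0); [apply exp_le; lra|rewrite exp_0; lra]).
  assert (E3 : (exp (- (1)) * Cmod (Fapp nu lx m (u, h)) <= exp (- (1)) * (Cmod (Fapp nu lx m (u, h) - Ff nu lx (u, h)) + Cmod (Ff nu lx (u, h))))%R).
  { apply Rmult_le_compat_l; lra. }
  assert (E4 : (exp (- (1)) * Cmod (Fapp nu lx m (u, h) - Ff nu lx (u, h)) <= 1 * (d / 4))%R).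
  { apply Rmult_le_compat; try lra. apply Cmod_ge_0. }
  unfold d in *. lra.
Qed.

Lemma Ff_lines_cont nu lx c h1 h2 : (0 < nu)%R -> (c < 0)%R -> (h1 < 0)%R -> (0 < h2)%R -> lines_cont (Ff nu lx) c h1 h2.
Proof.
  intros Hnu Hc Hh1 Hh2. split; [|split].
  - apply (Ff_cont nu lx (fun t => (t, h1) : C)), good_path_h. lra.
  - apply (Ff_cont nu lx (fun t => (t, h2) : C)), good_path_h. lra.
  - apply (Ff_cont nu lx (fun t => (c, t) : C)), good_path_v; auto.
Qed.

Lemma Lap_large lx : eventually (fun m => (1 <= Re (Lap lx m))%R).
Proof.
  set (K := (1 + Re lx)%R).
  destruct (nfloor_ex (exp (Rabs K)) ltac:(left; apply exp_pos)) as [N [_ HN]].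
  exists N. intros m Hm. unfold Lap, lnn. simpl.
  assert (H1 : (exp (Rabs K) <= INR (S m))%R).
  { apply le_INR in Hm. rewrite S_INR. lra. }
  assert (H2 : (Rabs K <= ln (INR (S m)))%R).
  { rewrite <- (ln_exp (Rabs K)). apply ln_le; auto. apply exp_pos. }
  assert (H3 := Rle_abs K). assert (H4 := Rabs_pos K). unfold K in *.
  change (match m with O => 1 | S _ => INR m + 1 end)%R with (INR (S m)). unfold Re in *. lra.
Qed.

Lemma Ff_loop nu lx (g : C) c h1 h2 : (0 < nu)%R -> (forall k, nu <> INR k) -> (c < 0)%R -> (h1 < 0)%R -> (0 < h2)%R ->
  ctends eventually (fun m => Gapp nu lx m) g ->
  loopval (Ff nu lx) c h1 h2 (2 * RtoC PI * Ci * g).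
Proof.
  intros Hnu Hnn Hc Hh1 Hh2 Hg.
  destruct (Fapp_dominated nu lx c h1 Hnu ltac:(lra)) as [M1 HM1].
  destruct (Fapp_dominated nu lx c h2 Hnu ltac:(lra)) as [M2 HM2].
  assert (EV := Lap_large lx).
  destruct (loop_limit eventually (Fapp nu lx) (Ff nu lx) c h1 h2 (Rmax M1 M2) (fun m => 2 * RtoC PI * Ci * Gapp nu lx m)) as [w [W1 W2]].
  - lra.
  - now apply Ff_lines_cont.
  - generalize EV. apply filter_imp. intros m Hm. now apply Fapp_loop.
  - generalize (filter_and _ _ HM1 HM2). apply filter_imp. intros m [A B] t Ht.
    assert (Pe := exp_pos (- t)). split.
    + eapply Rle_trans; [now apply A|]. apply Rmult_le_compat_r; [lra|apply Rmax_l].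
    + eapply Rle_trans; [now apply B|]. apply Rmult_le_compat_r; [lra|apply Rmax_r].
  - intros S eps He.
    destruct (Fapp_unif nu lx _ (good_path_h nu h1 ltac:(lra)) c S) as [U1 _].
    destruct (Fapp_unif nu lx _ (good_path_h nu h2 ltac:(lra)) c S) as [U2 _].
    generalize (filter_and _ _ (U1 eps He) (U2 eps He)). apply filter_imp. intros m [A B] t Ht. split; auto.
  - intros eps He. destruct (Fapp_unif nu lx _ (good_path_v nu c Hnu Hc) h1 h2) as [U1 _]. exact (U1 eps He).
  - generalize EV. apply filter_imp. intros m Hm. now apply Fapp_loop.
  - replace (2 * RtoC PI * Ci * g) with w; auto.
    apply (ctends_unique eventually (fun m => 2 * RtoC PI * Ci * Gapp nu lx m)); auto.
    apply ctends_mult; ev; auto. apply ctends_const; ev.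
Qed.

(** One loop with c < 0 avoids the poles for every positive order, so it can be kept fixed while the
    order moves; the locally uniform majorant then gives convergence of the loop integrals,
    including at orders where poles collide. *)
Lemma Ff_loop_limit nu0 lx (F : (R -> Prop) -> Prop) {FF : ProperFilter F} (v : R -> C) c h1 h2 :
  filter_le F (locally nu0) -> (0 < nu0)%R -> (c < 0)%R -> (h1 < 0)%R -> (0 < h2)%R ->
  F (fun nu => loopval (Ff nu lx) c h1 h2 (v nu)) ->
  exists w, loopval (Ff nu0 lx) c h1 h2 w /\ ctends F v w.
Proof.
  intros HF Hnu Hc Hh1 Hh2 Hv.
  destruct (Ff_dominated nu0 lx c h1 Hnu ltac:(lra)) as [M1 HM1].
  destruct (Ff_dominated nu0 lx c h2 Hnu ltac:(lra)) as [M2 HM2].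
  assert (FF' : Filter (locally nu0)) by apply locally_filter.
  apply (loop_limit F (fun nu => Ff nu lx) (Ff nu0 lx) c h1 h2 (Rmax M1 M2) v); auto.
  - lra.
  - now apply Ff_lines_cont.
  - apply HF. apply (locally_intro nu0 _ nu0 Hnu). intros nu Hn. apply Rabs_def2 in Hn. apply Ff_lines_cont; auto. lra.
  - apply HF. generalize (filter_and _ _ HM1 HM2). apply filter_imp. intros m [A B] t Ht.
    assert (Pe := exp_pos (- t)). split.
    + eapply Rle_trans; [now apply A|]. apply Rmult_le_compat_r; [lra|apply Rmax_l].
    + eapply Rle_trans; [now apply B|]. apply Rmult_le_compat_r; [lra|apply Rmax_r].
  - intros S eps He. apply HF.
    destruct (Ff_unif nu0 lx _ (good_path_h nu0 h1 ltac:(lra)) c S) as [U1 _].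
    destruct (Ff_unif nu0 lx _ (good_path_h nu0 h2 ltac:(lra)) c S) as [U2 _].
    generalize (filter_and _ _ (U1 eps He) (U2 eps He)). apply filter_imp. intros m [A B] t Ht. split; auto.
  - intros eps He. apply HF. destruct (Ff_unif nu0 lx _ (good_path_v nu0 c Hnu Hc) h1 h2) as [U1 _]. exact (U1 eps He).
Qed.

(** * Limits of the residues *)

Lemma dist_int (y : R) : (forall z : Z, y <> IZR z) -> exists d, (0 < d)%R /\ forall z : Z, (d <= Rabs (y - IZR z))%R.
Proof.
  intros H. destruct (archimed y) as [A1 A2]. set (u := up y) in *.
  assert (B : (IZR u - 1 < y)%R).
  { assert (N := H (u - 1)%Z). rewrite minus_IZR in N. lra. }
  exists (Rmin (IZR u - y) (y - (IZR u - 1)))%R. split. { apply Rmin_pos; lra. }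
  intros z. destruct (ZArith_dec.Z_lt_le_dec z u) as [L|L].
  - assert (Hz : (z <= u - 1)%Z) by lia. apply IZR_le in Hz. rewrite minus_IZR in Hz.
    eapply Rle_trans; [apply Rmin_r|]. rewrite Rabs_pos_eq; lra.
  - apply IZR_le in L. eapply Rle_trans; [apply Rmin_l|]. rewrite Rabs_left1; lra.
Qed.

Lemma exp_INR_mult (a : R) k : exp (INR k * a) = (exp a ^ k)%R.
Proof.
  induction k as [|k IH]; [simpl; rewrite Rmult_0_l; apply exp_0|].
  rewrite S_INR. simpl pow. rewrite <- IH, <- exp_plus. f_equal. ring.
Qed.

Lemma ex_series_exp (W Y : R) : ex_series (fun k => W * (Y ^ k / INR (fact k)))%R.
Proof.
  apply (ex_series_scal_l (V := R_NormedModule) W (fun k => Y ^ k / INR (fact k))%R).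
  exists (exp Y). assert (H := is_exp_Reals Y). unfold is_pseries in H.
  eapply is_series_ext; [|exact H]. intros n. rewrite pow_n_pow. unfold scal; simpl; unfold mult; simpl. reflexivity.
Qed.

Lemma cseries_finite (a : nat -> C) N :
  cseries (fun k => if le_dec k N then a k else RtoC 0) (csum a N).
Proof.
  assert (E : forall j, csum (fun k => if le_dec k N then a k else RtoC 0) (N + j) = csum a N).
  { induction j as [|j IH].
    - rewrite Nat.add_0_r. apply csum_ext. intros k Hk. destruct (le_dec k N); [reflexivity|lia].
    - rewrite Nat.add_succ_r. simpl. rewrite IH. destruct (le_dec (S (N + j)) N); [lia|]. ring. }
  unfold cseries. apply ctends_ext_loc with (fun _ => csum a N); ev.
  - exists N. intros n Hn. replace n with (N + (n - N))%nat by lia. now rewrite E.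
  - apply ctends_const; ev.
Qed.

Section Residues.
Variables (nu : R) (lx : C) (b1 b2 d1 d2 D : R).
Hypothesis (Hnu : (0 < nu)%R) (Hb1 : (0 <= b1)%R) (Hb2 : (0 <= b2)%R) (Hb : (b1 + b2 = nu)%R)
  (Hd1 : (0 < d1)%R) (Hd2 : (0 < d2)%R)
  (H1 : forall z : Z, (d1 <= Rabs (b1 - 1 / 2 - IZR z))%R)
  (H2 : forall z : Z, (d2 <= Rabs (b2 - b1 - IZR z))%R)
  (HD : forall k, (Cmod (/ RtoC (b1 + INR k)) <= D)%R).

Definition pk (k : nat) : C := RtoC (b1 + INR k).

(** Residue of the integrand at b1 + k, apart from the factor 1/(b1 + k) and the exponential, which
    [rlim] adds; the middle factor of [wres] has tended to 1. *)
Definition wlim (k : nat) : C :=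
  (- (1)) ^ k / RtoC (INR (fact k)) * (Rg (1 / 2 - pk k) * Rg (1 + RtoC nu + pk k) / Rg (RtoC b2 - pk k)).

Lemma pole_free k i : RtoC b2 - pk k + RtoC (INR i) <> RtoC 0.
Proof.
  unfold pk. rewrite <- RtoC_minus, <- RtoC_plus. apply RtoC_nz. intros E.
  assert (Z := H2 (Z.of_nat k - Z.of_nat i)). rewrite minus_IZR, <- !INR_IZR_INZ in Z.
  replace (b2 - b1 - (INR k - INR i))%R with 0%R in Z by lra. rewrite Rabs_R0 in Z. lra.
Qed.

Definition cfac (m k : nat) : C :=
  RtoC (INR (fact (S m))) / (RtoC (INR (S m)) ^ k * RtoC (INR (fact (S m - k)))).

Lemma cfac_S m k : (k < S m)%nat -> cfac m (S k) = cfac m k * RtoC ((INR (S m) - INR k) / INR (S m)).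
Proof.
  intros Hk. unfold cfac.
  assert (Nn : RtoC (INR (S m)) <> RtoC 0) by apply RtoC_nz, INR_S_nz.
  rewrite RtoC_div by apply INR_S_nz. rewrite <- minus_INR by lia.
  replace (S m - k)%nat with (S (S m - S k)) by lia.
  rewrite (fact_simpl (S m - S k)), mult_INR, RtoC_mult. rewrite Cpow_S.
  assert (N1 := fact_nz (S m - S k)). assert (N2 : RtoC (INR (S (S m - S k))) <> RtoC 0) by apply RtoC_nz, INR_S_nz.
  assert (N3 := Cpow_nz _ k Nn). field. auto.
Qed.

Lemma cfac_lim k : ctends eventually (fun m => cfac m k) (RtoC 1).
Proof.
  induction k as [|k IH].
  - apply ctends_ext with (fun _ => RtoC 1); ev; [|apply ctends_const; ev].
    intros m. unfold cfac. rewrite Nat.sub_0_r. simpl Cpow. field. apply fact_nz.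
  - apply ctends_ext_loc with (fun m => cfac m k * (1 - RtoC (INR k) * RtoC (tinv m))); ev.
    + exists k. intros m Hm. rewrite cfac_S by lia. f_equal.
      rewrite <- RtoC_mult, <- RtoC_minus. f_equal. unfold tinv. field. apply INR_S_nz.
    + assert (X : ctends eventually (fun m => cfac m k * (1 - RtoC (INR k) * RtoC (tinv m))) (1 * (1 - RtoC (INR k) * 0))).
      { apply ctends_mult; ev; auto. apply ctends_minus; ev; [apply ctends_const; ev|].
        apply ctends_mult; ev; [apply ctends_const; ev|apply ctends_tinv]. }
      replace (1 * (1 - RtoC (INR k) * 0)) with (RtoC 1) in X by ring. exact X.
Qed.

Lemma wres_lim k : ctends eventually (fun m => wres nu b1 b2 m k) (wlim k).
Proof.
  unfold wres, wlim. fold (pk k).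
  replace ((- (1)) ^ k / RtoC (INR (fact k)) * (Rg (1 / 2 - pk k) * Rg (1 + RtoC nu + pk k) / Rg (RtoC b2 - pk k)))
    with ((- (1)) ^ k / RtoC (INR (fact k)) * 1 * (Rg (1 / 2 - pk k) * Rg (1 + RtoC nu + pk k) / Rg (RtoC b2 - pk k))) by ring.
  apply ctends_mult; ev.
  - apply ctends_mult; ev; [apply ctends_const; ev|]. apply cfac_lim.
  - apply ctends_mult; ev; [apply ctends_mult; ev; apply Q_cv|].
    apply ctends_inv; ev; [|apply Q_cv]. apply Rg_lower. intros i. apply pole_free.
Qed.

(** First-order recurrence in k from the shift rules for [Q]. Its denominators stay away from 0
    because b1 - 1/2 and b2 - b1 keep a positive distance from the integers; for b1 = nu the former
    excludes half-odd orders. *)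
Lemma wres_S m k : (k < S m)%nat ->
  wres nu b1 b2 m (S k) = wres nu b1 b2 m k *
   (RtoC (/ INR (S k)) * RtoC ((INR (S m) - INR k) / INR (S m))
   * RtoC ((1 / 2 + (b1 + INR k)) / (1 + nu + (b1 + INR k))) * RtoC ((2 + nu + (b1 + INR k) + INR (S m)) / INR (S m))
   * RtoC ((INR (S m) + b2 - (b1 + INR k)) / ((INR (S m) + 1 / 2 - (b1 + INR k)) * (b2 - (b1 + INR k) - 1)))).
Proof.
  intros Hk. unfold wres. fold (cfac m (S k)). fold (cfac m k). rewrite cfac_S by auto. fold (pk k).
  assert (Pk := pos_INR k). assert (Pn : (1 <= INR (S m))%R) by (apply (le_INR 1); lia).
  set (nn := INR (S m)) in *. set (q := (b1 + INR k)%R) in *.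
  assert (E1 : RtoC (b1 + INR (S k)) = pk k + 1).
  { unfold pk. rewrite S_INR, <- RtoC_plus. f_equal. ring. }
  rewrite E1.
  assert (n1 : (nn + 1 / 2 - q)%R <> 0%R).
  { intros E. assert (Z := H1 (Z.of_nat (S m) - Z.of_nat k)). rewrite minus_IZR, <- !INR_IZR_INZ in Z.
    fold nn in Z. unfold q in E. replace (b1 - 1 / 2 - (nn - INR k))%R with 0%R in Z by lra. rewrite Rabs_R0 in Z. lra. }
  assert (n2 : (b2 - q - 1)%R <> 0%R).
  { intros E. assert (Z := H2 (Z.of_nat k + 1)). rewrite plus_IZR, <- INR_IZR_INZ in Z.
    unfold q in E. replace (b2 - b1 - (INR k + 1))%R with 0%R in Z by lra. rewrite Rabs_R0 in Z. lra. }
  assert (n3 : (nn + b2 - q)%R <> 0%R).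
  { intros E. assert (Z := H2 (Z.of_nat k - Z.of_nat (S m))). rewrite minus_IZR, <- !INR_IZR_INZ in Z.
    fold nn in Z. unfold q in E. replace (b2 - b1 - (INR k - nn))%R with 0%R in Z by lra. rewrite Rabs_R0 in Z. lra. }
  assert (n4 : (1 + nu + q)%R <> 0%R) by (unfold q; lra).
  assert (SS : RtoC (INR (S (S m))) = RtoC nn + 1) by (rewrite (S_INR (S m)), RtoC_plus; reflexivity).
  assert (Ep : pk k = RtoC q) by reflexivity.
  replace (1 + RtoC nu + (pk k + 1)) with ((1 + RtoC nu + pk k) + 1) by ring.
  rewrite (Q_shift_up m (1 + RtoC nu + pk k)).
  2:{ rewrite Ep, <- !RtoC_plus. now apply RtoC_nz. }
  rewrite (Q_shift_down m (1 / 2 - (pk k + 1))).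
  2:{ rewrite SS, Ep, <- RtoC_half. rewrite <- !RtoC_plus, <- !RtoC_minus, <- !RtoC_plus. apply RtoC_nz. lra. }
  rewrite (Q_shift_down m (RtoC b2 - (pk k + 1))).
  2:{ rewrite SS, Ep. rewrite <- !RtoC_plus, <- !RtoC_minus, <- !RtoC_plus. apply RtoC_nz. lra. }
  replace (1 / 2 - (pk k + 1) + 1) with (1 / 2 - pk k) by ring.
  replace (RtoC b2 - (pk k + 1) + 1) with (RtoC b2 - pk k) by ring.
  replace (1 / 2 - (pk k + 1) + RtoC (INR (S (S m)))) with (RtoC (nn + 1 / 2 - q)).
  2:{ rewrite SS, Ep, RtoC_minus, RtoC_plus, RtoC_half. ring. }
  replace (RtoC b2 - (pk k + 1) + RtoC (INR (S (S m)))) with (RtoC (nn + b2 - q)).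
  2:{ rewrite SS, Ep, RtoC_minus, RtoC_plus. ring. }
  replace (1 + RtoC nu + pk k + RtoC (INR (S (S m)))) with (RtoC (2 + nu + q + nn)).
  2:{ rewrite SS, Ep, !RtoC_plus. replace (RtoC 2) with (RtoC 1 + RtoC 1) by (rewrite <- RtoC_plus; f_equal; ring). ring. }
  replace (1 / 2 - (pk k + 1)) with (- RtoC (1 / 2 + q)).
  2:{ rewrite Ep, RtoC_plus, RtoC_half. field. }
  replace (RtoC b2 - (pk k + 1)) with (RtoC (b2 - q - 1)).
  2:{ rewrite Ep, !RtoC_minus. ring. }
  replace (1 + RtoC nu + pk k) with (RtoC (1 + nu + q)).
  2:{ rewrite Ep, !RtoC_plus. ring. }
  assert (Nq : Q m (RtoC b2 - pk k) <> RtoC 0) by (apply Q_nz; intros i; apply pole_free).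
  rewrite !RtoC_div, !RtoC_mult, RtoC_inv by (auto; try apply INR_S_nz; try lra; apply Rmult_integral_contrapositive; auto).
  rewrite fact_simpl, mult_INR, RtoC_mult, Cpow_S.
  assert (Z1 := fact_nz k). assert (Z2 : RtoC (INR (S k)) <> RtoC 0) by apply RtoC_nz, INR_S_nz.
  assert (Z3 : RtoC nn <> RtoC 0) by (apply RtoC_nz; lra).
  assert (Z4 := RtoC_nz _ n1). assert (Z5 := RtoC_nz _ n2). assert (Z6 := RtoC_nz _ n3). assert (Z7 := RtoC_nz _ n4).
  change (INR (S m)) with nn. field. repeat split; auto.
Qed.

(** Bound for k + 1 times the ratio of consecutive weights, uniform in m and in k <= m; it makes the
    weights decay like CW^k / k!. *)
Definition CW : R := ((4 + 2 * nu) * ((1 + Rabs (b2 - 1 / 2) / d1) / d2))%R.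

Lemma CW_pos : (0 < CW)%R.
Proof.
  unfold CW. assert (P := Rabs_pos (b2 - 1 / 2)).
  assert (0 <= Rabs (b2 - 1 / 2) / d1)%R by (apply Rdiv_le_0_compat; auto).
  apply Rmult_lt_0_compat; [lra|]. apply Rdiv_lt_0_compat; lra.
Qed.

Lemma wres_bound m k : (k <= S m)%nat ->
  (Cmod (wres nu b1 b2 m k) <= Cmod (wres nu b1 b2 m 0) * (CW ^ k / INR (fact k)))%R.
Proof.
  induction k as [|k IH]; intros Hk.
  - simpl. lra.
  - specialize (IH ltac:(lia)). rewrite wres_S by lia.
    assert (Pk := pos_INR k). assert (Pn : (1 <= INR (S m))%R) by (apply (le_INR 1); lia).
    assert (Hkn : (INR k + 1 <= INR (S m))%R) by (rewrite <- S_INR; apply le_INR; lia).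
    set (nn := INR (S m)) in *.
    assert (Pk1 : (0 < INR (S k))%R) by (apply lt_0_INR; lia).
    rewrite !Cmod_mult, !Cmod_R.
    assert (A1 : (Rabs ((nn - INR k) / nn) <= 1)%R).
    { rewrite Rabs_pos_eq by (apply Rdiv_le_0_compat; lra).
      apply Rmult_le_reg_r with nn; [lra|]. unfold Rdiv. rewrite Rmult_assoc, Rinv_l; lra. }
    assert (A2 : (Rabs ((1 / 2 + (b1 + INR k)) / (1 + nu + (b1 + INR k))) <= 1)%R).
    { rewrite Rabs_pos_eq by (apply Rdiv_le_0_compat; lra).
      apply Rmult_le_reg_r with (1 + nu + (b1 + INR k))%R; [lra|]. unfold Rdiv. rewrite Rmult_assoc, Rinv_l; lra. }
    assert (A3 : (Rabs ((2 + nu + (b1 + INR k) + nn) / nn) <= 4 + 2 * nu)%R).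
    { rewrite Rabs_pos_eq by (apply Rdiv_le_0_compat; lra).
      apply Rmult_le_reg_r with nn; [lra|]. unfold Rdiv. rewrite Rmult_assoc, Rinv_l, Rmult_1_r by lra. nra. }
    assert (A4 : (Rabs ((nn + b2 - (b1 + INR k)) / ((nn + 1 / 2 - (b1 + INR k)) * (b2 - (b1 + INR k) - 1)))
      <= (1 + Rabs (b2 - 1 / 2) / d1) / d2)%R).
    { assert (Z1 : (d1 <= Rabs (nn + 1 / 2 - (b1 + INR k)))%R).
      { assert (Z := H1 (Z.of_nat (S m) - Z.of_nat k)). rewrite minus_IZR, <- !INR_IZR_INZ in Z. fold nn in Z.
        rewrite <- Rabs_Ropp. replace (- (nn + 1 / 2 - (b1 + INR k)))%R with (b1 - 1 / 2 - (nn - INR k))%R by ring. auto. }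
      assert (Z2 : (d2 <= Rabs (b2 - (b1 + INR k) - 1))%R).
      { assert (Z := H2 (Z.of_nat k + 1)). rewrite plus_IZR, <- INR_IZR_INZ in Z.
        replace (b2 - (b1 + INR k) - 1)%R with (b2 - b1 - (INR k + 1))%R by ring. auto. }
      assert (Z3 : (Rabs (nn + b2 - (b1 + INR k)) <= Rabs (nn + 1 / 2 - (b1 + INR k)) * (1 + Rabs (b2 - 1 / 2) / d1))%R).
      { apply Rle_trans with (Rabs (nn + 1 / 2 - (b1 + INR k)) + Rabs (b2 - 1 / 2))%R.
        - eapply Rle_trans; [|apply Rabs_triang]. right. f_equal. ring.
        - assert (Rabs (b2 - 1 / 2) <= Rabs (nn + 1 / 2 - (b1 + INR k)) * (Rabs (b2 - 1 / 2) / d1))%R.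
          { apply Rle_trans with (d1 * (Rabs (b2 - 1 / 2) / d1))%R; [right; field; lra|].
            apply Rmult_le_compat_r; auto. apply Rdiv_le_0_compat; auto. apply Rabs_pos. }
          lra. }
      set (u := Rabs (nn + 1 / 2 - (b1 + INR k))) in *. set (v := Rabs (b2 - (b1 + INR k) - 1)) in *.
      unfold Rdiv at 1. rewrite Rabs_mult, Rabs_inv, Rabs_mult. fold u v.
      apply Rmult_le_reg_r with (u * v)%R; [apply Rmult_lt_0_compat; lra|].
      rewrite Rmult_assoc, Rinv_l, Rmult_1_r by (apply Rgt_not_eq, Rmult_lt_0_compat; lra).
      eapply Rle_trans; [exact Z3|].
      replace ((1 + Rabs (b2 - 1 / 2) / d1) / d2 * (u * v))%R with ((u * (1 + Rabs (b2 - 1 / 2) / d1)) * (v / d2))%R by (field; lra).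
      rewrite <- (Rmult_1_r (u * (1 + Rabs (b2 - 1 / 2) / d1))) at 1.
      assert (Zp : (0 <= Rabs (b2 - 1 / 2) / d1)%R) by (apply Rdiv_le_0_compat; auto; apply Rabs_pos).
      apply Rmult_le_compat_l; [apply Rmult_le_pos; lra|].
      apply Rmult_le_reg_r with d2; auto. unfold Rdiv. rewrite (Rmult_assoc v), Rinv_l, Rmult_1_r by lra. lra. }
    assert (A0 : Rabs (/ INR (S k)) = (/ INR (S k))%R) by (apply Rabs_pos_eq; left; now apply Rinv_0_lt_compat).
    rewrite A0.
    assert (G : (/ INR (S k) * Rabs ((nn - INR k) / nn) * Rabs ((1 / 2 + (b1 + INR k)) / (1 + nu + (b1 + INR k))) *
      Rabs ((2 + nu + (b1 + INR k) + nn) / nn) *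
      Rabs ((nn + b2 - (b1 + INR k)) / ((nn + 1 / 2 - (b1 + INR k)) * (b2 - (b1 + INR k) - 1)))
      <= / INR (S k) * 1 * 1 * (4 + 2 * nu) * ((1 + Rabs (b2 - 1 / 2) / d1) / d2))%R).
    { assert (Pi : (0 <= / INR (S k))%R) by (left; now apply Rinv_0_lt_compat).
      repeat (apply Rmult_le_compat; [repeat apply Rmult_le_pos; auto; apply Rabs_pos|apply Rabs_pos| |]); auto. lra. }
    eapply Rle_trans.
    { apply Rmult_le_compat; [apply Cmod_ge_0| |exact IH|exact G].
      repeat apply Rmult_le_pos; try apply Rabs_pos. left; now apply Rinv_0_lt_compat. }
    right. rewrite fact_simpl, mult_INR. unfold CW. simpl pow. field.
    repeat split; try apply INR_fact_neq_0; lra.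
Qed.

Definition rterm (m k : nat) : C := wres nu b1 b2 m k / RtoC (b1 + INR k) * Cexp (RtoC (b1 + INR k) * lx).
Definition rlim (k : nat) : C := wlim k / RtoC (b1 + INR k) * Cexp (RtoC (b1 + INR k) * lx).

(** The finite residue sums are series extended by zero. With [wres_bound] they have a common
    exponential majorant, so dominated convergence applies although the number of terms grows with
    m. *)
Lemma rterm_sum_lim : exists S, cseries rlim S /\ ctends eventually (fun m => csum (rterm m) (Datatypes.S m)) S.
Proof.
  set (W0 := (Cmod (wlim 0) + 1)%R).
  assert (PW : (0 <= W0)%R) by (unfold W0; generalize (Cmod_ge_0 (wlim 0)); lra).
  set (Y := (CW * exp (Re lx))%R). set (V := (W0 * D * exp (b1 * Re lx))%R).
  assert (PC := CW_pos).
  assert (PD : (0 <= D)%R) by (eapply Rle_trans; [apply Cmod_ge_0|apply (HD 0)]).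
  apply (tannery eventually (fun m k => if le_dec k (S m) then rterm m k else RtoC 0) (fun m => csum (rterm m) (S m)) rlim
    (fun k => V * (Y ^ k / INR (fact k)))%R).
  - apply ex_series_exp.
  - generalize (ctends_bounded eventually _ _ (wres_lim 0)). apply filter_imp. intros m Hm k.
    assert (Pf := INR_fact_lt_0 k). assert (Pe := exp_pos (Re lx)). assert (Pe2 := exp_pos (b1 * Re lx)).
    assert (PV : (0 <= V)%R) by (unfold V; apply Rmult_le_pos; [apply Rmult_le_pos; auto|lra]).
    assert (PY : (0 <= Y ^ k / INR (fact k))%R).
    { apply Rdiv_le_0_compat; auto. apply pow_le. unfold Y. apply Rmult_le_pos; lra. }
    destruct (le_dec k (S m)) as [L|L].
    2:{ rewrite Cmod_0. now apply Rmult_le_pos. }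
    unfold rterm, Cdiv. rewrite !Cmod_mult.
    assert (E : Cmod (Cexp (RtoC (b1 + INR k) * lx)) = (exp (b1 * Re lx) * exp (Re lx) ^ k)%R).
    { rewrite Cmod_Cexp. destruct lx as [xr xi]. simpl. rewrite <- exp_INR_mult, <- exp_plus. f_equal. ring. }
    rewrite E.
    apply Rle_trans with (W0 * (CW ^ k / INR (fact k)) * D * (exp (b1 * Re lx) * exp (Re lx) ^ k))%R.
    + apply Rmult_le_compat_r. { apply Rmult_le_pos; [lra|]. apply pow_le. lra. }
      apply Rmult_le_compat; try apply Cmod_ge_0; auto.
      eapply Rle_trans; [apply wres_bound; auto|]. apply Rmult_le_compat_r; [|exact Hm].
      apply Rdiv_le_0_compat; auto. apply pow_le. lra.
    + right. unfold V, Y. rewrite Rpow_mult_distr. unfold Rdiv. ring.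
  - intros k. apply ctends_ext_loc with (fun m => rterm m k); ev.
    + exists k. intros m Hm. destruct (le_dec k (S m)); [reflexivity|lia].
    + unfold rterm, rlim. apply ctends_mult; ev; [|apply ctends_const; ev].
      apply ctends_mult; ev; [apply wres_lim|apply ctends_const; ev].
  - exists 0%nat. intros m _. apply cseries_finite.
Qed.

End Residues.

Definition dig (w : C) : C := DRg w / Rg w.

Definition Gval (nu : R) (lx S1 S2 : C) : C :=
  - (Rg (1 / 2) * Rg (1 + RtoC nu) / Rg (RtoC nu) * (lx + dig 1 - dig (1 / 2) + dig (RtoC nu) + dig (1 + RtoC nu))) - S1 - S2.

Lemma Gapp_lim nu lx : (0 < nu)%R -> (forall z : Z, (2 * nu)%R <> IZR z) ->
  exists S1 S2, cseries (rlim nu lx 0 nu) S1 /\ cseries (rlim nu lx nu 0) S2 /\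
   ctends eventually (Gapp nu lx) (Gval nu lx S1 S2).
Proof.
  intros Hnu Hg.
  destruct (dist_int (0 - 1 / 2)) as [d1 [Pd1 K1]].
  { intros z E. assert (E2 : IZR (2 * z) = IZR (-1)) by (rewrite mult_IZR; lra). apply eq_IZR in E2. lia. }
  destruct (dist_int (nu - 0)) as [d2 [Pd2 K2]].
  { intros z E. apply (Hg (2 * z)%Z). rewrite mult_IZR. lra. }
  destruct (dist_int (nu - 1 / 2)) as [d3 [Pd3 K3]].
  { intros z E. apply (Hg (2 * z + 1)%Z). rewrite plus_IZR, mult_IZR. lra. }
  destruct (dist_int (0 - nu)) as [d4 [Pd4 K4]].
  { intros z E. apply (Hg (- 2 * z)%Z). rewrite mult_IZR. lra. }
  destruct (rterm_sum_lim nu lx 0 nu d1 d2 1) as [S1 [A1 A2]]; auto; try lra.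
  { intros k. destruct k as [|k].
    - simpl. rewrite Rplus_0_r, Cinv_0, Cmod_0. lra.
    - assert (P : (1 <= INR (S k))%R) by (apply (le_INR 1); lia). rewrite Rplus_0_l.
      rewrite Cmod_inv, Cmod_R, Rabs_pos_eq by (try lra; apply RtoC_nz; lra).
      rewrite <- Rinv_1. apply Rinv_le_contravar; lra. }
  destruct (rterm_sum_lim nu lx nu 0 d3 d4 (/ nu)) as [S2 [B1 B2]]; auto; try lra.
  { intros k. assert (P := pos_INR k). rewrite Cmod_inv, Cmod_R, Rabs_pos_eq by (try lra; apply RtoC_nz; lra).
    apply Rinv_le_contravar; lra. }
  exists S1, S2. split; [auto|split; [auto|]].
  unfold Gval.
  assert (Nn : forall k, RtoC nu + RtoC (INR k) <> RtoC 0).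
  { intros k. rewrite <- RtoC_plus. apply RtoC_nz. generalize (pos_INR k). lra. }
  assert (N1n : forall k, 1 + RtoC nu + RtoC (INR k) <> RtoC 0).
  { intros k. rewrite <- !RtoC_plus. apply RtoC_nz. generalize (pos_INR k). lra. }
  assert (N1 : forall k, 1 + RtoC (INR k) <> RtoC 0).
  { intros k. rewrite <- RtoC_plus. apply RtoC_nz. generalize (pos_INR k). lra. }
  assert (Nh : forall k, 1 / 2 + RtoC (INR k) <> RtoC 0).
  { intros k. rewrite <- RtoC_half, <- RtoC_plus. apply RtoC_nz. generalize (pos_INR k). lra. }
  apply ctends_ext with (fun m => - (Q m (1 / 2) * Q m (1 + RtoC nu) / Q m (RtoC nu)
     * (lx + (hdig 1 m - RtoC (tinv (S m))) - hdig (1 / 2) m + hdig (RtoC nu) m + hdig (1 + RtoC nu) m))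
     - csum (rterm nu lx 0 nu m) (S m) - csum (rterm nu lx nu 0 m) (S m)); ev.
  (* The term k = 0 of the first family is 0 by / 0 = 0, so the sum over k >= 1 may be taken from
     0. *)
  { intros m. unfold Gapp. rewrite (csum_shift (rterm nu lx 0 nu m)).
    replace (rterm nu lx 0 nu m 0) with (RtoC 0).
    2:{ unfold rterm, Cdiv. simpl INR. rewrite Rplus_0_r, Cinv_0. ring. }
    unfold rterm. ring. }
  apply ctends_minus; ev; [|exact B2]. apply ctends_minus; ev; [|exact A2].
  apply ctends_opp; ev. apply ctends_mult; ev.
  - apply ctends_mult; ev; [apply ctends_mult; ev; apply Q_cv|]. apply ctends_inv; ev; [|apply Q_cv].
    now apply Rg_lower.
  - replace (lx + dig 1 - dig (1 / 2) + dig (RtoC nu) + dig (1 + RtoC nu)) with (lx + (dig 1 - 0) - dig (1 / 2) + dig (RtoC nu) + dig (1 + RtoC nu)) by ring.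
    unfold dig, hdig.
    apply ctends_plus; ev; [apply ctends_plus; ev; [apply ctends_minus; ev; [apply ctends_plus; ev|]|]|].
    + apply ctends_const; ev.
    + apply ctends_minus; ev; [now apply digamma_lim|]. apply (ctends_subseq (fun m => RtoC (tinv m)) S); [intros; lia|apply ctends_tinv].
    + now apply digamma_lim.
    + now apply digamma_lim.
    + now apply digamma_lim.
Qed.

(** * Dependence of Bessel functions on the order *)

(** On a bounded interval this follows from the bounds on [Rg] and [DRg]. Beyond B + 3 the
    recurrence divides by t - 1 > 2, so the bound propagates to the right by unit steps. *)
Lemma rg_bounded_above_neg (B : R) : (0 <= B)%R ->
  exists M, (0 <= M)%R /\ forall t, (- B <= t)%R -> (Rabs (rg t) <= M)%R /\ (Rabs (drg t) <= M)%R.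
Proof.
  intros HB. set (M := (2 * KM (B + 3))%R). assert (PM := KM_pos (B + 3) ltac:(lra)).
  assert (H0 : forall t, (- B <= t <= B + 3)%R -> (Rabs (rg t) + Rabs (drg t) <= M)%R).
  { intros t Ht. assert (X : (Cmod (RtoC t) <= B + 3)%R) by (rewrite Cmod_R; apply Rabs_le; lra).
    generalize (Rg_bound _ _ X) (DRg_bound _ _ X). rewrite Rg_real, DRg_real, !Cmod_R. unfold M. lra. }
  assert (H1 : forall n t, (- B <= t <= B + 3 + INR n)%R -> (Rabs (rg t) + Rabs (drg t) <= M)%R).
  { induction n as [|n IH]; intros t Ht.
    - apply H0. simpl in Ht. lra.
    - rewrite S_INR in Ht. destruct (Rle_lt_dec t (B + 3)) as [L|L]; [apply H0; lra|].
      assert (S1 := IH (t - 1)%R ltac:(lra)).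
      assert (E1 := rg_rec (t - 1)). assert (E2 := drg_rec (t - 1)).
      replace (t - 1 + 1)%R with t in * by ring.
      assert (A1 : (2 * Rabs (rg t) <= Rabs (rg (t - 1)))%R).
      { rewrite E1, Rabs_mult, (Rabs_pos_eq (t - 1)) by lra. apply Rmult_le_compat_r; [apply Rabs_pos|lra]. }
      assert (A2 : (2 * Rabs (drg t) <= Rabs (drg (t - 1)) + Rabs (rg t))%R).
      { apply Rle_trans with (Rabs ((t - 1) * drg t)).
        - rewrite Rabs_mult, (Rabs_pos_eq (t - 1)) by lra. apply Rmult_le_compat_r; [apply Rabs_pos|lra].
        - replace ((t - 1) * drg t)%R with (drg (t - 1) + - rg t)%R by lra.
          eapply Rle_trans; [apply Rabs_triang|]. rewrite Rabs_Ropp. lra. }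
      assert (P1 := Rabs_pos (drg (t - 1))). assert (P2 := Rabs_pos (rg t)). lra. }
  exists M. split; [unfold M; lra|]. intros t Ht.
  assert (H : (Rabs (rg t) + Rabs (drg t) <= M)%R).
  { destruct (nfloor_ex (Rmax 0 (t - B - 3))) as [n Hn]; [apply Rmax_l|].
    apply (H1 (S n)). rewrite S_INR. generalize (Rmax_r 0 (t - B - 3)). lra. }
  generalize (Rabs_pos (rg t)) (Rabs_pos (drg t)). lra.
Qed.

Definition expc (x : C) (k : nat) : C := (- (1)) ^ k * x ^ k / RtoC (INR (fact k)).

Lemma Cmod_pow (x : C) k : Cmod (x ^ k) = (Cmod x ^ k)%R.
Proof. induction k as [|k IH]; simpl; [apply Cmod_1|]. now rewrite Cmod_mult, IH. Qed.

Lemma Cmod_expc x k : Cmod (expc x k) = (Cmod x ^ k / INR (fact k))%R.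
Proof.
  unfold expc, Cdiv. rewrite !Cmod_mult, !Cmod_pow, Cmod_inv by apply fact_nz.
  rewrite Cmod_R, (Rabs_pos_eq (INR (fact k))) by apply pos_INR.
  rewrite Cmod_opp, Cmod_1, pow1. unfold Rdiv. ring.
Qed.

(** With [f] equal to [rg] and x = (z/2)^2 this is (z/2)^(-mu) J_mu(z), defined for every real
    order; with [drg] it is its derivative in the order at fixed x. *)
Definition oser (f : R -> R) (x : C) (mu : R) : C := Cseries (fun k => expc x k * RtoC (f (mu + INR k + 1)%R)).

Lemma oser_dom x M k r : (Rabs r <= M)%R -> (Cmod (expc x k * RtoC r) <= M * (Cmod x ^ k / INR (fact k)))%R.
Proof.
  intros H. rewrite Cmod_mult, Cmod_expc, Cmod_R, Rmult_comm. apply Rmult_le_compat_r; auto.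
  apply Rdiv_le_0_compat; [apply pow_le, Cmod_ge_0|apply INR_fact_lt_0].
Qed.

Lemma oser_cv (f : R -> R) x mu M : (forall t, (mu <= t)%R -> (Rabs (f t) <= M)%R) ->
  cseries (fun k => expc x k * RtoC (f (mu + INR k + 1)%R)) (oser f x mu).
Proof.
  intros H. destruct (ex_cseries (fun k => expc x k * RtoC (f (mu + INR k + 1)%R)) (fun k => M * (Cmod x ^ k / INR (fact k)))%R) as [l Hl].
  - intros k. apply oser_dom, H. generalize (pos_INR k). lra.
  - apply ex_series_exp.
  - unfold oser. now rewrite (Cseries_eq _ l).
Qed.

Lemma cv_rg x mu : cseries (fun k => expc x k * RtoC (rg (mu + INR k + 1))) (oser rg x mu).
Proof.
  destruct (rg_bounded_above_neg (Rabs mu) (Rabs_pos _)) as [M [_ HM]].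
  apply oser_cv with M. intros t Ht. apply HM. generalize (Rabs_maj2 mu). lra.
Qed.

Lemma cv_drg x mu : cseries (fun k => expc x k * RtoC (drg (mu + INR k + 1))) (oser drg x mu).
Proof.
  destruct (rg_bounded_above_neg (Rabs mu) (Rabs_pos _)) as [M [_ HM]].
  apply oser_cv with M. intros t Ht. apply HM. generalize (Rabs_maj2 mu). lra.
Qed.

Lemma ctends_drg t0 : ctends (locally t0) (fun t => RtoC (drg t)) (RtoC (drg t0)).
Proof.
  rewrite <- DRg_real. apply ctends_ext with (fun t => DRg (RtoC t)).
  - apply locally_filter.
  - intros t. apply DRg_real.
  - apply ctends_DRg; [apply locally_filter|]. apply (cderive_continuous RtoC t0 1), cderive_id.
Qed.

Lemma ctends_shift (f : R -> C) (t0 a : R) (l : C) : ctends (locally (t0 + a)%R) f l ->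
  ctends (locally t0) (fun t => f (t + a)%R) l.
Proof.
  intros H eps He. destruct (H eps He) as [d Hd]. exists d. intros y Hy. apply Hd.
  change (Rabs (y - t0) < d)%R in Hy. change (Rabs ((y + a) - (t0 + a)) < d)%R.
  now replace ((y + a) - (t0 + a))%R with (y - t0)%R by ring.
Qed.

Lemma oser_drg_continuous x mu : ctends (locally mu) (oser drg x) (oser drg x mu).
Proof.
  destruct (rg_bounded_above_neg (Rabs mu + 1)) as [M [_ HM]]. { generalize (Rabs_pos mu). lra. }
  destruct (tannery (locally mu) (fun y k => expc x k * RtoC (drg (y + INR k + 1))) (oser drg x)
    (fun k => expc x k * RtoC (drg (mu + INR k + 1))) (fun k => M * (Cmod x ^ k / INR (fact k)))%R) as [L [H1 H2]].
  - apply ex_series_exp.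
  - apply (locally_intro mu _ 1); [lra|]. intros y Hy k. apply oser_dom, HM.
    apply Rabs_lt_between in Hy. generalize (pos_INR k) (Rabs_maj2 mu). lra.
  - intros k. apply ctends_mult; [apply locally_filter|apply ctends_const; apply locally_filter|].
    apply ctends_ext with (fun y => RtoC (drg (y + (INR k + 1)))); [apply locally_filter| |].
    + intros y. do 2 f_equal. ring.
    + replace (mu + INR k + 1)%R with (mu + (INR k + 1))%R by ring. apply (ctends_shift (fun t => RtoC (drg t))), ctends_drg.
  - apply filter_forall. intros y. apply cv_drg.
  - now rewrite (cseries_unique _ _ _ (cv_drg x mu) H1).
Qed.

(** Termwise differentiation: the difference quotients of the coefficients are bounded by the sup of
    [drg], uniformly in k, so they are dominated by an exponential series. *)
Lemma oser_derive x mu : cderive (oser rg x) mu (oser drg x mu).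
Proof.
  apply cderive_of_quotient.
  destruct (rg_bounded_above_neg (Rabs mu + 1)) as [M [PM HM]]. { generalize (Rabs_pos mu). lra. }
  destruct (tannery (locally' mu) (fun y k => expc x k * RtoC ((rg (y + INR k + 1) - rg (mu + INR k + 1)) / (y - mu)))
    (fun y => (oser rg x y - oser rg x mu) / RtoC (y - mu))
    (fun k => expc x k * RtoC (drg (mu + INR k + 1))) (fun k => M * (Cmod x ^ k / INR (fact k)))%R) as [L [H1 H2]].
  - apply ex_series_exp.
  - apply (locally'_intro mu _ 1); [lra|]. intros y Hn Hy k. apply oser_dom.
    unfold Rdiv. rewrite Rabs_mult, Rabs_inv.
    assert (P : (0 < Rabs (y - mu))%R) by (apply Rabs_pos_lt; lra).
    apply Rmult_le_reg_r with (Rabs (y - mu)); auto. rewrite Rmult_assoc, Rinv_l, Rmult_1_r by lra.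
    replace (Rabs (y - mu)) with (Rabs ((y + INR k + 1) - (mu + INR k + 1))) by (f_equal; ring).
    apply (bounded_variation rg drg). intros t Ht. split; [apply is_derive_rg|]. apply HM.
    replace ((y + INR k + 1) - (mu + INR k + 1))%R with (y - mu)%R in Ht by ring.
    assert (Ht2 : (Rabs (t - (mu + INR k + 1)) < 1)%R) by lra.
    apply Rabs_lt_between in Ht2. generalize (pos_INR k) (Rabs_maj2 mu). lra.
  - intros k. apply ctends_mult; [apply locally'_filter|apply ctends_const; apply locally'_filter|].
    assert (X : cderive (fun y => RtoC (rg (y + INR k + 1))) mu (RtoC (drg (mu + INR k + 1)))).
    { apply cderive_RtoC. evar_last.
      - apply (is_derive_comp rg (fun y => y + INR k + 1)%R); [apply is_derive_rg|]. auto_derive; auto.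
      - unfold scal; simpl; unfold mult; simpl. ring. }
    apply cderive_quotient in X. eapply ctends_ext_loc; [apply locally'_filter| |exact X].
    apply (locally'_intro mu _ 1); [lra|]. intros y Hn _. rewrite RtoC_div by lra. rewrite (RtoC_minus (rg _)). reflexivity.
  - apply (locally'_intro mu _ 1); [lra|]. intros y Hn _.
    apply cseries_ext with (fun k => / RtoC (y - mu) * (expc x k * RtoC (rg (y + INR k + 1)) + (- (1)) * (expc x k * RtoC (rg (mu + INR k + 1))))).
    { intros k. rewrite RtoC_div by lra. rewrite (RtoC_minus (rg _)). field. apply RtoC_nz. lra. }
    replace ((oser rg x y - oser rg x mu) / RtoC (y - mu)) with (/ RtoC (y - mu) * (oser rg x y + (- (1)) * oser rg x mu)).
    2:{ field. apply RtoC_nz. lra. }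
    apply cseries_scal, cseries_plus; [apply cv_rg|]. apply cseries_scal, cv_rg.
  - rewrite (cseries_unique _ _ _ (cv_drg x mu) H1). exact H2.
Qed.

(* [l] is a logarithm of z/2. *)
Definition jv (l : C) (mu : R) : C := Cexp (RtoC mu * l) * oser rg (Cexp (2 * l)) mu.
Definition djv (l : C) (mu : R) : C := l * jv l mu + Cexp (RtoC mu * l) * oser drg (Cexp (2 * l)) mu.

Lemma cderive_jv l mu : cderive (jv l) mu (djv l mu).
Proof.
  eapply cderive_eq; [|apply cderive_mult; [|apply oser_derive]].
  2:{ apply cderive_Cexp. apply (cderive_ext (fun t => 0 + RtoC t * l)); [intros; ring|]. apply cderive_affine. }
  unfold djv, jv. ring.
Qed.

Lemma jv_continuous l mu : ctends (locally mu) (jv l) (jv l mu).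
Proof. eapply cderive_continuous, cderive_jv. Qed.

Lemma djv_continuous l mu : ctends (locally mu) (djv l) (djv l mu).
Proof.
  assert (F : Filter (locally mu)) by apply locally_filter.
  apply ctends_plus; auto.
  - apply ctends_mult; auto; [now apply ctends_const|]. apply jv_continuous.
  - apply ctends_mult; auto; [|apply oser_drg_continuous]. apply ctends_Cexp; auto.
    apply ctends_mult; auto; [|now apply ctends_const]. apply (cderive_continuous RtoC mu 1), cderive_id.
Qed.

Lemma besselJ_jv l z mu : Cexp l = z / 2 -> (- PI < Im l <= PI)%R -> besselJ mu z = jv l mu.
Proof.
  intros Hl Hi. unfold besselJ, jv, Cpower. rewrite (Clog_unique l (z / 2)) by auto. f_equal.
  apply Cseries_eq. eapply cseries_ext; [|apply cv_rg]. intros k. cbv beta. unfold expc.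
  rewrite Gamma_eq, Rg_real. rewrite <- Hl, Cpow_mult_r.
  replace (Cexp (2 * l)) with (Cexp l ^ 2).
  2:{ rewrite <- Cexp_INR. f_equal. }
  assert (N := fact_nz k).
  (* At a pole of Gamma(mu + k + 1) the coefficient is 0 on both sides by / 0 = 0, which is the
     correct value for negative integer orders. *)
  destruct (Req_dec (rg (mu + INR k + 1)) 0) as [E|E].
  - rewrite E, Cinv_0, Cmult_0_r, Cmult_0_r. unfold Cdiv. rewrite Cinv_0. ring.
  - field. split; auto. now apply RtoC_nz.
Qed.

Lemma cseries_shift0 n (a : nat -> C) l : (forall k, (k < n)%nat -> a k = RtoC 0) ->
  cseries (fun j => a (n + j)%nat) l -> cseries a l.
Proof.
  revert a. induction n as [|n IH]; intros a H0 H; [exact H|].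
  replace l with (a O + l) by (rewrite H0 by lia; ring).
  apply cseries_decr. apply (IH (fun k => a (S k))); auto. intros k Hk. apply H0. lia.
Qed.

Lemma rg_fact n : rg (INR n + 1) = (/ INR (fact n))%R.
Proof.
  induction n as [|n IH].
  - simpl INR. rewrite Rplus_0_l, rg_1. simpl. lra.
  - assert (R := rg_rec (INR n + 1)). rewrite IH in R. rewrite fact_simpl, mult_INR.
    rewrite <- S_INR in R at 1. rewrite <- S_INR in R.
    assert (N := INR_S_nz n). assert (N2 := INR_fact_neq_0 n). rewrite Rinv_mult, R. field. auto.
Qed.

Lemma rg_neg_int n k : (k < n)%nat -> rg (- INR n + INR k + 1) = 0%R.
Proof.
  intros Hk. unfold rg. rewrite (Rg_zero (n - k - 1)); [reflexivity|].
  rewrite <- RtoC_plus. f_equal. rewrite !minus_INR by lia. simpl. ring.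
Qed.

(** The first n coefficients vanish because 1/Gamma does at 0, -1, ..., 1 - n; shifting the index by
    n reproduces the series of order n. *)
Lemma jv_neg_int l n : jv l (- INR n) = (- (1)) ^ n * jv l (INR n).
Proof.
  unfold jv. set (x := Cexp (2 * l)).
  assert (E : oser rg x (- INR n) = ((- (1)) ^ n * x ^ n) * oser rg x (INR n)).
  { apply (cseries_unique _ _ _ (cv_rg x (- INR n))).
    apply (cseries_shift0 n).
    - intros k Hk. rewrite rg_neg_int by auto. ring.
    - eapply cseries_ext; [|apply cseries_scal, cv_rg]. intros j. cbv beta.
      replace (- INR n + INR (n + j) + 1)%R with (INR j + 1)%R by (rewrite plus_INR; ring).
      replace (INR n + INR j + 1)%R with (INR (n + j) + 1)%R by (rewrite plus_INR; ring).
      rewrite !rg_fact. unfold expc. rewrite !RtoC_inv by apply INR_fact_neq_0. rewrite !Cpow_add_r.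
      assert (N1 := fact_nz j). assert (N2 := fact_nz (n + j)). field. auto. }
  rewrite E. unfold x. rewrite <- Cexp_INR.
  replace (Cexp (RtoC (INR n) * l)) with (Cexp (RtoC (- INR n) * l) * Cexp (RtoC (INR n) * (2 * l))).
  - ring.
  - rewrite <- Cexp_plus. f_equal. rewrite RtoC_opp. ring.
Qed.

(** * The Bessel function of the second kind as a limit in the order *)

Definition yq (l : C) (mu : R) : C := (jv l mu * RtoC (cos (PI * mu)) - jv l (- mu)) / RtoC (sin (PI * mu)).

Lemma yq_continuous l mu : sin (PI * mu) <> 0%R -> ctends (locally' mu) (yq l) (yq l mu).
Proof.
  intros Hs. apply ctends_filter_le with (locally mu). { intros P [d Hd]. exists d. intros y Hy _. auto. }
  assert (F : Filter (locally mu)) by apply locally_filter.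
  assert (D1 : is_derive (fun t => cos (PI * t)) mu (- PI * sin (PI * mu))%R) by (auto_derive; auto; ring).
  assert (D2 : is_derive (fun t => sin (PI * t)) mu (PI * cos (PI * mu))%R) by (auto_derive; auto; ring).
  unfold yq. apply ctends_mult; auto.
  - apply ctends_minus; auto.
    + apply ctends_mult; auto; [apply jv_continuous|].
      exact (cderive_continuous (fun t => RtoC (cos (PI * t))) mu _ (cderive_RtoC _ _ _ D1)).
    + assert (D3 : filterlim Ropp (locally mu) (locally (- mu)%R)).
      { apply (filterlim_opp (K := R_AbsRing) (V := R_NormedModule)). }
      intros eps He. exact (D3 _ (jv_continuous l (- mu)%R eps He)).
  - apply ctends_inv; auto. { now apply RtoC_nz. }
    exact (cderive_continuous (fun t => RtoC (sin (PI * t))) mu _ (cderive_RtoC _ _ _ D2)).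
Qed.

Lemma cos_sin_int (n : Z) : sin (PI * IZR n) = 0%R /\ cos (PI * IZR n) <> 0%R.
Proof.
  assert (S : sin (PI * IZR n) = 0%R) by (apply sin_eq_0_1; exists n; ring).
  split; auto. intros E. assert (H := sin2_cos2 (PI * IZR n)). unfold Rsqr in H. rewrite S, E in H. lra.
Qed.

Lemma jv_int_zero l (n : nat) : jv l (INR n) * RtoC (cos (PI * INR n)) - jv l (- INR n) = RtoC 0.
Proof.
  rewrite jv_neg_int.
  assert (E : RtoC (cos (PI * INR n)) = (- (1)) ^ n).
  { induction n as [|n IH].
    - simpl. now rewrite Rmult_0_r, cos_0.
    - rewrite S_INR. replace (PI * (INR n + 1))%R with (PI * INR n + PI)%R by ring.
      rewrite neg_cos, RtoC_opp, IH, Cpow_S. ring. }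
  rewrite E. ring.
Qed.

(* At an integer order both numerator and denominator of [yq] vanish; the limit is the quotient of their derivatives. *)
Lemma yq_int_limit l (n : nat) : exists y, ctends (locally' (INR n)) (yq l) y.
Proof.
  set (mu := INR n). set (N := fun t => jv l t * RtoC (cos (PI * t)) - jv l (- t)).
  assert (DN : exists d, cderive N mu d).
  { eexists. apply cderive_minus.
    - apply cderive_mult; [apply cderive_jv|]. apply (cderive_RtoC (fun t => cos (PI * t)) mu (- PI * sin (PI * mu))%R).
      auto_derive; auto; ring.
    - apply (is_derive_comp (K := R_AbsRing) (V := C_R_NormedModule) (jv l) (fun t => - t)%R mu (djv l (- mu)%R) (- (1))%R).
      + apply cderive_jv.
      + auto_derive; auto. }
  destruct DN as [d Hd].
  assert (DS : cderive (fun t => RtoC (sin (PI * t))) mu (RtoC (PI * cos (PI * mu)))).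
  { apply (cderive_RtoC (fun t => sin (PI * t))). auto_derive; auto; ring. }
  destruct (cos_sin_int (Z.of_nat n)) as [Sz Cn]. rewrite <- INR_IZR_INZ in Sz, Cn. fold mu in Sz, Cn.
  apply cderive_quotient in Hd. apply cderive_quotient in DS.
  exists (d * / RtoC (PI * cos (PI * mu))).
  assert (F : Filter (locally' mu)) by apply locally'_filter.
  assert (Nc : RtoC (PI * cos (PI * mu)) <> RtoC 0).
  { apply RtoC_nz. apply Rmult_integral_contrapositive. split; auto. apply PI_neq0. }
  assert (DI := ctends_inv _ _ _ Nc DS). assert (DM := ctends_mult _ _ _ _ _ Hd DI).
  eapply ctends_ext_loc; [apply F| |exact DM].
  apply (locally'_intro mu _ 1); [lra|]. intros y Hn _. cbv beta.
  assert (N0 : N mu = RtoC 0) by exact (jv_int_zero l n). rewrite N0, Sz.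
  unfold yq. fold (N y). assert (Hy := RtoC_nz (y - mu) ltac:(lra)).
  destruct (Req_dec (sin (PI * y)) 0) as [E|E].
  - rewrite E. unfold Cdiv. replace ((RtoC 0 - RtoC 0) * / RtoC (y - mu)) with (RtoC 0) by ring. rewrite Cinv_0. ring.
  - assert (Hs := RtoC_nz _ E). field. split; auto.
Qed.

(** At a non-integer order this is continuity of the quotient; at an integer it is the defining
    limit, whose existence [yq_int_limit] provides. Both branches thus enter the final passage to
    the limit in the same form. *)
Lemma besselY_limit l z nu : (0 < nu)%R -> Cexp l = z / 2 -> (- PI < Im l <= PI)%R ->
  ctends (locally' nu) (yq l) (besselY nu z).
Proof.
  intros Hnu Hl Hi.
  assert (E : forall mu, besselY_quotient mu z = yq l mu).
  { intros mu. unfold besselY_quotient, yq. now rewrite !(besselJ_jv l z). }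
  unfold besselY. destruct (Req_EM_T (frac_part nu) 0) as [F|F].
  - assert (En : exists n, nu = INR n).
    { unfold frac_part in F.
      assert (Z : (0 <= Int_part nu)%Z) by (apply le_IZR; lra).
      destruct (IZN _ Z) as [n Hn]. exists n. rewrite INR_IZR_INZ, <- Hn. lra. }
    destruct En as [n ->]. destruct (yq_int_limit l n) as [y Hy].
    assert (Hq : ctends (locally' (INR n)) (fun mu => besselY_quotient mu z) y).
    { eapply ctends_ext; [apply locally'_filter| |exact Hy]. intros; symmetry; apply E. }
    assert (Y := the_filterlim _ _ _ Hq). cbv beta in Y.
    match goal with |- ctends _ _ ?t => replace t with y; exact Hy end.
  - rewrite E. apply yq_continuous. intros S. apply sin_eq_0_0 in S. destruct S as [k Hk].
    apply F. assert (nu = IZR k). { apply Rmult_eq_reg_l with PI; [lra|apply PI_neq0]. }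
    subst nu. symmetry. apply (Int_part_frac_part_spec _ k); lra.
Qed.

(** * The residues in closed form *)

Lemma pochhammer_add (w : C) j k : pochhammer w (j + k) = pochhammer w j * pochhammer (w + RtoC (INR j)) k.
Proof.
  induction k as [|k IH]; [rewrite Nat.add_0_r; simpl; ring|].
  rewrite Nat.add_succ_r. simpl pochhammer. rewrite IH, plus_INR, RtoC_plus. ring.
Qed.

Lemma Rg_pochhammer (w : C) k : Rg w = pochhammer w k * Rg (w + RtoC (INR k)).
Proof.
  induction k as [|k IH]; [simpl; rewrite Cplus_0_r; ring|].
  rewrite IH, (Rg_rec (w + RtoC (INR k))). simpl pochhammer. rewrite S_INR, RtoC_plus, Cplus_assoc. ring.
Qed.

Lemma pochhammer_reflect (w : C) k : pochhammer (w - RtoC (INR k)) k = (- (1)) ^ k * pochhammer (1 - w) k.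
Proof.
  induction k as [|k IH]; [simpl; ring|].
  rewrite pochhammer_left. replace (w - RtoC (INR (S k)) + 1) with (w - RtoC (INR k)) by (rewrite S_INR, RtoC_plus; ring).
  rewrite IH. simpl pochhammer. rewrite Cpow_S, S_INR, RtoC_plus. ring.
Qed.

Lemma Rg_shift_down (w : C) k : Rg (w - RtoC (INR k)) = (- (1)) ^ k * pochhammer (1 - w) k * Rg w.
Proof.
  rewrite (Rg_pochhammer (w - RtoC (INR k)) k), pochhammer_reflect. do 2 f_equal. ring.
Qed.

(** The left side is (2 k)!/k!, so this is the duplication of Pochhammer symbols at 1/2. *)
Lemma pochhammer_central k : pochhammer (RtoC (INR k) + 1) k = 4 ^ k * pochhammer (1 / 2) k.
Proof.
  assert (D := poch_dup (1 / 2) k).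
  replace (1 / 2 + 1 / 2) with (RtoC 1) in D by field.
  replace (2 * (1 / 2)) with (RtoC 1) in D by field.
  replace (2 * k)%nat with (k + k)%nat in D by lia. rewrite pochhammer_add in D.
  assert (N : pochhammer 1 k <> RtoC 0).
  { apply pochhammer_nz. intros i. rewrite <- RtoC_plus. apply RtoC_nz. generalize (pos_INR i). lra. }
  apply (C_cancel_r (pochhammer 1 k)); auto. rewrite (Cplus_comm (RtoC (INR k))), (Cmult_comm (pochhammer (1 + _) k)).
  rewrite <- D. ring.
Qed.

Lemma nonint_shift_nz (t : R) : (forall n : Z, t <> IZR n) -> forall k, RtoC t + RtoC (INR k) <> RtoC 0.
Proof.
  intros H k. rewrite <- RtoC_plus. apply RtoC_nz. intros E. apply (H (- Z.of_nat k)%Z).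
  rewrite opp_IZR, <- INR_IZR_INZ. lra.
Qed.

Lemma nonint_opp (t : R) : (forall n : Z, t <> IZR n) -> forall n : Z, (- t)%R <> IZR n.
Proof. intros H n E. apply (H (- n)%Z). rewrite opp_IZR. lra. Qed.

Lemma nonint_succ (t : R) : (forall n : Z, t <> IZR n) -> forall n : Z, (t + 1)%R <> IZR n.
Proof. intros H n E. apply (H (n - 1)%Z). rewrite minus_IZR. lra. Qed.

Lemma nonint_nonneg_int (t : R) : (forall n : Z, t <> IZR n) -> ~ nonneg_int (RtoC t).
Proof. intros H [k E]. now apply (nonint_shift_nz t H (S k)). Qed.

(** * The 2F3 series and the two residue series *)

Definition pterm (nu : R) (k : nat) : C :=
  pochhammer (RtoC nu) k * pochhammer (1 / 2 + RtoC nu) k /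
  (pochhammer (2 * RtoC nu + 1) k * (pochhammer (RtoC nu + 1) k * pochhammer (RtoC nu + 1) k)).

Definition pratio (k : nat) (t : R) : R :=
  ((t + INR k) * (1 / 2 + t + INR k) / ((2 * t + 1 + INR k) * ((t + 1 + INR k) * (t + 1 + INR k))))%R.

Lemma denominators_nz nu : (0 < nu)%R ->
  (forall k, RtoC nu + 1 + RtoC (INR k) <> RtoC 0) /\ (forall k, 2 * RtoC nu + 1 + RtoC (INR k) <> RtoC 0) /\
  (forall k, RtoC nu + RtoC (INR k) <> RtoC 0).
Proof.
  intros H. repeat split; intros k; rewrite <- ?RtoC_mult, <- ?RtoC_plus; apply RtoC_nz; generalize (pos_INR k); lra.
Qed.

Lemma pterm_0 nu : pterm nu 0 = RtoC 1.
Proof. unfold pterm. simpl. field. Qed.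

Lemma pterm_S nu k : (0 < nu)%R -> pterm nu (S k) = pterm nu k * RtoC (pratio k nu).
Proof.
  intros H. destruct (denominators_nz nu H) as [N1 [N2 N3]]. unfold pterm, pratio. simpl pochhammer.
  assert (P := pos_INR k).
  rewrite RtoC_div, !RtoC_mult, !RtoC_plus, RtoC_mult, RtoC_half by
    (repeat (apply Rmult_integral_contrapositive; split); lra).
  assert (Q1 := pochhammer_nz _ k N1). assert (Q2 := pochhammer_nz _ k N2).
  field. repeat split; auto.
Qed.

Lemma pratio_bound nu k : (0 < nu)%R -> (Rabs (pratio k nu) <= 1)%R.
Proof.
  intros H. assert (P := pos_INR k). unfold pratio. set (n := INR k) in *.
  assert (D : (0 < (2 * nu + 1 + n) * ((nu + 1 + n) * (nu + 1 + n)))%R) by (repeat apply Rmult_lt_0_compat; lra).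
  rewrite Rabs_pos_eq.
  - apply Rmult_le_reg_r with (1 := D). unfold Rdiv. rewrite Rmult_assoc, Rinv_l, Rmult_1_r, Rmult_1_l by lra.
    rewrite (Rmult_comm (nu + n)).
    rewrite Rmult_1_l. apply Rmult_le_compat; [lra|lra|lra|].
    apply Rle_trans with ((nu + 1 + n) * 1)%R; [lra|]. apply Rmult_le_compat_l; lra.
  - apply Rdiv_le_0_compat; auto. apply Rmult_le_pos; lra.
Qed.

Lemma pterm_bound nu k : (0 < nu)%R -> (Cmod (pterm nu k) <= 1)%R.
Proof.
  intros H. induction k as [|k IH]; [rewrite pterm_0, Cmod_1; lra|].
  rewrite pterm_S by auto. rewrite Cmod_mult, Cmod_R. rewrite <- (Rmult_1_r 1).
  apply Rmult_le_compat; auto using Cmod_ge_0, Rabs_pos, pratio_bound.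
Qed.

Lemma locally_pos nu : (0 < nu)%R -> locally nu (fun y => (0 < y)%R).
Proof. intros H. apply (locally_intro nu _ nu H). intros y Hy. apply Rabs_lt_between in Hy. lra. Qed.

Lemma pterm_continuous nu k : (0 < nu)%R -> ctends (locally nu) (fun y => pterm y k) (pterm nu k).
Proof.
  intros H. assert (F : Filter (locally nu)) by apply locally_filter.
  induction k as [|k IH].
  - rewrite pterm_0. apply ctends_ext with (fun _ => RtoC 1); auto; [intros; now rewrite pterm_0|now apply ctends_const].
  - rewrite pterm_S by auto. apply ctends_ext_loc with (fun y => pterm y k * RtoC (pratio k y)); auto.
    + generalize (locally_pos nu H). apply filter_imp. intros y Hy. now rewrite pterm_S.
    + apply ctends_mult; auto. assert (P := pos_INR k).
      assert (X : ex_derive (pratio k) nu).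
      { unfold pratio. auto_derive. repeat (apply Rmult_integral_contrapositive; split); lra. }
      destruct X as [d Hd]. exact (cderive_continuous _ _ _ (cderive_RtoC _ _ _ Hd)).
Qed.

Definition pval (y : C) (nu : R) : C := Cseries (fun k => pterm nu k * (y ^ k / RtoC (INR (fact k)))).

Lemma pFq_pval nu y : pFq [RtoC nu; 1 / 2 + RtoC nu] [2 * RtoC nu + 1; RtoC nu + 1; RtoC nu + 1] y = pval y nu.
Proof.
  unfold pFq, pval. f_equal. apply FunctionalExtensionality.functional_extensionality. intros k.
  unfold pterm. simpl map. simpl Cprod. now rewrite !Cmult_1_r.
Qed.

Lemma pterm_dom y nu k : (0 < nu)%R ->
  (Cmod (pterm nu k * (y ^ k / RtoC (INR (fact k)))) <= 1 * (Cmod y ^ k / INR (fact k)))%R.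
Proof.
  intros H. assert (P := INR_fact_lt_0 k). rewrite Cmod_mult. unfold Cdiv. rewrite Cmod_mult, Cmod_pow, Cmod_inv by apply fact_nz.
  rewrite Cmod_R, (Rabs_pos_eq (INR (fact k))) by lra.
  apply Rmult_le_compat_r; [|now apply pterm_bound]. apply Rdiv_le_0_compat; auto. apply pow_le, Cmod_ge_0.
Qed.

Lemma pval_cv y nu : (0 < nu)%R -> cseries (fun k => pterm nu k * (y ^ k / RtoC (INR (fact k)))) (pval y nu).
Proof.
  intros H. destruct (ex_cseries _ _ (fun k => pterm_dom y nu k H) (ex_series_exp _ _)) as [l Hl].
  unfold pval. now rewrite (Cseries_eq _ l).
Qed.

Lemma pval_continuous y nu : (0 < nu)%R -> ctends (locally nu) (pval y) (pval y nu).
Proof.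
  intros H. assert (F : Filter (locally nu)) by apply locally_filter.
  destruct (tannery (locally nu) (fun t k => pterm t k * (y ^ k / RtoC (INR (fact k)))) (pval y)
    (fun k => pterm nu k * (y ^ k / RtoC (INR (fact k)))) (fun k => 1 * (Cmod y ^ k / INR (fact k)))%R) as [L [H1 H2]].
  - apply ex_series_exp.
  - generalize (locally_pos nu H). apply filter_imp. intros t Ht k. now apply pterm_dom.
  - intros k. apply ctends_mult; auto; [now apply pterm_continuous|now apply ctends_const].
  - generalize (locally_pos nu H). apply filter_imp. intros t Ht. now apply pval_cv.
  - now rewrite (cseries_unique _ _ _ (pval_cv y nu H) H1).
Qed.

(** The product formula for two equal orders, followed by duplication of (2 nu + 1)_{2k}, gives the
    2F3 coefficients at the argument -4 x, which is -z^2 for x = (z/2)^2. *)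
Lemma bes_a_pterm nu k (x : C) : (0 < nu)%R ->
  bes_a (RtoC nu) k * x ^ k = pterm nu k * ((- (4 * x)) ^ k / RtoC (INR (fact k))).
Proof.
  intros H. destruct (denominators_nz nu H) as [N1 [N2 N3]].
  assert (NI : ~ nonneg_int (RtoC nu)) by (intros [j E]; now apply (N3 (S j))).
  unfold bes_a. rewrite bes_product by auto.
  assert (D := poch_dup (RtoC nu + 1 / 2) k).
  replace (RtoC nu + 1 / 2 + 1 / 2) with (RtoC nu + 1) in D by field.
  replace (2 * (RtoC nu + 1 / 2)) with (2 * RtoC nu + 1) in D by field.
  replace (2 * k)%nat with (k + k)%nat in D by lia. rewrite pochhammer_add in D.
  replace (RtoC nu + RtoC nu + RtoC (INR k) + 1) with (2 * RtoC nu + 1 + RtoC (INR k)) by ring.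
  assert (E := pochhammer_left (RtoC nu) k). simpl pochhammer in E.
  assert (Q1 := pochhammer_nz _ k N1). assert (Q2 := pochhammer_nz _ k N2).
  replace (- (4 * x)) with (- (1) * (4 * x)) by ring. rewrite !Cpow_mult_l. unfold pterm.
  rewrite (Cplus_comm (1 / 2)).
  set (X := pochhammer (2 * RtoC nu + 1 + RtoC (INR k)) k) in *. set (Y := pochhammer (2 * RtoC nu + 1) k) in *.
  set (Z := pochhammer (RtoC nu + 1 / 2) k) in *. set (W := pochhammer (RtoC nu + 1) k) in *.
  set (V := pochhammer (RtoC nu) k) in *.
  assert (EX : X = Z * W * 4 ^ k / Y). { rewrite D. field. auto. }
  assert (EV : V = RtoC nu * W / (RtoC nu + RtoC (INR k))). { rewrite <- E. field. auto. }
  rewrite EX, EV. assert (Fk := fact_nz k). assert (N3k := N3 k). field. repeat split; auto.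
Qed.

Lemma Cexp_double_ln2 k l : Cexp (RtoC (INR k) * (2 * (l + RtoC (ln 2)))) = 4 ^ k * Cexp (2 * l) ^ k.
Proof.
  rewrite Cexp_INR. replace (2 * (l + RtoC (ln 2))) with (2 * l + RtoC (2 * ln 2)) by (rewrite RtoC_mult; ring).
  rewrite Cexp_plus, Cexp_RtoC, Cpow_mult_l, Cmult_comm. do 2 f_equal.
  replace (2 * ln 2)%R with (ln 2 + ln 2)%R by ring. rewrite exp_plus, exp_ln by lra. f_equal.
Qed.

Lemma Rg_half_inv : Rg (1 / 2) = / RtoC (sqrt PI).
Proof. rewrite <- RtoC_half, Rg_real, rg_half. apply RtoC_inv. apply Rgt_not_eq, sqrt_lt_R0, PI_RGT_0. Qed.

(** Moving the arguments 1/2 - k and nu - k of 1/Gamma back to 1/2 and nu produces (1/2)_k and (1 -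
    nu)_k, the symbols in the product formula for the orders nu and -nu, where (1/2)_k enters as (k
    + 1)_k / 4^k. *)
Lemma rlim_first nu l k : (0 < nu)%R -> (forall n : Z, nu <> IZR n) ->
  rlim nu (2 * (l + RtoC (ln 2))) 0 nu k = / (RtoC nu * RtoC (sqrt PI)) * (bes_b (RtoC nu) k * Cexp (2 * l) ^ k).
Proof.
  intros H Hn. destruct (denominators_nz nu H) as [N1 [N2 N3]].
  assert (SP : RtoC (sqrt PI) <> RtoC 0) by (apply RtoC_nz, Rgt_not_eq, sqrt_lt_R0, PI_RGT_0).
  unfold rlim. rewrite Rplus_0_l. destruct k as [|k].
  - simpl INR. unfold Cdiv. rewrite Cinv_0. simpl bes_b. ring.
  - set (j := S k). replace (bes_b (RtoC nu) j) with (fmul (bes (RtoC nu)) (bes (- RtoC nu)) j / RtoC (INR j)) by reflexivity.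
    rewrite bes_product; [|now apply nonint_nonneg_int|].
    2:{ rewrite <- RtoC_opp. now apply nonint_nonneg_int, nonint_opp. }
    rewrite Cexp_double_ln2.
    unfold wlim, pk. rewrite Rplus_0_l.
    replace (RtoC nu + - RtoC nu + RtoC (INR j) + 1) with (RtoC (INR j) + 1) by ring. rewrite pochhammer_central.
    rewrite !Rg_shift_down, Rg_half_inv.
    replace (1 - 1 / 2) with (1 / 2) by field.
    assert (E1 := Rg_pochhammer (1 + RtoC nu) j). rewrite (Cplus_comm 1 (RtoC nu)) in *.
    assert (E2 := Rg_rec (RtoC nu)).
    assert (M1 : pochhammer (RtoC nu + 1) j <> RtoC 0) by (apply pochhammer_nz; auto).
    assert (Hm : forall i, - RtoC nu + 1 + RtoC (INR i) <> RtoC 0).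
    { intros i. rewrite <- RtoC_opp, <- RtoC_plus. apply nonint_shift_nz. now apply nonint_succ, nonint_opp. }
    assert (M2 : pochhammer (- RtoC nu + 1) j <> RtoC 0) by (now apply pochhammer_nz).
    replace (1 - RtoC nu) with (- RtoC nu + 1) by ring.
    assert (M3 : Rg (RtoC nu + 1) <> RtoC 0) by (now apply Rg_lower).
    assert (M4 : RtoC nu <> RtoC 0) by (apply RtoC_nz; lra).
    assert (M5 : RtoC (INR j) <> RtoC 0) by apply RtoC_nz, INR_S_nz.
    assert (M6 : (- (1)) ^ j <> RtoC 0).
    { apply Cpow_nz. intros E. injection E. lra. }
    assert (Fk := fact_nz j).
    rewrite E2.
    replace (Rg (RtoC nu + 1 + RtoC (INR j))) with (Rg (RtoC nu + 1) / pochhammer (RtoC nu + 1) j).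
    2:{ rewrite E1. field. auto. }
    set (q := (- (1)) ^ j) in *.
    field. repeat split; auto.
Qed.

(** The residues at nu + k, divided by the one at nu, are the terms of the 2F3; the remaining
    constant is evaluated separately by reflection and duplication. *)
Lemma rlim_second nu l k : (0 < nu)%R -> (forall n : Z, nu <> IZR n) ->
  rlim nu (2 * (l + RtoC (ln 2))) nu 0 k =
   Rg (1 / 2 - RtoC nu) * Rg (1 + 2 * RtoC nu) / Rg (- RtoC nu) / RtoC nu * Cexp (RtoC nu * (2 * (l + RtoC (ln 2)))) *
   (pterm nu k * ((- (4 * Cexp (2 * l))) ^ k / RtoC (INR (fact k)))).
Proof.
  intros H Hn. destruct (denominators_nz nu H) as [N1 [N2 N3]].
  unfold rlim. rewrite RtoC_plus, Cmult_plus_distr_r, Cexp_plus, Cexp_double_ln2.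
  unfold wlim, pk. rewrite RtoC_plus.
  replace (1 / 2 - (RtoC nu + RtoC (INR k))) with (1 / 2 - RtoC nu - RtoC (INR k)) by ring.
  replace (RtoC 0 - (RtoC nu + RtoC (INR k))) with (- RtoC nu - RtoC (INR k)) by ring.
  rewrite !Rg_shift_down.
  replace (1 - (1 / 2 - RtoC nu)) with (1 / 2 + RtoC nu) by field.
  replace (1 - - RtoC nu) with (RtoC nu + 1) by ring.
  replace (1 + RtoC nu + (RtoC nu + RtoC (INR k))) with (2 * RtoC nu + 1 + RtoC (INR k)) by ring.
  rewrite (Cplus_comm 1 (2 * RtoC nu)).
  assert (E1 := Rg_pochhammer (2 * RtoC nu + 1) k).
  assert (M1 := pochhammer_nz _ k N1). assert (M2 := pochhammer_nz _ k N2). assert (N3k := N3 k).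
  assert (E := pochhammer_left (RtoC nu) k). simpl pochhammer in E.
  assert (M3 : Rg (- RtoC nu) <> RtoC 0).
  { apply Rg_lower. rewrite <- RtoC_opp. now apply nonint_shift_nz, nonint_opp. }
  assert (M4 : RtoC nu <> RtoC 0) by (apply RtoC_nz; lra).
  assert (M6 : (- (1)) ^ k <> RtoC 0).
  { apply Cpow_nz. intros X. injection X. lra. }
  assert (Fk := fact_nz k).
  replace (- (4 * Cexp (2 * l))) with (- (1) * (4 * Cexp (2 * l))) by ring. rewrite !Cpow_mult_l. unfold pterm.
  replace (pochhammer (RtoC nu) k) with (RtoC nu * pochhammer (RtoC nu + 1) k / (RtoC nu + RtoC (INR k))).
  2:{ rewrite <- E. field. auto. }
  rewrite E1. set (q := (- (1)) ^ k) in *. field. repeat split; auto.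
Qed.

(** * Orders away from the half-integers *)

Lemma bes_scaled mu k (x : C) : (forall i, RtoC mu + 1 + RtoC (INR i) <> RtoC 0) ->
  bes (RtoC mu) k * x ^ k = / RtoC (rg (mu + 1)) * (expc x k * RtoC (rg (mu + INR k + 1))).
Proof.
  intros N. assert (E := Rg_pochhammer (RtoC mu + 1) k).
  replace (RtoC mu + 1 + RtoC (INR k)) with (RtoC (mu + INR k + 1)) in E by (rewrite !RtoC_plus; ring).
  assert (M0 : Rg (RtoC mu + 1) <> RtoC 0) by now apply Rg_lower.
  assert (M1 := pochhammer_nz _ k N). assert (Fk := fact_nz k).
  rewrite <- RtoC_plus in E, M0. rewrite !Rg_real in E. rewrite Rg_real in M0.
  unfold bes, expc. rewrite E. rewrite RtoC_plus in *.
  assert (M2 : RtoC (rg (mu + INR k + 1)) <> RtoC 0). { intros X. apply M0. rewrite E, X. ring. }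
  field. repeat split; auto.
Qed.

Lemma hsum_dl nu k : (0 < nu)%R -> hsum (RtoC nu) k = RtoC (dl (nu + 1) - dl (nu + INR k + 1)).
Proof.
  intros H. induction k as [|k IH].
  - simpl. f_equal. rewrite Rplus_0_r. ring.
  - assert (P := pos_INR k). cbn [hsum]. rewrite IH. rewrite <- RtoC_plus, <- RtoC_inv, <- RtoC_plus by (rewrite S_INR; lra).
    f_equal. rewrite (dl_rec (nu + INR k + 1)) by lra. rewrite S_INR.
    replace (nu + (INR k + 1))%R with (nu + INR k + 1)%R by ring. ring.
Qed.

Lemma pos_succ_nz nu : (0 < nu)%R -> forall i, RtoC nu + 1 + RtoC (INR i) <> RtoC 0.
Proof. intros H. apply denominators_nz, H. Qed.

(** The quotient rule applied to rg (nu + k + 1) / rg (nu + 1), the normalised coefficient of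
    [bes_scaled], with [hsum] telescoped into a difference of logarithmic derivatives. *)
Lemma bes_e_scaled nu k (x : C) : (0 < nu)%R ->
  bes_e (RtoC nu) k * x ^ k = / RtoC (rg (nu + 1)) * (expc x k * RtoC (drg (nu + INR k + 1)) +
    - RtoC (dl (nu + 1)) * (expc x k * RtoC (rg (nu + INR k + 1)))).
Proof.
  intros H. assert (P := pos_INR k). unfold bes_e. rewrite hsum_dl by auto.
  replace (- (bes (RtoC nu) k * RtoC (dl (nu + 1) - dl (nu + INR k + 1))) * x ^ k)
    with (bes (RtoC nu) k * x ^ k * RtoC (dl (nu + INR k + 1) - dl (nu + 1))) by (rewrite !RtoC_minus; ring).
  rewrite bes_scaled by now apply pos_succ_nz.
  assert (N : rg (nu + INR k + 1) <> 0%R) by (apply rg_nz_pos; lra).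
  replace (drg (nu + INR k + 1)) with (dl (nu + INR k + 1) * rg (nu + INR k + 1))%R by (unfold dl; field; auto).
  rewrite RtoC_minus, RtoC_mult. ring.
Qed.

Lemma ex_series_Cmod_le (a : nat -> C) (b : nat -> R) : (forall k, (Cmod (a k) <= b k)%R) -> ex_series b ->
  ex_series (fun k => Cmod (a k)).
Proof.
  intros H Hb. apply (ex_series_le (K := R_AbsRing) (V := R_CompleteNormedModule) (fun k => Cmod (a k)) b); auto.
  intros n. change (Rabs (Cmod (a n)) <= b n)%R. rewrite Rabs_pos_eq by apply Cmod_ge_0. apply H.
Qed.

Lemma ex_series_Cmod_cconv (a b : nat -> C) : ex_series (fun k => Cmod (a k)) -> ex_series (fun k => Cmod (b k)) ->
  ex_series (fun k => Cmod (cconv a b k)).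
Proof.
  intros Ha Hb.
  apply ex_series_Cmod_le with (fun n => sum_f_R0 (fun k => Cmod (a k) * Cmod (b (n - k)%nat))%R n).
  - intros n. unfold cconv. apply Cmod_csum_le. intros k _. rewrite Cmod_mult. lra.
  - destruct Ha as [la Ha], Hb as [lb Hb]. exists (la * lb)%R.
    assert (A : forall c : nat -> C, forall l, is_series (fun k => Cmod (c k)) l -> ex_series (fun k => Rabs (Cmod (c k)))).
    { intros c l Hc. exists l. eapply is_series_ext; [|exact Hc]. intros n. simpl. symmetry. apply Rabs_pos_eq, Cmod_ge_0. }
    apply (is_series_mult (fun k => Cmod (a k)) (fun k => Cmod (b k))); eauto.
Qed.

Lemma cconv_weight (a b : nat -> C) (x : C) n :
  cconv (fun k => a k * x ^ k) (fun k => b k * x ^ k) n = fmul a b n * x ^ n.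
Proof.
  unfold fmul, cconv. rewrite Cmult_comm, <- csum_scal. apply csum_ext. intros k Hk.
  replace (x ^ n) with (x ^ k * x ^ (n - k)) by (rewrite <- Cpow_add_r; f_equal; lia). ring.
Qed.

Lemma bes_abs mu x : (forall i, RtoC mu + 1 + RtoC (INR i) <> RtoC 0) ->
  ex_series (fun k => Cmod (bes (RtoC mu) k * x ^ k)).
Proof.
  intros N. destruct (rg_bounded_above_neg (Rabs mu) (Rabs_pos _)) as [M [_ HM]].
  apply ex_series_Cmod_le with (fun k => (Cmod (/ RtoC (rg (mu + 1))) * M) * (Cmod x ^ k / INR (fact k)))%R; [|apply ex_series_exp].
  intros k. rewrite bes_scaled by auto. rewrite Cmod_mult, Rmult_assoc. apply Rmult_le_compat_l; [apply Cmod_ge_0|].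
  apply oser_dom. apply HM. generalize (pos_INR k) (Rabs_maj2 mu). lra.
Qed.

Lemma bes_cv mu x : (forall i, RtoC mu + 1 + RtoC (INR i) <> RtoC 0) ->
  cseries (fun k => bes (RtoC mu) k * x ^ k) (/ RtoC (rg (mu + 1)) * oser rg x mu).
Proof.
  intros N. eapply cseries_ext; [|apply cseries_scal, cv_rg]. intros k. symmetry. now apply bes_scaled.
Qed.

Lemma bes_e_cv nu x : (0 < nu)%R ->
  cseries (fun k => bes_e (RtoC nu) k * x ^ k)
    (/ RtoC (rg (nu + 1)) * (oser drg x nu + - RtoC (dl (nu + 1)) * oser rg x nu)).
Proof.
  intros H. eapply cseries_ext; [intros k; symmetry; now apply bes_e_scaled|].
  apply cseries_scal, cseries_plus; [apply cv_drg|apply cseries_scal, cv_rg].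
Qed.

Lemma bes_a_cv nu x : (0 < nu)%R ->
  cseries (fun k => bes_a (RtoC nu) k * x ^ k) (pval (- (4 * x)) nu) /\
  ex_series (fun k => Cmod (bes_a (RtoC nu) k * x ^ k)).
Proof.
  intros H. split.
  - eapply cseries_ext; [intros k; symmetry; now apply bes_a_pterm|]. now apply pval_cv.
  - apply ex_series_Cmod_le with (fun k => 1 * (Cmod (- (4 * x)) ^ k / INR (fact k)))%R; [|apply ex_series_exp].
    intros k. rewrite bes_a_pterm by auto. now apply pterm_dom.
Qed.

Lemma bes_b_abs nu x : (0 < nu)%R -> (forall n : Z, nu <> IZR n) ->
  ex_series (fun k => Cmod (bes_b (RtoC nu) k * x ^ k)).
Proof.
  intros H Hn.
  assert (N : forall i, RtoC (- nu) + 1 + RtoC (INR i) <> RtoC 0).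
  { intros i. rewrite <- RtoC_plus. now apply nonint_shift_nz, nonint_succ, nonint_opp. }
  assert (A := ex_series_Cmod_cconv _ _ (bes_abs nu x (pos_succ_nz nu H)) (bes_abs (- nu) x N)).
  eapply ex_series_Cmod_le; [|exact A]. intros k. cbv beta. rewrite cconv_weight, RtoC_opp.
  destruct k as [|k].
  - replace (bes_b (RtoC nu) 0%nat * x ^ 0) with (RtoC 0) by (simpl; ring). rewrite Cmod_0. apply Cmod_ge_0.
  - replace (bes_b (RtoC nu) (S k)) with (fmul (bes (RtoC nu)) (bes (- RtoC nu)) (S k) / RtoC (INR (S k))) by reflexivity.
    rewrite !Cmod_mult. apply Rmult_le_compat_r; [apply Cmod_ge_0|]. unfold Cdiv. rewrite Cmod_mult.
    rewrite <- (Rmult_1_r (Cmod (fmul _ _ _))) at 2. apply Rmult_le_compat_l; [apply Cmod_ge_0|].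
    assert (P : (1 <= INR (S k))%R) by (apply (le_INR 1); lia).
    rewrite Cmod_inv, Cmod_R, Rabs_pos_eq by (try apply RtoC_nz; lra). rewrite <- Rinv_1. apply Rinv_le_contravar; lra.
Qed.

(** The coefficient identity is summed at x; absolute convergence turns the formal products into
    products of sums, and the formal nu-derivative becomes an expression in [oser drg]. *)
Lemma bes_sum_identity nu x : (0 < nu)%R -> (forall n : Z, nu <> IZR n) ->
  exists b, cseries (fun k => bes_b (RtoC nu) k * x ^ k) b /\
  2 * RtoC nu * (/ RtoC (rg (nu + 1)) * (oser drg x nu + - RtoC (dl (nu + 1)) * oser rg x nu)) =
  / RtoC (rg (nu + 1)) * oser rg x nu - / RtoC (rg (- nu + 1)) * oser rg x (- nu) * pval (- (4 * x)) nu
   + RtoC nu * (/ RtoC (rg (nu + 1)) * oser rg x nu * b).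
Proof.
  intros H Hn.
  assert (N : forall i, RtoC (- nu) + 1 + RtoC (INR i) <> RtoC 0).
  { intros i. rewrite <- RtoC_plus. now apply nonint_shift_nz, nonint_succ, nonint_opp. }
  destruct (cseries_of_abs _ (bes_b_abs nu x H Hn)) as [b Hb]. exists b. split; auto.
  destruct (bes_a_cv nu x H) as [Ha Ha'].
  assert (N0 := pos_succ_nz nu H).
  assert (PV := cauchy_product _ _ _ _ (bes_cv (- nu) x N) Ha (bes_abs _ x N) Ha').
  assert (PB := cauchy_product _ _ _ _ (bes_cv nu x N0) Hb (bes_abs _ x N0) (bes_b_abs nu x H Hn)).
  apply (cseries_unique (fun k => 2 * RtoC nu * (bes_e (RtoC nu) k * x ^ k))).
  - apply cseries_scal. now apply bes_e_cv.
  - assert (T := cseries_plus _ _ _ _ (cseries_plus _ _ _ _ (bes_cv nu x N0) (cseries_scal (- (1)) _ _ PV)) (cseries_scal (RtoC nu) _ _ PB)).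
    cbv beta in T. match type of T with cseries _ ?l => replace l with
      (/ RtoC (rg (nu + 1)) * oser rg x nu - / RtoC (rg (- nu + 1)) * oser rg x (- nu) * pval (- (4 * x)) nu
   + RtoC nu * (/ RtoC (rg (nu + 1)) * oser rg x nu * b)) in T by ring end.
    eapply cseries_ext; [|exact T]. intros k. cbv beta. rewrite !cconv_weight.
    replace (2 * RtoC nu * (bes_e (RtoC nu) k * x ^ k)) with (2 * RtoC nu * bes_e (RtoC nu) k * x ^ k) by ring. rewrite (bes_identity (RtoC nu)); [rewrite RtoC_opp; ring|now apply nonint_nonneg_int| |apply RtoC_nz; lra].
    rewrite <- RtoC_opp. now apply nonint_nonneg_int, nonint_opp.
Qed.

(** The factor multiplying Y_nu in the theorem, (z/2)^(2 nu) / Gamma(nu+1)^2 times the 2F3, with l a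
    logarithm of z/2. *)
Definition aval (l : C) (nu : R) : C :=
  Cexp (2 * (RtoC nu * l)) * RtoC (rg (nu + 1)) ^ 2 * pval (- (4 * Cexp (2 * l))) nu.

(** Duplication at nu + 1/2 removes 1/Gamma(2 nu + 1); reflection at nu + 1/2 and at nu + 1 produces
    the cosine and the sine. The resulting cotangent will cancel the J_nu part of Y_nu. *)
Lemma second_residue_const nu l : (0 < nu)%R -> (forall n : Z, nu <> IZR n) ->
  Rg (1 / 2 - RtoC nu) * Rg (1 + 2 * RtoC nu) / Rg (- RtoC nu) / RtoC nu * Cexp (RtoC nu * (2 * (l + RtoC (ln 2)))) =
  - (RtoC (sqrt PI) * RtoC (cos (PI * nu)) / (RtoC nu * RtoC (sin (PI * nu)))) * (Cexp (2 * (RtoC nu * l)) * RtoC (rg (nu + 1)) ^ 2).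
Proof.
  intros H Hn.
  assert (PP := PI_RGT_0).
  assert (SP : sqrt PI <> 0%R) by apply Rgt_not_eq, sqrt_lt_R0, PI_RGT_0.
  assert (Sn : sin (PI * nu) <> 0%R).
  { intros S. apply sin_eq_0_0 in S. destruct S as [k Hk]. apply (Hn k). apply Rmult_eq_reg_l with PI; lra. }
  assert (D := rg_duplication (nu + 1 / 2)). rewrite rg_half in D.
  replace (nu + 1 / 2 + 1 / 2)%R with (nu + 1)%R in D by field.
  replace (2 * (nu + 1 / 2))%R with (2 * nu + 1)%R in D by field.
  replace ((2 * nu + 1) * ln 2)%R with (2 * nu * ln 2 + ln 2)%R in D by ring. rewrite exp_plus, exp_ln in D by lra.
  assert (R1 := rg_reflection (nu + 1 / 2)).
  replace (1 - (nu + 1 / 2))%R with (1 / 2 - nu)%R in R1 by field.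
  replace (PI * (nu + 1 / 2))%R with (PI / 2 + PI * nu)%R in R1 by field. rewrite <- cos_sin in R1.
  assert (R2 := rg_reflection (nu + 1)). replace (1 - (nu + 1))%R with (- nu)%R in R2 by ring.
  replace (PI * (nu + 1))%R with (PI * nu + PI)%R in R2 by ring. rewrite neg_sin in R2.
  assert (N1 : rg (nu + 1) <> 0%R) by (apply rg_nz_pos; lra).
  assert (E : rg (- nu) = (- sin (PI * nu) / PI / rg (nu + 1))%R) by (rewrite <- R2; field; auto).
  replace (Cexp (RtoC nu * (2 * (l + RtoC (ln 2))))) with (Cexp (2 * (RtoC nu * l)) * RtoC (exp (2 * nu * ln 2))).
  2:{ rewrite <- Cexp_RtoC, <- Cexp_plus. f_equal. rewrite !RtoC_mult. ring. }
  replace (1 / 2 - RtoC nu) with (RtoC (1 / 2 - nu)) by (rewrite RtoC_minus, RtoC_half; reflexivity).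
  replace (1 + 2 * RtoC nu) with (RtoC (2 * nu + 1)) by (rewrite RtoC_plus, RtoC_mult; ring).
  rewrite <- (RtoC_opp nu), !Rg_real.
  set (X := Cexp (2 * (RtoC nu * l))).
  assert (G : (rg (1 / 2 - nu) * rg (2 * nu + 1) / rg (- nu) / nu * exp (2 * nu * ln 2) =
    - (sqrt PI * cos (PI * nu) / (nu * sin (PI * nu))) * (rg (nu + 1) * rg (nu + 1)))%R).
  { assert (D2 : (rg (2 * nu + 1) * exp (2 * nu * ln 2) = sqrt PI * (rg (nu + 1 / 2) * rg (nu + 1)))%R).
    { apply Rmult_eq_reg_l with (2 * / sqrt PI)%R.
      - replace (2 * / sqrt PI * (sqrt PI * (rg (nu + 1 / 2) * rg (nu + 1))))%R with (2 * (rg (nu + 1 / 2) * rg (nu + 1)))%R by (field; auto).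
        rewrite D. ring.
      - apply Rmult_integral_contrapositive. split; [lra|]. now apply Rinv_neq_0_compat. }
    replace (rg (1 / 2 - nu) * rg (2 * nu + 1) / rg (- nu) / nu * exp (2 * nu * ln 2))%R
      with (rg (1 / 2 - nu) * (rg (2 * nu + 1) * exp (2 * nu * ln 2)) / rg (- nu) / nu)%R by (unfold Rdiv; ring).
    rewrite D2. replace (rg (1 / 2 - nu) * (sqrt PI * (rg (nu + 1 / 2) * rg (nu + 1))))%R
      with (rg (nu + 1 / 2) * rg (1 / 2 - nu) * sqrt PI * rg (nu + 1))%R by ring.
    rewrite R1, E. field. repeat split; auto; lra. }
  assert (N2 : rg (- nu) <> 0%R).
  { rewrite E. unfold Rdiv. repeat (apply Rmult_integral_contrapositive; split); try apply Rinv_neq_0_compat; auto; lra. }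
  apply (f_equal RtoC) in G. rewrite !RtoC_mult, !RtoC_div, RtoC_opp, RtoC_div, !RtoC_mult in G.
  replace (RtoC (rg (nu + 1)) ^ 2) with (RtoC (rg (nu + 1)) * RtoC (rg (nu + 1))) by (simpl; ring).
  match goal with |- ?a * (X * ?b) = ?c * (X * ?d) => transitivity (X * (a * b)); [ring|]; transitivity (X * (c * d)); [|ring]; f_equal end.
  exact G. all: auto; try lra; apply Rmult_integral_contrapositive; split; auto; lra.
Qed.

Lemma dig_real t : dig (RtoC t) = RtoC (dl t).
Proof.
  unfold dig, dl. rewrite Rg_real, DRg_real. destruct (Req_dec (rg t) 0) as [E|E].
  - rewrite E. unfold Cdiv, Rdiv. now rewrite Cinv_0, Rinv_0, Rmult_0_r, Cmult_0_r.
  - symmetry. now apply RtoC_div.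
Qed.

(** [dl_half] cancels the shift by ln 2, so that twice log(z/2) remains, and the recurrence of [dl]
    merges the values at nu and nu + 1 into 2 dl(nu + 1) + 1/nu. *)
Lemma Gval_first nu l : (0 < nu)%R ->
  Rg (1 / 2) * Rg (1 + RtoC nu) / Rg (RtoC nu) * (2 * (l + RtoC (ln 2)) + dig 1 - dig (1 / 2) + dig (RtoC nu) + dig (1 + RtoC nu)) =
  / (RtoC nu * RtoC (sqrt PI)) * (2 * l + 2 * RtoC (dl (nu + 1)) + / RtoC nu).
Proof.
  intros H. assert (SP : sqrt PI <> 0%R) by apply Rgt_not_eq, sqrt_lt_R0, PI_RGT_0.
  assert (N1 : rg (nu + 1) <> 0%R) by (apply rg_nz_pos; lra).
  rewrite <- RtoC_half, (Cplus_comm 1 (RtoC nu)), <- RtoC_plus, !Rg_real, !dig_real.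
  rewrite (dl_rec nu) by auto. rewrite (rg_rec nu), rg_half.
  assert (E := dl_half). replace (dl (1 / 2)) with (dl 1 + 2 * ln 2)%R by lra.
  rewrite !RtoC_plus, !RtoC_mult, !RtoC_inv by (auto; lra).
  assert (M1 := RtoC_nz _ N1). assert (M2 := RtoC_nz _ SP). assert (M3 : RtoC nu <> RtoC 0) by (apply RtoC_nz; lra).
  field. auto.
Qed.

(** The cotangent in S2 cancels the J_nu part of [yq] and leaves only J_{-nu}; the rest is
    [bes_sum_identity], whose series [b] is S1 up to a constant. *)
Lemma djv_generic nu l S1 S2 : (0 < nu)%R -> (forall n : Z, nu <> IZR n) ->
  cseries (rlim nu (2 * (l + RtoC (ln 2))) 0 nu) S1 -> cseries (rlim nu (2 * (l + RtoC (ln 2))) nu 0) S2 ->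
  djv l nu = RtoC PI / 2 * (yq l nu * aval l nu
    - RtoC nu * jv l nu / RtoC (sqrt PI) * Gval nu (2 * (l + RtoC (ln 2))) S1 S2).
Proof.
  intros H Hn HS1 HS2. set (x := Cexp (2 * l)).
  destruct (bes_sum_identity nu x H Hn) as [b [Hb ID]].
  assert (E1 : S1 = / (RtoC nu * RtoC (sqrt PI)) * b).
  { apply (cseries_unique _ _ _ HS1). eapply cseries_ext; [intros k; symmetry; now apply rlim_first|].
    now apply cseries_scal. }
  assert (E2 : S2 = - (RtoC (sqrt PI) * RtoC (cos (PI * nu)) / (RtoC nu * RtoC (sin (PI * nu)))) * aval l nu).
  { apply (cseries_unique _ _ _ HS2). eapply cseries_ext; [intros k; symmetry; now apply rlim_second|].
    rewrite second_residue_const by auto. unfold aval. rewrite !Cmult_assoc. apply cseries_scal. now apply pval_cv. }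
  unfold Gval. rewrite Gval_first by auto. rewrite E1, E2. unfold yq, djv.
  assert (PP := PI_RGT_0).
  assert (SP : sqrt PI <> 0%R) by apply Rgt_not_eq, sqrt_lt_R0, PI_RGT_0.
  assert (Sn : sin (PI * nu) <> 0%R).
  { intros S. apply sin_eq_0_0 in S. destruct S as [k Hk]. apply (Hn k). apply Rmult_eq_reg_l with PI; lra. }
  assert (N1 : rg (nu + 1) <> 0%R) by (apply rg_nz_pos; lra).
  assert (R1 := rg_reflection (nu + 1)). replace (1 - (nu + 1))%R with (- nu)%R in R1 by ring.
  replace (PI * (nu + 1))%R with (PI * nu + PI)%R in R1 by ring. rewrite neg_sin, (rg_rec (- nu)) in R1.
  assert (N2 : rg (- nu + 1) <> 0%R).
  { intros Z. rewrite Z in R1. apply Sn. apply Rmult_eq_reg_r with (/ PI)%R; [|apply Rinv_neq_0_compat; lra]. unfold Rdiv in R1. lra. }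
  (* Reflection in the form that turns 1/sin into the same product of 1/Gamma values as in the
     summed identity. *)
  assert (R2 : (sin (PI * nu) = PI * nu * rg (nu + 1) * rg (- nu + 1))%R).
  { apply Rmult_eq_reg_r with (/ PI)%R; [|apply Rinv_neq_0_compat; lra].
    replace (PI * nu * rg (nu + 1) * rg (- nu + 1) * / PI)%R with (- (rg (nu + 1) * (- nu * rg (- nu + 1))))%R by (field; lra).
    rewrite R1. field. lra. }
  unfold aval, jv. fold x. fold x in ID.
  set (a := pval (- (4 * x)) nu) in *. set (p := oser rg x nu) in *. set (m := oser rg x (- nu)) in *.
  set (d := oser drg x nu) in *.
  replace (Cexp (2 * (RtoC nu * l))) with (Cexp (RtoC nu * l) * Cexp (RtoC nu * l)).
  2:{ rewrite <- Cexp_plus. f_equal. ring. }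
  replace (RtoC (- nu) * l) with (- (RtoC nu * l)) by (rewrite RtoC_opp; ring).
  rewrite Cexp_opp. assert (Ez := Cexp_nz (RtoC nu * l)). set (X := Cexp (RtoC nu * l)) in *.
  (* The summed identity solved for the derivative series, the only part of the derivative of J_nu
     that does not come from differentiating the power (z/2)^nu. *)
  assert (ED : d = RtoC (dl (nu + 1)) * p + (p - RtoC (rg (nu + 1)) / RtoC (rg (- nu + 1)) * m * a + RtoC nu * p * b) / (2 * RtoC nu)).
  { assert (M1 := RtoC_nz _ N1). assert (M2 := RtoC_nz _ N2). assert (M3 : RtoC nu <> RtoC 0) by (apply RtoC_nz; lra).
    apply (C_cancel_r (2 * RtoC nu * / RtoC (rg (nu + 1)))).
    { apply Cmult_neq_0; [apply Cmult_neq_0; auto using C2_nz|]. intros Z. apply (RtoC_nz 1); [lra|]. rewrite <- (Cinv_r (RtoC (rg (nu + 1)))), Z by auto. ring. }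
    transitivity (2 * RtoC nu * (/ RtoC (rg (nu + 1)) * (d + - RtoC (dl (nu + 1)) * p)) + 2 * RtoC nu * / RtoC (rg (nu + 1)) * RtoC (dl (nu + 1)) * p); [ring|].
    rewrite ID. field. auto using C2_nz. }
  rewrite ED. rewrite R2, !RtoC_mult.
  assert (M1 := RtoC_nz _ N1). assert (M2 := RtoC_nz _ N2). assert (M3 : RtoC nu <> RtoC 0) by (apply RtoC_nz; lra).
  assert (M4 := RtoC_nz _ SP). assert (M5 : RtoC PI <> RtoC 0) by (apply RtoC_nz; lra).
  set (cc := RtoC (cos (PI * nu))).
  assert (EP : RtoC PI = RtoC (sqrt PI) * RtoC (sqrt PI)) by (rewrite <- RtoC_mult, sqrt_sqrt by lra; reflexivity).
  rewrite EP. field. repeat split; auto using C2_nz.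
Qed.

(** * All orders *)

Lemma Cinv_mult_all (a b : C) : / (a * b) = / a * / b.
Proof.
  destruct (Ceq_dec a 0) as [->|Ha]; [rewrite Cmult_0_l, Cinv_0; ring|].
  destruct (Ceq_dec b 0) as [->|Hb]; [rewrite Cmult_0_r, Cinv_0; ring|].
  field. auto.
Qed.

Lemma Cinv_involutive (a : C) : / / a = a.
Proof. destruct (Ceq_dec a 0) as [->|Ha]; [now rewrite !Cinv_0|]. field. auto. Qed.

Lemma near_half_integers (nu : R) : exists d, (0 < d)%R /\
  forall y, y <> nu -> (Rabs (y - nu) < d)%R -> forall n : Z, (2 * y)%R <> IZR n.
Proof.
  destruct (archimed (2 * nu)) as [A1 A2]. set (u := up (2 * nu)) in *.
  (* [e] is the distance from 2 nu down to the preceding integer, or 1 when 2 nu is that integer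
     itself; in the latter case the excluded value is nu alone. *)
  set (e := if Rle_dec (2 * nu) (IZR u - 1) then 1%R else (2 * nu - (IZR u - 1))%R).
  assert (Pe : (0 < e)%R) by (unfold e; destruct (Rle_dec _ _); lra).
  exists (Rmin (Rmin ((IZR u - 2 * nu) / 2) (e / 2)) (1 / 2)).
  split; [repeat apply Rmin_pos; lra|]. intros y Hy Hd n E.
  assert (B1 : (Rabs (y - nu) < (IZR u - 2 * nu) / 2)%R) by (eapply Rlt_le_trans; [exact Hd|eapply Rle_trans; apply Rmin_l]).
  assert (B2 : (Rabs (y - nu) < e / 2)%R) by (eapply Rlt_le_trans; [exact Hd|eapply Rle_trans; [apply Rmin_l|apply Rmin_r]]).
  assert (B3 : (Rabs (y - nu) < 1 / 2)%R) by (eapply Rlt_le_trans; [exact Hd|apply Rmin_r]).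
  apply Rabs_lt_between in B1, B2, B3.
  assert (L1 : (n < u)%Z) by (apply lt_IZR; lra).
  assert (L2 : (u - 2 < n)%Z) by (apply lt_IZR; rewrite minus_IZR; lra).
  assert (En : n = (u - 1)%Z) by lia. rewrite En, minus_IZR in E.
  unfold e in B2. destruct (Rle_dec _ _); lra.
Qed.

Lemma loop_nonpole c h1 h2 (s : C) : (c < 0)%R -> (h1 < 0)%R -> (0 < h2)%R ->
  (exists t, s = (t, h1) \/ s = (t, h2) \/ s = (c, t)) -> forall k, - s + RtoC (INR k) <> RtoC 0.
Proof.
  intros Hc H1 H2 [t Ht] k E. assert (P := pos_INR k).
  apply (f_equal Re) in E as Er. apply (f_equal Im) in E.
  destruct Ht as [->|[->| ->]]; simpl in E, Er; lra.
Qed.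

(** The power (z^2)^s equals exp(2 L s) by the bound on Im L. The poles are avoided on the contour,
    so Gamma(-s)/Gamma(1 - s) may be replaced by -1/s; the other factors agree even where a
    reciprocal is taken of 0. *)
Lemma integrand_Ff nu L c h1 h2 (s : C) : (- (PI / 2) < Im L < PI / 2)%R -> (c < 0)%R -> (h1 < 0)%R -> (0 < h2)%R ->
  (exists t, s = (t, h1) \/ s = (t, h2) \/ s = (c, t)) ->
  meijerG_integrand 3 0 [1 / 2; RtoC 1] [RtoC 0; RtoC 0; RtoC nu; - RtoC nu] (Cexp L ^ 2) s = Ff nu (2 * L) s.
Proof.
  intros HL Hc H1 H2 Hs. assert (NP := loop_nonpole c h1 h2 s Hc H1 H2 Hs).
  assert (M0 : Rg (- s) <> RtoC 0) by now apply Rg_lower.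
  assert (M1 : s <> RtoC 0). { intros Z. apply (NP 0%nat). rewrite Z. simpl. ring. }
  unfold meijerG_integrand, Cpower. rewrite Clog_sqr by auto. simpl. rewrite !Gamma_eq.
  unfold Ff, Cdiv. rewrite !Cinv_mult_all, !Cinv_involutive.
  replace (RtoC 0 - s) with (- s) by ring.
  replace (1 - - RtoC nu + s) with (1 + RtoC nu + s) by ring.
  replace (RtoC 1 - s) with (- s + 1) by ring.
  assert (R := Rg_rec (- s)).
  replace (Rg (- s + 1)) with (- / s * Rg (- s)).
  2:{ rewrite R. field. auto. }
  replace (/ RtoC 1) with (RtoC 1) by field.
  transitivity (/ Rg (- s) * (/ Rg (RtoC nu - s)) * (Rg (1 + RtoC nu + s) * (Rg (1 * / 2 - s) * - / s)) * Cexp (s * (2 * L))); [|ring].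
  set (V := / Rg (RtoC nu - s)). field. auto.
Qed.

Definition two_pi_i : C := 2 * RtoC PI * Ci.

Lemma two_pi_i_nz : two_pi_i <> RtoC 0.
Proof.
  assert (P := PI_RGT_0). unfold two_pi_i. intros E. apply (f_equal Im) in E. simpl in E. lra.
Qed.

(** Every separating loop surrounds the parameter 0, hence has c < 0 and h1 < 0 < h2, where the
    value is known. One concrete loop, with corners at -1 - i and -1 + i, gives existence of a loop
    and uniqueness of the value. *)
Lemma meijerG_loopval nu L g : (0 < nu)%R -> (- (PI / 2) < Im L < PI / 2)%R ->
  (forall c h1 h2, (c < 0)%R -> (h1 < 0)%R -> (0 < h2)%R -> loopval (Ff nu (2 * L)) c h1 h2 (two_pi_i * g)) ->
  meijerG 3 0 [1 / 2; RtoC 1] [RtoC 0; RtoC 0; RtoC nu; - RtoC nu] (Cexp L ^ 2) = g.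
Proof.
  intros Hnu HL H.
  assert (I : forall c h1 h2, separating_loop 3 0 [1 / 2; RtoC 1] [RtoC 0; RtoC 0; RtoC nu; - RtoC nu] c h1 h2 ->
    is_loop_integral (meijerG_integrand 3 0 [1 / 2; RtoC 1] [RtoC 0; RtoC 0; RtoC nu; - RtoC nu] (Cexp L ^ 2)) c h1 h2 (two_pi_i * g)).
  { intros c h1 h2 [S _]. destruct (S (RtoC 0) (or_introl eq_refl) 0%nat) as [S1 [S2 S3]]. simpl in S1, S2, S3.
    assert (Hc : (c < 0)%R) by lra. assert (H1 : (h1 < 0)%R) by lra. assert (H2 : (0 < h2)%R) by lra.
    apply (loopval_is_loop_integral _ (Ff nu (2 * L))); auto using Ff_lines_cont;
      intros t; apply (integrand_Ff nu L c h1 h2); eauto. }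
  assert (Sep : separating_loop 3 0 [1 / 2; RtoC 1] [RtoC 0; RtoC 0; RtoC nu; - RtoC nu] (- (1)) (- (1)) 1).
  { split; [|split; [simpl; tauto|lra]]. intros bl Hb k. assert (P := pos_INR k). simpl in Hb.
    destruct Hb as [<-|[<-|[<-|[]]]]; simpl; lra. }
  apply the_unique.
  - intros y [_ Hy]. specialize (Hy _ _ _ Sep). specialize (I _ _ _ Sep).
    assert (E := is_loop_integral_unique _ _ _ _ _ _ Hy I). fold two_pi_i in E.
    apply (C_cancel_r two_pi_i); [apply two_pi_i_nz|]. rewrite !(Cmult_comm _ two_pi_i). exact E.
  - split; [now exists (- (1))%R, (- (1))%R, 1%R|]. exact I.
Qed.

Lemma aval_continuous l nu : (0 < nu)%R -> ctends (locally nu) (aval l) (aval l nu).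
Proof.
  intros H. assert (F : Filter (locally nu)) by apply locally_filter. unfold aval.
  apply ctends_mult; auto; [apply ctends_mult; auto|now apply pval_continuous].
  - apply ctends_Cexp; auto. apply ctends_mult; auto; [now apply ctends_const|].
    apply ctends_mult; auto; [|now apply ctends_const]. apply (cderive_continuous RtoC nu 1), cderive_id.
  - assert (X : ctends (locally nu) (fun t => RtoC (rg (t + 1))) (RtoC (rg (nu + 1)))).
    { apply (ctends_shift (fun t => RtoC (rg t))). exact (cderive_continuous _ _ _ (cderive_RtoC _ _ _ (is_derive_rg _))). }
    apply ctends_ext with (fun t => RtoC (rg (t + 1)) * RtoC (rg (t + 1))); auto; [intros; simpl; ring|].
    replace (RtoC (rg (nu + 1)) ^ 2) with (RtoC (rg (nu + 1)) * RtoC (rg (nu + 1))) by (simpl; ring).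
    now apply ctends_mult.
Qed.

Lemma locally'_le_locally (x : R) : filter_le (locally' x) (locally x).
Proof. intros P [d Hd]. exists d. intros y Hy _. auto. Qed.

(* Both sides are continuous in the order, so the case 2 nu integer follows from the generic one;
   the limit of the generic loop integrals is the loop integral at nu. *)
Lemma djv_formula nu l z : (0 < nu)%R -> Cexp l = z / 2 -> (- PI < Im l <= PI)%R ->
  exists g, (forall c h1 h2, (c < 0)%R -> (h1 < 0)%R -> (0 < h2)%R ->
     loopval (Ff nu (2 * (l + RtoC (ln 2)))) c h1 h2 (two_pi_i * g)) /\
  djv l nu = RtoC PI / 2 * (besselY nu z * aval l nu - RtoC nu * jv l nu / RtoC (sqrt PI) * g).
Proof.
  intros H Hl Hi. set (lx := 2 * (l + RtoC (ln 2))). set (G := fun t => Clim (Gapp t lx)).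
  assert (FF : ProperFilter (locally' nu)) by apply locally'_proper.
  assert (F : Filter (locally' nu)) by apply locally'_filter.
  destruct (near_half_integers nu) as [d [Pd Hd]].
  assert (Gen : locally' nu (fun t => (0 < t)%R /\ forall n : Z, (2 * t)%R <> IZR n)).
  { apply (locally'_intro nu _ (Rmin d nu)); [now apply Rmin_pos|]. intros y Hn Hy. split.
    - assert (B : (Rabs (y - nu) < nu)%R) by (eapply Rlt_le_trans; [exact Hy|apply Rmin_r]). apply Rabs_lt_between in B. lra.
    - apply Hd; auto. eapply Rlt_le_trans; [exact Hy|apply Rmin_l]. }
  assert (Loop : forall c h1 h2, (c < 0)%R -> (h1 < 0)%R -> (0 < h2)%R ->
    exists w, loopval (Ff nu lx) c h1 h2 w /\ ctends (locally' nu) (fun t => two_pi_i * G t) w).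
  { intros c h1 h2 Hc H1 H2. apply Ff_loop_limit; auto using locally'_le_locally.
    generalize Gen. apply filter_imp. intros t [Ht Hn].
    destruct (Gapp_lim t lx Ht Hn) as [S1 [S2 [_ [_ Lim]]]]. apply Ff_loop; auto.
    - intros k E. apply (Hn (2 * Z.of_nat k)%Z). rewrite mult_IZR, <- INR_IZR_INZ. lra.
    - unfold G. now rewrite (Clim_eq _ _ Lim). }
  destruct (Loop (- (1))%R (- (1))%R 1%R ltac:(lra) ltac:(lra) ltac:(lra)) as [w [_ Hw]].
  assert (Tp := two_pi_i_nz). set (g := / two_pi_i * w).
  assert (HG : ctends (locally' nu) G g).
  { apply ctends_ext with (fun t => / two_pi_i * (two_pi_i * G t)); auto; [intros; field; auto|].
    apply ctends_mult; auto. now apply ctends_const. }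
  exists g. split.
  - intros c h1 h2 Hc H1 H2. destruct (Loop c h1 h2 Hc H1 H2) as [w' [A B]].
    rewrite (ctends_unique _ _ _ _ B Hw) in A. unfold g.
    replace (two_pi_i * (/ two_pi_i * w)) with w by (field; auto). exact A.
  - assert (LE := locally'_le_locally nu).
    apply (ctends_unique (locally' nu) (djv l)).
    + apply (ctends_filter_le _ _ _ _ LE), djv_continuous.
    + apply ctends_ext_loc with (fun t => RtoC PI / 2 * (yq l t * aval l t - RtoC t * jv l t / RtoC (sqrt PI) * G t)); auto.
      * generalize Gen. apply filter_imp. intros t [Ht Hn]. symmetry.
        destruct (Gapp_lim t lx Ht Hn) as [S1 [S2 [B1 [B2 Lim]]]]. unfold G. rewrite (Clim_eq _ _ Lim).
        apply djv_generic; auto. intros n E. apply (Hn (2 * n)%Z). rewrite mult_IZR. lra.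
      * apply ctends_mult; auto; [now apply ctends_const|]. apply ctends_minus; auto; apply ctends_mult; auto.
        -- now apply besselY_limit.
        -- apply (ctends_filter_le _ _ _ _ LE). now apply aval_continuous.
        -- apply ctends_mult; auto; [apply ctends_mult; auto|now apply ctends_const].
           ++ apply (ctends_filter_le _ _ _ _ LE), (cderive_continuous RtoC nu 1), cderive_id.
           ++ apply (ctends_filter_le _ _ _ _ LE), jv_continuous.
Qed.

Theorem mainTheorem7 (nu : R) (z : C) (hnu : (0 < nu)%R) (hz : (0 < Re z)%R) :
  is_derive (K := R_AbsRing) (V := C_R_NormedModule)
    (fun mu : R => besselJ mu z) nu
    (RtoC PI / 2 *
      (besselY nu z
         * (Cpower (z / 2) (2 * RtoC nu) / Gamma (RtoC nu + 1) ^ 2)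
         * pFq [RtoC nu; 1 / 2 + RtoC nu]
               [2 * RtoC nu + 1; RtoC nu + 1; RtoC nu + 1]
               (- z ^ 2)
       - RtoC nu * besselJ nu z / RtoC (sqrt PI)
         * meijerG 3 0 [1 / 2; RtoC 1]
                       [RtoC 0; RtoC 0; RtoC nu; - RtoC nu]
                       (z ^ 2))).
Proof.
  (* [L] is the principal logarithm of z and [l] that of z/2; the former is doubled in the
     G-function, the latter appears in the Bessel functions. *)
  destruct (exists_log z hz) as [L [EL HL]]. set (l := L - RtoC (ln 2)).
  assert (P := PI_RGT_0).
  assert (El : Cexp l = z / 2) by (unfold l; rewrite Cexp_minus, Cexp_RtoC, exp_ln by lra; now rewrite EL).
  assert (Hi : (- PI < Im l <= PI)%R) by (unfold l; clear -HL P; destruct L as [a b]; simpl in *; split; lra).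
  destruct (djv_formula nu l z hnu El Hi) as [g [Hg D]].
  replace (l + RtoC (ln 2)) with L in Hg by (unfold l; ring).
  assert (EG := meijerG_loopval nu L g hnu HL Hg). rewrite EL in EG. rewrite EG.
  apply (cderive_ext (jv l)). { intros t. symmetry. now apply besselJ_jv. }
  rewrite (besselJ_jv l z) by auto. rewrite pFq_pval.
  eapply cderive_eq; [|apply cderive_jv]. rewrite D. do 2 f_equal. rewrite <- Cmult_assoc. f_equal.
  unfold aval. rewrite Gamma_eq, <- RtoC_plus, Rg_real. unfold Cpower. rewrite (Clog_unique l (z / 2)) by auto.
  assert (N : RtoC (rg (nu + 1)) <> RtoC 0) by (apply RtoC_nz, rg_nz_pos; lra).
  (* The 2F3 was obtained at -4 x with x = exp(2 l) = (z/2)^2. *)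
  replace (4 * Cexp (2 * l)) with (z ^ 2).
  - replace (2 * RtoC nu * l) with (2 * (RtoC nu * l)) by ring. simpl. field. auto.
  - replace (2 * l) with (l + l) by ring. rewrite Cexp_plus, El. simpl. field.
Qed.
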